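(* Let $L$ be an integral lattice of rank two and choose a Gram matrix of the form $\begin{pmatrix} a+b & b \\ b & c+b \end{pmatrix}$ with $a, b, c \in \mathbb{N}_0$. Let $P_a$, $Q_a$ denote the Laurent polynomials $$P_a(t) = t^{-a} + \frac {1 - t^{1-a}}{1 - t^{-1}} = t^{-a} + t^{2-a} + \dots + 1, \; a \ge 2$$ and $$Q_a(t) = \frac{1 - t^{-a}}{1 - t^{-1}} = t^{1-a} + t^{2-a} + \dots + 1, \; a \ge 1,$$ and define $P_0(t) = 1, P_1(t) = t^{-1}$ and $Q_{-1}(t) = Q_0(t) = 0$. Then the $\mathbb{C}[E_4, E_6]$-module $J_{*, L}^w$ of weak Jacobi forms of index $L$ is free on generators $\varphi_1,\dots,\varphi_n$ of weights $k_1,\dots,k_n$ that are determined by \begin{align*} & t^{k_1} + \dots + t^{k_n} \\ =& P_a(t)P_b(t)P_c(t) + Q_a(t) Q_b(t) Q_c(t) + (2t^{-1} - 1) Q_{a-1}(t) Q_{b-1}(t) Q_{c-1}(t) \\ &- t^{-1} \Big(Q_{a}(t)Q_{b-1}(t)Q_{c-1}(t) + Q_{a-1}(t)Q_b(t)Q_{c-1}(t) + Q_{a-1}(t)Q_{b-1}(t)Q_c(t)\Big) \\ &+ \begin{cases} t^{1-a-b-c}: & abc \ne 0; \\ 0: & abc = 0. \end{cases} \end{align*}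
   Context: For an integral lattice $L$ with positive semidefinite bilinear form $\langle-,-\rangle$ and $Q(x)=\langle x,x\rangle/2$ (odd and degenerate lattices allowed), a weak Jacobi form of weight $k\in\mathbb{Z}$ and index $L$ is a holomorphic $f:\mathbb{H}\times(L\otimes\mathbb{C})\to\mathbb{C}$ with $f(\frac{a\tau+b}{c\tau+d},\frac{\mathfrak z}{c\tau+d})=(c\tau+d)^k\exp(\frac{2\pi i c}{c\tau+d}Q(\mathfrak z))f(\tau,\mathfrak z)$ for all $\begin{pmatrix} a&b\\c&d\end{pmatrix}\in\mathrm{SL}_2(\mathbb{Z})$, $f(\tau,\mathfrak z+\lambda\tau+\mu)=(-1)^{Q(\lambda)+Q(\mu)}\exp(-2\pi i\tau Q(\lambda)-2\pi i\langle\lambda,\mathfrak z\rangle)f(\tau,\mathfrak z)$ for $\lambda,\mu\in L$, and whose Fourier expansion in $q=e^{2\pi i\tau}$ involves only nonnegative powers of $q$. $J^w_{k,L}$ denotes the space of these forms; $J^w_{*,L}=\bigoplus_k J^w_{k,L}$ is a module over the ring $\mathbb{C}[E_4,E_6]$ of modular forms for $\mathrm{SL}_2(\mathbb{Z})$.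
   Formalization: The sign in the elliptic law is taken as (-1)^{<λ,λ>+<μ,μ>} instead of (-1)^{Q(λ)+Q(μ)}, which is undefined for odd L and, e.g. for the Gram matrix diag(2,0), would force every form to vanish. *)

(* Defs.v *)
From HB Require Import structures.
From mathcomp Require Import all_boot all_order all_algebra.
From mathcomp Require Import polyXY fraction zify ring lra.
From mathcomp Require Import complex.
From mathcomp Require Import all_classical all_reals all_analysis.

Set Implicit Arguments.
Unset Strict Implicit.
Unset Printing Implicit Defensive.

Import Order.TTheory GRing.Theory Num.Theory.
Import numFieldNormedType.Exports.

Local Open Scope classical_set_scope.
Local Open Scope ring_scope.

(* Naming [R[i]] as a [numClosedFieldType] makes the norm topology and the
   normed module structures of numerical fields canonical on it; in
   particular [differentiable] below is complex Frechet differentiability. *)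
Definition CC (R : realType) : numClosedFieldType := R[i].

Definition cexp (R : realType) (z : CC R) : CC R :=
  (expR (complex.Re z) * cos (complex.Im z)
   +i* (expR (complex.Re z) * sin (complex.Im z)))%C.

(* exp (2 pi i z) *)
Definition e2pi (R : realType) (z : CC R) : CC R :=
  cexp (((0 : R) +i* (2 * pi))%C * z).

Definition uhp (R : realType) := {tau : CC R | 0 < complex.Im tau}.

Definition SL2Z := {g : 'M[int]_2 | \det g == 1}.

(* c tau + d *)
Definition autj (R : realType) (g : SL2Z) (tau : uhp R) : CC R :=
  (val g 1 0)%:~R * val tau + (val g 1 1)%:~R.

Lemma mobius_subproof (R : realType) (g : SL2Z) (tau : uhp R) :
  0 < complex.Im
    (((val g 0 0)%:~R * val tau + (val g 0 1)%:~R) / autj g tau : CC R).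
Proof.
have intC (m : int) : (m%:~R : CC R) = (m%:~R +i* 0)%C.
  by rewrite -[RHS]/(real_complex R _) rmorph_int.
rewrite /autj; move: (val g) (valP g) (val tau) (valP tau) => {tau} {}g /=.
move=> /eqP dg [x y] /= y0; rewrite !intC.
have {}dg : (g 0 0)%:~R * (g 1 1)%:~R - (g 0 1)%:~R * (g 1 0)%:~R = 1 :> R.
  rewrite -!intrM -intrB -[1 in RHS](_ : 1%:~R = 1) // -dg.
  rewrite (expand_det_row _ 0) !big_ord_recl big_ord0 /cofactor !det_mx11.
  rewrite !mxE addr0 expr0 mul1r expr1 mulN1r mulrN.
  by congr (_ * _ - _ * _)%:~R; congr (g _ _); apply: val_inj.
move: dg; set a := (g 0 0)%:~R; set b := (g 0 1)%:~R.
set c := (g 1 0)%:~R; set d := (g 1 1)%:~R => dg.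
rewrite /= !mul0r !addr0 !subr0.
set u := c * x + d; set v := c * y.
have N0 : 0 < u ^+ 2 + v ^+ 2.
  rewrite lt_neqAle addr_ge0 ?sqr_ge0 // andbT eq_sym.
  rewrite paddr_eq0 ?sqr_ge0 // !sqrf_eq0 mulf_eq0 (gt_eqF y0) orbF.
  apply/negP => /andP[/eqP u0 /eqP c0].
  have d0 : d = 0 by move: u0; rewrite /u c0 mul0r add0r.
  by move/eqP: dg; rewrite c0 d0 !mulr0 subrr eq_sym oner_eq0.
suff -> : (a * x + b) * - (v / (u ^+ 2 + v ^+ 2))
    + a * y * (u / (u ^+ 2 + v ^+ 2)) = y / (u ^+ 2 + v ^+ 2).
  by rewrite divr_gt0.
rewrite -[y in RHS]mul1r -dg /u /v.
by field; rewrite gt_eqF.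
Qed.

Definition mobius (R : realType) (g : SL2Z) (tau : uhp R) : uhp R :=
  exist (fun w : CC R => is_true (0 < complex.Im w)) _ (mobius_subproof g tau).

(* An integral lattice of rank n, with underlying group Z^n (row vectors). The
   form may be odd and may be degenerate. *)
Record lattice (n : nat) := Lattice {
  gram : 'M[int]_n;
  gram_sym : gram^T = gram;
  gram_psd : forall x : 'rV[int]_n, 0 <= (x *m gram *m x^T) 0 0
}.

(* The bilinear form of L extended to L (x) A = A^n. *)
Definition bil (n : nat) (L : lattice n) (A : nzRingType) (x y : 'rV[A]_n) : A :=
  (x *m map_mx intr (gram L) *m y^T) 0 0.

Definition qform (n : nat) (L : lattice n) (R : realType) (z : 'rV[CC R]_n) :
  CC R := bil L z z / 2.

(* The rows of U are the chosen Z-basis of L. *)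
Definition is_gram_matrix (n : nat) (L : lattice n) (G : 'M[int]_n) :=
  exists2 U : 'M[int]_n, U \in unitmx &
    G = \matrix_(i, j) bil L (row i U) (row j U).

Definition lat_incl (R : realType) (n : nat) (x : 'rV[int]_n) : 'rV[CC R]_n :=
  map_mx intr x.

Definition jfun (R : realType) (n : nat) := uhp R -> 'rV[CC R]_n -> CC R.

(* Extension by 0 outside of the open set H x C^n. *)
Definition jext (R : realType) (n : nat) (f : jfun R n)
    (p : (CC R * 'rV[CC R]_n)%type) : CC R :=
  if insub p.1 is Some tau then f tau p.2 else 0.

Definition holomorphic (R : realType) (n : nat) (f : jfun R n) :=
  forall (tau : uhp R) (z : 'rV[CC R]_n), differentiable (jext f) (val tau, z).

Definition modular_law (R : realType) (n : nat) (L : lattice n) (k : int)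
    (f : jfun R n) :=
  forall (g : SL2Z) (tau : uhp R) (z : 'rV[CC R]_n),
    f (mobius g tau) ((autj g tau)^-1 *: z) =
    autj g tau ^ k * e2pi ((val g 1 0)%:~R / autj g tau * qform L z) * f tau z.

(* The sign is (-1)^(<l,l> + <m,m>), i.e. (-1)^(2 Q(l) + 2 Q(m)): a character
   of L x L which is trivial for even lattices, and which is the one of
   theta(tau, z) for the odd unimodular lattice of rank one. The exponent
   Q(l) + Q(m) is half-integral in general. *)
Definition elliptic_law (R : realType) (n : nat) (L : lattice n)
    (f : jfun R n) :=
  forall (l m : 'rV[int]_n) (tau : uhp R) (z : 'rV[CC R]_n),
    f tau (z + val tau *: lat_incl R l + lat_incl R m) =
    (-1) ^ (bil L l l + bil L m m)
    * e2pi (- (val tau * qform L (lat_incl R l)) - bil L (lat_incl R l) z)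
    * f tau z.

(* f = \sum_(j >= 0) c_j(z) q^j with q = exp (2 pi i tau). *)
Definition fourier_nonneg (R : realType) (n : nat) (f : jfun R n) :=
  exists c : nat -> 'rV[CC R]_n -> CC R, forall (tau : uhp R) z,
    series (fun j => c j z * e2pi (val tau) ^+ j) @ \oo --> f tau z.

Definition weak_jacobi (R : realType) (n : nat) (L : lattice n) (k : int) :
    set (jfun R n) :=
  [set f | [/\ holomorphic f, modular_law L k f, elliptic_law L f
             & fourier_nonneg f]].

(* The direct sum over k of the spaces of weak Jacobi forms of weight k, as an
   internal sum of subspaces of the space of functions on H x C^n; see
   [weak_jacobi_direct]. *)
Definition weak_jacobi_all (R : realType) (n : nat) (L : lattice n) :
    set (jfun R n) :=
  [set f | exists (s : seq int) (F : int -> jfun R n),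
     [/\ uniq s, forall k, k \in s -> weak_jacobi L k (F k)
       & f = fun tau z => \sum_(k <- s) F k tau z]].

Lemma cexp_neq0 (R : realType) (z : CC R) : cexp z != 0.
Proof.
apply/eqP => /eqP; rewrite eq_complex /= !mulf_eq0 !(gt_eqF (expR_gt0 _)) /=.
move=> /andP[/eqP c0 /eqP s0]; have := cos2Dsin2 (complex.Im z).
by rewrite c0 s0 expr0n addr0 => /eqP; rewrite eq_sym oner_eq0.
Qed.

Lemma weak_jacobi_direct (R : realType) (n : nat) (L : lattice n)
    (s : seq int) (F : int -> jfun R n) :
  uniq s -> (forall k, k \in s -> weak_jacobi L k (F k)) ->
  (forall tau z, \sum_(k <- s) F k tau z = 0) ->
  forall k, k \in s -> forall tau z, F k tau z = 0.
Proof.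
move=> us JF sum0 k0 k0s tau z.
pose gm (N : nat) : 'M[int]_2 :=
  \matrix_(i, j) if i == 0 then (if j == 0 then 0 else -1)
                 else (if j == 0 then 1 else N%:Z).
have gP N : \det (gm N) == 1.
  rewrite (expand_det_row _ 0) !big_ord_recl big_ord0 /cofactor !det_mx11.
  by rewrite !mxE /= mul0r expr1 add0r addr0 mulr1 mulN1r opprK.
pose g N : SL2Z := exist (fun h : 'M[int]_2 => is_true (\det h == 1)) _ (gP N).
pose x (N : nat) : CC R := val tau + N%:R.
have gx N : autj (g N) tau = x N by rewrite /autj /= !mxE /= mul1r.
have xinj : injective x by move=> N M /addrI/eqP; rewrite eqr_nat => /eqP.
have x0 N : x N != 0.
  apply/eqP => /(congr1 (@complex.Im R)); rewrite /x raddfD /=.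
  have -> : complex.Im (N%:R : CC R) = 0.
    by rewrite -[N%:R](rmorph_nat (real_complex R)).
  by rewrite addr0 => t0; have := valP tau; rewrite /= t0 ltxx.
have sx N : \sum_(k <- s) x N ^ k * F k tau z = 0.
  have := sum0 (mobius (g N) tau) ((x N)^-1 *: z).
  set e := e2pi ((val (g N) 1 0)%:~R / x N * qform L z).
  rewrite (eq_big_seq (fun k => e * (x N ^ k * F k tau z))); last first.
    move=> k ks; have [_ + _ _] := JF k ks => /(_ (g N) tau z).
    by rewrite !gx => ->; rewrite [RHS]mulrCA mulrA.
  rewrite -big_distrr /= => /eqP; rewrite mulf_eq0.
  by rewrite (negPf (cexp_neq0 _)) /= => /eqP.
pose M := \max_(k <- s) `|k|%N.
have Ms k : k \in s -> 0 <= k + M%:Z.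
  move=> ks; have : (`|k| <= M)%N by rewrite /M (big_rem k) //= leq_maxl.
  by lia.
pose p : {poly CC R} := \sum_(k <- s) F k tau z *: 'X^(`|k + M%:Z|).
have px N : p.[x N] = 0.
  transitivity (x N ^ M%:Z * \sum_(k <- s) x N ^ k * F k tau z); last first.
    by rewrite sx mulr0.
  rewrite horner_sum big_distrr /=.
  apply: eq_big_seq => k ks; rewrite hornerZ hornerXn mulrC [RHS]mulrA.
  by rewrite -expfzDr // [M%:Z + k]addrC exprnP gez0_abs ?Ms.
have p0 : p = 0.
  apply: (@roots_geq_poly_eq0 _ p [seq x N | N <- iota 0 (size p)]).
  - by apply/allP => _ /mapP[N _ ->]; rewrite /root px.
  - by rewrite map_inj_uniq ?iota_uniq.
  - by rewrite size_map size_iota.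
have := congr1 (fun q : {poly CC R} => q`_(`|k0 + M%:Z|)) p0.
rewrite coef0 coef_sum (bigD1_seq k0) //= coefZ coefXn eqxx mulr1.
rewrite big_seq_cond big1 ?addr0 // => k /andP[ks kk0].
rewrite coefZ coefXn; case: eqP => [E|]; last by rewrite mulr0.
case/eqP: kk0; have := Ms k ks; have := Ms k0 k0s.
by lia.
Qed.

Definition sigma (k m : nat) : nat := (\sum_(d <- divisors m) d ^ k)%N.

Definition eis_series (R : realType) (k : nat) (tau : uhp R) : CC R :=
  limn (series (fun j => (sigma k j.+1)%:R * e2pi (val tau) ^+ j.+1)).

Definition E4 (R : realType) (tau : uhp R) : CC R := 1 + 240 * eis_series 3 tau.

Definition E6 (R : realType) (tau : uhp R) : CC R := 1 - 504 * eis_series 5 tau.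

(* C[E4, E6], as a ring of functions on H. *)
Definition modular_ring (R : realType) : set (uhp R -> CC R) :=
  [set g | exists p : {poly {poly CC R}}, g = fun tau => p.[E4 tau, E6 tau]].

(* phi is a basis of the module M of functions on H x C^n over the ring A of
   functions on H. *)
Definition free_on (R : realType) (n : nat) (A : set (uhp R -> CC R))
    (M : set (jfun R n)) (r : nat) (phi : 'I_r -> jfun R n) :=
  (forall i, M (phi i)) /\
  (forall f, M f -> exists! g : 'I_r -> uhp R -> CC R,
     (forall i, A (g i)) /\
     f = fun tau z => \sum_(i < r) g i tau * phi i tau z).

Definition gram3 (a b c : nat) : 'M[int]_2 :=
  \matrix_(i < 2, j < 2)
    if i != j then b%:Z
    else if i == 0 then (a + b)%N%:Z else (c + b)%N%:Z.

Definition Ppol (F : fieldType) (t : F) (a : nat) : F :=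
  match a with
  | 0 => 1
  | 1 => t ^ (-1)
  | _ => t ^ (- a%:Z) + (1 - t ^ (1 - a%:Z)) / (1 - t ^ (-1))
  end.

Definition Qpol (F : fieldType) (t : F) (a : int) : F :=
  if a <= 0 then 0 else (1 - t ^ (- a)) / (1 - t ^ (-1)).

(* The variable t of the ring Z[t, 1/t] of Laurent polynomials, which is viewed
   inside its fraction field. *)
Definition tvar : {fraction {poly int}} := tofrac 'X.

(* Main.v *)
(** A lattice vector is written in coordinates (x, y) in which 2 Q = a x^2 + b (x+y)^2 + c y^2. Let
   theta be the theta function of weight -1 with simple zeros exactly at the lattice points.
   A form of index (a, b, c) that vanishes at x = 0 is theta(x) times a form of index (a-1, b, c),
   and restriction to x = 0 sends index (a, b, c) to index b + c in the single variable y.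
   So a basis for (a, b, c) consists of theta(x) times a basis for (a-1, b, c) and of lifts of a
   basis of rank one forms, and freeness and the weights follow by induction.
   The rank one generators are theta(y)^m and theta(y)^(m-j) u_j for j = 2, ..., m,
   with u_j of weight 0 and value 1 at the origin. They lift to products of theta(x+y) and theta(y)
   with forms of weight 0 and value 1 at the origin; the latter are averages,
   over the three points w of order two, of products of the functions theta(z+w)/theta(w).
   The one case not covered, theta(y)^2 in index (1, 1, 1), is lifted by theta'(x) theta(x+y)
   theta(y) - theta(x) theta'(x+y) theta(y) + theta(x) theta(x+y) theta'(y).
   Index 0 gives modular forms. These form C[E4, E6] because cusp forms can be divided by Delta,
   built from the values of theta at the points of order two, and because E4 and E6 are modular as
   Taylor coefficients of log theta. *)

From HB Require Import structures.
Require Import Defs.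
From mathcomp Require Import all_boot all_order all_algebra.
From mathcomp Require Import fraction zify ring lra.
From mathcomp Require Import complex.
From mathcomp Require Import all_classical all_reals all_analysis.

Set Implicit Arguments.
Unset Strict Implicit.
Unset Printing Implicit Defensive.

Import Order.TTheory GRing.Theory Num.Theory.
Import numFieldNormedType.Exports.

Local Open Scope classical_set_scope.
Local Open Scope ring_scope.

(** * Complex absolute value and convergence *)

Section Basics.
Variable R : realType.
Notation C := (CC R).

(** Which restrictions lift is decided by characters. Translating theta by a point of order two
    multiplies its elliptic law by a character, linear in the lattice vector. In a product of
    factors in x, x + y and y the characters cancel if all three factors carry one, or none does.
    Factors with the character exist in every index n >= 1; factors without it and with value 1 at
    the origin exist only for n <> 1, since in index 1 the plain law forces a zero. Hence index (a,
    b, c) with positive entries, and index (a, 0, 0) with a >= 2, have a form of weight 0 and value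
    1 at the origin, while (1, 0, 0) has none; this is why theta(y)^2 in index (1, 1, 1) stands
    apart. Division by theta must preserve every clause of the definition. The laws pass to the
    quotient because theta is nonzero on a dense set; boundedness at the cusp passes because circles
    of half-integral radius avoid the zeros of sin(pi z). The induction treats a, b, c unequally,
    and the symmetric formula for the weights is recovered only at the end, as an identity of
    rational functions. *)

Definition cabs (z : C) : R := Normc.normc z.

Lemma cabsM (x y : C) : cabs (x * y) = cabs x * cabs y.
Proof. exact: Normc.normcM. Qed.
Lemma cabsD (x y : C) : cabs (x + y) <= cabs x + cabs y.
Proof. exact: le_normcD. Qed.
Lemma cabsN (x : C) : cabs (- x) = cabs x.
Proof. exact: normcN. Qed.
Lemma cabsB (x y : C) : cabs (x - y) <= cabs x + cabs y.
Proof. by rewrite -(cabsN y) cabsD. Qed.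
Lemma cabsC (x y : C) : cabs (x - y) = cabs (y - x).
Proof. by rewrite -cabsN opprB. Qed.
Lemma cabs0 : cabs 0 = 0. Proof. exact: Normc.normc0. Qed.
Lemma cabs1 : cabs 1 = 1. Proof. exact: Normc.normc1. Qed.
Lemma cabsV (x : C) : cabs x^-1 = (cabs x)^-1. Proof. exact: Normc.normcV. Qed.
Lemma cabs_ge0 (x : C) : 0 <= cabs x.
Proof. by case: x => a b; rewrite /cabs /= sqrtr_ge0. Qed.
Lemma cabs_eq0 (x : C) : (cabs x == 0) = (x == 0).
Proof.
apply/idP/idP => [/eqP/Normc.eq0_normc -> //|/eqP ->]; by rewrite cabs0.
Qed.

Lemma cabs_gt0 (x : C) : (0 < cabs x) = (x != 0).
Proof. by rewrite lt_neqAle cabs_ge0 andbT eq_sym cabs_eq0. Qed.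
Lemma cabsX (x : C) n : cabs (x ^+ n) = cabs x ^+ n.
Proof. by elim: n => [|n IH]; rewrite ?expr0 ?cabs1 // !exprS cabsM IH. Qed.
Lemma cabs_norm (x : C) : `|x| = (cabs x)%:C%C.
Proof. by rewrite normc_def /cabs; case: x. Qed.
Lemma cabs_real (x : R) : cabs (x%:C%C) = `|x|.
Proof. by rewrite /cabs /= expr0n addr0 sqrtr_sqr. Qed.
Lemma cabs_nat n : cabs (n%:R) = n%:R.
Proof.
by rewrite -(rmorph_nat (real_complex R)) -[LHS]/(cabs ((n%:R)%:C%C)) cabs_real normr_nat.
Qed.

Lemma cabs_Re (x : C) : `|complex.Re x| <= cabs x.
Proof.
case: x => a b; rewrite /cabs /= -sqrtr_sqr ler_wsqrtr // lerDl sqr_ge0 //.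
Qed.

Lemma cabs_Im (x : C) : `|complex.Im x| <= cabs x.
Proof.
case: x => a b; rewrite /cabs /= -sqrtr_sqr ler_wsqrtr // lerDr sqr_ge0 //.
Qed.

Lemma cabs_le (x : C) : cabs x <= `|complex.Re x| + `|complex.Im x|.
Proof.
case: x => a b; rewrite /cabs /= -[leRHS]ger0_norm ?addr_ge0 // -sqrtr_sqr ler_wsqrtr //.
rewrite sqrrD !real_normK ?num_real //.
have := mulr_ge0 (normr_ge0 a) (normr_ge0 b); lra.
Qed.

Lemma cabs_sq (x : C) : cabs x ^+ 2 = complex.Re x ^+ 2 + complex.Im x ^+ 2.
Proof. by case: x => a b; rewrite /cabs /= sqr_sqrtr // addr_ge0 ?sqr_ge0. Qed.
Lemma cabsBB (x y : C) : cabs x - cabs y <= cabs (x - y).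
Proof. by rewrite lerBlDr (le_trans _ (cabsD _ _)) // subrK. Qed.
Lemma cabs_sum (I : Type) (r : seq I) (P : pred I) (F : I -> C) :
  cabs (\sum_(i <- r | P i) F i) <= \sum_(i <- r | P i) cabs (F i).
Proof.
elim/big_rec2: _ => [|i y1 y2 _ h]; first by rewrite cabs0.
by rewrite (le_trans (cabsD _ _)) // lerD2l.
Qed.

Lemma cabs_tri (x y z : C) : cabs (x - z) <= cabs (x - y) + cabs (y - z).
Proof. by apply: le_trans (cabsD _ _); rewrite addrA subrK. Qed.
Lemma ReD (x y : C) : complex.Re (x + y) = complex.Re x + complex.Re y.
Proof. by case: x y => [a b] [c d]. Qed.
Lemma ImD (x y : C) : complex.Im (x + y) = complex.Im x + complex.Im y.
Proof. by case: x y => [a b] [c d]. Qed.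
Lemma ReN (x : C) : complex.Re (- x) = - complex.Re x.
Proof. by case: x => [a b]. Qed.
Lemma ImN (x : C) : complex.Im (- x) = - complex.Im x.
Proof. by case: x => [a b]. Qed.
Lemma ReM (x y : C) : complex.Re (x * y) = complex.Re x * complex.Re y - complex.Im x *
    complex.Im y.
Proof. by case: x y => [a b] [c d]. Qed.
Lemma ImM (x y : C) : complex.Im (x * y) = complex.Re x * complex.Im y + complex.Im x *
    complex.Re y.
Proof. by case: x y => [a b] [c d]. Qed.
Lemma C_eqP (x y : C) : complex.Re x = complex.Re y -> complex.Im x = complex.Im y -> x = y.
Proof. by case: x y => [a b] [c d] /= -> ->. Qed.
Lemma intC (m : int) : (m%:~R : C) = (m%:~R : R)%:C%C.
Proof. by rewrite -[RHS]/(real_complex R _) rmorph_int. Qed.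
Lemma Re_int (m : int) : complex.Re (m%:~R : C) = m%:~R.
Proof. by rewrite intC. Qed.
Lemma Im_int (m : int) : complex.Im (m%:~R : C) = 0.
Proof. by rewrite intC. Qed.
Lemma Re_nat (m : nat) : complex.Re (m%:R : C) = m%:R.
Proof. exact: (Re_int m). Qed.
Lemma Im_nat (m : nat) : complex.Im (m%:R : C) = 0.
Proof. exact: (Im_int m). Qed.
Lemma half_C : (2^-1 : C) = (2^-1 : R)%:C%C.
Proof. by rewrite -(rmorph_nat (real_complex R)) -fmorphV. Qed.

(** * Convergent sequences of complex numbers *)

Definition ccvg (u : nat -> C) (l : C) :=
  forall e : R, 0 < e -> exists N, forall n, (N <= n)%N -> cabs (u n - l) < e.

Lemma ccvg_unique u l l' : ccvg u l -> ccvg u l' -> l = l'.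
Proof.
move=> h h'; apply/eqP; rewrite -subr_eq0 -cabs_eq0; apply: contraT => ne.
have e0 : 0 < cabs (l - l') / 2 by rewrite divr_gt0 // lt_neqAle cabs_ge0 eq_sym ne.
have [N hN] := h _ e0; have [M hM] := h' _ e0.
have := hN (maxn N M) (leq_maxl _ _); have := hM (maxn N M) (leq_maxr _ _).
have := cabs_tri l (u (maxn N M)) l'; rewrite (cabsC l (u _)); lra.
Qed.

Lemma ccvgD u v l m : ccvg u l -> ccvg v m -> ccvg (fun n => u n + v n) (l + m).
Proof.
move=> h h' e e0; have e2 : 0 < e / 2 by lra.
have [N hN] := h _ e2; have [M hM] := h' _ e2; exists (maxn N M) => n.
rewrite geq_max => /andP[/hN a /hM b].
have := cabsD (u n - l) (v n - m); rewrite opprD addrACA; lra.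
Qed.

Lemma ccvg_const l : ccvg (fun=> l) l.
Proof. by move=> e e0; exists 0 => n _; rewrite subrr cabs0. Qed.

Lemma ccvgZ k u l : ccvg u l -> ccvg (fun n => k * u n) (k * l).
Proof.
move=> h e e0; have k1 : 0 < cabs k + 1 by have := cabs_ge0 k; lra.
have [N hN] := h (e / (cabs k + 1)) (divr_gt0 e0 k1); exists N => n /hN.
rewrite -mulrBr cabsM ltr_pdivlMr // => a; apply: le_lt_trans a.
by rewrite mulrDr mulr1 mulrC lerDl cabs_ge0.
Qed.

Lemma ccvgN u l : ccvg u l -> ccvg (fun n => - u n) (- l).
Proof. by move=> h e /h[N hN]; exists N => n /hN; rewrite -opprD cabsN. Qed.

Lemma ccvgB u v l m : ccvg u l -> ccvg v m -> ccvg (fun n => u n - v n) (l - m).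
Proof. by move=> h h'; apply: ccvgD => //; apply: ccvgN. Qed.

Lemma ccvg_bounded u l : ccvg u l -> exists2 N, True & forall n, (N <= n)%N -> cabs (u n) <=
    cabs l + 1.
Proof.
move=> h; have [N hN] := h 1 ltr01; exists N => // n /hN.
by have := cabsBB (u n) l; lra.
Qed.

Lemma ccvgM u v l m : ccvg u l -> ccvg v m -> ccvg (fun n => u n * v n) (l * m).
Proof.
move=> h h' e e0; have [M _ hM] := ccvg_bounded h'.
have B0 : 0 < cabs m + 1 by have := cabs_ge0 m; lra.
have A0 : 0 < cabs l + 1 by have := cabs_ge0 l; lra.
have [N1 h1] := h (e / 2 / (cabs m + 1)) ltac:(by rewrite !divr_gt0).
have [N2 h2] := h' (e / 2 / (cabs l + 1)) ltac:(by rewrite !divr_gt0).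
exists (maxn M (maxn N1 N2)) => n; rewrite !geq_max => /and3P[/hM c /h1 a /h2 b].
have -> : u n * v n - l * m = (u n - l) * v n + l * (v n - m) by ring.
apply: le_lt_trans (cabsD _ _) _; rewrite !cabsM.
move: a b; rewrite !ltr_pdivlMr // => a b.
have : cabs (u n - l) * cabs (v n) <= cabs (u n - l) * (cabs m + 1).
  by rewrite ler_wpM2l ?cabs_ge0.
have : cabs l * cabs (v n - m) <= cabs (v n - m) * (cabs l + 1).
  by rewrite mulrC ler_wpM2l ?cabs_ge0 ?lerDl.
lra.
Qed.

Lemma ccvg_le u l (B : R) : (exists N, forall n, (N <= n)%N -> cabs (u n) <= B) -> ccvg u l ->
    cabs l <= B.
Proof.
move=> [N hN] h; apply/ler_addgt0Pr => e e0; have [M hM] := h e e0.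
have := hM _ (leq_maxr N M); have := hN _ (leq_maxl N M).
by have := cabsBB l (u (maxn N M)); rewrite cabsC; lra.
Qed.

Lemma ccvg_shift u l k : ccvg u l -> ccvg (fun n => u (n + k)%N) l.
Proof. by move=> h e /h[N hN]; exists N => n hn; apply: hN; apply: leq_trans hn (leq_addr _ _). Qed.

Lemma ccvg_ext u v l : (forall n, u n = v n) -> ccvg u l -> ccvg v l.
Proof. by move=> h /[swap] e /[apply] -[N hN]; exists N => n; rewrite -h; exact: hN. Qed.

Lemma real_cauchy (u : nat -> R) :
  (forall e : R, 0 < e -> exists N, forall n m, (N <= n)%N -> (N <= m)%N -> `|u n - u m| < e) ->
  exists l, forall e : R, 0 < e -> exists N, forall n, (N <= n)%N -> `|u n - l| < e.
Proof.
move=> h; have : cauchy (u @ \oo).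
  apply/cauchy_ballP => e e0; have [N hN] := h e e0.
  exists ([set y | exists2 n, (N <= n)%N & y = u n], [set y | exists2 n, (N <= n)%N & y = u n]).
    by split; exists N => // n /= hn; exists n.
  by move=> [a b] /= [[n hn ->] [m hm ->]]; exact: hN.
move/cauchy_cvg => /cvg_ex [l /cvgrPdist_lt hl]; exists l => e e0.
have [N _ hN] := hl e e0; exists N => n hn; rewrite distrC; exact: hN.
Qed.

Lemma ccauchy (u : nat -> C) :
  (forall e : R, 0 < e -> exists N, forall n m, (N <= n)%N -> (N <= m)%N -> cabs (u n - u m) < e) ->
  exists l, ccvg u l.
Proof.
move=> h.
have [|a ha] := @real_cauchy (fun n => complex.Re (u n)).
  move=> e /h[N hN]; exists N => n m hn hm; apply: le_lt_trans (hN n m hn hm).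
  by rewrite -ReN -ReD; apply: cabs_Re.
have [|b hb] := @real_cauchy (fun n => complex.Im (u n)).
  move=> e /h[N hN]; exists N => n m hn hm; apply: le_lt_trans (hN n m hn hm).
  by rewrite -ImN -ImD; apply: cabs_Im.
exists (a +i* b)%C => e e0; have e2 : 0 < e / 2 by lra.
have [N hN] := ha _ e2; have [M hM] := hb _ e2; exists (maxn N M) => n.
rewrite geq_max => /andP[/hN x /hM y]; apply: le_lt_trans (cabs_le _) _.
rewrite ReD ImD ReN ImN /=; lra.
Qed.

Lemma pow2_small (e : R) : 0 < e -> forall B : R, 0 <= B -> exists N, forall n, (N <= n)%N ->
    B / 2 ^+ n < e.
Proof.
move=> e0 B B0; have [N hN] : exists N : nat, B / e < N%:R.
  by exists (Num.truncn (B / e)).+1; exact: truncnS_gt.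
exists N => n hn; rewrite ltr_pdivrMr ?exprn_gt0 //.
rewrite ltr_pdivrMr // in hN; rewrite mulrC; apply: lt_le_trans hN _.
rewrite ler_pM2r // -natrX ler_nat; apply: leq_trans hn _; exact/ltnW/ltn_expl.
Qed.

Lemma exprn_small (r e : R) : 0 <= r < 1 -> 0 < e -> exists N, forall n, (N <= n)%N -> r ^+ n < e.
Proof.
move=> /andP[r0 r1] e0; have := @cvg_expr R r ltac:(by rewrite ger0_norm).
move=> /cvgrPdist_lt /(_ e e0) [N _ hN]; exists N => n /hN /=.
by rewrite sub0r normrN ger0_norm ?exprn_ge0.
Qed.

Lemma sum_geo_le (r : R) n m : 0 <= r < 1 -> \sum_(n <= i < m) r ^+ i <= r ^+ n / (1 - r).
Proof.
move=> /andP[r0 r1]; have d0 : 0 < 1 - r by lra.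
rewrite ler_pdivlMr //; case: (leqP n m) => [nm|mn]; last first.
  by rewrite big_geq ?mul0r ?exprn_ge0 // ltnW.
rewrite -(subnKC nm); elim: (m - n)%N => [|k IH].
  by rewrite addn0 big_geq ?mul0r ?exprn_ge0.
suff -> : (\sum_(n <= i < n + k.+1) r ^+ i) * (1 - r) = r ^+ n - r ^+ (n + k.+1).
  by rewrite gerBl exprn_ge0.
elim: k {IH} => [|k IH].
  by rewrite addn1 big_nat1 exprS; ring.
by rewrite addnS big_nat_recr ?leq_addr //= mulrDl IH !addnS !exprS; ring.
Qed.

(** The tail of the geometric series bounds the distance to the limit. Bisection, infinite products
    and power series all converge through this estimate. *)
Lemma ccvg_geo (u : nat -> C) (B r : R) : 0 <= B -> 0 <= r < 1 ->
  (forall n, cabs (u n.+1 - u n) <= B * r ^+ n) ->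
  exists2 l, ccvg u l & forall n, cabs (u n - l) <= B * r ^+ n / (1 - r).
Proof.
move=> B0 /[dup] r01 /andP[r0 r1] h.
have st n m : (n <= m)%N -> cabs (u m - u n) <= B * r ^+ n / (1 - r).
  move=> nm; apply: le_trans (_ : \sum_(n <= i < m) B * r ^+ i <= _); last first.
    by rewrite -mulr_sumr -mulrA ler_wpM2l // sum_geo_le.
  rewrite -(subnKC nm); elim: (m - n)%N => [|k IH]; first by rewrite addn0 subrr cabs0 big_geq.
  rewrite addnS big_nat_recr ?leq_addr //=; apply: le_trans (cabs_tri _ (u (n + k)%N) _) _.
  by rewrite addrC lerD.
have d0 : 0 < 1 - r by lra.
have [l hl] : exists l, ccvg u l.
  apply: ccauchy => e e0; have B1 : 0 < B + 1 by lra.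
  have [N hN] := exprn_small r01 (divr_gt0 (mulr_gt0 e0 d0) B1).
  have key n m : (N <= n)%N -> (n <= m)%N -> cabs (u m - u n) < e.
    move=> hn hm; apply: le_lt_trans (st n m hm) _; rewrite ltr_pdivrMr //.
    have := hN n hn; rewrite ltr_pdivlMr //; have := exprn_ge0 n r0; lra.
  exists N => n m hn hm; case: (leqP n m) => [nm|/ltnW mn]; last exact: key.
  by rewrite cabsC; exact: key.
exists l => // n; have hB := ccvgB (ccvg_const (u n)) hl.
apply: ccvg_le hB; exists n => m nm; rewrite cabsC; exact: st.
Qed.

(* A bisection argument, which stands in for compactness throughout. *)
Lemma bisection (X : Type) (bad : X -> Prop) (pt : X -> C) (sz : X -> R) (x0 : X) (K : C -> Prop) :
  bad x0 -> (forall x, 0 <= sz x) -> (forall x, bad x -> K (pt x)) ->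
  (forall u l, (forall n, K (u n)) -> ccvg u l -> K l) ->
  (forall x, bad x -> exists y, [/\ bad y, sz y = sz x / 2 & cabs (pt y - pt x) <= sz x]) ->
  exists2 z, K z & forall d : R, 0 < d -> exists x, [/\ bad x, sz x < d & cabs (pt x - z) <= 2 *
      sz x].
Proof.
move=> b0 sz0 bK cK step.
have nx (x : {x | bad x}) : {y : {x | bad x} | sz (sval y) = sz (sval x) / 2 /\
    cabs (pt (sval y) - pt (sval x)) <= sz (sval x)}.
  by apply: cid; case: x => x bx; have [y [by_ h1 h2]] := step x bx; exists (exist _ y by_).
pose u n := iter n (fun x => sval (nx x)) (exist _ x0 b0).
have szu n : sz (sval (u n)) = sz x0 * 2^-1 ^+ n.
  elim: n => [|n IH]; first by rewrite expr0 mulr1.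
  by rewrite /= exprS; have [-> _] := svalP (nx (u n)); rewrite IH; ring.
(* Consecutive points differ by at most the current size, which halves each time; the remaining
   steps add up to at most twice the size, whence the bound [2 * sz x]. *)
have [|l hl hb] := @ccvg_geo (fun n => pt (sval (u n))) (sz x0) 2^-1 (sz0 _) ltac:(lra).
  by move=> n; have [_ h] := svalP (nx (u n)); apply: (le_trans h); rewrite szu.
exists l; first by apply: cK hl => n; apply: bK; apply: svalP.
move=> d d0; have [N hN] := pow2_small d0 (sz0 x0); exists (sval (u N)).
have {hN} := hN N (leqnn _); have := hb N; rewrite szu -exprVn.
have e2 : 1 - 2^-1 = 2^-1 :> R by lra.
rewrite e2 invrK => h1 h3.
by split; [exact: svalP| exact: h3 | rewrite mulrC].
Qed.

End Basics.

(** * Continuity and holomorphy *)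

Section Cont.
Variable R : realType.
Notation C := (CC R).
Section Gen.
Variables (T : Type) (d : T -> T -> R).

(** [d] stands for a distance and is left abstract, so that one set of lemmas serves functions on
    [C] (with [d1]) and on [C3] (with [d3]). *)
Definition cont_at (f : T -> C) (p : T) :=
  forall e : R, 0 < e -> exists2 r : R, 0 < r & forall q, d p q < r -> cabs (f q - f p) < e.

Hypothesis dpp : forall p, d p p = 0.

Lemma cont_const k p : cont_at (fun=> k) p.
Proof. by move=> e e0; exists 1 => // q _; rewrite subrr cabs0. Qed.

Lemma contD f g p : cont_at f p -> cont_at g p -> cont_at (fun q => f q + g q) p.
Proof.
move=> hf hg e e0; have e2 : 0 < e / 2 by lra.
have [r r0 hr] := hf _ e2; have [s s0 hs] := hg _ e2.
exists (Num.min r s); first by rewrite lt_min r0.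
move=> q; rewrite lt_min => /andP[/hr a /hs b].
have := cabsD (f q - f p) (g q - g p).
rewrite opprD addrACA; lra.
Qed.

Lemma cont_bd f p : cont_at f p -> exists2 r : R, 0 < r & forall q, d p q < r -> cabs (f q) <=
    cabs (f p) + 1.
Proof.
move=> h; have [r r0 hr] := h 1 ltr01; exists r => // q /hr.
by have := cabsBB (f q) (f p); lra.
Qed.

Lemma contM f g p : cont_at f p -> cont_at g p -> cont_at (fun q => f q * g q) p.
Proof.
move=> hf hg e e0.
have A0 : 0 < cabs (f p) + 1 by have := cabs_ge0 (f p); lra.
have B0 : 0 < cabs (g p) + 1 by have := cabs_ge0 (g p); lra.
have [b b0 hb] := cont_bd hf.
have [r r0 hr] := hf (e / 2 / (cabs (g p) + 1)) ltac:(by rewrite !divr_gt0).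
have [s s0 hs] := hg (e / 2 / (cabs (f p) + 1)) ltac:(by rewrite !divr_gt0).
exists (Num.min b (Num.min r s)); first by rewrite !lt_min b0 r0.
move=> q; rewrite !lt_min => /and3P[/hb fb /hr a /hs a'].
have -> : f q * g q - f p * g p = f q * (g q - g p) + (f q - f p) * g p by ring.
apply: le_lt_trans (cabsD _ _) _; rewrite !cabsM.
move: a a'; rewrite !ltr_pdivlMr // => a a'.
have : cabs (f q) * cabs (g q - g p) <= cabs (g q - g p) * (cabs (f p) + 1).
  by rewrite mulrC ler_wpM2l ?cabs_ge0.
have : cabs (f q - f p) * cabs (g p) <= cabs (f q - f p) * (cabs (g p) + 1).
  by rewrite ler_wpM2l ?cabs_ge0 ?lerDl.
lra.
Qed.

Lemma contN f p : cont_at f p -> cont_at (fun q => - f q) p.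
Proof. by move=> h e /h[r r0 hr]; exists r => // q /hr; rewrite -opprD cabsN. Qed.

Lemma cont_ne0 f p : cont_at f p -> f p != 0 -> exists2 r : R, 0 < r & forall q, d p q < r ->
    cabs (f p) / 2 <= cabs (f q).
Proof.
move=> h n0; have a0 : 0 < cabs (f p) / 2 by rewrite divr_gt0 ?cabs_gt0.
have [r r0 hr] := h _ a0; exists r => // q /hr.
by have := cabsBB (f p) (f q); rewrite cabsC; lra.
Qed.

Lemma contV f p : cont_at f p -> f p != 0 -> cont_at (fun q => (f q)^-1) p.
Proof.
move=> h n0 e e0; have [b b0 hb] := cont_ne0 h n0.
have A0 : 0 < cabs (f p) by rewrite cabs_gt0.
have [r r0 hr] := h (e * (cabs (f p) * (cabs (f p) / 2))) ltac:(by rewrite !(mulr_gt0,divr_gt0)).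
exists (Num.min b r); first by rewrite lt_min b0.
move=> q; rewrite lt_min => /andP[/hb B /hr h1].
have fq0 : 0 < cabs (f q) by lra.
have nq : f q != 0 by rewrite -cabs_gt0.
have -> : (f q)^-1 - (f p)^-1 = (f p - f q) * ((f p) * f q)^-1 by field; rewrite nq.
rewrite cabsM cabsC cabsV cabsM ltr_pdivrMr ?mulr_gt0 //.
apply: lt_le_trans h1 _; rewrite !ler_pM2l //.
Qed.

Lemma cont_ext f g p : (exists2 r : R, 0 < r & forall q, d p q < r -> f q = g q) -> cont_at f p ->
    cont_at g p.
Proof.
move=> [r r0 hr] h e /h[s s0 hs]; exists (Num.min r s); first by rewrite lt_min r0.
by move=> q; rewrite lt_min => /andP[/hr <- /hs]; rewrite -hr ?dpp.
Qed.

End Gen.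

Definition d1 (z w : C) := cabs (w - z).
Definition C3 := (C * C * C)%type.
Definition d3 (p q : C3) := cabs (q.1.1 - p.1.1) + cabs (q.1.2 - p.1.2) + cabs (q.2 - p.2).

Lemma d1xx z : d1 z z = 0. Proof. by rewrite /d1 subrr cabs0. Qed.
Lemma d3xx p : d3 p p = 0. Proof. by rewrite /d3 !subrr cabs0 !addr0. Qed.
Lemma d3_0 p q : cabs (q.1.1 - p.1.1) <= d3 p q.
Proof. rewrite /d3; have := cabs_ge0 (q.1.2 - p.1.2); have := cabs_ge0 (q.2 - p.2); lra. Qed.
Lemma d3_1 p q : cabs (q.1.2 - p.1.2) <= d3 p q.
Proof. rewrite /d3; have := cabs_ge0 (q.1.1 - p.1.1); have := cabs_ge0 (q.2 - p.2); lra. Qed.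
Lemma d3_2 p q : cabs (q.2 - p.2) <= d3 p q.
Proof. rewrite /d3; have := cabs_ge0 (q.1.2 - p.1.2); have := cabs_ge0 (q.1.1 - p.1.1); lra. Qed.
Lemma d3_ge0 p q : 0 <= d3 p q.
Proof. by rewrite /d3 !addr_ge0 ?cabs_ge0. Qed.
Lemma d3_tri p q r : d3 p r <= d3 p q + d3 q r.
Proof.
rewrite /d3; have := cabs_tri r.1.1 q.1.1 p.1.1; have := cabs_tri r.1.2 q.1.2 p.1.2.
have := cabs_tri r.2 q.2 p.2; lra.
Qed.

Definition cont1 := cont_at d1.
Definition cont3 := cont_at d3.

Lemma cont1_id z : cont1 id z. Proof. by move=> e e0; exists e. Qed.
Lemma cont3_0 p : cont3 (fun q => q.1.1) p.
Proof. by move=> e e0; exists e => // q; apply: le_lt_trans (d3_0 _ _). Qed.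
Lemma cont3_1 p : cont3 (fun q => q.1.2) p.
Proof. by move=> e e0; exists e => // q; apply: le_lt_trans (d3_1 _ _). Qed.
Lemma cont3_2 p : cont3 (fun q => q.2) p.
Proof. by move=> e e0; exists e => // q; apply: le_lt_trans (d3_2 _ _). Qed.

Lemma cont_comp1 T (d : T -> T -> R) F f p : cont1 F (f p) -> cont_at d f p ->
    cont_at d (fun q => F (f q)) p.
Proof. by move=> hF hf e /hF[r r0 hr]; have [s s0 hs] := hf r r0; exists s => // q /hs /hr. Qed.

Lemma cont_comp3 T (d : T -> T -> R) (F : C3 -> C) f g h p : cont3 F (f p, g p, h p) ->
  cont_at d f p -> cont_at d g p -> cont_at d h p -> cont_at d (fun q => F (f q, g q, h q)) p.
Proof.
move=> hF hf hg hh e /hF[r r0 hr]; have r3 : 0 < r / 3 by lra.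
have [s s0 hs] := hf _ r3; have [t t0 ht] := hg _ r3; have [u u0 hu] := hh _ r3.
exists (Num.min s (Num.min t u)); first by rewrite !lt_min s0 t0.
move=> q; rewrite !lt_min => /and3P[/hs a /ht b /hu c]; apply: hr; rewrite /d3 /=; lra.
Qed.

(* Caratheodory's form of complex differentiability: the difference quotient extends continuously to
   z. *)
Definition cdiff (f : C -> C) (z l : C) :=
  exists phi : C -> C, [/\ cont1 phi z, phi z = l &
    exists2 r : R, 0 < r & forall w, cabs (w - z) < r -> f w - f z = phi w * (w - z)].

Definition cder f z := exists l, cdiff f z l.

Lemma cdiff_cont f z l : cdiff f z l -> cont1 f z.
Proof.
move=> [phi [hp _ [r r0 hr]]].
have h : cont1 (fun w => f z + phi w * (w - z)) z.
  by apply: contD; [exact: cont_const|apply: contM => //; apply: contD;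
      [exact: cont1_id|exact: cont_const]].
apply: cont_ext h; first exact: d1xx.
by exists r => // w hw; rewrite -hr // addrC subrK.
Qed.

Lemma cder_cont f z : cder f z -> cont1 f z.
Proof. by case=> l /cdiff_cont. Qed.

Lemma cdiff_const k z : cdiff (fun=> k) z 0.
Proof. by exists (fun=> 0); split => //; [exact: cont_const|exists 1 => // w _;
    rewrite subrr mul0r]. Qed.
Lemma cdiff_id z : cdiff id z 1.
Proof. by exists (fun=> 1); split => //; [exact: cont_const|exists 1 => // w _; rewrite mul1r]. Qed.
Lemma cdiffD f g z l m : cdiff f z l -> cdiff g z m -> cdiff (fun w => f w + g w) z (l + m).
Proof.
move=> [p [hp <- [r r0 hr]]] [q [hq <- [s s0 hs]]].
exists (fun w => p w + q w); split => //; first exact: contD.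
exists (Num.min r s); first by rewrite lt_min r0.
by move=> w; rewrite lt_min => /andP[/hr a /hs b]; rewrite mulrDl -a -b; ring.
Qed.

Lemma cdiffM f g z l m : cdiff f z l -> cdiff g z m -> cdiff (fun w => f w * g w) z
    (f z * m + l * g z).
Proof.
move=> hf [q [hq <- [s s0 hs]]]; have cf := cdiff_cont hf; move: hf => [p [hp <- [r r0 hr]]].
exists (fun w => f w * q w + p w * g z); split => //.
  by apply: contD; apply: contM => //; apply: cont_const.
exists (Num.min r s); first by rewrite lt_min r0.
move=> w; rewrite lt_min => /andP[/hr a /hs b]; rewrite mulrDl -mulrA -b mulrAC -a; ring.
Qed.

Lemma cdiffV f z l : cdiff f z l -> f z != 0 -> cdiff (fun w => (f w)^-1) z (- l / (f z * f z)).
Proof.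
move=> hf n0; have cf := cdiff_cont hf; move: hf => [p [hp <- [r r0 hr]]].
have [b b0 hb] := cont_ne0 cf n0.
exists (fun w => - p w / (f w * f z)); split => //.
  apply: contM; first exact: contN.
  apply: contV; last by rewrite mulf_neq0.
  by apply: contM => //; apply: cont_const.
exists (Num.min r b); first by rewrite lt_min r0.
move=> w; rewrite lt_min => /andP[/hr a hw]; have nw : f w != 0.
  by rewrite -cabs_gt0; apply: lt_le_trans (hb w hw); rewrite divr_gt0 ?cabs_gt0.
rewrite mulrAC mulNr -a; by field; rewrite nw n0.
Qed.

Lemma cdiff_comp F f z l m : cdiff F (f z) m -> cdiff f z l -> cdiff (fun w => F (f w)) z (m * l).
Proof.
move=> [P [hP <- [s s0 hs]]] hf; have cf := cdiff_cont hf; move: hf => [p [hp <- [r r0 hr]]].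
have [t t0 ht] := cf s s0.
exists (fun w => P (f w) * p w); split => //.
  by apply: contM => //; apply: cont_comp1.
exists (Num.min r t); first by rewrite lt_min r0.
by move=> w; rewrite lt_min => /andP[/hr a /ht b]; rewrite hs // a mulrA.
Qed.

Lemma cdiff_ext f g z l : (exists2 r : R, 0 < r & forall q, cabs (q - z) < r -> f q = g q) ->
    cdiff f z l -> cdiff g z l.
Proof.
move=> [r r0 hr] [p [hp hl [s s0 hs]]]; exists p; split => //.
exists (Num.min r s); first by rewrite lt_min r0.
by move=> w; rewrite lt_min => /andP[a /hs <-]; rewrite !hr // subrr cabs0.
Qed.

Lemma cdiff_eps f z l : cdiff f z l -> forall e : R, 0 < e -> exists2 r : R, 0 < r &
  forall w, cabs (w - z) < r -> cabs (f w - f z - l * (w - z)) <= e * cabs (w - z).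
Proof.
move=> [p [hp <- [s s0 hs]]] e /hp[r r0 hr]; exists (Num.min r s); first by rewrite lt_min r0.
move=> w; rewrite lt_min => /andP[/hr a /hs ->]; rewrite -mulrBl cabsM.
by rewrite ler_wpM2r ?cabs_ge0 // ltW.
Qed.

Lemma cdiffP f z l : (forall e : R, 0 < e -> exists2 r : R, 0 < r &
  forall w, cabs (w - z) < r -> cabs (f w - f z - l * (w - z)) <= e * cabs (w - z)) -> cdiff f z l.
Proof.
move=> h; exists (fun w => if w == z then l else (f w - f z) / (w - z)); split.
- move=> e e0; have [r r0 hr] := h (e / 2) ltac:(lra); exists r => // w hw; rewrite eqxx.
  case: eqP => [|/eqP n]; first by rewrite subrr cabs0.
  have n1 : w - z != 0 by rewrite subr_eq0.
  have -> : (f w - f z) / (w - z) - l = (f w - f z - l * (w - z)) / (w - z) by field.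
  rewrite cabsM cabsV ltr_pdivrMr ?cabs_gt0 //; apply: le_lt_trans (hr w hw) _.
  by rewrite ltr_pM2r ?cabs_gt0 //; lra.
- by rewrite eqxx.
- exists 1 => // w _; case: eqP => [->|/eqP n]; first by rewrite !subrr mulr0.
  by rewrite mulfVK // subr_eq0.
Qed.

Lemma cdiff_quad f z l (r B : R) : 0 < r -> 0 <= B ->
  (forall w, cabs (w - z) < r -> cabs (f w - f z - l * (w - z)) <= B * cabs (w - z) ^+ 2) ->
      cdiff f z l.
Proof.
move=> r0 B0 h; apply: cdiffP => e e0; have B1 : 0 < B + 1 by lra.
exists (Num.min r (e / (B + 1))); first by rewrite lt_min r0 divr_gt0.
move=> w; rewrite lt_min => /andP[/h a b]; apply: le_trans a _.
rewrite expr2 mulrA ler_wpM2r ?cabs_ge0 //; move: b; rewrite ltr_pdivlMr //.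
have := cabs_ge0 (w - z); nra.
Qed.

Lemma cdiff_unique f z l m : cdiff f z l -> cdiff f z m -> l = m.
Proof.
move=> h h'; apply/eqP; rewrite -subr_eq0 -cabs_eq0; apply: contraT => ne.
have D0 : 0 < cabs (l - m) by rewrite lt_neqAle cabs_ge0 eq_sym ne.
have [r r0 hr] := cdiff_eps h (e := cabs (l - m) / 4) ltac:(lra).
have [s s0 hs] := cdiff_eps h' (e := cabs (l - m) / 4) ltac:(lra).
pose t := Num.min r s / 2; have t0 : 0 < t by rewrite divr_gt0 // lt_min r0.
have mr : Num.min r s <= r by rewrite ge_min lexx.
have ms : Num.min r s <= s by rewrite ge_min lexx orbT.
have tr : t < r by move: t0; rewrite /t; lra.
have ts : t < s by move: t0; rewrite /t; lra.
have ez : z + t%:C%C - z = t%:C%C by rewrite addrC addKr.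
have := hr (z + t%:C%C); have := hs (z + t%:C%C); rewrite ez cabs_real gtr0_norm // =>
    /(_ ts) a /(_ tr) b.
have := cabsB (f (z + t%:C%C) - f z - m * t%:C%C) (f (z + t%:C%C) - f z - l * t%:C%C).
have -> : (f (z + t%:C%C) - f z - m * t%:C%C) - (f (z + t%:C%C) - f z - l * t%:C%C) = (l - m) *
    t%:C%C by ring.
rewrite cabsM cabs_real gtr0_norm //; nra.
Qed.

(* Caratheodory's form of Frechet differentiability, with partial derivatives A, B, D. *)
Definition hol3d (f : C3 -> C) (p : C3) (A B D : C) :=
  exists (a b c : C3 -> C), [/\ cont3 a p /\ a p = A, cont3 b p /\ b p = B, cont3 c p /\ c p = D &
    exists2 r : R, 0 < r & forall q, d3 p q < r ->
      f q - f p = a q * (q.1.1 - p.1.1) + b q * (q.1.2 - p.1.2) + c q * (q.2 - p.2)].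
Definition hol3 f p := exists A B D, hol3d f p A B D.

Lemma hol3_cont f p : hol3 f p -> cont3 f p.
Proof.
move=> [A [B [D [a [b [c [[ha _] [hb _] [hc _] [r r0 hr]]]]]]]].
have h : cont3 (fun q => f p + (a q * (q.1.1 - p.1.1) + b q * (q.1.2 - p.1.2) + c q * (q.2 - p.2)))
    p.
  apply: contD; first exact: cont_const.
  apply: contD; [apply: contD|]; apply: contM => //; apply: contD; try exact: cont_const.
  - exact: cont3_0.
  - exact: cont3_1.
  - exact: cont3_2.
apply: cont_ext h; first exact: d3xx.
by exists r => // w hw; rewrite -hr // addrC subrK.
Qed.

Lemma hol3_const k p : hol3 (fun=> k) p.
Proof.
exists 0, 0, 0, (fun=> 0), (fun=> 0), (fun=> 0); split; try (split => //; exact: cont_const).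
by exists 1 => // q _; rewrite !mul0r !addr0 subrr.
Qed.

Lemma hol3_0 p : hol3 (fun q => q.1.1) p.
Proof.
exists 1, 0, 0, (fun=> 1), (fun=> 0), (fun=> 0); split; try (split => //; exact: cont_const).
by exists 1 => // q _; rewrite !mul0r !addr0 mul1r.
Qed.

Lemma hol3_1 p : hol3 (fun q => q.1.2) p.
Proof.
exists 0, 1, 0, (fun=> 0), (fun=> 1), (fun=> 0); split; try (split => //; exact: cont_const).
by exists 1 => // q _; rewrite !mul0r addr0 add0r mul1r.
Qed.

Lemma hol3_2 p : hol3 (fun q => q.2) p.
Proof.
exists 0, 0, 1, (fun=> 0), (fun=> 0), (fun=> 1); split; try (split => //; exact: cont_const).
by exists 1 => // q _; rewrite !mul0r !add0r mul1r.
Qed.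

Lemma hol3D f g p : hol3 f p -> hol3 g p -> hol3 (fun q => f q + g q) p.
Proof.
move=> [A [B [D [a [b [c [[ha _] [hb _] [hc _] [r r0 hr]]]]]]]].
move=> [A' [B' [D' [a' [b' [c' [[ha' _] [hb' _] [hc' _] [s s0 hs]]]]]]]].
do 3 eexists; exists (fun q => a q + a' q), (fun q => b q + b' q), (fun q => c q + c' q).
split; try (split; [exact: contD|reflexivity]).
exists (Num.min r s); first by rewrite lt_min r0.
by move=> q; rewrite lt_min => /andP[/hr x /hs y]; rewrite opprD addrACA x y; ring.
Qed.

Lemma hol3M f g p : hol3 f p -> hol3 g p -> hol3 (fun q => f q * g q) p.
Proof.
move=> hf; have cf := hol3_cont hf; move: hf.
move=> [A [B [D [a [b [c [[ha _] [hb _] [hc _] [r r0 hr]]]]]]]].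
move=> [A' [B' [D' [a' [b' [c' [[ha' _] [hb' _] [hc' _] [s s0 hs]]]]]]]].
do 3 eexists; exists (fun q => a q * g p + f q * a' q), (fun q => b q * g p + f q * b' q),
    (fun q => c q * g p + f q * c' q).
split; try (split; [by apply: contD; apply: contM => //; exact: cont_const|reflexivity]).
exists (Num.min r s); first by rewrite lt_min r0.
move=> q; rewrite lt_min => /andP[/hr x /hs y].
have -> : f q * g q - f p * g p = f q * (g q - g p) + (f q - f p) * g p by ring.
rewrite x y; ring.
Qed.

Lemma hol3_comp1 F f p : cder F (f p) -> hol3 f p -> hol3 (fun q => F (f q)) p.
Proof.
move=> [m [P [hP _ [s s0 hs]]]] hf; have cf := hol3_cont hf; move: hf.
move=> [A [B [D [a [b [c [[ha _] [hb _] [hc _] [r r0 hr]]]]]]]].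
have [t t0 ht] := cf s s0; have cP : cont3 (fun q => P (f q)) p by apply: cont_comp1.
do 3 eexists; exists (fun q => P (f q) * a q), (fun q => P (f q) * b q), (fun q => P (f q) * c q).
split; try (split; [by apply: contM|reflexivity]).
exists (Num.min r t); first by rewrite lt_min r0.
by move=> q; rewrite lt_min => /andP[/hr x /ht y]; rewrite hs // x; ring.
Qed.

Lemma hol3_comp3 F f g h p : hol3 F (f p, g p, h p) -> hol3 f p -> hol3 g p -> hol3 h p ->
  hol3 (fun q => F (f q, g q, h q)) p.
Proof.
move=> [? [? [? [P [Q [S [[hP _] [hQ _] [hS _] [t t0 ht]]]]]]]] hf hg hh.
have cf := hol3_cont hf; have cg := hol3_cont hg; have ch := hol3_cont hh; move: hf hg hh.
move=> [? [? [? [a [b [c [[ha _] [hb _] [hc _] [r r0 hr]]]]]]]].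
move=> [? [? [? [a' [b' [c' [[ha' _] [hb' _] [hc' _] [r' r0' hr']]]]]]]].
move=> [? [? [? [a2 [b2 [c2 [[ha2 _] [hb2 _] [hc2 _] [r2 r02 hr2]]]]]]]].
have cP : cont3 (fun q => P (f q, g q, h q)) p by apply: cont_comp3.
have cQ : cont3 (fun q => Q (f q, g q, h q)) p by apply: cont_comp3.
have cS : cont3 (fun q => S (f q, g q, h q)) p by apply: cont_comp3.
do 3 eexists; exists (fun q => P (f q, g q, h q) * a q + Q (f q, g q, h q) * a' q +
    S (f q, g q, h q) * a2 q),
 (fun q => P (f q, g q, h q) * b q + Q (f q, g q, h q) * b' q + S (f q, g q, h q) * b2 q),
 (fun q => P (f q, g q, h q) * c q + Q (f q, g q, h q) * c' q + S (f q, g q, h q) * c2 q).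
split; try (split; [by apply: contD; [apply: contD|]; apply: contM|reflexivity]).
have t3 : 0 < t / 3 by lra.
have [u u0 hu] := cf _ t3; have [u' u0' hu'] := cg _ t3; have [u2 u02 hu2] := ch _ t3.
exists (Num.min (Num.min r (Num.min r' r2)) (Num.min u (Num.min u' u2)));
    first by rewrite !lt_min r0 r0' r02 u0 u0'.
move=> q; rewrite !lt_min => /andP[/and3P[/hr x /hr' y /hr2 z] /and3P[/hu x' /hu' y' /hu2 z']].
rewrite ht /=; last by rewrite /d3 /=; lra.
rewrite x y z; ring.
Qed.

Lemma hol3_ext f g p : (exists2 r : R, 0 < r & forall q, d3 p q < r -> f q = g q) -> hol3 f p ->
    hol3 g p.
Proof.
move=> [s s0 hs] [A [B [D [a [b [c [ha hb hc [r r0 hr]]]]]]]]; exists A, B, D, a, b, c; split => //.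
exists (Num.min r s); first by rewrite lt_min r0.
by move=> q; rewrite lt_min => /andP[/hr x /hs <-]; rewrite -hs ?d3xx.
Qed.

Lemma hol3_eq f g p : (forall q, f q = g q) -> hol3 f p -> hol3 g p.
Proof. by move=> h; apply: hol3_ext; exists 1. Qed.
Lemma hol3N f p : hol3 f p -> hol3 (fun q => - f q) p.
Proof.
move=> hf; have := hol3M (hol3_const (-1) p) hf; apply: hol3_eq => q; by rewrite mulN1r.
Qed.

Lemma hol3V f p : hol3 f p -> f p != 0 -> hol3 (fun q => (f q)^-1) p.
Proof.
move=> hf n0; apply: (hol3_comp1 (F := fun z => z^-1)) => //.
by eexists; apply: cdiffV => //; apply: cdiff_id.
Qed.

Lemma hol3X f p n : hol3 f p -> hol3 (fun q => f q ^+ n) p.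
Proof.
move=> hf; elim: n => [|n IH]; first by apply: hol3_eq (hol3_const 1 p) => q.
by apply: hol3_eq (hol3M hf IH) => q; rewrite exprS.
Qed.

(** The chain rule along a curve. Applied to straight lines it turns joint holomorphy into
    one-variable statements, to which Cauchy's estimates apply. *)
Lemma hol3d_curve f p A B D (x y z : C -> C) t x' y' z' : hol3d f p A B D -> p = (x t, y t, z t) ->
  cdiff x t x' -> cdiff y t y' -> cdiff z t z' ->
  cdiff (fun s => f (x s, y s, z s)) t (A * x' + B * y' + D * z').
Proof.
move=> + pE; subst p; move=> [a [b [c [[ha <-] [hb <-] [hc <-] [r r0 hr]]]]] hx hy hz.
have cx := cdiff_cont hx; have cy := cdiff_cont hy; have cz := cdiff_cont hz.
move: hx hy hz => [X [hX <- [s s0 hs]]] [Y [hY <- [s' s0' hs']]] [Z [hZ <- [s2 s02 hs2]]].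
exists (fun w => a (x w, y w, z w) * X w + b (x w, y w, z w) * Y w + c (x w, y w, z w) * Z w).
split => //.
  by apply: contD; [apply: contD|]; apply: contM => //; apply: cont_comp3.
have r3 : 0 < r / 3 by lra.
have [u u0 hu] := cx _ r3; have [u' u0' hu'] := cy _ r3; have [u2 u02 hu2] := cz _ r3.
exists (Num.min (Num.min s (Num.min s' s2)) (Num.min u (Num.min u' u2)));
    first by rewrite !lt_min s0 s0' s02 u0 u0'.
move=> w; rewrite !lt_min => /andP[/and3P[/hs e1 /hs' e2 /hs2 e3] /and3P[/hu k1 /hu' k2 /hu2 k3]].
rewrite hr /=; last by rewrite /d3 /=; lra.
rewrite e1 e2 e3; ring.
Qed.

End Cont.

(** * The complex exponential *)

Section Cexp.
Variable R : realType.
Notation C := (CC R).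
(* 2 pi i *)
Definition tpi : C := ((0 : R) +i* (2 * pi))%C.

Lemma cexpD (x y : C) : cexp (x + y) = cexp x * cexp y.
Proof.
case: x y => [a b] [c d]; rewrite /cexp /= expRD cosD sinD.
by apply: C_eqP => /=; ring.
Qed.

Lemma cexp0 : cexp 0 = 1 :> C.
Proof. by rewrite /cexp /= expR0 cos0 sin0 mulr0 mulr1. Qed.
Lemma cexp_ne0 (z : C) : cexp z != 0. Proof. exact: cexp_neq0. Qed.
Lemma cexpN (z : C) : cexp (- z) = (cexp z)^-1.
Proof.
by apply: (mulIf (cexp_ne0 z)); rewrite mulVf ?cexp_ne0 // -cexpD addNr cexp0.
Qed.

Lemma cexpMn (z : C) n : cexp (n%:R * z) = cexp z ^+ n.
Proof.
by elim: n => [|n IH]; rewrite ?mul0r ?cexp0 // exprS -IH -cexpD; congr cexp; rewrite -natr1; ring.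
Qed.

Lemma cabs_cexp (z : C) : cabs (cexp z) = expR (complex.Re z).
Proof.
apply/eqP; rewrite -(eqrXn2 (n := 2)) ?cabs_ge0 ?expR_ge0 // cabs_sq /cexp /=.
by rewrite !exprMn -mulrDr cos2Dsin2 mulr1.
Qed.

Lemma sin_le_id (x : R) : 0 <= x -> `|sin x| <= x.
Proof.
move=> x0; have [c _] := @MVT_segment R sin cos 0 x x0 (fun y _ => is_derive_sin y)
    ltac:(exact/continuous_subspaceT/continuous_sin).
rewrite sin0 !subr0 => ->; rewrite normrM (ger0_norm x0) ler_piMl //.
by have := cos_max c.
Qed.

Lemma sin_abs (x : R) : `|sin x| <= `|x|.
Proof.
case: (leP 0 x) => h; first by rewrite (ger0_norm h) sin_le_id.
rewrite -normrN -sinN -[leRHS]normrN (ger0_norm (x := - x)); last by lra.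
by apply: sin_le_id; lra.
Qed.

Lemma cos_quad (x : R) : `|cos x - 1| <= x ^+ 2.
Proof.
have -> : cos x = 1 - 2 * sin (x / 2) ^+ 2.
  have {1}-> : x = x / 2 + x / 2 by lra.
  rewrite cosD -!expr2; have := cos2Dsin2 (x / 2); lra.
have -> : 1 - 2 * sin (x / 2) ^+ 2 - 1 = - (2 * sin (x / 2) ^+ 2) by ring.
rewrite normrN ger0_norm; last by apply: mulr_ge0 => //; exact: sqr_ge0.
have : sin (x / 2) ^+ 2 <= (x / 2) ^+ 2.
  rewrite -(real_normK (num_real (sin _))) -[leRHS](real_normK (num_real (x / 2))).
  by rewrite lerXn2r ?nnegrE ?normr_ge0 // sin_abs.
have := sqr_ge0 x; rewrite exprMn; have -> : (2^-1 : R) ^+ 2 = 4^-1 by field.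
by lra.
Qed.

Lemma sin_quad (x : R) : `|x| <= 1 -> `|sin x - x| <= x ^+ 2.
Proof.
wlog x0 : x / 0 <= x => [h|x1].
  case: (leP 0 x) => hx; first exact: h.
  by rewrite -normrN => x1; have := h (- x) ltac:(lra) x1; rewrite sinN sqrrN opprK addrC -normrN
      opprB.
have [c] := @MVT_segment R sin cos 0 x x0 (fun y _ => is_derive_sin y)
    ltac:(exact/continuous_subspaceT/continuous_sin).
rewrite in_itv /= => /andP[c0 cx]; rewrite sin0 !subr0 => ->.
have -> : cos c * x - x = (cos c - 1) * x by ring.
rewrite normrM (ger0_norm x0); have := cos_quad c; move: x1; rewrite (ger0_norm x0) => x1 h.
apply: le_trans (_ : c ^+ 2 * x <= _); first by rewrite ler_wpM2r.
rewrite [leRHS]expr2 ler_wpM2r //; nra.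
Qed.

Lemma expR_quad (x : R) : `|x| <= 2^-1 -> `|expR x - 1 - x| <= 2 * x ^+ 2.
Proof.
rewrite ler_norml => /andP[a b]; have h1 := expR_ge1Dx x; have h2 := expR_ge1Dx (- x).
have := expR_gt0 x; rewrite expRN in h2 => e0.
have h3 : expR x * (1 - x) <= 1 by rewrite -ler_pdivlMl // mulr1.
rewrite ger0_norm; last lra.
nra.
Qed.

(** The constant 20 is crude: what counts is the quadratic error, which [cdiff_quad] turns into the
    derivative. *)
Lemma cexp_quad (w : C) : cabs w <= 2^-1 -> cabs (cexp w - 1 - w) <= 20 * cabs w ^+ 2.
Proof.
move=> hw; have hre := le_trans (cabs_Re w) hw; have him := le_trans (cabs_Im w) hw.
apply: le_trans (cabs_le _) _.
rewrite cabs_sq; case: w hre him {hw} => a b /= ha hb; rewrite /cexp /=.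
have Ea := expR_quad ha; have Cb := cos_quad b; have Sb := @sin_quad b ltac:(lra).
have sb := sin_abs b; have e0 := expR_gt0 a.
have e1 : expR a <= 3 by move: Ea; rewrite ler_norml => /andP[_]; move: ha; rewrite ler_norml; nra.
have e2 : `|expR a - 1| <= 2 * `|a|.
  have -> : expR a - 1 = (expR a - 1 - a) + a by ring.
  apply: le_trans (ler_normD _ _) _; rewrite -(real_normK (num_real a)) in Ea.
  have := normr_ge0 a; nra.
have -> : expR a * cos b - 1 - a = (expR a - 1 - a) + expR a * (cos b - 1) by ring.
have -> : expR a * sin b - 0 - b = (expR a - 1) * sin b + (sin b - b) by ring.
have t1 := ler_normD (expR a - 1 - a) (expR a * (cos b - 1)).
have t2 := ler_normD ((expR a - 1) * sin b) (sin b - b).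
move: t1 t2; rewrite !normrM (gtr0_norm e0) => t1 t2.
have u1 : expR a * `|cos b - 1| <= 3 * b ^+ 2 by apply: ler_pM => //; exact: ltW.
have u2 : `|expR a - 1| * `|sin b| <= (2 * `|a|) * `|b| by apply: ler_pM.
have u3 : 2 * `|a| * `|b| <= a ^+ 2 + b ^+ 2.
  rewrite -(real_normK (num_real a)) -(real_normK (num_real b)).
  have := sqr_ge0 (`|a| - `|b|); rewrite sqrrB; lra.
have := sqr_ge0 a; have := sqr_ge0 b; lra.
Qed.

Lemma cdiff_cexp (z : C) : cdiff (@cexp R) z (cexp z).
Proof.
apply: (@cdiff_quad R _ z _ 2^-1 (20 * cabs (cexp z))); rewrite ?mulr_ge0 ?cabs_ge0 ?invr_gt0 //.
move=> w hw; have -> : cexp w = cexp z * cexp (w - z) by rewrite -cexpD addrC subrK.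
have -> : cexp z * cexp (w - z) - cexp z - cexp z * (w - z) = cexp z * (cexp (w - z) - 1 - (w - z))
    by ring.
rewrite cabsM [20 * _]mulrC -mulrA ler_wpM2l ?cabs_ge0 // cexp_quad // ltW //.
Qed.

Lemma cexp_tpi : cexp tpi = 1.
Proof. by rewrite /cexp /tpi /= expR0 !mul1r mulr_natl cos2pi sin2pi. Qed.
Lemma cabs_tpi : cabs tpi = 2 * pi.
Proof.
rewrite /cabs /tpi /= expr0n add0r sqrtr_sqr ger0_norm //.
by rewrite mulr_ge0 // ltW // pi_gt0.
Qed.

Lemma tpi_ne0 : tpi != 0.
Proof. by rewrite -cabs_gt0 cabs_tpi mulr_gt0 // pi_gt0. Qed.
Lemma cexp_int_tpi (k : int) : cexp (k%:~R * tpi) = 1.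
Proof.
case: k => n; first by rewrite (cexpMn tpi n) cexp_tpi expr1n.
by rewrite NegzE mulrNz mulNr cexpN (cexpMn tpi n.+1) cexp_tpi expr1n invr1.
Qed.

Lemma cexp_eq1 (z : C) : cexp z = 1 -> exists k : int, z = k%:~R * tpi.
Proof.
move=> h; have p0 := pi_gt0 R.
(* After [k] periods are subtracted the imaginary part v lies in [0, 2 pi), where cos v = 1 - 2
   sin^2(v / 2) equals 1 only at v = 0. *)
pose k := Num.floor (complex.Im z / (2 * pi)); exists k.
pose w := z - k%:~R * tpi.
have hw : cexp w = 1 by rewrite /w cexpD cexpN cexp_int_tpi invr1 mulr1.
suff : w = 0 by move/eqP; rewrite subr_eq0 => /eqP.
have re0 : complex.Re w = 0.
  have := cabs_cexp w; rewrite hw cabs1 => e1; apply: expR_inj; by rewrite expR0.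
have iw : complex.Im w = complex.Im z - k%:~R * (2 * pi).
  by rewrite /w ImD ImN ImM Re_int Im_int /tpi /= mul0r addr0.
have p2 : 0 < 2 * pi :> R by lra.
have i0 : 0 <= complex.Im w.
  by rewrite iw subr_ge0 -ler_pdivlMr // floor_le.
have i1 : complex.Im w < 2 * pi.
  rewrite iw ltrBlDr -[X in X + _]mul1r -mulrDl -ltr_pdivrMr // addrC -(intrD _ k 1).
  exact: floorD1_gt.
have c1 : cos (complex.Im w) = 1.
  by have := congr1 (@complex.Re R) hw; rewrite /cexp /= re0 expR0 mul1r.
apply: C_eqP => //; apply/eqP; apply: contraT => ne.
have s0 : 0 < sin (complex.Im w / 2).
  apply: sin_gt0_pi; apply/andP; split; last by lra.
  by rewrite divr_gt0 // lt_neqAle eq_sym ne.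
have : cos (complex.Im w) = 1 - 2 * sin (complex.Im w / 2) ^+ 2.
  have {1}-> : complex.Im w = complex.Im w / 2 + complex.Im w / 2 by lra.
  by rewrite cosD -!expr2; have := cos2Dsin2 (complex.Im w / 2); lra.
rewrite c1; have := exprn_gt0 2 s0; lra.
Qed.

Lemma cexp_surj (q : C) : q != 0 -> exists z, cexp z = q.
Proof.
case: q => x y q0; have a0 : 0 < cabs (x +i* y)%C by rewrite cabs_gt0.
set r := cabs _ in a0.
have r2 : x ^+ 2 + y ^+ 2 = r ^+ 2 by rewrite /r cabs_sq.
(* The argument will be the arccosine of x / r, with the sign of y. *)
have x1 : -1 <= x / r <= 1.
  by rewrite -ler_norml normrM normfV (gtr0_norm a0) ler_pdivrMr // mul1r;
      exact: (cabs_Re (x +i* y)%C).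
have c := acosK (x := x / r) ltac:(by rewrite in_itv).
have s := sin_acos x1.
have sy : Num.sqrt (1 - (x / r) ^+ 2) = `|y| / r.
  have -> : 1 - (x / r) ^+ 2 = (`|y| / r) ^+ 2.
    rewrite !exprMn exprVn real_normK ?num_real //.
    have -> : y ^+ 2 = r ^+ 2 - x ^+ 2 by rewrite -r2; ring.
    by field; rewrite gt_eqF.
  by rewrite sqrtr_sqr ger0_norm // divr_ge0 // ltW.
case: (leP 0 y) => y0.
  exists (ln r +i* acos (x / r))%C; rewrite /cexp /= lnK ?posrE // c s sy ger0_norm //.
  by congr (_ +i* _)%C; field; rewrite gt_eqF.
exists (ln r +i* - acos (x / r))%C; rewrite /cexp /= lnK ?posrE // cosN sinN c s sy ltr0_norm //.
by congr (_ +i* _)%C; field; rewrite gt_eqF.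
Qed.

End Cexp.

(** * Midpoint sums and Goursat's theorem *)

Section Seg.
Variable R : realType.
Notation C := (CC R).
Notation tpi := (tpi R).

Definition mid (a b : C) : C := (a + b) / 2.
(* The midpoint Riemann sum with 2^d pieces for the integral of f over the segment from a to b. It
   changes sign exactly under reversal, is exact on affine functions, and splits exactly at the
   midpoint, so Goursat's subdivision works on the sums themselves. *)
Fixpoint midsum (f : C -> C) (d : nat) (a b : C) : C :=
  if d is d'.+1 then midsum f d' a (mid a b) + midsum f d' (mid a b) b else (b - a) * f (mid a b).

Lemma midC a b : mid a b = mid b a. Proof. by rewrite /mid addrC. Qed.
Lemma mid_l a b : mid a b - a = (b - a) / 2. Proof. by rewrite /mid; field. Qed.
Lemma mid_r a b : b - mid a b = (b - a) / 2. Proof. by rewrite /mid; field. Qed.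
Lemma cabs_half (z : C) : cabs (z / 2) = cabs z / 2.
Proof. by rewrite cabsM cabsV cabs_nat. Qed.

Lemma midsum_rev f d a b : midsum f d b a = - midsum f d a b.
Proof.
elim: d a b => [|d IH] a b /=; first by rewrite midC -mulNr opprB.
by rewrite (midC b a) (IH (mid a b) b) (IH a (mid a b)) addrC opprD.
Qed.

Lemma midsumD f g d a b : midsum (fun z => f z + g z) d a b = midsum f d a b + midsum g d a b.
Proof. by elim: d a b => [|d IH] a b /=; rewrite ?IH; ring. Qed.
Lemma midsumZ k f d a b : midsum (fun z => k * f z) d a b = k * midsum f d a b.
Proof. by elim: d a b => [|d IH] a b /=; rewrite ?IH; ring. Qed.
Lemma midsum_ext f g d a b (K : C -> Prop) : K a -> K b -> (forall x y, K x -> K y -> K (mid x y))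
    ->
  (forall z, K z -> f z = g z) -> midsum f d a b = midsum g d a b.
Proof.
move=> + + cv e; elim: d a b => [|d IH] a b ka kb /=; first by rewrite e //; apply: cv.
by rewrite !IH //; apply: cv.
Qed.

Lemma midsum_sum (I : Type) (r : seq I) (F : I -> C -> C) d a b :
  midsum (fun z => \sum_(i <- r) F i z) d a b = \sum_(i <- r) midsum (F i) d a b.
Proof.
elim: r => [|i r IH].
  rewrite big_nil (_ : (fun z => _) = (fun z => 0 * 0)); first by rewrite midsumZ mul0r.
  by apply/funext => z; rewrite big_nil mul0r.
rewrite big_cons -IH -midsumD; congr (midsum _ _ _ _); apply/funext => z; by rewrite big_cons.
Qed.

Lemma midsum_affine al be d a b : midsum (fun z => al + be * z) d a b =
  (al * b + be * b ^+ 2 / 2) - (al * a + be * a ^+ 2 / 2).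
Proof. by elim: d a b => [|d IH] a b /=; rewrite ?IH /mid; field. Qed.
Lemma midsum_const k d a b : midsum (fun=> k) d a b = k * (b - a).
Proof.
rewrite (_ : (fun=> k) = (fun z => k + 0 * z)); first by rewrite midsum_affine; ring.
by apply/funext => z; rewrite mul0r addr0.
Qed.

Lemma midsum_shift f h d a b : midsum f d (a + h) (b + h) = midsum (fun z => f (z + h)) d a b.
Proof.
have e x y : mid (x + h) (y + h) = mid x y + h by rewrite /mid; field.
by elim: d a b => [|d IH] a b /=; rewrite e ?IH //; ring.
Qed.

Lemma midsum_bound f d a b (K : C -> Prop) (M : R) : K a -> K b -> (forall x y, K x -> K y ->
    K (mid x y)) ->
  (forall z, K z -> cabs (f z) <= M) -> cabs (midsum f d a b) <= M * cabs (b - a).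
Proof.
move=> + + cv e; elim: d a b => [|d IH] a b ka kb /=.
  by rewrite cabsM mulrC ler_wpM2r ?cabs_ge0 // e //; apply: cv.
apply: le_trans (cabsD _ _) _.
have h1 := IH a (mid a b) ka (cv _ _ ka kb); have h2 := IH _ b (cv _ _ ka kb) kb.
apply: le_trans (lerD h1 h2) _; rewrite mid_l mid_r !cabs_half -mulrDr -splitr //.
Qed.

Definition ballK (z : C) (r : R) (w : C) := cabs (w - z) < r.
Lemma ballK_mid z r x y : ballK z r x -> ballK z r y -> ballK z r (mid x y).
Proof.
rewrite /ballK => a b; have -> : mid x y - z = (x - z) / 2 + (y - z) / 2 by rewrite /mid; field.
apply: le_lt_trans (cabsD _ _) _; rewrite !cabs_half; lra.
Qed.

(** Exactly what iterated halving asks of a domain: midpoints stay in it, and so do limits. It plays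
    the role of a closed convex set. *)
Definition mclosed (K : C -> Prop) := (forall x y, K x -> K y -> K (mid x y)) /\
  (forall u l, (forall n, K (u n)) -> ccvg u l -> K l).

(** The estimate is uniform in the depth [d], so short segments are harmless in any statement about
    large [d]. *)
Lemma midsum_near f z (e : R) : cont1 f z -> 0 < e -> exists2 r : R, 0 < r &
  forall a b d, cabs (a - z) < r -> cabs (b - z) < r -> cabs (midsum f d a b - f z * (b - a)) <= e *
      cabs (b - a).
Proof.
move=> cf e0; have [r r0 hr] := cf e e0; exists r => // a b d ha hb.
have -> : midsum f d a b - f z * (b - a) = midsum (fun w => f w + - f z) d a b.
  by rewrite midsumD (midsum_const (- f z)); ring.
apply: (@midsum_bound _ d a b (ballK z r)) => //; first exact: ballK_mid.
by move=> w hw; rewrite ltW // hr.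
Qed.

(** A bad segment has a bad half; iterated halves shrink to a point of [K], near which no segment is
    bad. *)
Lemma seg_nested (bad : C -> C -> Prop) (K : C -> Prop) a b : mclosed K ->
  (forall z, K z -> exists2 r : R, 0 < r & forall a b, cabs (a - z) < r -> cabs (b - z) < r ->
      ~ bad a b) ->
  (forall a b, K a -> K b -> bad a b -> bad a (mid a b) \/ bad (mid a b) b) ->
  K a -> K b -> ~ bad a b.
Proof.
move=> [Km Kc] loc step ka kb bab.
have [|||||z kz hz] := @bisection R (C * C) (fun x => [/\ K x.1, K x.2 & bad x.1 x.2]) fst
    (fun x => cabs (x.2 - x.1)) (a, b) K.
- by split.
- by move=> x; exact: cabs_ge0.
- by move=> x [].
- exact: Kc.
- move=> [x y] /= [kx ky bxy]; have kmm := Km _ _ kx ky.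
  have hh := cabs_ge0 (y - x).
  case: (step x y kx ky bxy) => h.
  + exists (x, mid x y) => /=; rewrite mid_l cabs_half subrr cabs0; split => //; lra.
  + exists (mid x y, y) => /=; rewrite mid_l mid_r cabs_half; split => //; lra.
have [r r0 hr] := loc z kz; have [[x y] /= [[kx ky bxy] h1 h2]] := hz (r / 4) ltac:(lra).
apply: (hr x y _ _ bxy); first lra.
by have := cabs_tri y x z; lra.
Qed.

Lemma midsum_cvg f K a b : mclosed K -> (forall z, K z -> cont1 f z) -> K a -> K b ->
  exists l, ccvg (fun d => midsum f d a b) l.
Proof.
move=> Kcl cf ka kb; apply: ccauchy => e e0.
(* The tolerance is proportional to the length, so that those of the two halves add up to that of
   the whole. The [+ 1] covers [a = b]. *)
pose e' := e / (cabs (b - a) + 1).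
have ab1 : 0 < cabs (b - a) + 1 by have := cabs_ge0 (b - a); lra.
have e'0 : 0 < e' by rewrite divr_gt0.
pose good x y := exists N, forall n m, (N <= n)%N -> (N <= m)%N ->
    cabs (midsum f n x y - midsum f m x y) <= e' * cabs (y - x).
have : ~ ~ good a b.
  apply: (@seg_nested (fun x y => ~ good x y) K) => //.
  - move=> z kz; have [r r0 hr] := midsum_near (cf z kz) (e := e' / 2) ltac:(lra);
        exists r => // x y hx hy []; exists 0 => n m _ _.
    have := hr x y n hx hy; have := hr x y m hx hy.
    by have := cabs_tri (midsum f n x y) (f z * (y - x)) (midsum f m x y);
        rewrite (cabsC (f z * _) (midsum _ _ _ _)); lra.
  - move=> x y kx ky; apply: contra_notP => /not_orP[/contrapT[N hN] /contrapT[M hM]].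
    exists (maxn N M).+1 => -[|n] [|m] //; rewrite !ltnS !geq_max => /andP[n1 n2] /andP[m1 m2] /=.
    have := hN n m n1 m1; have := hM n m n2 m2; rewrite mid_l mid_r cabs_half opprD addrACA.
    by have := cabsD (midsum f n x (mid x y) - midsum f m x (mid x y))
        (midsum f n (mid x y) y - midsum f m (mid x y) y); lra.
move=> /contrapT[N hN]; exists N => n m hn hm; apply: le_lt_trans (hN n m hn hm) _.
rewrite /e' mulrAC ltr_pdivrMr //; have := cabs_ge0 (b - a); nra.
Qed.

(** Serves to compare circles of nearby radii when the integrand is merely continuous on one of
    them. *)
Lemma midsum_cont f K a b (e : R) : mclosed K -> (forall z, K z -> cont1 f z) -> K a -> K b ->
    0 < e ->
  exists2 r : R, 0 < r & exists N, forall h d, cabs h < r -> (N <= d)%N ->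
    cabs (midsum f d (a + h) (b + h) - midsum f d a b) <= e * cabs (b - a).
Proof.
move=> Kcl cf ka kb e0.
pose good x y := exists2 r : R, 0 < r & exists N, forall h d, cabs h < r -> (N <= d)%N ->
    cabs (midsum f d (x + h) (y + h) - midsum f d x y) <= e * cabs (y - x).
suff : ~ ~ good a b by move/contrapT.
apply: (@seg_nested (fun x y => ~ good x y) K) => //.
- move=> z kz; have [r r0 hr] := midsum_near (cf z kz) (e := e / 2) ltac:(lra); exists (r / 2);
      first lra.
  move=> x y hx hy []; exists (r / 2); first lra.
  exists 0 => h d hh _; have l1 : cabs (x + h - z) < r.
    by rewrite addrAC; apply: le_lt_trans (cabsD _ _) _; lra.
  have l2 : cabs (y + h - z) < r.
    by rewrite addrAC; apply: le_lt_trans (cabsD _ _) _; lra.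
  have := hr x y d ltac:(lra) ltac:(lra); have := hr _ _ d l1 l2.
  have -> : y + h - (x + h) = y - x by ring.
  have := cabs_tri (midsum f d (x + h) (y + h)) (f z * (y - x)) (midsum f d x y).
  by rewrite (cabsC (f z * _) (midsum _ _ _ _)); lra.
- move=> x y kx ky; apply: contra_notP => /not_orP[/contrapT[r r0 [N hN]] /contrapT[s s0 [M hM]]].
  exists (Num.min r s); first by rewrite lt_min r0.
  exists (maxn N M).+1 => h [|d] //; rewrite lt_min ltnS geq_max => /andP[h1 h2] /andP[d1 d2] /=.
  have e1 : mid (x + h) (y + h) = mid x y + h by rewrite /mid; field.
  have := hN h d h1 d1; have := hM h d h2 d2; rewrite e1 mid_l mid_r cabs_half opprD addrACA.
  have := cabsD (midsum f d (x + h) (mid x y + h) - midsum f d x (mid x y))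
      (midsum f d (mid x y + h) (y + h) - midsum f d (mid x y) y); lra.
Qed.

(** * Goursat's theorem for midpoint sums *)

Definition trisum f d a b c := midsum f d a b + midsum f d b c + midsum f d c a.
Lemma trisumS f d a b c : trisum f d.+1 a b c = trisum f d a (mid a b) (mid c a) + trisum f d
    (mid a b) b (mid b c)
  + trisum f d (mid c a) (mid b c) c + trisum f d (mid b c) (mid c a) (mid a b).
Proof.
rewrite /trisum /=.
rewrite (midsum_rev f d (mid a b) (mid c a)) (midsum_rev f d (mid a b) (mid b c))
    (midsum_rev f d (mid b c) (mid c a)).
ring.
Qed.

Lemma trisum_affine al be d a b c : trisum (fun z => al + be * z) d a b c = 0.
Proof. by rewrite /trisum !midsum_affine; ring. Qed.

Lemma goursat f K a b c (e : R) : mclosed K -> (forall z, K z -> cder f z) -> K a -> K b -> K c ->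
    0 < e ->
  exists N, forall d, (N <= d)%N -> cabs (trisum f d a b c) <= e.
Proof.
move=> [Km Kc] df ka kb kc e0.
pose s0 := cabs (b - a) + cabs (c - b) + cabs (a - c) + 1.
have s00 : 0 < s0 by rewrite /s0; have := cabs_ge0 (b - a); have := cabs_ge0 (c - b);
    have := cabs_ge0 (a - c); lra.
pose e' := e / s0 ^+ 2; have e'0 : 0 < e' by rewrite divr_gt0 // exprn_gt0.
(* The fourth component bounds the perimeter and is halved exactly at each subdivision. The
   tolerance is quadratic in it, so the four quarters together use up the tolerance of the whole. *)
pose good (x : C * C * C * R) := exists N, forall d, (N <= d)%N ->
    cabs (trisum f d x.1.1.1 x.1.1.2 x.1.2) <= e' * x.2 ^+ 2.
pose ok (x : C * C * C * R) := [/\ K x.1.1.1, K x.1.1.2 & K x.1.2] /\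
  cabs (x.1.1.2 - x.1.1.1) + cabs (x.1.2 - x.1.1.2) + cabs (x.1.1.1 - x.1.2) <= x.2.
suff : good (a, b, c, s0) by move=> [N hN]; exists N => d /hN;
    rewrite /= /e' divfK // gt_eqF // exprn_gt0.
apply: contrapT => bad0.
have [|||||z kz hz] := @bisection R _ (fun x => ok x /\ ~ good x) (fun x => x.1.1.1)
    (fun x => `|x.2|) (a, b, c, s0) K.
- by split => //; split => //=; rewrite /s0; lra.
- by move=> x; exact: normr_ge0.
- by move=> x [[[]]].
- exact: Kc.
- move=> [[[x y] z] s] /= [[/= [kx ky kz] hs] bd].
  have s_0 : 0 <= s by have := cabs_ge0 (y - x); have := cabs_ge0 (z - y); have := cabs_ge0 (x - z);
      lra.
  have k1 := Km _ _ kx ky; have k2 := Km _ _ ky kz; have k3 := Km _ _ kz kx.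
  have [a1 a2 a3] : [/\ 0 <= cabs (y - x), 0 <= cabs (z - y) & 0 <= cabs (x - z)] by rewrite
      !cabs_ge0.
  have m1 : mid z x - mid x y = (z - y) / 2 by rewrite /mid; field.
  have m2 : mid x y - mid y z = (x - z) / 2 by rewrite /mid; field.
  have m3 : mid y z - mid z x = (y - x) / 2 by rewrite /mid; field.
  have r1 : x - mid z x = (x - z) / 2 by rewrite mid_r.
  have r2 : y - mid x y = (y - x) / 2 by rewrite mid_r.
  have r3 : z - mid y z = (z - y) / 2 by rewrite mid_r.
  have l1 : mid x y - x = (y - x) / 2 by rewrite mid_l.
  have l2 : mid y z - y = (z - y) / 2 by rewrite mid_l.
  have l3 : mid z x - z = (x - z) / 2 by rewrite mid_l.
  have sh : `|s / 2| = `|s| / 2 by rewrite !ger0_norm ?divr_ge0.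
  have : ~ good (x, mid x y, mid z x, s / 2) \/ ~ good (mid x y, y, mid y z, s / 2) \/
      ~ good (mid z x, mid y z, z, s / 2) \/ ~ good (mid y z, mid z x, mid x y, s / 2).
    apply: contrapT => /not_orP[/contrapT[N1 h1] /not_orP[/contrapT[N2 h2] /not_orP[/contrapT[N3 h3]
        /contrapT[N4 h4]]]].
    apply: bd; exists (maxn (maxn N1 N2) (maxn N3 N4)).+1 => -[//|d]; rewrite ltnS !geq_max /=.
    move=> /andP[/andP[/h1 /= g1 /h2 /= g2] /andP[/h3 /= g3 /h4 /= g4]]; rewrite trisumS.
    have := cabsD (trisum f d x (mid x y) (mid z x) + trisum f d (mid x y) y (mid y z) + trisum f d
        (mid z x) (mid y z) z) (trisum f d (mid y z) (mid z x) (mid x y)).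
    have := cabsD (trisum f d x (mid x y) (mid z x) + trisum f d (mid x y) y (mid y z))
        (trisum f d (mid z x) (mid y z) z).
    have := cabsD (trisum f d x (mid x y) (mid z x)) (trisum f d (mid x y) y (mid y z)).
    move: g1 g2 g3 g4; rewrite exprMn; have -> : (2^-1 : R) ^+ 2 = 4^-1 by field.
    by rewrite !mulrA; lra.
  case=> [h|[h|[h|h]]]; [exists (x, mid x y, mid z x, s / 2)|exists (mid x y, y, mid y z, s / 2)|
    exists (mid z x, mid y z, z, s / 2)|exists (mid y z, mid z x, mid x y, s / 2)];
    (split; [split; [split=> /=; first by split | exact: h]| exact: sh | ]).
  all: rewrite /= ?subrr ?cabs0 ?m1 ?m2 ?m3 ?r1 ?r2 ?r3 ?l1 ?l2 ?l3 ?cabs_half ?(ger0_norm s_0);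
      try lra.
  + by rewrite -(cabsN (mid z x - x)) opprB r1 cabs_half; lra.
  + by rewrite (cabsC (mid z x) (mid y z)) (cabsC (mid x y) (mid z x)) (cabsC (mid y z) (mid x y))
        m1 m2 m3 !cabs_half; lra.
  + have -> : mid y z - x = (y - x) / 2 + (z - x) / 2 by rewrite /mid; field.
    by have := cabsD ((y - x) / 2) ((z - x) / 2); rewrite !cabs_half (cabsC z x); lra.
have [l dl] := df z kz; have [r r0 hr] := cdiff_eps dl (e := e' / 4) ltac:(lra).
have [[[[x y] w] s] /= [[[/= [kx ky kw] hs] bd] h1 h2]] := hz (r / 8) ltac:(lra).
apply: bd; exists 0 => d _ /=.
have [a1 a2 a3] : [/\ 0 <= cabs (y - x), 0 <= cabs (w - y) & 0 <= cabs (x - w)] by rewrite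
    !cabs_ge0.
have s_0 : 0 <= s by lra.
rewrite (ger0_norm s_0) in h1 h2.
(* Removing the affine approximation of [f] at [z] does not change triangle sums, as midpoint sums
   are exact on affine functions. What remains is small compared with the size [s]. *)
pose g v := f v + (-1) * ((f z - l * z) + l * v).
have -> : trisum f d x y w = trisum g d x y w.
  rewrite /g /trisum !midsumD !midsumZ; have := trisum_affine (f z - l * z) l d x y w;
      rewrite /trisum => t0.
  transitivity (midsum f d x y + midsum f d y w + midsum f d w x + -1 *
      (midsum (fun z0 => (f z - l * z) + l * z0) d x y + midsum (fun z0 => (f z - l * z) + l * z0) d
      y w + midsum (fun z0 => (f z - l * z) + l * z0) d w x)); last ring.
  by rewrite t0 mulr0 addr0.
pose Kb v := cabs (v - z) <= 3 * s.
have Kbm u v : Kb u -> Kb v -> Kb (mid u v).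
  rewrite /Kb => p1 p2; have -> : mid u v - z = (u - z) / 2 + (v - z) / 2 by rewrite /mid; field.
  apply: le_trans (cabsD _ _) _; rewrite !cabs_half; lra.
have Kx : Kb x by rewrite /Kb; lra.
have Ky : Kb y by rewrite /Kb; have := cabs_tri y x z; lra.
have Kw : Kb w by rewrite /Kb; have := cabs_tri w x z; rewrite (cabsC w x); lra.
have gb v : Kb v -> cabs (g v) <= e' / 4 * (3 * s).
  rewrite /Kb => hv; have -> : g v = f v - f z - l * (v - z) by rewrite /g; ring.
  apply: le_trans (hr v _) _; first lra.
  by rewrite ler_wpM2l //; lra.
have b1 := midsum_bound d Kx Ky Kbm gb; have b2 := midsum_bound d Ky Kw Kbm gb;
    have b3 := midsum_bound d Kw Kx Kbm gb.
rewrite /trisum; have := cabsD (midsum g d x y + midsum g d y w) (midsum g d w x);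
    have := cabsD (midsum g d x y) (midsum g d y w).
have es : e' / 4 * (3 * s) * (cabs (y - x) + cabs (w - y) + cabs (x - w)) <= e' / 4 * (3 * s) * s.
  by rewrite ler_wpM2l // mulr_ge0 //; lra.
have : 0 <= e' * s ^+ 2 by rewrite mulr_ge0 ?sqr_ge0 // ltW.
rewrite expr2; move: es b1 b2 b3; rewrite !mulrDr; lra.
Qed.

(* In the coordinate log z, the integral over the circle of radius exp x is over a segment of length
   2 pi. *)
Definition circ_sum (g : C -> C) (d : nat) (x : R) := midsum g d x%:C%C (x%:C%C + tpi).

Lemma re_mclosed (x y : R) : mclosed (fun z => x <= complex.Re z <= y).
Proof.
split=> [a b /andP[h1 h2] /andP[h3 h4]|u l h cu].
  rewrite /mid half_C ReM ReD /= mulr0 subr0; apply/andP; split; lra.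
apply/andP; split; apply/ler_addgt0Pr => e /cu[N /(_ N (leqnn _)) hN].
  have := cabs_Re (u N - l); rewrite ReD ReN; have /andP[+ _] := h N.
  by rewrite ler_norml => a /andP[_ b]; lra.
have := cabs_Re (u N - l); rewrite ReD ReN; have /andP[_ +] := h N.
by rewrite ler_norml => a /andP[b _]; lra.
Qed.

(** The rectangle with corners x, y, y + 2 pi i, x + 2 pi i is cut into two triangles; its
    horizontal sides cancel by periodicity. *)
Lemma strip_shift g (x y e : R) : x <= y -> (forall z, x <= complex.Re z <= y -> cder g z) ->
    (forall z, g (z + tpi) = g z) ->
  0 < e -> exists N, forall d, (N <= d)%N -> cabs (circ_sum g d y - circ_sum g d x) <= e.
Proof.
move=> xy dg per e0; have K := re_mclosed x y; have e2 : 0 < e / 2 by lra.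
have K1 : x <= complex.Re (x%:C%C : C) <= y by rewrite /= lexx.
have K2 : x <= complex.Re (y%:C%C : C) <= y by rewrite /= lexx xy.
have K3 : x <= complex.Re (x%:C%C + tpi) <= y by rewrite /= addr0 lexx.
have K4 : x <= complex.Re (y%:C%C + tpi) <= y by rewrite /= addr0 lexx xy.
have [N hN] := goursat K dg K1 K2 K4 e2.
have [M hM] := goursat K dg K1 K4 K3 e2.
exists (maxn N M) => d; rewrite geq_max => /andP[/hN h1 /hM h2].
have := cabsD (trisum g d x%:C%C y%:C%C (y%:C%C + tpi)) (trisum g d x%:C%C (y%:C%C + tpi)
    (x%:C%C + tpi)).
suff -> : trisum g d x%:C%C y%:C%C (y%:C%C + tpi) + trisum g d x%:C%C (y%:C%C + tpi) (x%:C%C + tpi)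
    = circ_sum g d y - circ_sum g d x by lra.
rewrite /trisum /circ_sum (midsum_rev g d x%:C%C (y%:C%C + tpi))
    (midsum_rev g d x%:C%C (x%:C%C + tpi)) (midsum_rev g d (x%:C%C + tpi) (y%:C%C + tpi)).
rewrite midsum_shift (_ : (fun z => g (z + tpi)) = g); last by apply/funext.
ring.
Qed.

Lemma circ_sum_bound g d (x M : R) : (forall z, complex.Re z = x -> cabs (g z) <= M) ->
    cabs (circ_sum g d x) <= M * (2 * pi).
Proof.
move=> h; rewrite /circ_sum; have e : x%:C%C + tpi - x%:C%C = tpi by rewrite addrC addKr.
have := @midsum_bound g d x%:C%C (x%:C%C + tpi) (fun z => complex.Re z = x) M.
rewrite e cabs_tpi; apply => //=; first by rewrite addr0.
by move=> a b ha hb; rewrite /mid half_C ReM ReD /= mulr0 subr0 ha hb; lra.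
Qed.

End Seg.

(** * Cauchy's formula and Taylor expansions *)

Section CIF.
Variable R : realType.
Notation C := (CC R).
Notation tpi := (tpi R).

Lemma cderD (f g : C -> C) z : cder f z -> cder g z -> cder (fun w => f w + g w) z.
Proof. by move=> [l hl] [m hm]; eexists; apply: cdiffD; eassumption. Qed.
Lemma cderM (f g : C -> C) z : cder f z -> cder g z -> cder (fun w => f w * g w) z.
Proof. by move=> [l hl] [m hm]; eexists; apply: cdiffM; eassumption. Qed.
Lemma cderV (f : C -> C) z : cder f z -> f z != 0 -> cder (fun w => (f w)^-1) z.
Proof. by move=> [l hl] n0; eexists; apply: cdiffV; eassumption. Qed.
Lemma cder_comp (F f : C -> C) z : cder F (f z) -> cder f z -> cder (fun w => F (f w)) z.
Proof. by move=> [l hl] [m hm]; eexists; apply: cdiff_comp; eassumption. Qed.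
Lemma cder_const (k z : C) : cder (fun=> k) z. Proof. by eexists; exact: cdiff_const. Qed.
Lemma cder_id (z : C) : cder id z. Proof. by eexists; exact: cdiff_id. Qed.
Lemma cder_ext (f g : C -> C) z : (exists2 r : R, 0 < r & forall q, cabs (q - z) < r -> f q = g q)
    -> cder f z -> cder g z.
Proof. by move=> h [l hl]; exists l; exact: cdiff_ext hl. Qed.
Lemma cder_cexp (z : C) : cder (@cexp R) z. Proof. by eexists; exact: cdiff_cexp. Qed.
Lemma cderX (f : C -> C) z n : cder f z -> cder (fun w => f w ^+ n) z.
Proof.
move=> h; elim: n => [|n IH]; first exact: (cder_const 1).
by apply: cder_ext (cderM h IH); exists 1 => // q _; rewrite exprS.
Qed.

Lemma cderN (f : C -> C) z : cder f z -> cder (fun w => - f w) z.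
Proof. by move=> h; apply: cder_ext (cderM (cder_const (-1) z) h); exists 1 => // q _;
    rewrite mulN1r. Qed.

Lemma cexp_per (z : C) : cexp (z + tpi) = cexp z.
Proof. by rewrite cexpD cexp_tpi mulr1. Qed.

(** In the coordinate s = log z one has ds = dz / z, so this says that the integral of g(z) dz / z
    over the circle of radius exp x is zero. *)
Definition circ_null (g : C -> C) (x : R) := forall e : R, 0 < e -> exists N, forall d,
    (N <= d)%N -> cabs (circ_sum (fun s => g (cexp s)) d x) <= e.

Lemma circ_sum_cexp_bound g d (x M : R) : (forall z, cabs z = expR x -> cabs (g z) <= M) ->
    cabs (circ_sum (fun s => g (cexp s)) d x) <= M * (2 * pi).
Proof. by move=> h; apply: circ_sum_bound => z zx; apply: h; rewrite cabs_cexp zx. Qed.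

Lemma circ_null_in g (x : R) : g 0 = 0 -> cont1 g 0 -> (forall z, z != 0 -> cabs z <= expR x ->
    cder g z) -> circ_null g x.
Proof.
move=> g0 cg dg e e0; have p0 := pi_gt0 R.
have [r r0 hr] := cg (e / 2 / (2 * pi)) ltac:(by rewrite !divr_gt0 ?mulr_gt0).
pose y := Num.min x (ln (r / 2)).
have yx : y <= x by rewrite ge_min lexx.
have ey : expR y < r.
  apply: le_lt_trans (_ : expR (ln (r / 2)) < _); first by rewrite ler_expR ge_min lexx orbT.
  by rewrite lnK ?posrE; lra.
have st : exists N, forall d, (N <= d)%N ->
    cabs (circ_sum (fun s => g (cexp s)) d x - circ_sum (fun s => g (cexp s)) d y) <= e / 2.
  apply: strip_shift => //; [|by move=> z; rewrite cexp_per|lra].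
  move=> z /andP[h1 h2]; apply: cder_comp; last exact: cder_cexp.
  by apply: dg; rewrite ?cexp_ne0 // cabs_cexp ler_expR.
have [N hN] := st; exists N => d /hN h.
have := @circ_sum_cexp_bound g d y (e / 2 / (2 * pi)) _; rewrite divfK;
    last by rewrite gt_eqF // mulr_gt0.
have hb z : cabs z = expR y -> cabs (g z) <= e / 2 / (2 * pi).
  by move=> hz; have := hr z; rewrite /d1 g0 !subr0 hz => /(_ ey) /ltW.
move=> /(_ hb) h'; have := cabsBB (circ_sum (fun s => g (cexp s)) d x)
    (circ_sum (fun s => g (cexp s)) d y); lra.
Qed.

(** The circle is enlarged until the decay of [g] makes the sum small. *)
Lemma circ_null_out g (x : R) (A : R) : (forall z, expR x <= cabs z -> cder g z) ->
  (forall z, expR x <= cabs z -> cabs (g z) <= A / cabs z) -> circ_null g x.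
Proof.
move=> dg bg e e0; have p0 := pi_gt0 R.
have A0 : 0 <= A.
  have c0 : cabs (cexp (x%:C%C : C)) = expR x by rewrite cabs_cexp.
  have := bg (cexp x%:C%C); rewrite c0 => /(_ (lexx _)) h; have := le_trans (cabs_ge0 _) h.
  by rewrite pmulr_lge0 // invr_gt0 expR_gt0.
pose B := (A * (2 * pi) + 1) / (e / 2); have B0 : 0 < B.
  by rewrite !divr_gt0 //; have := mulr_ge0 A0 (ltW p0); lra.
pose y := Num.max x (ln B).
have yx : x <= y by rewrite le_max lexx.
have ey : B <= expR y.
  by apply: le_trans (_ : expR (ln B) <= _);
      [rewrite lnK ?posrE | rewrite ler_expR le_max lexx orbT].
have [|||N hN] := @strip_shift R (fun s => g (cexp s)) x y (e / 2) yx.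
- move=> z /andP[h1 h2]; apply: cder_comp; last exact: cder_cexp.
  by apply: dg; rewrite cabs_cexp ler_expR.
- by move=> z; rewrite cexp_per.
- lra.
exists N => d /hN h.
have := @circ_sum_cexp_bound g d y (A / expR y) _.
have hb z : cabs z = expR y -> cabs (g z) <= A / expR y.
  by move=> hz; rewrite -hz; apply: bg; rewrite hz ler_expR.
move=> /(_ hb) h'; have h2 : A / expR y * (2 * pi) <= e / 2.
  rewrite mulrAC ler_pdivrMr ?expR_gt0 //; move: ey; rewrite /B ler_pdivrMr; last lra.
  by lra.
by have := cabsBB (circ_sum (fun s => g (cexp s)) d x) (circ_sum (fun s => g (cexp s)) d y);
    rewrite cabsC; lra.
Qed.

Lemma circ_sum_near g (x e : R) : (forall z, cabs z = expR x -> cont1 g z) -> 0 < e ->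
  exists2 r : R, 0 < r & exists N, forall t d, `|t| < r -> (N <= d)%N ->
    cabs (circ_sum (fun s => g (cexp s)) d (x + t) - circ_sum (fun s => g (cexp s)) d x) <= e.
Proof.
move=> cg e0; have p2 : 0 < 2 * pi :> R by have := pi_gt0 R; lra.
have Kx : x <= complex.Re (x%:C%C : C) <= x by rewrite /= lexx.
have Kp : x <= complex.Re (x%:C%C + tpi) <= x by rewrite /= addr0 lexx.
have cg' z : x <= complex.Re z <= x -> cont1 (fun s => g (cexp s)) z.
  move=> /le_anti zx; apply: cont_comp1; last exact/cder_cont/cder_cexp.
  by apply: cg; rewrite cabs_cexp zx.
have [s s0 [N hN]] := midsum_cont (re_mclosed x x) cg' Kx Kp (divr_gt0 e0 p2).
exists s => //; exists N => t d ts dN; have := hN (t%:C%C) d _ dN; rewrite cabs_real => /(_ ts).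
have -> : x%:C%C + tpi - x%:C%C = tpi by rewrite addrC addKr.
rewrite cabs_tpi divfK; last by rewrite gt_eqF.
by rewrite /circ_sum rmorphD -addrAC.
Qed.

(** Split f(z) z / (z - w) into h(z) = z (f(z) - f(w)) / (z - w), which has no singularity left and
    vanishes at 0, and f(w) (1 + w / (z - w)), whose last term decays at infinity. Both h and the
    decaying term integrate to 0 against dz / z; the constant f(w) gives 2 pi i f(w). *)
Lemma cauchy_formula f (w : C) (r R0 : R) : r < R0 -> (forall z, cabs z < R0 -> cder f z) ->
    cabs w < r ->
  ccvg (fun d => circ_sum (fun s => f (cexp s) * (cexp s / (cexp s - w))) d (ln r)) (tpi * f w).
Proof.
move=> rR df wr; have r0 : 0 < r by apply: le_lt_trans wr; exact: cabs_ge0.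
have er : expR (ln r) = r by rewrite lnK ?posrE.
have [l dl] := df w (lt_trans wr rR).
pose h z := if z == w then w * l else z * ((f z - f w) / (z - w)).
have dh z : z != w -> cabs z < R0 -> cder h z.
  move=> zw zR; apply: (@cder_ext (fun z => z * ((f z - f w) / (z - w)))).
    exists (cabs (z - w)); first by rewrite cabs_gt0 subr_eq0.
    move=> q hq; rewrite /h; case: eqP => // qw; move: hq; rewrite qw cabsC ltxx //.
  apply: cderM; first exact: cder_id.
  apply: cderM; first by apply: cderD; [exact: df|exact: cder_const].
  by apply: cderV; [apply: cderD; [exact: cder_id|exact: cder_const]|rewrite subr_eq0].
have ch : cont1 h w.
  case: dl => phi [cp pl [s s0 hs]].
  have c2 : cont1 (fun z => z * phi z) w by apply: contM => //; exact: cont1_id.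
  apply: cont_ext c2; first exact: d1xx.
  exists s => // q hq; rewrite /h; case: eqP => [->|/eqP qw]; first by rewrite pl.
  by rewrite hs // mulfK // subr_eq0.
have hz : circ_null h (ln r).
  case: (eqVneq w 0) => w0.
    subst w; apply: circ_null_in => //; first by rewrite /h eqxx mul0r.
    by move=> z z0; rewrite er => zr; apply: dh => //; apply: le_lt_trans zr rR.
  have h0 : h 0 = 0 by rewrite /h eq_sym (negPf w0) mul0r.
  have wp : 0 < cabs w by rewrite cabs_gt0.
  have lw : expR (ln (cabs w)) = cabs w by rewrite lnK ?posrE.
  have lwr : ln (cabs w) < ln r by rewrite ltr_ln ?posrE.
  have inn y : y < ln (cabs w) -> circ_null h y.
    move=> yw; apply: circ_null_in => //; first by apply/cder_cont/dh; rewrite ?cabs0 1?eq_sym //;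
        lra.
    move=> z z0 zy; have zw : cabs z < cabs w by rewrite -lw; apply: le_lt_trans zy _;
        rewrite ltr_expR.
    apply: dh; last by apply: lt_trans zw _; apply: lt_trans wr rR.
    by apply: contraTneq zw => ->; rewrite ltxx.
  have chw z : cabs z = expR (ln (cabs w)) -> cont1 h z.
    rewrite lw => zw; case: (eqVneq z w) => [->//|n]; apply/cder_cont/dh => //.
    by rewrite zw (lt_trans wr).
  move=> e e0.
  (* At [w] only continuity of [h] is known, so the circle through [w] is jumped over: circles just
     inside and just outside have nearly the same sums, and [h] is differentiable on either side. *)
  have [s s0 [N hN]] := circ_sum_near chw (e := e / 4) ltac:(lra).
  pose t := Num.min ((ln r - ln (cabs w)) / 2) (s / 2).
  have t0 : 0 < t by rewrite lt_min !divr_gt0 ?subr_gt0.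
  have tr : ln (cabs w) + t < ln r.
    have : t <= (ln r - ln (cabs w)) / 2 by rewrite ge_min lexx.
    lra.
  have ts : t < s by apply: le_lt_trans (_ : s / 2 < _); [rewrite ge_min lexx orbT|lra].
  have [M hM] := inn (ln (cabs w) - t) ltac:(lra) (e / 4) ltac:(lra).
  have [|||Q hQ] := @strip_shift R (fun s => h (cexp s)) (ln (cabs w) + t) (ln r) (e / 4) (ltW tr).
  - move=> z /andP[z1 z2]; apply: cder_comp; last exact: cder_cexp.
    apply: dh; last by rewrite cabs_cexp (le_lt_trans _ rR) // -er ler_expR.
    have : cabs w < cabs (cexp z) by rewrite cabs_cexp -[ltLHS]lw ltr_expR; lra.
    by apply: contraTneq => ->; rewrite ltxx.
  - by move=> z; rewrite cexp_per.
  - lra.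
  exists (maxn N (maxn M Q)) => d; rewrite !geq_max => /and3P[dN /hM h1 /hQ h3].
  have := hN t d _ dN; have := hN (- t) d _ dN; rewrite normrN gtr0_norm // =>
      /(_ ts) h2 /(_ ts) h4.
  have := cabsBB (circ_sum (fun s => h (cexp s)) d (ln r)) (circ_sum (fun s => h (cexp s)) d
      (ln (cabs w) + t)).
  have := cabsBB (circ_sum (fun s => h (cexp s)) d (ln (cabs w) + t))
      (circ_sum (fun s => h (cexp s)) d (ln (cabs w))).
  have := cabsBB (circ_sum (fun s => h (cexp s)) d (ln (cabs w))) (circ_sum (fun s => h (cexp s)) d
      (ln (cabs w) - t)).
  rewrite (cabsC (circ_sum _ _ (ln (cabs w))) (circ_sum _ _ (ln (cabs w) - t))); lra.
have hz2 : circ_null (fun z => w / (z - w)) (ln r).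
  apply: (@circ_null_out _ _ (cabs w * r / (r - cabs w))); rewrite er => z zr.
    apply: cderM; first exact: cder_const.
    apply: cderV; first by apply: cderD; [exact: cder_id|exact: cder_const].
    rewrite subr_eq0; apply: contraTneq zr => ->; by rewrite -ltNge.
  have zp : 0 < cabs z by lra.
  have zw : 0 < cabs z - cabs w by lra.
  have zw' : cabs z - cabs w <= cabs (z - w) by exact: cabsBB.
  have rw : r - cabs w != 0 by rewrite gt_eqF // subr_gt0.
  have -> : cabs w * r / (r - cabs w) / cabs z = cabs w * (r / ((r - cabs w) * cabs z)).
    by field; rewrite rw gt_eqF.
  rewrite cabsM cabsV; apply: ler_wpM2l; first exact: cabs_ge0.
  rewrite ler_pdivlMr; last by rewrite mulr_gt0 //; lra.
  rewrite mulrC ler_pdivrMr; last lra.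
  have : (r - cabs w) * cabs z <= r * (cabs z - cabs w) by have := cabs_ge0 w; nra.
  have : r * (cabs z - cabs w) <= r * cabs (z - w) by rewrite ler_wpM2l // ltW.
  lra.
move=> e e0; have p0 := pi_gt0 R.
have [N hN] := hz (e / 4) ltac:(lra).
have fw1 : 0 < cabs (f w) + 1 by have := cabs_ge0 (f w); lra.
have [M hM] := hz2 (e / 4 / (cabs (f w) + 1)) ltac:(by rewrite !divr_gt0).
exists (maxn N M) => d; rewrite geq_max => /andP[/hN h1 /hM h2].
have eqn : circ_sum (fun s => f (cexp s) * (cexp s / (cexp s - w))) d (ln r) =
    circ_sum (fun s => h (cexp s)) d (ln r) + f w * (tpi + circ_sum (fun s => w / (cexp s - w)) d
        (ln r)).
  transitivity (circ_sum (fun s => h (cexp s) + f w * (1 + w / (cexp s - w))) d (ln r)).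
    rewrite /circ_sum; apply: (@midsum_ext _ _ _ d _ _ (fun z => complex.Re z = ln r)) => //=;
        first by rewrite addr0.
      by move=> a b ha hb; rewrite /mid half_C ReM ReD /= mulr0 subr0 ha hb; lra.
    move=> z zx; have n : cexp z - w != 0.
      rewrite subr_eq0; apply: contraTneq wr => e1; by rewrite -e1 cabs_cexp zx er ltxx.
    by rewrite /h; case: eqP => [e1|_]; [move: n; rewrite e1 subrr eqxx|field].
  rewrite {1}/circ_sum midsumD midsumZ midsumD midsum_const /circ_sum; have -> : (ln r)%:C%C +
      tpi - (ln r)%:C%C = tpi by rewrite addrC addKr.
  by rewrite mul1r.
rewrite eqn; set v1 := circ_sum _ _ _; set v2 := circ_sum _ _ _.
have -> : v1 + f w * (tpi + v2) - tpi * f w = v1 + f w * v2 by ring.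
apply: le_lt_trans (cabsD _ _) _; rewrite cabsM.
move: h1 h2; rewrite -/v1 -/v2 => h1; rewrite ler_pdivlMr // => h2.
have := cabs_ge0 v2; lra.
Qed.

(** One sequence [a] serves all radii: it is computed on the circle of radius [R0 / 2], and
    [strip_shift] carries it to every other circle. The remainder is the tail of the geometric
    series in w / z, inserted in Cauchy's formula. *)
Theorem taylor f (R0 : R) : 0 < R0 -> (forall z, cabs z < R0 -> cder f z) ->
  exists a : nat -> C, forall r : R, 0 < r < R0 -> forall M, (forall z, cabs z = r -> cabs (f z) <=
      M) ->
   (forall n, cabs (a n) * r ^+ n <= M) /\
   forall w, cabs w < r -> forall N, cabs (f w - \sum_(n < N) a n * w ^+ n) <= M * (cabs w / r) ^+ N
       * (r / (r - cabs w)).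
Proof.
move=> R00 df; have p0 := pi_gt0 R.
pose F n s := f (cexp s) * cexp (- (n%:R * s)) : C.
have Fe n s : F n s = f (cexp s) / cexp s ^+ n by rewrite /F cexpN cexpMn.
have Fper n s : F n (s + tpi) = F n s by rewrite !Fe cexp_per.
have dF n s : cabs (cexp s) < R0 -> cder (F n) s.
  move=> hs; apply: cderM; first by apply: cder_comp; [exact: df|exact: cder_cexp].
  apply: cder_comp; first exact: cder_cexp.
  by apply: cderN; apply: cderM; [exact: cder_const|exact: cder_id].
have ex n x : expR x < R0 -> exists l, ccvg (fun d => circ_sum (F n) d x) l.
  move=> xR; apply: (midsum_cvg (re_mclosed x x)); rewrite ?lexx //=; last by rewrite addr0 lexx.
  move=> z /le_anti zx; apply/cder_cont/dF; by rewrite cabs_cexp -zx.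
have h2 : expR (ln (R0 / 2)) = R0 / 2 by rewrite lnK ?posrE; lra.
have [a ha] : exists a : nat -> C, forall n, ccvg (fun d => circ_sum (F n) d (ln (R0 / 2)))
    (tpi * a n).
  have h n : {l | ccvg (fun d => circ_sum (F n) d (ln (R0 / 2))) l}.
    by apply: cid; apply: ex; rewrite h2; lra.
  exists (fun n => sval (h n) / tpi) => n; rewrite [tpi * _]mulrC divfK ?tpi_ne0 //; exact: svalP.
exists a => r /andP[r0 rR] M hM.
have er : expR (ln r) = r by rewrite lnK ?posrE.
have har n : ccvg (fun d => circ_sum (F n) d (ln r)) (tpi * a n).
  have st (x y : R) : x <= y -> expR y < R0 -> forall e, 0 < e -> exists N, forall d, (N <= d)%N ->
      cabs (circ_sum (F n) d y - circ_sum (F n) d x) <= e.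
    move=> xy yR e e0; apply: strip_shift => //.
    by move=> z /andP[_ z2]; apply: dF; rewrite cabs_cexp (le_lt_trans _ yR) // ler_expR.
  move=> e e0.
  have [N hN] : exists N, forall d, (N <= d)%N -> cabs (circ_sum (F n) d (ln r) - circ_sum (F n) d
      (ln (R0 / 2))) <= e / 2.
    case: (leP (ln (R0 / 2)) (ln r)) => h; first by apply: st; rewrite ?er //; lra.
    have [N hN] := st _ _ (ltW h) ltac:(lra) (e / 2) ltac:(lra).
    by exists N => d /hN; rewrite cabsC.
  have [M' hM'] := ha n (e / 2) ltac:(lra); exists (maxn N M') => d; rewrite geq_max =>
      /andP[/hN g1 /hM' g2].
  by have := cabs_tri (circ_sum (F n) d (ln r)) (circ_sum (F n) d (ln (R0 / 2))) (tpi * a n); lra.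
have M0 : 0 <= M.
  by have := hM r%:C%C; rewrite cabs_real gtr0_norm // => /(_ erefl); apply: le_trans (cabs_ge0 _).
have cs z : complex.Re z = ln r -> cabs (cexp z) = r by move=> zx; rewrite cabs_cexp zx.
split=> [n|w wr N].
  have := @ccvg_le R _ _ (M / r ^+ n * (2 * pi)) _ (har n); rewrite cabsM cabs_tpi => h.
  rewrite -ler_pdivlMr ?exprn_gt0 //.
  have p2 : 0 < 2 * pi :> R by lra.
  rewrite -(ler_pM2l p2) [leRHS]mulrC; apply: h; exists 0 => d _; apply: circ_sum_bound => z zx.
  by rewrite Fe cabsM cabsV cabsX cs // ler_wpM2r ?invr_ge0 ?exprn_ge0 ?(ltW r0) // hM // cs.
have cf := cauchy_formula rR df wr.
have csum : ccvg (fun d => \sum_(n < N) w ^+ n * circ_sum (F n) d (ln r)) (\sum_(n < N) w ^+ n *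
    (tpi * a n)).
  elim: N => [|N IH].
    by rewrite big_ord0; apply: ccvg_ext (ccvg_const 0) => d; rewrite big_ord0.
  rewrite big_ord_recr /=; apply: ccvg_ext (ccvgD IH (ccvgZ (w ^+ N) (har N))) => d.
  by rewrite big_ord_recr.
have cB := ccvgB cf csum.
have eqP' : tpi * f w - \sum_(n < N) w ^+ n * (tpi * a n) = tpi * (f w - \sum_(n < N) a n * w ^+ n).
  by rewrite mulrBr mulr_sumr; congr (_ - _); apply: eq_bigr => i _; ring.
rewrite eqP' in cB.
set B := M * (cabs w / r) ^+ N * (r / (r - cabs w)).
have p2 : 0 < 2 * pi :> R by lra.
rewrite -(ler_pM2l p2) -cabs_tpi -cabsM [leRHS]mulrC; apply: ccvg_le cB; exists 0 => d _.
have -> : circ_sum (fun s => f (cexp s) * (cexp s / (cexp s - w))) d (ln r) - \sum_(n < N) w ^+ n *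
    circ_sum (F n) d (ln r) =
   circ_sum (fun s => f (cexp s) * (cexp s / (cexp s - w)) + \sum_(n < N) (- w ^+ n) * F n s) d
       (ln r).
  rewrite /circ_sum midsumD midsum_sum; congr (_ + _); rewrite -sumrN; apply: eq_bigr => i _.
  by rewrite midsumZ mulNr.
rewrite cabs_tpi; apply: circ_sum_bound => z zx; have cz := cs z zx.
have n1 : cexp z - w != 0 by rewrite subr_eq0; apply: contraTneq wr => e1; rewrite -e1 cz ltxx.
have geo : cexp z / (cexp z - w) + \sum_(n < N) (- w ^+ n) / cexp z ^+ n = (w / cexp z) ^+ N *
    (cexp z / (cexp z - w)).
  elim: N {csum eqP' B} => [|N IH]; first by rewrite big_ord0 expr0; ring.
  rewrite big_ord_recr /= addrA IH !exprS exprMn exprVn.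
  have nN : cexp z ^+ N != 0 by rewrite expf_neq0 // cexp_ne0.
  by field; rewrite n1 nN cexp_ne0.
have -> : f (cexp z) * (cexp z / (cexp z - w)) + \sum_(n < N) - w ^+ n * F n z = f (cexp z) *
    ((w / cexp z) ^+ N * (cexp z / (cexp z - w))).
  rewrite -geo mulrDr mulr_sumr; congr (_ + _); apply: eq_bigr => i _; rewrite Fe; ring.
rewrite !cabsM !cabsX !cabsM !cabsV cz /B -[leRHS]mulrA.
have fM : cabs (f (cexp z)) <= M by apply: hM.
have q0 : 0 <= (cabs w / r) ^+ N by rewrite exprn_ge0 // divr_ge0 ?cabs_ge0 // ltW.
apply: ler_pM => //; rewrite ?cabs_ge0 ?mulr_ge0 ?invr_ge0 ?cabs_ge0 ?(ltW r0) //.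
apply: ler_wpM2l => //; apply: ler_wpM2l; first exact: ltW.
rewrite lef_pV2 ?posrE ?cabs_gt0 ?subr_gt0 //; have := cabsBB (cexp z) w; lra.
Qed.

End CIF.

(** * Compactness, Liouville and limits of holomorphic functions *)

Section Hol.
Variable R : realType.
Notation C := (CC R).
Notation tpi := (tpi R).
Notation C3 := (C3 R).

Definition inrect (z0 : C) (w h : R) (z : C) :=
  (complex.Re z0 <= complex.Re z <= complex.Re z0 + w) && (complex.Im z0 <= complex.Im z <=
      complex.Im z0 + h).

Lemma inrect_closed z0 w h (u : nat -> C) l : (forall n, inrect z0 w h (u n)) -> ccvg u l ->
    inrect z0 w h l.
Proof.
move=> hu cu; have near (e : R) : 0 < e -> exists N, `|complex.Re (u N) - complex.Re l| < e /\
    `|complex.Im (u N) - complex.Im l| < e.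
  move=> /cu[N /(_ N (leqnn _)) hN]; exists N; rewrite -!ReN -!ImN -!ReD -!ImD.
  by split; [apply: le_lt_trans (cabs_Re _) hN|apply: le_lt_trans (cabs_Im _) hN].
apply/andP; split; apply/andP; split; apply/ler_addgt0Pr => e /near[N []];
    have /andP[/andP[a b] /andP[c d]] := hu N;
  rewrite !ltr_norml => /andP[a1 a2] /andP[b1 b2]; lra.
Qed.

(** Compactness of a rectangle by quartering: if no pair [d], [M] serves the whole, none serves some
    quarter. The margin [d] is kept besides the bound [M] for the sake of further variables, and
    width or height 0 covers segments. *)
Lemma rect_bd (Bd : C -> R -> R -> Prop) z0 w0 h0 : 0 <= w0 -> 0 <= h0 ->
  (forall z d M d' M', d' <= d -> M <= M' -> Bd z d M -> Bd z d' M') ->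
  (forall z, inrect z0 w0 h0 z -> exists2 d : R, 0 < d & exists M, forall z', cabs (z' - z) < d ->
      Bd z' d M) ->
  exists2 d : R, 0 < d & exists M, forall z, inrect z0 w0 h0 z -> Bd z d M.
Proof.
move=> w00 h00 mono loc.
pose good z w h := exists2 d : R, 0 < d & exists M, forall z', inrect z w h z' -> Bd z' d M.
apply: contrapT => bad0.
have [|||||z kz hz] := @bisection R _ (fun x : C * R * R => [/\ 0 <= x.1.2, 0 <= x.2,
    (forall z', inrect x.1.1 x.1.2 x.2 z' -> inrect z0 w0 h0 z') & ~ good x.1.1 x.1.2 x.2])
  (fun x => x.1.1) (fun x => `|x.1.2 + x.2|) (z0, w0, h0) (inrect z0 w0 h0).
- by split.
- by move=> x; exact: normr_ge0.
- by move=> [[z w] h] /= [a b c _]; apply: c; rewrite /inrect !lexx !lerDl a b.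
- exact: inrect_closed.
- move=> [[z w] h] /= [a b c bd].
  have : exists s t : R, [/\ 0 <= s <= w / 2, 0 <= t <= h / 2 & ~ good (z + (s +i* t)%C) (w / 2)
      (h / 2)].
    apply: contrapT => nb; apply: bd.
    have g s t : 0 <= s <= w / 2 -> 0 <= t <= h / 2 -> good (z + (s +i* t)%C) (w / 2) (h / 2).
      by move=> hs ht; apply: contrapT => ng; apply: nb; exists s, t.
    have [d1 p1 [M1 b1]] := g 0 0 ltac:(lra) ltac:(lra).
    have [d2 p2 [M2 b2]] := g (w / 2) 0 ltac:(lra) ltac:(lra).
    have [d3 p3 [M3 b3]] := g 0 (h / 2) ltac:(lra) ltac:(lra).
    have [d4 p4 [M4 b4]] := g (w / 2) (h / 2) ltac:(lra) ltac:(lra).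
    exists (Num.min (Num.min d1 d2) (Num.min d3 d4)); first by rewrite !lt_min p1 p2 p3 p4.
    exists (Num.max (Num.max M1 M2) (Num.max M3 M4)) => z' /andP[/andP[x1 x2] /andP[y1 y2]].
    case: (leP (complex.Re z') (complex.Re z + w / 2)) => hx;
        case: (leP (complex.Im z') (complex.Im z + h / 2)) => hy.
    + apply: (mono _ d1 M1); rewrite ?ge_min ?le_max ?lexx ?orbT //; apply: b1;
          rewrite /inrect ReD ImD /=; lra.
    + apply: (mono _ d3 M3); rewrite ?ge_min ?le_max ?lexx ?orbT //; apply: b3;
          rewrite /inrect ReD ImD /=; lra.
    + apply: (mono _ d2 M2); rewrite ?ge_min ?le_max ?lexx ?orbT //; apply: b2;
          rewrite /inrect ReD ImD /=; lra.
    + apply: (mono _ d4 M4); rewrite ?ge_min ?le_max ?lexx ?orbT //; apply: b4;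
          rewrite /inrect ReD ImD /=; lra.
  move=> [s [t [hs ht ng]]]; exists (z + (s +i* t)%C, w / 2, h / 2); split => /=.
  + split; [lra|lra| |exact: ng].
    by move=> z' /andP[]; rewrite ReD ImD /= => x1 x2; apply: c; rewrite /inrect; lra.
  + by rewrite -mulrDl !ger0_norm ?divr_ge0 ?addr_ge0.
  + rewrite addrC addKr; apply: le_trans (cabs_le _) _ => /=; rewrite !ger0_norm; lra.
have [d d0 [M hM]] := loc z kz.
have [[[x w] h] /= [[a b c bd] h1 h2]] := hz (d / 4) ltac:(lra).
rewrite ger0_norm ?addr_ge0 // in h1 h2; apply: bd; exists d => //; exists M => z' /andP[x1 x2].
apply: hM; have := cabs_tri z' x z; have := cabs_le (z' - x); rewrite ReD ImD ReN ImN !ger0_norm;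
    lra.
Qed.

Lemma inrect_ball (K : R) z : cabs z <= K -> inrect ((- K) +i* (- K))%C (2 * K) (2 * K) z.
Proof.
move=> zK; have := le_trans (cabs_Re z) zK; have := le_trans (cabs_Im z) zK.
rewrite /inrect /= !ler_norml; lra.
Qed.

Lemma disc_bd (f : C -> C) (K : R) : 0 <= K -> (forall z, cont1 f z) -> exists M, forall z,
    cabs z <= K -> cabs (f z) <= M.
Proof.
move=> K0 cf; have [||||d d0 [M hM]] := @rect_bd (fun z d M => cabs (f z) <= M) ((- K) +i* (- K))%C
    (2 * K) (2 * K).
- lra.
- lra.
- by move=> z d M d' M' _ MM h; apply: le_trans MM.
- by move=> z _; have [r r0 hr] := cont_bd (cf z); exists r => //; exists (cabs (f z) + 1).
by exists M => z /inrect_ball; exact: hM.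
Qed.

Lemma circle_bd (f : C -> C) (r : R) : 0 < r -> (forall z, cabs z = r -> cont1 f z) ->
  exists2 M, 0 <= M & forall z, cabs z = r -> cabs (f z) <= M.
Proof.
move=> r0 cf; have p2 : 0 < 2 * pi :> R by have := pi_gt0 R; lra.
have er : expR (ln r) = r by rewrite lnK ?posrE.
(* The circle is the image under [cexp] of a vertical segment, that is, of a rectangle of width
   0. *)
have [||||d d0 [M hM]] := @rect_bd (fun z d M => complex.Re z = ln r -> cabs (f (cexp z)) <= M)
    ((ln r) +i* 0)%C 0 (2 * pi).
- by [].
- lra.
- by move=> z d M d' M' _ MM h /h h'; apply: le_trans MM.
- move=> z /andP[/=]; rewrite addr0 => /le_anti zr _.
  have c : cont1 (fun s => f (cexp s)) z.
    by apply: cont_comp1; [apply: cf; rewrite cabs_cexp -zr|exact/cder_cont/cder_cexp].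
  have [s s0 hs] := cont_bd c; exists s => //; exists (cabs (f (cexp z)) + 1) => z' hz' _;
      exact: hs.
exists (Num.max M 0); first by rewrite le_max lexx orbT.
move=> z zr; have z0 : z != 0 by rewrite -cabs_gt0 zr.
have [s es] := cexp_surj z0.
have re : complex.Re s = ln r by apply: expR_inj; rewrite er -cabs_cexp es.
pose k := Num.floor (complex.Im s / (2 * pi)); pose w := s - k%:~R * tpi.
have ew : cexp w = z by rewrite /w cexpD cexpN cexp_int_tpi invr1 mulr1.
have rw : complex.Re w = ln r by rewrite /w ReD ReN ReM Re_int Im_int /= mulr0 mul0r subrr subr0.
have iw : complex.Im w = complex.Im s - k%:~R * (2 * pi).
  by rewrite /w ImD ImN ImM Re_int Im_int /= mul0r addr0.
rewrite -ew le_max hM //; rewrite /inrect /= rw addr0 lexx /= iw add0r.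
rewrite subr_ge0 -ler_pdivlMr // floor_le /= lerBlDr -[X in X + _]mul1r -mulrDl -ler_pdivrMr //
    addrC -(intrD _ k 1).
exact/ltW/floorD1_gt.
Qed.

Lemma cder_shift (f : C -> C) p z : cder f (p + z) -> cder (fun w => f (p + w)) z.
Proof. by move=> h; apply: cder_comp => //; apply: cderD; [exact: cder_const|exact: cder_id]. Qed.
Lemma cdiff_shift (f : C -> C) p l : cdiff f p l -> cdiff (fun w => f (p + w)) 0 l.
Proof.
move=> h; have := @cdiff_comp R f (fun w => p + w) 0 1 l; rewrite addr0 mulr1; apply => //.
by have := cdiffD (cdiff_const p 0) (cdiff_id (0 : C)); rewrite add0r.
Qed.

Lemma nnq (k M r : R) n : 0 <= k -> 0 <= M -> 0 < r -> 0 <= k * M / r ^+ n.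
Proof. by move=> k0 M0 r0; apply: mulr_ge0; [exact: mulr_ge0|rewrite invr_ge0 exprn_ge0 // ltW].
    Qed.

(** Taylor's remainder of order 2 on the circle of radius [R0 / 2]. Within [R0 / 4] of the center
    the factor r / (r - |w|) is at most 2, whence 2 M (2 / R0)^2 = 8 M / R0^2. *)
Lemma quad_bound f (p l : C) (R0 M : R) : 0 < R0 -> (forall z, cabs (z - p) < R0 -> cder f z) ->
  (forall z, cabs (z - p) < R0 -> cabs (f z) <= M) -> cdiff f p l ->
  forall z, cabs (z - p) <= R0 / 4 -> cabs (f z - f p - l * (z - p)) <= 8 * M / R0 ^+ 2 *
      cabs (z - p) ^+ 2.
Proof.
move=> R00 df bf dl.
have [|a ha] := @taylor R (fun w => f (p + w)) R0 R00.
  by move=> z zR; apply: cder_shift; apply: df; rewrite addrC addKr.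
have [||_ hw] := ha (R0 / 2) _ M; first lra.
  by move=> z zR; apply: bf; rewrite addrC addKr zR; lra.
have M0 : 0 <= M by apply: le_trans (bf p _); rewrite ?cabs_ge0 // subrr cabs0.
have a0 : a 0 = f p.
  have := hw 0 ltac:(rewrite cabs0; lra) 1; rewrite big_ord1 expr0 mulr1 addr0 cabs0 mul0r expr1
      mulr0 mul0r.
  move=> h; apply/eqP; rewrite eq_sym -subr_eq0 -cabs_eq0 eq_le h cabs_ge0 //.
have q w : cabs w <= R0 / 4 -> cabs (f (p + w) - f p - a 1 * w) <= 8 * M / R0 ^+ 2 * cabs w ^+ 2.
  move=> wR; have := hw w ltac:(lra) 2; rewrite big_ord_recl big_ord1 /= expr0 mulr1 a0 expr1 opprD
      addrA => h.
  apply: le_trans h _; have d1 : 0 < R0 / 2 - cabs w by lra.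
  have : R0 / 2 / (R0 / 2 - cabs w) <= 2 by rewrite ler_pdivrMr //; lra.
  have -> : 8 * M / R0 ^+ 2 * cabs w ^+ 2 = M * (cabs w / (R0 / 2)) ^+ 2 * 2 by field;
      rewrite gt_eqF.
  by move=> h; rewrite ler_wpM2l // mulr_ge0 // exprn_ge0 // divr_ge0 ?cabs_ge0 //; lra.
have la : a 1 = l.
  apply: (@cdiff_unique R (fun w => f (p + w)) 0); last exact: cdiff_shift.
  apply: (@cdiff_quad R _ _ _ (R0 / 4) (8 * M / R0 ^+ 2)); first lra.
    by apply: nnq.
  by move=> w; rewrite subr0 addr0 => hw1; apply: q; apply: ltW.
move=> z zR; have := q (z - p) zR; by rewrite la [p + _]addrC subrK.
Qed.

Lemma liouville (f : C -> C) M : (forall z, cder f z) -> (forall z, cabs (f z) <= M) -> forall z,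
    f z = f 0.
Proof.
move=> df bf z; apply/eqP; rewrite -subr_eq0 -cabs_eq0 eq_le cabs_ge0 andbT.
have M0 := le_trans (cabs_ge0 _) (bf 0).
apply/ler_addgt0Pr => e e0; rewrite add0r.
(* A radius at which the first Taylor remainder M |z| / (r - |z|) falls below [e]. *)
pose r := 2 * cabs z + 2 * M * cabs z / e + 1.
have c0 := cabs_ge0 z.
have t0 : 0 <= 2 * M * cabs z / e by rewrite divr_ge0 ?mulr_ge0 // ltW.
have r0 : 0 < r by rewrite /r; lra.
have [|a ha] := @taylor R f (r + 1) ltac:(lra); first by move=> *; apply: df.
have [||_ hw] := ha r _ M; [lra|by move=> *; apply: bf|].
have a0 : a 0 = f 0.
  have := hw 0 ltac:(rewrite cabs0; lra) 1; rewrite big_ord1 expr0 mulr1 cabs0 mul0r expr1 mulr0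
      mul0r.
  move=> h; apply/eqP; rewrite eq_sym -subr_eq0 -cabs_eq0 eq_le h cabs_ge0 //.
have := hw z ltac:(rewrite /r; lra) 1; rewrite big_ord1 expr0 mulr1 a0 expr1 => h;
    apply: le_trans h _.
have d0 : 0 < r - cabs z by rewrite /r; lra.
have -> : M * (cabs z / r) * (r / (r - cabs z)) = M * cabs z / (r - cabs z) by field;
    rewrite !gt_eqF.
rewrite ler_pdivrMr //; have : 2 * M * cabs z / e * e = 2 * M * cabs z by rewrite divfK // gt_eqF.
have : 0 <= M * cabs z by rewrite mulr_ge0.
have : 0 <= e * cabs z by rewrite mulr_ge0 // ltW.
rewrite /r; set u := 2 * M * cabs z / e; move=> q1 q2 q3; rewrite !mulrDr mulrN [e * u]mulrC q3;
    lra.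
Qed.

(** The derivative of the quotient at 0 is the second Taylor coefficient of [f]: the remainder of
    order 3, divided by z, is quadratic. *)
Lemma cder_div_id (f : C -> C) (R0 : R) l : 0 < R0 -> (forall z, cabs z < R0 -> cder f z) ->
    f 0 = 0 -> cdiff f 0 l ->
  forall z, cabs z < R0 -> cder (fun z => if z == 0 then l else f z / z) z.
Proof.
move=> R00 df f0 dl z zR; case: (eqVneq z 0) => [->|z0]; last first.
  apply: (@cder_ext R (fun z => f z / z)).
    exists (cabs z); first by rewrite cabs_gt0.
    by move=> q; case: (eqVneq q 0) => [->|//]; rewrite sub0r cabsN ltxx.
  by apply: cderM; [exact: df|apply: cderV => //; exact: cder_id].
have [a ha] := taylor R00 df.
have [|M M0 bM] := @circle_bd f (R0 / 2) ltac:(lra).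
  by move=> w ww; apply/cder_cont/df; rewrite ww; lra.
have [|//|_ hw] := ha (R0 / 2) _ M; first lra.
have a0 : a 0 = 0.
  have := hw 0 ltac:(rewrite cabs0; lra) 1; rewrite big_ord1 expr0 mulr1 cabs0 mul0r expr1 mulr0
      mul0r f0 sub0r cabsN.
  by move=> h; apply/eqP; rewrite -cabs_eq0 eq_le h cabs_ge0.
have a1 : a 1 = l.
  apply: (@cdiff_unique R f 0) => //.
  apply: (@cdiff_quad R _ _ _ (R0 / 4) (8 * M / R0 ^+ 2)); first lra.
    by apply: nnq.
  move=> w; rewrite !subr0 f0 => wR; have := hw w ltac:(lra) 2;
      rewrite big_ord_recl big_ord1 /= expr1 a0 mul0r add0r subr0.
  move=> h; apply: le_trans h _; have d1 : 0 < R0 / 2 - cabs w by lra.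
  have : R0 / 2 / (R0 / 2 - cabs w) <= 2 by rewrite ler_pdivrMr //; lra.
  have -> : 8 * M / R0 ^+ 2 * cabs w ^+ 2 = M * (cabs w / (R0 / 2)) ^+ 2 * 2 by field;
      rewrite gt_eqF.
  by move=> h; rewrite ler_wpM2l // mulr_ge0 // exprn_ge0 // divr_ge0 ?cabs_ge0 //; lra.
exists (a 2); apply: (@cdiff_quad R _ _ _ (R0 / 4) (16 * M / R0 ^+ 3)); first lra.
  by apply: nnq.
move=> w; rewrite eqxx !subr0 => wR; case: (eqVneq w 0) => [->|w0].
  by rewrite subrr mulr0 subrr cabs0 mulr_ge0 ?exprn_ge0 //; apply: nnq.
have := hw w ltac:(lra) 3; rewrite !big_ord_recl big_ord0 /= addr0 expr1 a0 mul0r add0r a1.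
have -> : f w / w - l - a 2 * w = (f w - (l * w + a 2 * w ^+ 2)) / w by field.
move=> h; rewrite cabsM cabsV ler_pdivrMr ?cabs_gt0 //; apply: le_trans h _;
    have d1 : 0 < R0 / 2 - cabs w by lra.
have : R0 / 2 / (R0 / 2 - cabs w) <= 2 by rewrite ler_pdivrMr //; lra.
have -> : 16 * M / R0 ^+ 3 * cabs w ^+ 2 * cabs w = M * (cabs w / (R0 / 2)) ^+ 3 * 2 by field;
    rewrite gt_eqF.
by move=> h; rewrite ler_wpM2l // mulr_ge0 // exprn_ge0 // divr_ge0 ?cabs_ge0 //; lra.
Qed.

Lemma hol3P f p A B D : (forall e : R, 0 < e -> exists2 r : R, 0 < r & forall q : C3, d3 p q < r ->
  cabs (f q - f p - (A * (q.1.1 - p.1.1) + B * (q.1.2 - p.1.2) + D * (q.2 - p.2))) <= e * d3 p q) ->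
      hol3d f p A B D.
Proof.
(* The remainder [r] has to be distributed over the three increments with small coefficients. The
   phases [u] satisfy u(z) z = |z|, so the increments multiplied by their phases add up to
   [d3 p q]. *)
move=> h; pose r q := f q - f p - (A * (q.1.1 - p.1.1) + B * (q.1.2 - p.1.2) + D * (q.2 - p.2)).
pose u (z : C) : C := if z == 0 then 0 else (cabs z)%:C%C / z.
have uz z : u z * z = (cabs z)%:C%C.
  by rewrite /u; case: eqP => [->|/eqP n]; [rewrite cabs0 mulr0|rewrite divfK].
have u1 z : cabs (u z) <= 1.
  rewrite /u; case: eqP => [_|/eqP n]; first by rewrite cabs0 ler01.
  by rewrite cabsM cabsV cabs_real ger0_norm ?cabs_ge0 // divff // cabs_eq0.
pose E K (w : C3 -> C) q := K + r q * u (w q) / (d3 p q)%:C%C.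
have rp : r p = 0 by rewrite /r !subrr !mulr0 !addr0 subrr.
have Ep K w : E K w p = K by rewrite /E rp !mul0r addr0.
have cE K w : cont3 (E K w) p.
  move=> e e0; have [s s0 hs] := h (e / 2) ltac:(lra); exists s => // q hq;
      rewrite Ep /E addrC addKr.
  have [d0|d0] := eqVneq (d3 p q) 0; first by rewrite d0 invr0 mulr0 cabs0.
  have dp : 0 < d3 p q by rewrite lt_neqAle eq_sym d0 d3_ge0.
  rewrite !cabsM cabsV cabs_real gtr0_norm // ltr_pdivrMr //.
  have := hs q hq; rewrite -/(r q) => hr; have := u1 (w q); have := cabs_ge0 (r q);
      have := cabs_ge0 (u (w q)); nra.
exists (E A (fun q => q.1.1 - p.1.1)), (E B (fun q => q.1.2 - p.1.2)), (E D (fun q => q.2 - p.2)).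
split; try by split.
exists 1 => // q _; have [d0|d0] := eqVneq (d3 p q) 0.
  have z0 : q.1.1 = p.1.1 by apply/eqP; rewrite -subr_eq0 -cabs_eq0 eq_le cabs_ge0 -d0 d3_0.
  have z1 : q.1.2 = p.1.2 by apply/eqP; rewrite -subr_eq0 -cabs_eq0 eq_le cabs_ge0 -d0 d3_1.
  have z2 : q.2 = p.2 by apply/eqP; rewrite -subr_eq0 -cabs_eq0 eq_le cabs_ge0 -d0 d3_2.
  have -> : q = p by move: z0 z1 z2; case: q {d0} => [[? ?] ?]; case: (p) => [[? ?] ?] /= -> -> ->.
  by rewrite !subrr !mulr0 !addr0.
have d0' : (d3 p q)%:C%C != 0 :> C by rewrite -cabs_eq0 cabs_real normr_eq0.
have -> : f q - f p = r q + (A * (q.1.1 - p.1.1) + B * (q.1.2 - p.1.2) + D * (q.2 - p.2)) by rewrite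
    /r subrK.
rewrite /E; set x := _ - _; set y := _ - _; set z := _ - _.
transitivity (A * x + B * y + D * z + r q * (u x * x + u y * y + u z * z) / (d3 p q)%:C%C);
    last ring.
have -> : u x * x + u y * y + u z * z = (d3 p q)%:C%C by rewrite !uz /d3 !rmorphD.
by rewrite mulfK // addrC.
Qed.

(* The slopes c n are Cauchy because v n s / s approximates c n uniformly in n. *)
Lemma cauchy_slope (c : nat -> C) (v : nat -> R -> C) (K s0 : R) : 0 <= K -> 0 < s0 ->
  (forall n s, 0 < s < s0 -> cabs (v n s - c n * s%:C%C) <= K * s ^+ 2) ->
  (forall s, 0 < s < s0 -> exists l, ccvg (fun n => v n s) l) -> exists l, ccvg c l.
Proof.
move=> K0 s00 hv cv; apply: ccauchy => e e0.
pose s := Num.min (s0 / 2) (e / (4 * K + 1) / 2).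
have K1 : 0 < 4 * K + 1 by lra.
have sp : 0 < s by rewrite lt_min !divr_gt0.
have ss : 0 < s < s0.
  by rewrite sp /=; apply: le_lt_trans (_ : s0 / 2 < _); [rewrite ge_min lexx|lra].
have sK : s * (4 * K + 1) * 2 <= e.
  by rewrite -ler_pdivlMr // -ler_pdivlMr // mulrAC ge_min lexx orbT.
have [l hl] := cv s ss; have [N hN] := hl (e * s / 8) ltac:(by rewrite divr_gt0 ?mulr_gt0).
exists N => n m /hN hn /hN hm; rewrite -(ltr_pM2r sp) -[X in _ * X]gtr0_norm // -cabs_real -cabsM
    mulrBl.
have e1 := hv n s ss; have e2 := hv m s ss.
have -> : c n * s%:C%C - c m * s%:C%C = (v n s - l) - (v m s - l) - ((v n s - c n * s%:C%C) -
    (v m s - c m * s%:C%C)) by ring.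
apply: le_lt_trans (cabsB _ _) _.
have := cabsB (v n s - l) (v m s - l).
have := cabsB (v n s - c n * s%:C%C) (v m s - c m * s%:C%C).
rewrite expr2 in e1 e2; nra.
Qed.

(* By Cauchy's estimates the quadratic Taylor bounds are uniform in n, so the derivatives converge
   too. *)
Lemma vitali (g : nat -> C3 -> C) (G : C3 -> C) p (rho M : R) : 0 < rho ->
  (forall n q, d3 p q < rho -> hol3 (g n) q) -> (forall n q, d3 p q < rho -> cabs (g n q) <= M) ->
  (forall q, d3 p q < rho -> ccvg (fun n => g n q) (G q)) -> hol3 G p.
Proof.
move=> r0 hg bg cg.
have M0 : 0 <= M by apply: le_trans (bg 0%N p _); rewrite ?cabs_ge0 // d3xx.
pose K := 8 * M / rho ^+ 2; have K0 : 0 <= K by apply: nnq.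
have co n : {abc : C * C * C | hol3d (g n) p abc.1.1 abc.1.2 abc.2}.
  apply: cid; have [A [B [D h]]] := hg n p ltac:(by rewrite d3xx); by exists (A, B, D).
pose A n := (sval (co n)).1.1; pose B n := (sval (co n)).1.2; pose D n := (sval (co n)).2.
have hd n : hol3d (g n) p (A n) (B n) (D n) by exact: (svalP (co n)).
have quad n q : d3 p q <= rho / 4 -> cabs (g n q - g n p - (A n * (q.1.1 - p.1.1) + B n *
    (q.1.2 - p.1.2) + D n * (q.2 - p.2))) <= K * d3 p q ^+ 2.
  move=> hq; set x := q.1.1 - p.1.1; set y := q.1.2 - p.1.2; set z := q.2 - p.2.
  have [d0|d0] := eqVneq (d3 p q) 0.
    have z0 : q.1.1 = p.1.1 by apply/eqP; rewrite -subr_eq0 -cabs_eq0 eq_le cabs_ge0 -d0 d3_0.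
    have z1 : q.1.2 = p.1.2 by apply/eqP; rewrite -subr_eq0 -cabs_eq0 eq_le cabs_ge0 -d0 d3_1.
    have z2 : q.2 = p.2 by apply/eqP; rewrite -subr_eq0 -cabs_eq0 eq_le cabs_ge0 -d0 d3_2.
    have e : q = p by move: z0 z1 z2; case: (q) => [[? ?] ?]; case: (p) => [[? ?] ?] /= -> -> ->.
    by rewrite /x /y /z e !subrr !mulr0 !addr0 subrr cabs0 mulr_ge0 // sqr_ge0.
  have dp : 0 < d3 p q by rewrite lt_neqAle eq_sym d0 d3_ge0.
  (* The complex line through [p] and [q]. It stays in the ball as long as |t| < rho / d3 p q, and
     [quad_bound] on that disc gives a constant independent of [n] and of the direction. *)
  pose c t : C3 := (p.1.1 + t * x, p.1.2 + t * y, p.2 + t * z).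
  have dc t s : d3 (c t) (c s) = cabs (s - t) * d3 p q.
    have e (k v : C) : k + s * v - (k + t * v) = (s - t) * v by ring.
    by rewrite /d3 /c /= !e !cabsM -!mulrDr.
  have c0 : c 0 = p by rewrite /c !mul0r !addr0; case: (p) => [[? ?] ?].
  have c1 : c 1 = q by rewrite /c !mul1r ![_ + (_ - _)]addrC !subrK; case: (q) => [[? ?] ?].
  have dpc t : d3 p (c t) = cabs t * d3 p q by rewrite -{1}c0 dc subr0.
  have lin (k v : C) t : cdiff (fun s => k + s * v) t v.
    have := cdiffD (cdiff_const k t) (cdiffM (cdiff_id t) (cdiff_const v t)).
    by rewrite mulr0 mul1r !add0r.
  have dl : cdiff (fun t => g n (c t)) 0 (A n * x + B n * y + D n * z).
    by apply: hol3d_curve (hd n) _ (lin _ _ _) (lin _ _ _) (lin _ _ _); rewrite -[LHS]c0.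
  have := @quad_bound (fun t => g n (c t)) 0 _ (rho / d3 p q) M _ _ _ dl 1.
  rewrite subr0 cabs1 mulr1 c0 c1 expr1n mulr1.
  have -> : 8 * M / (rho / d3 p q) ^+ 2 = K * d3 p q ^+ 2 by rewrite /K; field; rewrite !gt_eqF.
  apply.
  - by rewrite divr_gt0.
  - move=> t; rewrite subr0 ltr_pdivlMr // -dpc => ht; have [A' [B' [D' h']]] := hg n (c t) ht.
    by exists (A' * x + B' * y + D' * z); apply: hol3d_curve h' _ (lin _ _ _) (lin _ _ _)
        (lin _ _ _).
  - by move=> t; rewrite subr0 ltr_pdivlMr // -dpc => ht; apply: bg.
  - by rewrite ler_pdivlMr // ler_pdivlMr //; lra.
have cvB q : d3 p q < rho -> ccvg (fun n => g n q - g n p) (G q - G p).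
  by move=> hq; apply: ccvgB; apply: cg => //; rewrite d3xx.
have sl (c : nat -> C) (w : R -> C3) : (forall s : R, 0 < s -> d3 p (w s) = s) ->
   (forall n (s : R), 0 < s -> A n * ((w s).1.1 - p.1.1) + B n * ((w s).1.2 - p.1.2) + D n *
       ((w s).2 - p.2) = c n * s%:C%C) -> exists l, ccvg c l.
  move=> dw ew; apply: (@cauchy_slope c (fun n s => g n (w s) - g n p) K (rho / 4)) => //;
      first lra.
    by move=> n s /andP[s0 sr]; rewrite -ew //; have := quad n (w s); rewrite dw //; apply;
        apply: ltW.
  by move=> s /andP[s0 sr]; exists (G (w s) - G p); apply: cvB; rewrite dw //; lra.
have ek (k v : C) : k + v - k = v by ring.
have [||a ca] := sl A (fun s => (p.1.1 + s%:C%C, p.1.2, p.2)).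
- by move=> s s0; rewrite /d3 /= ek !subrr cabs0 !addr0 cabs_real gtr0_norm.
- by move=> n s s0 /=; rewrite ek !subrr !mulr0 !addr0.
have [||b cb] := sl B (fun s => (p.1.1, p.1.2 + s%:C%C, p.2)).
- by move=> s s0; rewrite /d3 /= ek !subrr cabs0 add0r addr0 cabs_real gtr0_norm.
- by move=> n s s0 /=; rewrite ek !subrr !mulr0 add0r addr0.
have [||d cd] := sl D (fun s => (p.1.1, p.1.2, p.2 + s%:C%C)).
- by move=> s s0; rewrite /d3 /= ek !subrr cabs0 !add0r cabs_real gtr0_norm.
- by move=> n s s0 /=; rewrite ek !subrr !mulr0 !add0r.
exists a, b, d; apply: hol3P => e e0; have K1 : 0 < K + 1 by lra.
exists (Num.min (rho / 4) (e / (K + 1))); first by rewrite lt_min !divr_gt0.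
move=> q; rewrite lt_min => /andP[q1 q2].
have := @ccvg_le R _ _ (K * d3 p q ^+ 2) _ (ccvgB (cvB q ltac:(lra))
    (ccvgD (ccvgD (ccvgZ (q.1.1 - p.1.1) ca) (ccvgZ (q.1.2 - p.1.2) cb)) (ccvgZ (q.2 - p.2) cd))).
rewrite ![(_ - _) * a]mulrC ![(_ - _) * b]mulrC ![(_ - _) * d]mulrC => h; apply: le_trans (h _) _.
  by exists 0 => n _; rewrite ![(_ - _) * A n]mulrC ![(_ - _) * B n]mulrC ![(_ - _) * D n]mulrC;
      apply: quad; apply: ltW.
rewrite expr2 mulrA ler_wpM2r ?d3_ge0 //; move: q2; rewrite ltr_pdivlMr //; have := d3_ge0 p q; nra.
Qed.

End Hol.

(** * Division by a coordinate, removable singularities and q-expansions *)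

Section Div.
Variable R : realType.
Notation C := (CC R).
Notation tpi := (tpi R).
Notation C3 := (C3 R).

Definition inH (p : C3) := 0 < complex.Im p.1.1.

Lemma Im_near (t0 t : C) : cabs (t - t0) < complex.Im t0 -> 0 < complex.Im t.
Proof.
move=> h; have := le_lt_trans (cabs_Im (t - t0)) h; rewrite ImD ImN ltr_norml => /andP[a b]; lra.
Qed.

Lemma inH_near p q : d3 p q < complex.Im p.1.1 -> inH q.
Proof. by move=> h; apply: (@Im_near p.1.1); apply: le_lt_trans (d3_0 _ _) h. Qed.

Lemma slice0 (f : C3 -> C) p : hol3 f p -> cder (fun t => f (t, p.1.2, p.2)) p.1.1.
Proof.
move=> [A [B [D h]]]; eexists; apply: (hol3d_curve h _ (cdiff_id _) (cdiff_const _ _)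
    (cdiff_const _ _)).
by case: p h => [[? ?] ?].
Qed.

Lemma slice1 (f : C3 -> C) p : hol3 f p -> cder (fun t => f (p.1.1, t, p.2)) p.1.2.
Proof.
move=> [A [B [D h]]]; eexists; apply: (hol3d_curve h _ (cdiff_const _ _) (cdiff_id _)
    (cdiff_const _ _)).
by case: p h => [[? ?] ?].
Qed.

Lemma slice2 (f : C3 -> C) p : hol3 f p -> cder (fun t => f (p.1.1, p.1.2, t)) p.2.
Proof.
move=> [A [B [D h]]]; eexists; apply: (hol3d_curve h _ (cdiff_const _ _) (cdiff_const _ _)
    (cdiff_id _)).
by case: p h => [[? ?] ?].
Qed.

Lemma midsum_hol3 (G : C3 -> C -> C) d a b p (K : C -> Prop) : K a -> K b ->
    (forall x y, K x -> K y -> K (mid x y)) ->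
  (forall s, K s -> hol3 (fun q => G q s) p) -> hol3 (fun q => midsum (G q) d a b) p.
Proof.
move=> + + cv h; elim: d a b => [|d IH] a b ka kb /=.
  by apply: hol3M; [exact: hol3_const|apply: h; apply: cv].
by apply: hol3D; apply: IH => //; apply: cv.
Qed.

(** Compactness in x alone; the common margin around [t0] and [y0] is the [d] of [rect_bd]. *)
Lemma tube (f : C3 -> C) t0 y0 (K : R) : 0 <= K -> (forall x, cont3 f (t0, x, y0)) ->
  exists2 d : R, 0 < d & exists M, forall t x y, cabs (t - t0) < d -> cabs (y - y0) < d -> cabs x <=
      K -> cabs (f (t, x, y)) <= M.
Proof.
move=> K0 cf.
have [||||d d0 [M hM]] := @rect_bd R (fun x d M => forall t y, cabs (t - t0) < d -> cabs (y - y0) <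
    d -> cabs (f (t, x, y)) <= M) ((- K) +i* (- K))%C (2 * K) (2 * K).
- lra.
- lra.
- move=> z d M d' M' dd MM h t y ht hy; apply: le_trans MM; apply: h; exact: lt_le_trans dd.
- move=> x _; have [r r0 hr] := cont_bd (cf x); exists (r / 3); first lra.
  exists (cabs (f (t0, x, y0)) + 1) => x' hx t y ht hy; apply: hr; rewrite /d3 /=; lra.
by exists d => //; exists M => t x y ht hy /inrect_ball/hM; apply.
Qed.

(** For x near 0 the quotient is the mean over |u| = 1 of f(t, u, y) / (u - x), by Cauchy's formula.
    The finite sums approximating it are visibly holomorphic in all three variables, and [vitali]
    passes this to the limit. *)
Theorem hol3_div_x (f : C3 -> C) : (forall p, inH p -> hol3 f p) ->
    (forall t y : C, 0 < complex.Im t -> f (t, 0, y) = 0) ->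
  exists2 F : C3 -> C, (forall p, inH p -> hol3 F p) & (forall t x y : C, 0 < complex.Im t ->
      f (t, x, y) = x * F (t, x, y)).
Proof.
move=> hf f0.
pose l t y := xget 0 [set l : C | cdiff (fun x => f (t, x, y)) 0 l].
have hl (t y : C) : 0 < complex.Im t -> cdiff (fun x => f (t, x, y)) 0 (l t y).
  move=> ht; have [m hm] := @slice1 f (t, 0, y) (hf (t, 0, y) ht).
  by rewrite /l; case: xgetP => // /(_ m).
pose F (p : C3) := if p.1.2 == 0 then l p.1.1 p.2 else f p / p.1.2.
have cF (t y x : C) : 0 < complex.Im t -> cder (fun x => F (t, x, y)) x.
  move=> ht; apply: (@cder_div_id R (fun x => f (t, x, y)) (cabs x + 1) (l t y)).
  - by have := cabs_ge0 x; lra.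
  - by move=> z _; exact: (@slice1 f (t, z, y) (hf (t, z, y) ht)).
  - exact: f0.
  - exact: hl.
  - by rewrite ltrDl.
exists F; last first.
  move=> t x y ht; rewrite /F /=; case: eqP => [->|/eqP n]; first by rewrite mul0r f0.
  by rewrite mulrC divfK.
move=> [[t0 x0] y0] ht0; rewrite /inH /= in ht0.
case: (eqVneq x0 0) => [->|x00]; last first.
  apply: (@hol3_ext R (fun p => f p * p.1.2^-1)).
    exists (cabs x0); first by rewrite cabs_gt0.
    move=> q hq; rewrite /F; case: eqP => // q0; have := le_lt_trans (d3_1 _ _) hq.
    by rewrite q0 /= sub0r cabsN ltxx.
  by apply: hol3M; [exact: hf|apply: hol3V => //; exact: hol3_1].
have [|d d0 [M hM]] := @tube f t0 y0 1 ltac:(lra); first by move=> x; apply: hol3_cont; exact: hf.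
pose g n (q : C3) := tpi^-1 * circ_sum (fun s => f (q.1.1, cexp s, q.2) / (cexp s - q.1.2)) n 0.
pose rho := Num.min d (Num.min (2^-1) (complex.Im t0)).
have rho0 : 0 < rho by rewrite !lt_min d0 ht0 invr_gt0 ltr0n.
have P0 := tpi_ne0 R; have p0 := pi_gt0 R.
have near q : d3 (t0, 0, y0) q < rho -> [/\ cabs (q.1.1 - t0) < d, cabs (q.2 - y0) < d, cabs q.1.2 <
    2^-1 & 0 < complex.Im q.1.1].
  rewrite !lt_min => /and3P[h1 h2 h3]; split.
  - exact: le_lt_trans (d3_0 _ _) h1.
  - exact: le_lt_trans (d3_2 _ _) h1.
  - by have := le_lt_trans (d3_1 _ _) h2; rewrite /= subr0.
  - exact: (@inH_near (t0, 0, y0)).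
have e1 s : complex.Re s = 0 -> cabs (cexp s) = 1 :> R by move=> hs; rewrite cabs_cexp hs expR0.
apply: (@vitali R g F _ rho ((2 * pi)^-1 * (Num.max M 0 * 2 * (2 * pi))) rho0).
- move=> n q /near[_ _ hx hq]; apply: hol3M; first exact: hol3_const.
  apply: (@midsum_hol3 (fun q s => f (q.1.1, cexp s, q.2) / (cexp s - q.1.2)) n _ _ q
      (fun s => complex.Re s = 0)) => //=; first by rewrite addr0.
    by move=> x y ex ey; rewrite /mid half_C ReM ReD /= mulr0 subr0 ex ey; lra.
  move=> s hs; apply: hol3M.
    by apply: hol3_comp3; [exact: hf|exact: hol3_0|exact: hol3_const|exact: hol3_2].
  apply: hol3V; first by apply: hol3D; [exact: hol3_const|apply: hol3N; exact: hol3_1].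
  rewrite subr_eq0; apply: contraTneq hx => <-; rewrite e1 //; by rewrite -leNgt invf_le1 // ler1n.
- move=> n q /near[h1 h2 hx hq]; rewrite /g cabsM cabsV cabs_tpi ler_wpM2l ?invr_ge0 //; first lra.
  apply: circ_sum_bound => s hs; rewrite cabsM cabsV; apply: ler_pM;
      rewrite ?cabs_ge0 ?invr_ge0 ?cabs_ge0 //.
    by rewrite le_max hM // e1.
  rewrite invf_ple ?posrE //; first by have := cabsBB (cexp s) q.1.2; rewrite e1 //; lra.
  by have := cabsBB (cexp s) q.1.2; rewrite e1 //; lra.
- move=> [[t x] y] /near[/= h1 h2 hx ht].
  have := ccvgZ tpi^-1 (@cauchy_formula R (fun x => F (t, x, y)) x 1 2 _ _ _);
      rewrite mulKf // ln1 => h.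
  apply: ccvg_ext (h _ _ _) => [n|||]; last 1 first.
  + lra.
  + congr (_ * _); rewrite /circ_sum; apply: (@midsum_ext R _ _ n _ _ (fun s => complex.Re s = 0))
        => //=; first by rewrite addr0.
      by move=> a b ea eb; rewrite /mid half_C ReM ReD /= mulr0 subr0 ea eb; lra.
    move=> s hs; rewrite /F /= (negPf (cexp_ne0 s)) mulrA divfK ?cexp_ne0 //.
  + lra.
  + by move=> z _; apply: cF.
Qed.

Lemma vitali1 (g : nat -> C -> C) (G : C -> C) p (rho M : R) : 0 < rho ->
  (forall n z, cabs (z - p) < rho -> cder (g n) z) -> (forall n z, cabs (z - p) < rho ->
      cabs (g n z) <= M) ->
  (forall z, cabs (z - p) < rho -> ccvg (fun n => g n z) (G z)) -> cder G p.
Proof.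
move=> r0 hg bg cg.
have h : hol3 (fun q : C3 => G q.1.1) (p, 0, 0).
  apply: (@vitali R (fun n q => g n q.1.1) _ _ rho M r0).
  - by move=> n q hq; apply: (hol3_comp1 (F := g n));
        [apply: hg; apply: le_lt_trans (d3_0 _ _) hq|exact: hol3_0].
  - by move=> n q hq; apply: bg; apply: le_lt_trans (d3_0 _ _) hq.
  - by move=> q hq; apply: cg; apply: le_lt_trans (d3_0 _ _) hq.
exact: (slice0 h).
Qed.

(** z^2 F(z), set to 0 at 0, is differentiable there with derivative 0; dividing by z twice keeps it
    differentiable. *)
Lemma removable0 (F : C -> C) (R0 R1 M : R) : 0 < R1 <= R0 -> (forall z, z != 0 -> cabs z < R0 ->
    cder F z) ->
  (forall z, z != 0 -> cabs z < R1 -> cabs (F z) <= M) ->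
  exists2 G, (forall z, cabs z < R0 -> cder G z) & forall z, z != 0 -> G z = F z.
Proof.
move=> /andP[R10 R11] dF bF; pose h z := if z == 0 then 0 else z ^+ 2 * F z.
have R00 : 0 < R0 by lra.
have d0 : cdiff h 0 0.
  apply: (@cdiff_quad R _ _ _ R1 (Num.max M 0)) => //; first by rewrite le_max lexx orbT.
  move=> w; rewrite /h eqxx !subr0 mul0r subr0; case: eqP => [->|/eqP n] wR.
    by rewrite !cabs0 expr0n mulr0.
  by rewrite cabsM cabsX mulrC ler_wpM2r ?exprn_ge0 ?cabs_ge0 // le_max bF.
have dh z : cabs z < R0 -> cder h z.
  move=> zR; case: (eqVneq z 0) => [->|n]; first by exists 0.
  apply: (@cder_ext R (fun z => z ^+ 2 * F z)).
    exists (cabs z); first by rewrite cabs_gt0.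
    by move=> q; rewrite /h; case: eqP => // ->; rewrite sub0r cabsN ltxx.
  by apply: cderM; [apply: cderX; exact: cder_id|exact: dF].
have h0 : h 0 = 0 by rewrite /h eqxx.
have dh1 := cder_div_id R00 dh h0 d0; set h1 := fun z => _ in dh1.
have [l hl] := dh1 0 ltac:(by rewrite cabs0).
have h10 : h1 0 = 0 by rewrite /h1 eqxx.
have dh2 := cder_div_id R00 dh1 h10 hl.
exists (fun z => if z == 0 then l else h1 z / z) => // z n.
by rewrite (negPf n) /h1 (negPf n) /h (negPf n); field.
Qed.

(** * A logarithm that is regular near 1 *)

Lemma clog_ex (w : C) : w != 0 -> exists s, cexp s = w /\ `|complex.Im s| <= pi.
Proof.
move=> /cexp_surj[s es]; have p2 : 0 < 2 * pi :> R by have := pi_gt0 R; lra.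
have p0 := pi_gt0 R.
pose k := Num.floor (complex.Im s / (2 * pi)); pose v := s - k%:~R * tpi.
have ev : cexp v = w by rewrite /v cexpD cexpN cexp_int_tpi invr1 mulr1.
have iv : complex.Im v = complex.Im s - k%:~R * (2 * pi).
  by rewrite /v ImD ImN ImM Re_int Im_int /= mul0r addr0.
have v0 : 0 <= complex.Im v by rewrite iv subr_ge0 -ler_pdivlMr // floor_le.
have v1 : complex.Im v < 2 * pi.
  rewrite iv ltrBlDr -[X in X + _]mul1r -mulrDl -ltr_pdivrMr // addrC -(intrD _ k 1).
  exact: floorD1_gt.
case: (leP (complex.Im v) pi) => h; first by exists v; rewrite ger0_norm.
exists (v - tpi); rewrite cexpD cexpN cexp_tpi invr1 mulr1; split => //.
by rewrite ImD ImN /= ler0_norm; lra.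
Qed.

Definition clog (w : C) : C := xget 0 [set s | cexp s = w /\ `|complex.Im s| <= pi].
Lemma clogP w : w != 0 -> cexp (clog w) = w /\ `|complex.Im (clog w)| <= pi.
Proof. by move=> /clog_ex[s hs]; rewrite /clog; case: xgetP => [x _ []//|/(_ s)]. Qed.
Lemma clog1 : clog 1 = 0.
Proof.
have [e h] := clogP (oner_neq0 _); have p0 := pi_gt0 R; have [k ek] := cexp_eq1 e.
have : `|k%:~R * (2 * pi)| <= pi :> R.
  by move: h; rewrite ek ImM Re_int Im_int /= mul0r addr0.
rewrite normrM (ger0_norm (x := 2 * pi)); last lra.
rewrite -intr_norm => h'; rewrite ek; suff -> : k = 0 by rewrite mul0r.
apply: contraTeq h' => k0; rewrite -ltNge.
have : 1 <= `|k|%:~R :> R by rewrite ler1z -gtz0_ge1 normr_gt0.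
nra.
Qed.

Lemma sin_half_le (t : R) : `|t| <= pi / 2 -> `|sin t| < 4^-1 -> `|t| <= 2 * `|sin t|.
Proof.
wlog t0 : t / 0 <= t.
  move=> h; case: (leP 0 t) => ht; first exact: h.
  by rewrite -normrN => h1 h2; rewrite -(normrN (sin t)) -sinN; apply: h => //;
      [lra|rewrite sinN normrN].
rewrite (ger0_norm t0) => tp; have p0 := pi_gt0 R.
have s0 : 0 <= sin t by apply: sin_ge0_pi; lra.
rewrite (ger0_norm s0) => s1.
have lo (u : R) : 0 <= u <= 2^-1 -> u <= 2 * sin u.
  move=> /andP[u0 u1]; have := @sin_quad R u ltac:(rewrite ger0_norm //; lra); rewrite ler_norml =>
      /andP[h _]; nra.
case: (leP t 2^-1) => ht; first by apply: lo; lra.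
have h2 := lo 2^-1 ltac:(lra).
have : sin 2^-1 <= sin t.
  have [c] := @MVT_segment R sin cos 2^-1 t (ltW ht) (fun y _ => is_derive_sin y)
      ltac:(exact/continuous_subspaceT/continuous_sin).
  rewrite in_itv /= => /andP[c0 c1] e; rewrite -subr_ge0 e mulr_ge0 //; last lra.
  by apply: cos_ge0_pihalf; lra.
lra.
Qed.

Lemma clog_cont : cont1 clog 1.
Proof.
(* For the real part of the logarithm [d] has to be of first order in [e]; for the imaginary part v
   it has to be of second order, because |w| - Re w = 2 |w| sin^2(v / 2). *)
move=> e e0; rewrite clog1; pose d := Num.min (4^-1 / 16) (Num.min (e / 8) (e ^+ 2 / 200)).
have d0 : 0 < d by rewrite !lt_min !divr_gt0 ?exprn_gt0 //; rewrite invr_gt0.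
have dd1 : d <= 4^-1 / 16 by rewrite ge_min lexx.
have d2 : d <= e / 8 by rewrite !ge_min lexx orbT.
have d3' : d <= e ^+ 2 / 200 by rewrite !ge_min lexx !orbT.
exists d => // w hw; rewrite subr0 /d1 in hw *.
have w0 : w != 0 by apply: contraTneq hw => ->; rewrite sub0r cabsN cabs1 -leNgt; lra.
have [es hs] := clogP w0; set s := clog w in es hs *.
have wa : `|cabs w - 1| < d.
  have := cabsBB w 1; have := cabsBB 1 w; rewrite cabs1 (cabsC 1) ltr_norml; lra.
have wr : `|complex.Re w - 1| < d by have := cabs_Re (w - 1); rewrite ReD ReN /=; lra.
move: wa wr; rewrite !ltr_norml => /andP[a1 a2] /andP[b1 b2].
have re : `|complex.Re s| <= 2 * d.
  have := cabs_cexp s; rewrite es => ew; have h1 := expR_ge1Dx (complex.Re s);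
      have h2 := expR_ge1Dx (- complex.Re s).
  rewrite expRN -ew in h2; rewrite -ew in h1.
  have h3 : (1 - complex.Re s) * cabs w <= 1 by rewrite -ler_pdivlMr ?div1r //; lra.
  rewrite ler_norml; apply/andP; split; nra.
have cw : complex.Re w = cabs w * cos (complex.Im s).
  by rewrite -es cabs_cexp /cexp /=.
have cs : cos (complex.Im s) = 1 - 2 * sin (complex.Im s / 2) ^+ 2.
  have {1}-> : complex.Im s = complex.Im s / 2 + complex.Im s / 2 by lra.
  by rewrite cosD -!expr2; have := cos2Dsin2 (complex.Im s / 2); lra.
have s2 : sin (complex.Im s / 2) ^+ 2 <= 2 * d.
  have : 2 * (cabs w * sin (complex.Im s / 2) ^+ 2) = cabs w - complex.Re w by rewrite cw cs; ring.
  have := sqr_ge0 (sin (complex.Im s / 2)); nra.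
have s3 : `|sin (complex.Im s / 2)| < 4^-1.
  rewrite ltNge; apply/negP => h; have : (4^-1 : R) ^+ 2 <= `|sin (complex.Im s / 2)| ^+ 2 by
      rewrite lerXn2r ?nnegrE.
  have -> : (4^-1 : R) ^+ 2 = 16^-1 by field.
  by rewrite real_normK ?num_real //; lra.
have s4 : `|complex.Im s / 2| <= pi / 2 by rewrite normrM (ger0_norm (x := 2^-1)) // ler_wpM2r.
have := sin_half_le s4 s3; rewrite normrM (ger0_norm (x := 2^-1)) // => s5.
have s6 : `|sin (complex.Im s / 2)| <= e / 10.
  rewrite leNgt; apply/negP => h; have : (e / 10) ^+ 2 < `|sin (complex.Im s / 2)| ^+ 2 by rewrite
      ltrXn2r ?nnegrE //; lra.
  rewrite real_normK ?num_real // exprMn; have -> : (10^-1 : R) ^+ 2 = 100^-1 by field.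
  lra.
by apply: le_lt_trans (cabs_le _) _; lra.
Qed.

Lemma clog_cder : cder clog 1.
Proof.
have [phi [cp p1 [r r0 hr]]] := cdiff_cexp (0 : C); rewrite cexp0 in p1.
have c2 : cont1 (fun w => phi (clog w)) 1 by apply: cont_comp1; rewrite ?clog1 //; exact: clog_cont.
have n1 : phi (clog 1) != 0 by rewrite clog1 p1 oner_neq0.
have [s s0 hs] := cont_ne0 c2 n1.
exists (phi (clog 1))^-1, (fun w => (phi (clog w))^-1); split => //; first exact: contV.
have [t t0 ht] := clog_cont r0.
exists (Num.min 1 (Num.min s t)); first by rewrite !lt_min s0 t0 ltr01.
move=> w; rewrite !lt_min => /and3P[w1 /hs w2 /ht]; rewrite clog1 subr0 => w3.
have w0 : w != 0 by apply: contraTneq w1 => ->; rewrite sub0r cabsN cabs1 ltxx.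
have np : phi (clog w) != 0 by rewrite -cabs_gt0; apply: lt_le_trans w2; rewrite divr_gt0 ?cabs_gt0.
have := hr (clog w); rewrite subr0 => /(_ w3); rewrite cexp0 (clogP w0).1 => ->.
by rewrite mulKf.
Qed.

(** * The variable q = exp(2 pi i t) *)

Lemma e2piD (x y : C) : e2pi (x + y) = e2pi x * e2pi y.
Proof. by rewrite /e2pi mulrDr cexpD. Qed.
Lemma e2pi_ne0 (x : C) : e2pi x != 0. Proof. exact: cexp_ne0. Qed.
Lemma e2piN (x : C) : e2pi (- x) = (e2pi x)^-1. Proof. by rewrite /e2pi mulrN cexpN. Qed.
Lemma e2pi0 : e2pi 0 = 1 :> C. Proof. by rewrite /e2pi mulr0 cexp0. Qed.
Lemma e2piMn (x : C) n : e2pi (n%:R * x) = e2pi x ^+ n.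
Proof. by rewrite /e2pi mulrCA cexpMn. Qed.
Lemma e2pi_int (k : int) : e2pi (k%:~R : C) = 1.
Proof. by rewrite /e2pi mulrC cexp_int_tpi. Qed.
Lemma cabs_e2pi (x : C) : cabs (e2pi x) = expR (- (2 * pi * complex.Im x)).
Proof. by rewrite /e2pi cabs_cexp ReM /= mul0r sub0r. Qed.
Lemma e2pi_eq (x y : C) : e2pi x = e2pi y -> exists k : int, x = y + k%:~R.
Proof.
move=> h; have : e2pi (x - y) = 1 by rewrite e2piD e2piN h divff // e2pi_ne0.
move=> /cexp_eq1[k]; rewrite -/tpi mulrC => /(mulIf (tpi_ne0 R)) hk; exists k;
    by rewrite -hk addrC subrK.
Qed.

Lemma cder_e2pi (x : C) : cder (@e2pi R) x.
Proof.
by apply: (cder_comp (F := @cexp R)); [exact: cder_cexp|apply: cderM;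
    [exact: cder_const|exact: cder_id]].
Qed.

Lemma e2pi_surj (q : C) : q != 0 -> exists t, e2pi t = q.
Proof. by move=> /cexp_surj[s es]; exists (s / tpi); rewrite /e2pi -/tpi mulrC divfK ?tpi_ne0. Qed.
Lemma e2pi_lt1 (t : C) : (cabs (e2pi t) < 1) = (0 < complex.Im t).
Proof.
rewrite cabs_e2pi expR_lt1 oppr_lt0 pmulr_rgt0 // mulr_gt0 // pi_gt0 //.
Qed.

(** A function of period 1 factors through q, and boundedness for large Im t makes q = 0 a removable
    singularity. *)
Theorem qdisc (f : C -> C) (M Y : R) : (forall t : C, 0 < complex.Im t -> cder f t) ->
  (forall t : C, 0 < complex.Im t -> f (t + 1) = f t) -> (forall t : C, Y < complex.Im t ->
      cabs (f t) <= M) ->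
  exists2 G, (forall q, cabs q < 1 -> cder G q) & forall t : C, 0 < complex.Im t ->
      f t = G (e2pi t).
Proof.
move=> df per bf.
have perz (t : C) (k : int) : 0 < complex.Im t -> f (t + k%:~R) = f t.
  have pern (u : C) (n : nat) : 0 < complex.Im u -> f (u + n%:R) = f u.
    move=> hu; elim: n => [|n IH]; first by rewrite addr0.
    by rewrite -natr1 addrA per // ImD Im_nat addr0.
  case: k => n ht; first exact: pern.
  have ht' : 0 < complex.Im (t + (Negz n)%:~R) by rewrite ImD Im_int addr0.
  by rewrite -(pern _ n.+1 ht') NegzE mulrNz subrK.
pose T q := xget 0 [set t : C | e2pi t = q].
have hT (q : C) : q != 0 -> e2pi (T q) = q.
  by move=> /e2pi_surj[t ht]; rewrite /T; case: xgetP => // /(_ t).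
have TH (q : C) : q != 0 -> cabs q < 1 -> 0 < complex.Im (T q) by move=> q0; rewrite -e2pi_lt1 hT.
pose F q := f (T q).
have Fe (t : C) : 0 < complex.Im t -> F (e2pi t) = f t.
  move=> ht; have [k hk] := e2pi_eq (hT _ (e2pi_ne0 t)); rewrite /F hk perz //.
have dF (q : C) : q != 0 -> cabs q < 1 -> cder F q.
  move=> q0 q1; have ht := TH q q0 q1; set t0 := T q in ht.
  have P0 := tpi_ne0 R.
  (* A local inverse of [e2pi] near [q], which shows that the factored function is
     differentiable. *)
  pose g w := t0 + clog (w / q) / tpi.
  have dg : cder g q.
    apply: cderD; first exact: cder_const.
    apply: cderM; last exact: cder_const.
    apply: (cder_comp (F := clog) (f := fun w => w / q)); first by rewrite divff //;
        exact: clog_cder.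
    by apply: cderM; [exact: cder_id|exact: cder_const].
  have gq : g q = t0 by rewrite /g divff // clog1 mul0r addr0.
  have dfg : cder (fun w => f (g w)) q by apply: cder_comp => //; rewrite gq; exact: df.
  apply: cder_ext dfg.
  have [r r0 hr] := cder_cont dg ht.
  exists (Num.min r (cabs q)); first by rewrite lt_min r0 cabs_gt0.
  move=> w; rewrite lt_min => /andP[/hr]; rewrite gq => /Im_near gH wq.
  have w0 : w != 0 by apply: contraTneq wq => ->; rewrite sub0r cabsN ltxx.
  rewrite -Fe //; congr F; rewrite /g e2piD (hT q q0).
  have -> : e2pi (clog (w / q) / tpi) = cexp (clog (w / q)) by rewrite /e2pi -/tpi [tpi * _]mulrC
      divfK.
  by rewrite (clogP _).1 ?mulf_neq0 ?invr_eq0 // mulrC divfK.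
pose R1 := Num.min 1 (expR (- (2 * pi * Y))).
have R1b : 0 < R1 <= 1 by rewrite lt_min ltr01 expR_gt0 ge_min lexx.
have [|G dG hG] := removable0 (M := M) R1b dF.
  move=> q q0; rewrite lt_min => /andP[q1 q2]; apply: bf.
  by move: q2; rewrite -{1}(hT q q0) cabs_e2pi ltr_expR ltrN2 ltr_pM2l // mulr_gt0 // pi_gt0.
by exists G => // t ht; rewrite hG ?e2pi_ne0 // Fe.
Qed.

End Div.

(** * The theta function *)

Section Theta.
Variable R : realType.
Notation C := (CC R).
Notation tpi := (tpi R).
Notation C3 := (C3 R).

(** * Infinite products *)

Definition pprod (u : nat -> C) N : C := \prod_(n < N) (1 + u n).
Definition plim (u : nat -> C) : C := xget 0 [set l | ccvg (pprod u) l].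

Lemma pprodS u N : pprod u N.+1 = pprod u N * (1 + u N).
Proof. by rewrite /pprod big_ord_recr. Qed.

Lemma expR_sum_le (K r : R) N : 0 <= K -> 0 <= r < 1 -> expR (\sum_(n < N) K * r ^+ n) <=
    expR (K / (1 - r)).
Proof.
move=> K0 r01; rewrite ler_expR -mulr_sumr; apply: ler_wpM2l => //.
have := @sum_geo_le R r 0 N r01; by rewrite expr0 big_mkord div1r.
Qed.

Lemma pprod_bd u (K r : R) N : 0 <= K -> 0 <= r < 1 -> (forall n, cabs (u n) <= K * r ^+ n) ->
  cabs (pprod u N) <= expR (K / (1 - r)).
Proof.
move=> K0 r01 hu; apply: le_trans (expR_sum_le N K0 r01).
elim: N => [|N IH]; first by rewrite /pprod !big_ord0 cabs1 expR0.
rewrite pprodS big_ord_recr /= expRD cabsM; apply: ler_pM; rewrite ?cabs_ge0 //.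
apply: le_trans (cabsD _ _) _; rewrite cabs1; apply: le_trans (expR_ge1Dx _); by rewrite lerD2l.
Qed.

Lemma pprod_bd1 u (K r : R) N : 0 <= K -> 0 <= r < 1 -> (forall n, cabs (u n) <= K * r ^+ n) ->
  cabs (pprod u N - 1) <= expR (K / (1 - r)) - 1.
Proof.
move=> K0 r01 hu; apply: le_trans (_ : expR (\sum_(n < N) K * r ^+ n) - 1 <= _);
    last by rewrite lerD2r expR_sum_le.
have r0 : 0 <= r by case/andP: r01.
elim: N => [|N IH]; first by rewrite /pprod !big_ord0 expR0 !subrr cabs0.
rewrite pprodS big_ord_recr /= expRD; set S := \sum_(_ < _) _ in IH *.
have -> : pprod u N * (1 + u N) - 1 = (pprod u N - 1) * (1 + u N) + u N by ring.
apply: le_trans (cabsD _ _) _; rewrite cabsM.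
have h1 : cabs (1 + u N) <= 1 + K * r ^+ N by apply: le_trans (cabsD _ _) _; rewrite cabs1 lerD2l.
have h2 := expR_ge1Dx (K * r ^+ N); have h3 := expR_gt0 S; have h0 := hu N.
have h4 : cabs (pprod u N - 1) * cabs (1 + u N) <= (expR S - 1) * (1 + K * r ^+ N) by apply: ler_pM;
    rewrite ?cabs_ge0.
have h5 : expR S * (1 + K * r ^+ N) <= expR S * expR (K * r ^+ N) by rewrite ler_pM2l.
lra.
Qed.

Lemma plim_cvg u (K r : R) : 0 <= K -> 0 <= r < 1 -> (forall n, cabs (u n) <= K * r ^+ n) ->
    ccvg (pprod u) (plim u).
Proof.
move=> K0 r01 hu; have B0 : 0 <= expR (K / (1 - r)) * K by rewrite mulr_ge0 ?expR_ge0.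
have [|l hl _] := @ccvg_geo R (pprod u) _ r B0 r01.
  move=> n; have -> : pprod u n.+1 - pprod u n = pprod u n * u n by rewrite pprodS; ring.
  by rewrite cabsM -mulrA; apply: ler_pM; rewrite ?cabs_ge0 // pprod_bd.
by rewrite /plim; case: xgetP => // /(_ l).
Qed.

Lemma pprod_cat u N M : pprod u (N + M) = pprod u N * pprod (fun n => u (N + n)%N) M.
Proof. by elim: M => [|M IH]; rewrite ?addn0 ?addnS ?pprodS ?IH ?mulrA // /pprod big_ord0 mulr1.
    Qed.

(** A finite head of nonzero factors is split off; the products of the remaining factors stay within
    1/2 of 1. *)
Lemma plim_ne0 u (K r : R) : 0 <= K -> 0 <= r < 1 -> (forall n, cabs (u n) <= K * r ^+ n) ->
  (forall n, 1 + u n != 0) -> plim u != 0.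
Proof.
move=> K0 /[dup] r01 /andP[r0 r1] hu un; have d0 : 0 < 1 - r by lra.
have [N hN] := exprn_small r01 (e := (1 - r) / (4 * (K + 1))) ltac:(by rewrite divr_gt0 // mulr_gt0
    //; lra).
have {hN} := hN N (leqnn _); rewrite ltr_pdivlMr; last by rewrite mulr_gt0 //; lra.
move=> hN; have rN := exprn_ge0 N r0.
have K4 : K * r ^+ N / (1 - r) <= 4^-1 by rewrite ler_pdivrMr //; lra.
have low M : 2^-1 <= cabs (pprod (fun n => u (N + n)%N) M).
  have KN : 0 <= K * r ^+ N by rewrite mulr_ge0.
  have := @pprod_bd1 (fun n => u (N + n)%N) (K * r ^+ N) r M KN r01.
  have hh n : cabs (u (N + n)%N) <= K * r ^+ N * r ^+ n by rewrite -mulrA -exprD.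
  move=> /(_ hh); set k := K * r ^+ N / (1 - r) in K4 *.
  have k0 : 0 <= k by rewrite divr_ge0 // ltW.
  have := @expR_quad R k ltac:(rewrite ger0_norm //; lra); rewrite ler_norml => /andP[_ e1].
  have := cabsBB 1 (pprod (fun n => u (N + n)%N) M); rewrite cabs1 cabsC; nra.
have pN : 0 < cabs (pprod u N) by rewrite cabs_gt0 /pprod; apply/prodf_neq0 => i _; exact: un.
apply/eqP => p0; have := plim_cvg K0 r01 hu; rewrite p0 => /(_ (cabs (pprod u N) / 2)).
move=> /(_ ltac:(by rewrite divr_gt0)) [M hM]; have := hM (N + M)%N (leq_addl _ _).
by rewrite subr0 pprod_cat cabsM; have := low M; nra.
Qed.

Definition ss (z : C) : C := e2pi (z / 2) - e2pi (- (z / 2)).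
Definition Qn (q : C) (n : nat) : C := q ^+ n.+1 / (1 - q ^+ n.+1) ^+ 2.
Definition tfac (t z : C) (n : nat) : C := - (ss z) ^+ 2 * Qn (e2pi t) n.
Definition tprod (t z : C) : C := plim (tfac t z).
(* The Jacobi theta function divided by eta^3: weight -1, theta'(0) = 2 pi i, and simple zeros
   exactly at the lattice points. Indeed 1 - s^2 Q_n = (1 - q^n w)(1 - q^n / w) / (1 - q^n)^2 with w
   = exp (2 pi i z). *)
Definition theta (t z : C) : C := ss z * tprod t z.

Lemma e2pi_half2 (z : C) : e2pi (z / 2) ^+ 2 = e2pi z.
Proof. by rewrite -e2piMn mulrC divfK ?pnatr_eq0. Qed.
Lemma e2pi_2 (h : C) : h + h = 1 -> e2pi h = -1.
Proof.
move=> hh; have hr : complex.Re h = 2^-1 by have := congr1 (@complex.Re R) hh; rewrite ReD /=; lra.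
have hi : complex.Im h = 0 by have := congr1 (@complex.Im R) hh; rewrite ImD /=; lra.
rewrite /e2pi /cexp ReM ImM /= hr hi mulr0 mul0r subr0 expR0 !mul1r mul0r add0r.
have -> : 2 * pi * 2^-1 = pi :> R by field.
by rewrite cospi sinpi; apply: C_eqP => /=; rewrite ?oppr0.
Qed.

Lemma e2pi_per (z : C) : e2pi (z + 1) = e2pi z.
Proof. by rewrite e2piD (e2pi_int R 1) mulr1. Qed.
Lemma e2pi_half1 (z : C) : e2pi ((z + 1) / 2) = - e2pi (z / 2).
Proof. by rewrite -[(z + 1) / 2](subrK (z / 2)) e2piD e2pi_2 ?mulN1r //; field. Qed.
Lemma ss_per z : ss (z + 1) = - ss z.
Proof. by rewrite /ss !e2piN e2pi_half1 invrN; ring. Qed.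
Lemma ssN z : ss (- z) = - ss z.
Proof. by rewrite /ss mulNr opprK opprB. Qed.
Lemma ss2 z : ss z ^+ 2 = e2pi z + e2pi (- z) - 2.
Proof.
rewrite /ss -(e2pi_half2 z) -(e2pi_half2 (- z)) mulNr e2piN; field; exact: e2pi_ne0.
Qed.

Lemma q_lt1 (t : C) n : 0 < complex.Im t -> cabs (e2pi t ^+ n.+1) < 1.
Proof. by rewrite -e2pi_lt1 => h; rewrite cabsX exprn_ilt1 ?cabs_ge0. Qed.
Lemma q_ne1 (t : C) n : 0 < complex.Im t -> 1 - e2pi t ^+ n.+1 != 0.
Proof.
move=> /(q_lt1 n) h; rewrite subr_eq0; apply: contraTneq h => <-; by rewrite cabs1 ltxx.
Qed.

Lemma Qn_bd q n : cabs q < 1 -> cabs (Qn q n) <= cabs q / (1 - cabs q) ^+ 2 * cabs q ^+ n.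
Proof.
move=> q1; have c0 := cabs_ge0 q; have d0 : 0 < 1 - cabs q by lra.
have qn : cabs q ^+ n.+1 <= cabs q by rewrite exprS ler_piMr // exprn_ile1 // ltW.
have d1 : 1 - cabs q <= cabs (1 - q ^+ n.+1).
  by have := cabsBB 1 (q ^+ n.+1); rewrite cabs1 cabsX; lra.
have -> : cabs q / (1 - cabs q) ^+ 2 * cabs q ^+ n = cabs q ^+ n.+1 / (1 - cabs q) ^+ 2 by rewrite
    [cabs q ^+ n.+1]exprS; ring.
rewrite /Qn cabsM cabsV !cabsX ler_wpM2l ?exprn_ge0 //.
by rewrite lef_pV2 ?posrE ?exprn_gt0 ?lerXn2r ?nnegrE ?cabs_ge0 ?(ltW d0) //; lra.
Qed.

(** The constant in |s^2 Q_n| <= Kt r^n for |q| <= r and |s| <= b. It depends only on these bounds,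
    so the estimate is locally uniform. *)
Definition Kt (r b : R) : R := b ^+ 2 * (r / (1 - r) ^+ 2).
Lemma Kt_ge0 r b : 0 <= r < 1 -> 0 <= Kt r b.
Proof. by move=> /andP[r0 r1]; rewrite mulr_ge0 ?sqr_ge0 // divr_ge0 // sqr_ge0. Qed.
Lemma tfac_bd t z n (r b : R) : cabs (e2pi t) <= r -> r < 1 -> cabs (ss z) <= b ->
  cabs (tfac t z n) <= Kt r b * r ^+ n.
Proof.
move=> qr r1 sb; have c0 := cabs_ge0 (e2pi t); have r0 : 0 <= r by lra.
have q1 : cabs (e2pi t) < 1 by lra.
rewrite /tfac cabsM cabsN cabsX /Kt -mulrA; apply: ler_pM; rewrite ?exprn_ge0 ?cabs_ge0 //.
  by rewrite lerXn2r ?nnegrE ?cabs_ge0 //; apply: le_trans sb; exact: cabs_ge0.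
apply: le_trans (Qn_bd n q1) _; apply: ler_pM; rewrite ?exprn_ge0 ?divr_ge0 ?sqr_ge0 //.
  apply: ler_pM => //; rewrite ?invr_ge0 ?sqr_ge0 // lef_pV2 ?posrE ?exprn_gt0 ?lerXn2r ?nnegrE //;
      lra.
by rewrite lerXn2r ?nnegrE.
Qed.

Lemma tprod_cvg (t z : C) : 0 < complex.Im t -> ccvg (pprod (tfac t z)) (tprod t z).
Proof.
rewrite -e2pi_lt1 => q1; apply: (@plim_cvg _ (Kt (cabs (e2pi t)) (cabs (ss z))) (cabs (e2pi t))).
- by rewrite Kt_ge0 // cabs_ge0.
- by rewrite cabs_ge0.
- by move=> n; apply: tfac_bd.
Qed.

Lemma hol3_e2pi (f : C3 -> C) p : hol3 f p -> hol3 (fun q => e2pi (f q)) p.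
Proof. by apply: hol3_comp1; exact: cder_e2pi. Qed.
Lemma hol3_ss (f : C3 -> C) p : hol3 f p -> hol3 (fun q => ss (f q)) p.
Proof.
move=> h; have h2 : hol3 (fun q => f q / 2) p by apply: hol3M => //; exact: hol3_const.
by apply: hol3D; [|apply: hol3N]; apply: hol3_e2pi => //; apply: hol3N.
Qed.

(** The partial products are holomorphic and, by [Kt], bounded near [p] independently of their
    length, so [vitali] applies. *)
Lemma hol3_tprod0 (p : C3) : inH p -> hol3 (fun q => tprod q.1.1 q.1.2) p.
Proof.
move=> hp; rewrite /inH in hp.
have [b b0 hb] := cont_bd (hol3_cont (hol3_ss (hol3_1 p))).
pose rho := Num.min b (complex.Im p.1.1 / 2).
have rho0 : 0 < rho by rewrite lt_min b0 divr_gt0.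
pose r := expR (- (2 * pi * (complex.Im p.1.1 / 2))).
have p0 := pi_gt0 R.
have r1 : r < 1 by rewrite /r expR_lt1 oppr_lt0 !mulr_gt0 // invr_gt0.
have r01 : 0 <= r < 1 by rewrite r1 expR_ge0.
have near q : d3 p q < rho -> [/\ 0 < complex.Im q.1.1, cabs (e2pi q.1.1) <= r & cabs (ss q.1.2) <=
    cabs (ss p.1.2) + 1].
  rewrite lt_min => /andP[h1 h2].
  have him : complex.Im p.1.1 / 2 < complex.Im q.1.1.
    have := le_trans (cabs_Im _) (le_trans (d3_0 p q) (ltW h2)); rewrite ImD ImN ler_norml =>
        /andP[a _].
    have := le_lt_trans (d3_0 p q) h2; move=> h3; have := le_lt_trans (cabs_Im _) h3.
    by rewrite ImD ImN ltr_norml => /andP[? _]; lra.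
  split; [lra| |exact: hb].
  by rewrite cabs_e2pi ler_expR lerN2 ler_pM2l ?mulr_gt0 // ltW.
apply: (@vitali R (fun N q => pprod (tfac q.1.1 q.1.2) N) _ p rho
    (expR (Kt r (cabs (ss p.1.2) + 1) / (1 - r))) rho0).
- move=> N q /near[hq _ _]; elim: N => [|N IH].
    by apply: hol3_eq (hol3_const 1 q) => x; rewrite /pprod big_ord0.
  apply: (@hol3_eq R (fun q => pprod (tfac q.1.1 q.1.2) N * (1 + tfac q.1.1 q.1.2 N)));
      first by move=> x; rewrite pprodS.
  have hq' : hol3 (fun x : C3 => e2pi x.1.1 ^+ N.+1) q by apply: hol3X; apply: hol3_e2pi;
      exact: hol3_0.
  apply: hol3M => //; apply: hol3D; first exact: hol3_const.
  apply: hol3M; first by apply: hol3N; apply: hol3X; apply: hol3_ss; exact: hol3_1.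
  apply: hol3M => //; apply: hol3V; last by rewrite expf_neq0 // q_ne1.
  by apply: hol3X; apply: hol3D; [exact: hol3_const|exact: hol3N].
- move=> N q /near[hq h1 h2]; apply: pprod_bd => //; first exact: Kt_ge0.
  by move=> n; apply: tfac_bd.
- by move=> q /near[hq _ _]; apply: tprod_cvg.
Qed.

Lemma hol3_theta (f g : C3 -> C) p : 0 < complex.Im (f p) -> hol3 f p -> hol3 g p ->
    hol3 (fun q => theta (f q) (g q)) p.
Proof.
move=> hp hf hg; apply: hol3M; first exact: hol3_ss.
have := @hol3_comp3 R (fun q => tprod q.1.1 q.1.2) f g g p; apply => //; exact: hol3_tprod0.
Qed.

Lemma cder_theta (t z : C) : 0 < complex.Im t -> cder (theta t) z.
Proof.
move=> ht; apply: (@slice1 R (fun q => theta q.1.1 q.1.2) (t, z, 0)).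
by apply: hol3_theta => //; [exact: hol3_0|exact: hol3_1].
Qed.

Lemma tfac_s0 (t z : C) : ss z = 0 -> tprod t z = 1.
Proof.
move=> s0; have h : ccvg (pprod (tfac t z)) 1.
  apply: ccvg_ext (ccvg_const 1) => N; rewrite /pprod big1 // => i _.
  by rewrite /tfac s0 expr0n /= oppr0 mul0r addr0.
by rewrite /tprod /plim; case: xgetP => [l _ /= hl|/(_ _ h)//]; apply: ccvg_unique hl h.
Qed.

Lemma ss0 : ss 0 = 0. Proof. by rewrite /ss mul0r oppr0 subrr. Qed.
Lemma theta0 (t : C) : theta t 0 = 0. Proof. by rewrite /theta ss0 mul0r. Qed.
Lemma cdiff_e2pi0 : cdiff (@e2pi R) 0 tpi.
Proof.
have := @cdiff_comp R (@cexp R) (fun w => tpi * w) 0 tpi 1; rewrite mul1r; apply.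
  by rewrite mulr0; have := cdiff_cexp (0 : C); rewrite cexp0.
by have := cdiffM (cdiff_const tpi 0) (cdiff_id (0 : C)); rewrite mulr1 mul0r addr0.
Qed.

Lemma cdiff_ss0 : cdiff ss 0 tpi.
Proof.
have lin (k : C) : cdiff (fun z => k * z) 0 k.
  by have := cdiffM (cdiff_const k 0) (cdiff_id (0 : C)); rewrite mulr1 mul0r addr0.
have ee (k : C) : cdiff (fun z => e2pi (k * z)) 0 (tpi * k).
  by apply: (cdiff_comp (F := @e2pi R)) => //; rewrite mulr0; exact: cdiff_e2pi0.
have h := cdiffD (ee 2^-1) (cdiffM (cdiff_const (-1) 0) (ee (- 2^-1))).
have e : tpi = tpi * 2^-1 + (-1 * (tpi * - 2^-1) + 0 * e2pi (- 2^-1 * 0)) by field.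
rewrite e; apply: cdiff_ext h; exists 1 => // z _; rewrite /ss mulN1r mulNr ![2^-1 * z]mulrC //.
Qed.

Lemma cdiff_theta0 (t : C) : 0 < complex.Im t -> cdiff (theta t) 0 tpi.
Proof.
move=> ht; have [l hl] := @slice1 R (fun q => tprod q.1.1 q.1.2) (t, 0, 0)
    (@hol3_tprod0 (t, 0, 0) ht).
have := cdiffM cdiff_ss0 hl; by rewrite /= ss0 mul0r add0r tfac_s0 ?ss0 // mulr1.
Qed.

Lemma theta_1 (t z : C) : theta t (z + 1) = - theta t z.
Proof.
rewrite /theta ss_per mulNr; congr (- (_ * plim _)); apply/funext => n.
by rewrite /tfac ss_per sqrrN.
Qed.

Lemma thetaN (t z : C) : theta t (- z) = - theta t z.
Proof.
rewrite /theta ssN mulNr; congr (- (_ * plim _)); apply/funext => n.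
by rewrite /tfac ssN sqrrN.
Qed.

Lemma theta_T (t z : C) : theta (t + 1) z = theta t z.
Proof.
have e : tfac (t + 1) z = tfac t z by apply/funext => n; rewrite /tfac e2pi_per.
by rewrite /theta /tprod e.
Qed.

Lemma tfac1 (t z : C) n : 0 < complex.Im t -> 1 + tfac t z n =
  (1 - e2pi t ^+ n.+1 * e2pi z) * (1 - e2pi t ^+ n.+1 / e2pi z) / (1 - e2pi t ^+ n.+1) ^+ 2.
Proof.
move=> ht; rewrite /tfac /Qn ss2 e2piN; have h1 := q_ne1 n ht; have h2 := e2pi_ne0 z.
move: (e2pi t ^+ n.+1) (e2pi z) h1 h2 => y x h1 h2.
by field; rewrite h1 h2.
Qed.

(** Adding t to z moves the factors 1 - q^n w and 1 - q^n / w by one index in opposite directions.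
    [id] records this for partial products, with two leftover factors that tend to 1. *)
Lemma theta_tau (t z : C) : 0 < complex.Im t -> theta t (z + t) = - e2pi (- (t / 2) - z) *
    theta t z.
Proof.
move=> ht; have q1 := q_lt1 0 ht; rewrite expr1 in q1.
set q := e2pi t in q1; set x := e2pi z; have x0 : x != 0 by exact: e2pi_ne0.
have q0 : q != 0 by exact: e2pi_ne0.
have id N : (1 - q * x) * (pprod (tfac t (z + t)) N * (1 - q ^+ N / x)) = (1 - x^-1) *
    (pprod (tfac t z) N * (1 - q ^+ N.+1 * x)).
  elim: N => [|N IH]; first by rewrite /pprod !big_ord0 expr0 expr1; ring.
  rewrite !pprodS !tfac1 // e2piD -/q -/x.
  have n1 := q_ne1 N ht; rewrite -/q in n1.
  transitivity ((1 - q * x) * (pprod (tfac t (z + t)) N * (1 - q ^+ N / x)) *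
      ((1 - q ^+ N.+1 * (x * q)) * (1 - q ^+ N.+1 / x) / (1 - q ^+ N.+1) ^+ 2)).
    rewrite !exprS; rewrite exprS in n1; by field; rewrite n1 x0 q0.
  rewrite IH !exprS; rewrite exprS in n1; by field; rewrite n1 x0.
have lim0 (k : C) j : ccvg (fun N => 1 - q ^+ (N + j) * k) 1.
  have := ccvgB (ccvg_const 1) (ccvgZ k (_ : ccvg (fun N => q ^+ (N + j)) 0));
      rewrite mulr0 subr0 => h.
  apply: ccvg_ext (h _) => [N|]; first by rewrite mulrC.
  apply: (@ccvg_shift R (fun N => q ^+ N)) => e e0; have [N hN] := exprn_small (r := cabs q)
      ltac:(by rewrite cabs_ge0 q1) e0.
  by exists N => n /hN; rewrite subr0 cabsX.
have l1 := ccvgZ (1 - q * x) (ccvgM (tprod_cvg (z + t) ht) (lim0 x^-1 0%N)).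
have l2 := ccvgZ (1 - x^-1) (ccvgM (tprod_cvg z ht) (lim0 x 1%N)).
have e : (1 - q * x) * (tprod t (z + t) * 1) = (1 - x^-1) * (tprod t z * 1).
  apply: ccvg_unique l1 _; apply: ccvg_ext l2 => N; rewrite addn0 addn1; by rewrite id.
rewrite !mulr1 in e; rewrite /theta.
pose a := e2pi (z / 2); pose b := e2pi (t / 2).
have xa : x = a ^+ 2 by rewrite e2pi_half2.
have qb : q = b ^+ 2 by rewrite e2pi_half2.
have a0 : a != 0 by exact: e2pi_ne0.
have b0 : b != 0 by exact: e2pi_ne0.
have s1 : ss (z + t) = - (a * b)^-1 * (1 - q * x).
  by rewrite /ss mulrDl e2piN e2piD -/a -/b xa qb; field; rewrite a0 b0.
have s2 : ss z = a * (1 - x^-1) by rewrite /ss e2piN -/a xa; field.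
rewrite s1 -mulrA e s2 e2piD !e2piN -/b -/x xa; by field; rewrite a0 b0.
Qed.

(** The product vanishes only if one of its factors does, and 1 - q^n w or 1 - q^n / w vanishes only
    if z is -n t or n t up to an integer. The factor [ss] accounts for n = 0. *)
Lemma theta_zero (t z : C) : 0 < complex.Im t -> theta t z = 0 -> exists l m : int, z = l%:~R * t +
    m%:~R.
Proof.
move=> ht /eqP; rewrite mulf_eq0; have x0 := e2pi_ne0 z.
have i1 (w : C) : e2pi w = 1 -> exists m : int, w = m%:~R.
  by move=> h; have [k ->] := @e2pi_eq R w 0 ltac:(by rewrite h e2pi0); exists k; rewrite add0r.
case: (eqVneq (ss z) 0) => [s0 _|s0 /= /eqP p0].
  have : e2pi z = 1.
    move: s0; rewrite /ss e2piN => /eqP; rewrite subr_eq0 => /eqP e;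
        rewrite -e2pi_half2 expr2 {1}e mulVf // e2pi_ne0 //.
  by move=> /i1[m ->]; exists 0, m; rewrite mul0r add0r.
have [n hn] : exists n, 1 + tfac t z n = 0.
  apply: contrapT => nz; have q1 := ht; rewrite -e2pi_lt1 in q1.
  have := @plim_ne0 (tfac t z) (Kt (cabs (e2pi t)) (cabs (ss z))) (cabs (e2pi t)).
  rewrite -/(tprod t z) p0 eqxx => /(_ _ _ _ _) h; have : false; last by [].
  apply: h; first by rewrite Kt_ge0 // cabs_ge0.
  - by rewrite cabs_ge0.
  - by move=> n; apply: tfac_bd.
  - by move=> n; apply/eqP => e; apply: nz; exists n.
have n1 := q_ne1 n ht; move: hn; rewrite tfac1 // => /eqP.
rewrite !mulf_eq0 invr_eq0 expf_eq0 /= (negPf n1) orbF !subr_eq0 -e2piMn -e2piN -!e2piD =>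
    /orP[] /eqP/esym/i1[m e].
  by exists (- (n.+1%:Z)), m; rewrite -e mulrNz; ring.
exists n.+1%:Z, (- m); rewrite mulrNz -e; ring.
Qed.

Lemma theta_law (t z : C) (l m : int) : 0 < complex.Im t -> theta t (z + l%:~R * t + m%:~R) =
  (-1) ^ (l + m) * e2pi (- (l%:~R ^+ 2 * t / 2) - l%:~R * z) * theta t z.
Proof.
move=> ht.
have n1 : (-1 : C) != 0 by rewrite oppr_eq0 oner_eq0.
have L (n : nat) w : theta t (w + n%:R * t) = (-1) ^+ n * e2pi (- (n%:R ^+ 2 * t / 2) - n%:R * w) *
    theta t w.
  elim: n w => [|n IH] w; first by rewrite !mul0r addr0 expr0 expr0n /= !mul0r oppr0 addr0 e2pi0
      !mul1r.
  have -> : w + n.+1%:R * t = (w + n%:R * t) + t by rewrite -natr1; ring.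
  rewrite theta_tau // IH [(-1) ^+ n.+1]exprS.
  have -> : - (n.+1%:R ^+ 2 * t / 2) - n.+1%:R * w = (- (t / 2) - (w + n%:R * t)) +
      (- (n%:R ^+ 2 * t / 2) - n%:R * w).
    by rewrite -natr1; field.
  rewrite [e2pi (_ + (- (n%:R ^+ 2 * t / 2) - n%:R * w))]e2piD; ring.
have M (n : nat) w : theta t (w + n%:R) = (-1) ^+ n * theta t w.
  elim: n => [|n IH]; first by rewrite addr0 mul1r.
  by rewrite -natr1 addrA theta_1 IH exprS mulN1r mulNr.
have Mz w : theta t (w + m%:~R) = (-1) ^ m * theta t w.
  case: (m) => n; first exact: M.
  rewrite NegzE mulrNz; have := M n.+1 (w - n.+1%:R); rewrite subrK => ->.
  by rewrite -exprnN mulrA mulVf ?mul1r // expf_neq0.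
have Lz w : theta t (w + l%:~R * t) = (-1) ^ l * e2pi (- (l%:~R ^+ 2 * t / 2) - l%:~R * w) *
    theta t w.
  case: (l) => n; first exact: L.
  rewrite NegzE mulrNz mulNr sqrrN; have := L n.+1 (w - n.+1%:R * t); rewrite subrK => ->.
  set A := theta t (w - _); have -> : (n.+1 : int)%:~R = n.+1%:R :> C by [].
  transitivity (((-1) ^- n.+1 * (-1) ^+ n.+1) * (e2pi (- (n.+1%:R ^+ 2 * t / 2) - - n.+1%:R * w) *
      e2pi (- (n.+1%:R ^+ 2 * t / 2) - n.+1%:R * (w - n.+1%:R * t))) * A); last by rewrite -exprnN;
      ring.
  rewrite mulVf ?expf_neq0 // mul1r -e2piD.
  have -> : - (n.+1%:R ^+ 2 * t / 2) - - n.+1%:R * w + (- (n.+1%:R ^+ 2 * t / 2) - n.+1%:R *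
      (w - n.+1%:R * t)) = 0 by field.
  by rewrite e2pi0 mul1r.
by rewrite Mz Lz expfzDr // !mulrA [(-1) ^ m * _]mulrC.
Qed.

(** If z + a and z + a / 2 were both zeros, their difference would be a real lattice vector strictly
    between 0 and 1. *)
Lemma theta_dense (t z : C) (r : R) : 0 < complex.Im t -> 0 < r -> exists2 w, cabs (w - z) < r &
    theta t w != 0.
Proof.
move=> ht r0; pose a := Num.min r 1 / 2; have a0 : 0 < a by rewrite divr_gt0 // lt_min r0 ltr01.
have mr : Num.min r 1 <= r by rewrite ge_min lexx.
have m1 : Num.min r 1 <= 1 by rewrite ge_min lexx orbT.
have ar : a < r by move: a0; rewrite /a; lra.
have a1 : a < 1 by move: a0; rewrite /a; lra.
case: (eqVneq (theta t (z + a%:C%C)) 0) => [e1|n1]; last first.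
  by exists (z + a%:C%C) => //; rewrite addrC addKr cabs_real gtr0_norm.
case: (eqVneq (theta t (z + (a / 2)%:C%C)) 0) => [e2|n2]; last first.
  by exists (z + (a / 2)%:C%C) => //; rewrite addrC addKr cabs_real gtr0_norm; lra.
have [l [m hm]] := theta_zero ht e1; have [l' [m' hm']] := theta_zero ht e2.
have e : (a / 2)%:C%C = (l - l')%:~R * t + (m - m')%:~R :> C.
  rewrite !intrB; have -> : (l%:~R - l'%:~R) * t + (m%:~R - m'%:~R) = (l%:~R * t + m%:~R) -
      (l'%:~R * t + m'%:~R) :> C by ring.
  rewrite -hm -hm'; have -> : a%:C%C = (a / 2)%:C%C + (a / 2)%:C%C :> C by rewrite -rmorphD /=;
      congr (_%:C)%C; lra.
  ring.
have := congr1 (@complex.Im R) e; rewrite ImD ImM Re_int !Im_int /= mul0r !addr0 => /esym/eqP.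
rewrite mulf_eq0 (gt_eqF ht) orbF => /eqP ll; have := congr1 (@complex.Re R) e.
rewrite ReD ReM !Re_int Im_int ll !mul0r subr0 add0r /= => em.
have : 0 < (m - m')%:~R :> R by rewrite -em; lra.
have : (m - m')%:~R < 1 :> R by rewrite -em; lra.
by rewrite ltrz1 ltr0z; lia.
Qed.

(** Under these bounds the majorant of the sum of the |s^2 Q_n| is at most 3/16, and exp(3/16) - 1 <
    1/2. *)
Lemma theta_asym (t z : C) : cabs (e2pi t) <= 4^-1 -> cabs (ss z) ^+ 2 * cabs (e2pi t) <= 16^-1 ->
    0 < complex.Im t ->
  cabs (tprod t z - 1) <= 2^-1.
Proof.
move=> q4 sq ht; have q0 := cabs_ge0 (e2pi t); have s0 := sqr_ge0 (cabs (ss z)).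
have r01 : 0 <= cabs (e2pi t) < 1 by lra.
set r := cabs (e2pi t) in r01 q4 sq q0 *; pose K := Kt r (cabs (ss z)).
have d0 : 0 < 1 - r by lra.
have kb : K / (1 - r) <= 3 / 16.
  rewrite ler_pdivrMr // /K /Kt mulrA ler_pdivrMr ?exprn_gt0 //.
  have : (1 - r) ^+ 3 >= 27 / 64.
    have -> : 27 / 64 = (3 / 4) ^+ 3 :> R by field.
    by rewrite lerXn2r ?nnegrE; lra.
  by rewrite -mulrA -exprS; nra.
apply: (@ccvg_le R _ _ _ _ (ccvgB (tprod_cvg z ht) (ccvg_const 1))); exists 0 => N _.
have k0 : 0 <= K / (1 - r) by rewrite divr_ge0 ?Kt_ge0 // ltW.
apply: le_trans (@pprod_bd1 (tfac t z) K r N _ r01 _) _; first exact: Kt_ge0.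
  by move=> n; apply: tfac_bd => //; case/andP: r01.
have := @expR_quad R (K / (1 - r)) ltac:(rewrite ger0_norm //; lra); rewrite ler_norml =>
    /andP[_ e1]; nra.
Qed.

End Theta.

(** * The modular law of theta *)

Section ThetaMod.
Variable R : realType.
Notation C := (CC R).
Notation tpi := (tpi R).

(** The elliptic law carries the simple zero at 0 to every lattice point. *)
Lemma theta_der_lat (t : C) (l m : int) : 0 < complex.Im t -> exists2 k, k != 0 & cdiff (theta t)
    (l%:~R * t + m%:~R) k.
Proof.
move=> ht; set p := l%:~R * t + m%:~R.
pose U w := (-1) ^ (l + m) * e2pi (- (l%:~R ^+ 2 * t / 2) - l%:~R * w) : C.
have U0 w : U w != 0.
  by rewrite mulf_neq0 ?e2pi_ne0 // expfz_neq0 // oppr_eq0 oner_eq0.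
have e w : theta t (p + w) = U w * theta t w by rewrite -theta_law // /p; congr (theta t _); ring.
have [u hu] : cder U 0.
  apply: cderM; first exact: cder_const.
  apply: (cder_comp (F := @e2pi R)); first exact: cder_e2pi.
  apply: cderD; first exact: cder_const.
  by apply: cderN; apply: cderM; [exact: cder_const|exact: cder_id].
have [k hk] := cder_theta p ht; exists k => //.
have h2 : cdiff (fun w => theta t (p + w)) 0 (U 0 * tpi + u * theta t 0).
  by apply: (@cdiff_ext R (fun w => U w * theta t w));
      [exists 1 => // q _; rewrite e|exact: (cdiffM hu (cdiff_theta0 ht))].
by rewrite (cdiff_unique (cdiff_shift hk) h2) theta0 mulr0 addr0 mulf_neq0 // tpi_ne0.
Qed.

(** At a zero [p] of theta, numerator and denominator are both divided by z - p; the new denominator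
    is nonzero at [p] because the zero is simple. *)
Lemma theta_div (t : C) (g : C -> C) : 0 < complex.Im t -> (forall z, cder g z) ->
  (forall l m : int, g (l%:~R * t + m%:~R) = 0) ->
  exists2 h, (forall z, cder h z) & forall z, g z = theta t z * h z.
Proof.
move=> ht dg g0.
pose lg z := xget 0 [set l | cdiff g z l].
pose lt z := xget 0 [set l | cdiff (theta t) z l].
have hlg z : cdiff g z (lg z) by have [m hm] := dg z; rewrite /lg; case: xgetP => // /(_ m).
have hlt z : cdiff (theta t) z (lt z) by have [m hm] := cder_theta z ht; rewrite /lt; case: xgetP =>
    // /(_ m).
exists (fun z => if theta t z == 0 then lg z / lt z else g z / theta t z); last first.
  move=> z; case: eqP => [e|/eqP n]; last by rewrite mulrC divfK.
  by rewrite e mul0r; have [l [m ->]] := theta_zero ht e; rewrite g0.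
move=> p; case: (eqVneq (theta t p) 0) => [e|n]; last first.
  apply: (@cder_ext R (fun z => g z / theta t z)); last first.
    by apply: cderM => //; apply: cderV => //; exact: cder_theta.
  have [r r0 hr] := cont_ne0 (cder_cont (cder_theta p ht)) n; exists r => // q /hr hq.
  case: eqP => // e; move: hq; rewrite e cabs0 leNgt divr_gt0 ?cabs_gt0 //.
have [l [m pe]] := theta_zero ht e.
have [k k0 hk] := theta_der_lat l m ht; rewrite -pe in hk.
have lk : lt p = k by exact: cdiff_unique (hlt p) hk.
have gp : g (p + 0) = 0 by rewrite addr0 pe g0.
have tp : theta t (p + 0) = 0 by rewrite addr0.
have dG := @cder_div_id R (fun w => g (p + w)) 1 (lg p) ltr01 (fun z _ => cder_shift (dg _)) gp
    (cdiff_shift (hlg p)) 0.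
have dT := @cder_div_id R (fun w => theta t (p + w)) 1 (lt p) ltr01 (fun z _ =>
    cder_shift (cder_theta _ ht)) tp (cdiff_shift (hlt p)) 0.
rewrite cabs0 in dG dT; have {}dG := dG ltr01; have {}dT := dT ltr01.
set G1 := (fun w => _) in dG; set T1 := (fun w => _) in dT.
have T10 : T1 0 != 0 by rewrite /T1 eqxx lk.
have dK : cder (fun w => G1 w / T1 w) 0 by apply: cderM => //; apply: cderV.
have [r r0 hr] := cont_ne0 (cder_cont dT) T10.
have dK' : cder (fun z => G1 (z - p) / T1 (z - p)) p.
  apply: (cder_comp (F := fun w => G1 w / T1 w) (f := fun z => z - p)); first by rewrite subrr.
  by apply: cderD; [exact: cder_id|exact: cder_const].
apply: cder_ext dK'; exists r => // q hq.
have := hr (q - p); rewrite /d1 subr0 => /(_ hq) hT.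
rewrite /G1 /T1 subr_eq0; case: (eqVneq q p) => [->|n]; first by rewrite e eqxx.
have qp : q - p != 0 by rewrite subr_eq0.
have pq : p + (q - p) = q by rewrite addrC subrK.
move: hT; rewrite /T1 (negPf qp) pq => hT.
have nT : theta t q / (q - p) != 0.
  by rewrite -cabs_gt0; apply: lt_le_trans hT; rewrite divr_gt0 ?cabs_gt0.
have nT' : theta t q != 0 by apply: contraNneq nT => ->; rewrite mul0r.
by rewrite (negPf nT') ?pq; field; rewrite nT' qp.
Qed.

(** Periodicity is asked of |h| only, so multipliers of absolute value 1 are allowed. It moves every
    z into a bounded set without changing |h|, and Liouville's theorem applies. *)
Lemma ell_liouville (t : C) (h : C -> C) : 0 < complex.Im t -> (forall z, cder h z) ->
  (forall z, cabs (h (z + 1)) = cabs (h z)) -> (forall z, cabs (h (z + t)) = cabs (h z)) ->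
      forall z, h z = h 0.
Proof.
move=> ht dh h1 h2.
have it (w : C) : (forall z, cabs (h (z + w)) = cabs (h z)) -> forall (k : int) z,
    cabs (h (z + k%:~R * w)) = cabs (h z).
  move=> hw; have nat (n : nat) z : cabs (h (z + n%:R * w)) = cabs (h z).
    by elim: n => [|n IH]; [rewrite mul0r addr0|rewrite -natr1 mulrDl mul1r addrA hw].
  case=> n z; first exact: nat.
  by rewrite NegzE mulrNz mulNr -(nat n.+1 (z - _)) subrK.
have [||M hM] := @disc_bd R h (1 + complex.Im t); first lra.
  by move=> z; exact: cder_cont.
apply: (@liouville R h M) => // z.
pose l := Num.floor (complex.Im z / complex.Im t); pose z1 := z - l%:~R * t.
pose m := Num.floor (complex.Re z1); pose z2 := z1 - m%:~R.
have e1 : cabs (h z1) = cabs (h z) by rewrite -(it t h2 l z1) /z1 subrK.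
have e2 : cabs (h z2) = cabs (h z1) by rewrite -(it 1 h1 m z2) mulr1 /z2 subrK.
rewrite -e1 -e2; apply: hM; apply: le_trans (cabs_le _) _.
have i2 : complex.Im z2 = complex.Im z - l%:~R * complex.Im t.
  by rewrite /z2 /z1 !(ImD, ImN) ImM Re_int !Im_int mul0r addr0 subr0.
have r2 : complex.Re z2 = complex.Re z1 - m%:~R by rewrite /z2 ReD ReN Re_int.
have a1 : 0 <= complex.Im z2 by rewrite i2 subr_ge0 -ler_pdivlMr // floor_le.
have a2 : complex.Im z2 <= complex.Im t.
  rewrite i2 lerBlDr -[X in X + _]mul1r -mulrDl -ler_pdivrMr // addrC -(intrD _ l 1).
  exact/ltW/floorD1_gt.
have a3 : 0 <= complex.Re z2 by rewrite r2 subr_ge0 floor_le.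
have a4 : complex.Re z2 <= 1 by rewrite r2 lerBlDr addrC -(intrD _ m 1); exact/ltW/floorD1_gt.
rewrite !ger0_norm //; lra.
Qed.

(** Extends identities obtained by cancelling theta to the points where theta vanishes. *)
Lemma cont_eq_dense (t : C) (f g : C -> C) z : 0 < complex.Im t -> cont1 f z -> cont1 g z ->
  (forall w, theta t w != 0 -> f w = g w) -> f z = g z.
Proof.
move=> ht cf cg e; apply/eqP; rewrite -subr_eq0 -cabs_eq0; apply: contraT => ne.
have D0 : 0 < cabs (f z - g z) / 2 by rewrite divr_gt0 // lt_neqAle cabs_ge0 eq_sym ne.
have [r r0 hr] := cf _ D0; have [s s0 hs] := cg _ D0.
have m0 : 0 < Num.min r s by rewrite lt_min r0.
have [w] := theta_dense z ht m0.
rewrite lt_min => /andP[/hr a /hs b] /e ew; move: a b; rewrite ew => a b.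
by have := cabs_tri (f z) (g w) (g z); rewrite (cabsC (f z) (g w)); lra.
Qed.

(** The law spreads the zero at 0 over the whole lattice, so g / theta is entire, with multipliers
    of absolute value 1. *)
Lemma theta_unique (t : C) (g : C -> C) (m1 m2 : C) : 0 < complex.Im t -> (forall z, cder g z) ->
  cabs m1 = 1 -> cabs m2 = 1 -> g 0 = 0 ->
  (forall z, g (z + 1) = m1 * g z) -> (forall z, g (z + t) = m2 * e2pi (- (t / 2) - z) * g z) ->
  exists k, forall z, g z = k * theta t z.
Proof.
move=> ht dg c1 c2 g0 g1 gt.
have n1 : m1 != 0 by rewrite -cabs_eq0 c1 oner_eq0.
have n2 : m2 != 0 by rewrite -cabs_eq0 c2 oner_eq0.
have z0 (l m : int) : g (l%:~R * t + m%:~R) = 0.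
  have Z (w : C) : (forall z, g z = 0 <-> g (z + w) = 0) -> forall (k : int) z, g z = 0 ->
      g (z + k%:~R * w) = 0.
    move=> hw; have nat (n : nat) z : g z = 0 <-> g (z + n%:R * w) = 0.
      elim: n => [|n IH]; first by rewrite mul0r addr0.
      by rewrite -natr1 mulrDl mul1r addrA -hw.
    case=> n z; first by move/(nat n).
    by rewrite NegzE mulrNz mulNr => hz; apply/(nat n.+1); rewrite subrK.
  have := Z 1 _ m (l%:~R * t); rewrite mulr1; apply.
    by move=> z; rewrite g1; split=> [->|/eqP]; rewrite ?mulr0 // mulf_eq0 (negPf n1) => /eqP.
  have := Z t _ l 0; rewrite add0r; apply => // z; rewrite gt; split=> [->|/eqP]; rewrite ?mulr0 //.
  by rewrite !mulf_eq0 (negPf n2) (negPf (e2pi_ne0 _)) => /eqP.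
have [h dh gh] := theta_div ht dg z0.
have hc : forall z, h z = h 0; last by exists (h 0) => z; rewrite gh hc mulrC.
have shift (w z : C) : cont1 (fun z => h (z + w)) z.
  by apply/cder_cont/cder_comp => //; apply: cderD; [exact: cder_id|exact: cder_const].
apply: (ell_liouville ht dh) => z.
  have -> : h (z + 1) = - m1 * h z; last by rewrite cabsM cabsN c1 mul1r.
  apply: (@cont_eq_dense t (fun z => h (z + 1)) (fun z => - m1 * h z) z ht) => //.
    by apply: contM; [exact: cont_const|exact: cder_cont].
  by move=> w n; have := g1 w; rewrite !gh theta_1 => e; apply: (mulfI n);
      rewrite mulrCA mulNr -e mulNr opprK.
have -> : h (z + t) = - m2 * h z; last by rewrite cabsM cabsN c2 mul1r.
apply: (@cont_eq_dense t (fun z => h (z + t)) (fun z => - m2 * h z) z ht) => //.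
  by apply: contM; [exact: cont_const|exact: cder_cont].
move=> w n; have := gt w; rewrite !gh theta_tau // => e.
apply: (mulfI n); apply: (mulfI (e2pi_ne0 (- (t / 2) - w))); apply: oppr_inj.
transitivity (- e2pi (- (t / 2) - w) * theta t w * h (w + t)); first by ring.
by rewrite e; ring.
Qed.

Lemma theta_half (t : C) (p r : int) : 0 < complex.Im t -> theta t ((p%:~R * t + r%:~R) / 2) = 0 ->
  exists l m : int, p = 2 * l /\ r = 2 * m.
Proof.
move=> ht /(theta_zero ht)[l [m e]]; exists l, m.
have {e} e : p%:~R * t + r%:~R = (2 * l)%:~R * t + (2 * m)%:~R.
  by rewrite !intrM -[LHS](@divfK _ 2) ?pnatr_eq0 // e; ring.
have := congr1 (@complex.Im R) e; rewrite !ImD !ImM !Re_int !Im_int !mul0r !addr0 =>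
    /(mulIf (lt0r_neq0 ht))/eqP.
rewrite eqr_int => /eqP pl; split => //; move: e; rewrite pl => /addrI/eqP; by rewrite eqr_int =>
    /eqP.
Qed.

(** The even part of [g], shifted by 1/2, vanishes at 0 and obeys the law of theta up to a sign, so
    it is k theta. The even part also vanishes at t / 2, and theta does not vanish at (t + 1) / 2,
    so k = 0. *)
Lemma theta_law_zero (t : C) (g : C -> C) : 0 < complex.Im t -> (forall z, cder g z) ->
  (forall z, g (z + 1) = - g z) -> (forall z, g (z + t) = - e2pi (- (t / 2) - z) * g z) -> g 0 = 0.
Proof.
move=> ht dg g1 gt.
have gm1 z : g (z - 1) = - g z by rewrite -{2}[z](subrK 1) g1 opprK.
have gN z : g (- z - t) = - e2pi (- (t / 2) - z) * g (- z).
  have := gt (- z - t); rewrite subrK => ->; rewrite mulrA mulrNN -e2piD.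
  have -> : - (t / 2) - z + (- (t / 2) - (- z - t)) = 0 by field.
  by rewrite e2pi0 mul1r.
pose E z := g z + g (- z).
have E1 z : E (z + 1) = - E z by rewrite /E g1 opprD gm1 -opprD.
have Et z : E (z + t) = - e2pi (- (t / 2) - z) * E z by rewrite /E gt opprD gN mulrDr.
have EN z : E (- z) = E z by rewrite /E opprK addrC.
have two : (2 : C) != 0 by rewrite pnatr_eq0.
have dE z : cder E z.
  apply: cderD => //; apply: (cder_comp (F := g)) => //; apply: cderN; exact: cder_id.
have half z : E z = - E z -> E z = 0.
  move=> /eqP; rewrite -subr_eq0 opprK -mulr2n -mulr_natl mulf_eq0 (negPf two) => /eqP//.
pose G z := E (z - 2^-1).
have G0 : G 0 = 0.
  rewrite /G sub0r; apply: half; have := E1 (- 2^-1); have -> : - 2^-1 + 1 = - (- 2^-1) :> C by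
      field.
  by rewrite EN.
have dG z : cder G z by apply: (cder_comp (F := E)) => //; apply: cderD;
    [exact: cder_id|exact: cder_const].
have e2 : e2pi (2^-1 : C) = -1 by apply: e2pi_2; field.
have G1 z : G (z + 1) = -1 * G z.
  by rewrite /G (_ : z + 1 - 2^-1 = (z - 2^-1) + 1) ?E1 ?mulN1r //; ring.
have Gt z : G (z + t) = 1 * e2pi (- (t / 2) - z) * G z.
  rewrite /G (_ : z + t - 2^-1 = (z - 2^-1) + t); last by ring.
  rewrite Et (_ : - (t / 2) - (z - 2^-1) = (- (t / 2) - z) + 2^-1); last by ring.
  by rewrite e2piD e2; ring.
have cN1 : cabs (-1 : C) = 1 by rewrite cabsN cabs1.
have [k hk] := theta_unique ht dG cN1 (cabs1 R) G0 G1 Gt.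
have E2 : E (t / 2) = 0.
  have h := Et (- (t / 2)); rewrite EN opprK addNr e2pi0 mulN1r in h; apply: half.
  by rewrite -h; congr E; field.
have k0 : k = 0.
  have := hk (t / 2 + 2^-1); rewrite /G addrK E2 => /esym/eqP; rewrite mulf_eq0 =>
      /orP[/eqP//|/eqP].
  have -> : t / 2 + 2^-1 = (1%:~R * t + 1%:~R) / 2 by rewrite mulr1z; field.
  by move=> /(theta_half ht)[l [m [h _]]]; lia.
have := hk (0 + 2^-1); rewrite k0 mul0r /G addrK /E oppr0 => /eqP.
by rewrite -mulr2n -mulr_natl mulf_eq0 (negPf two) => /eqP.
Qed.

Lemma e2pi_halfz (k : int) (h : C) : h + h = k%:~R -> e2pi h = (-1) ^ k.
Proof.
move=> hh; have two : (2 : C) != 0 by rewrite pnatr_eq0.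
have -> : h = k%:~R * 2^-1 by rewrite -hh; field.
have e2 : e2pi (2^-1 : C) = -1 by apply: e2pi_2; field.
case: k {hh} => n; first by rewrite (e2piMn _ n) e2.
by rewrite NegzE mulrNz mulNr e2piN (e2piMn _ n.+1) e2 -exprnN.
Qed.

Lemma signz_odd (k x : int) : k = 2 * x + 1 -> (-1) ^ k = -1 :> C.
Proof.
move=> ->; have n1 : (-1 : C) != 0 by rewrite oppr_eq0 oner_eq0.
by rewrite expfzDr // expr1z -exprz_exp -exprnP sqrrN expr1n exp1rz mul1r.
Qed.

Lemma signz_even (k x : int) : k = 2 * x -> (-1) ^ k = 1 :> C.
Proof. by move=> ->; rewrite -exprz_exp -exprnP sqrrN expr1n exp1rz. Qed.
Lemma par2 (k : int) : exists x : int, k = 2 * x \/ k = 2 * x + 1.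
Proof. by exists (k %/ 2)%Z; have := divz_eq k 2; have := modz_ge0 k (isT : (2 : int) != 0);
    have := ltz_mod k (isT : (2 : int) != 0); rewrite /=; lia. Qed.
(** [a] and [c] are not both even, so (a + 1) (c + 1) is even and a + c + a c is odd. *)
Lemma sign_coprime (a c x y : int) : a * x + c * y = 1 -> (-1) ^ (a + c + a * c) = -1 :> C.
Proof.
move=> h; have [u [hu|hu]] := par2 a; have [v [hv|hv]] := par2 c.
- by exfalso; move: h; rewrite hu hv -!mulrA -mulrDr; lia.
- by apply: (@signz_odd _ (u + v + 2 * u * v + u)); rewrite hu hv; ring.
- by apply: (@signz_odd _ (u + v + 2 * u * v + v)); rewrite hu hv; ring.
- by apply: (@signz_odd _ (u + v + 2 * u * v + u + v + 1)); rewrite hu hv; ring.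
Qed.

(* Both sides obey the same quasi-periodicity and vanish at 0, so by [theta_unique] they are
   proportional; the derivatives at 0 fix the constant. *)
Lemma theta_mod (t z : C) (a b c d : int) : 0 < complex.Im t -> a * d - b * c = 1 ->
  0 < complex.Im ((a%:~R * t + b%:~R) / (c%:~R * t + d%:~R)) -> c%:~R * t + d%:~R != 0 ->
  theta ((a%:~R * t + b%:~R) / (c%:~R * t + d%:~R)) (z / (c%:~R * t + d%:~R)) =
  (c%:~R * t + d%:~R)^-1 * e2pi (c%:~R / (c%:~R * t + d%:~R) * (z ^+ 2 / 2)) * theta t z.
Proof.
move=> ht det; set j := c%:~R * t + d%:~R; set t' := _ / j => ht' j0.
have detC : a%:~R * d%:~R - b%:~R * c%:~R = 1 :> C by rewrite -!intrM -intrB det.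
pose u := j^-1.
have u1 : u = a%:~R - c%:~R * t'.
  rewrite /u /t'; apply: (mulIf j0); rewrite mulVf // mulrBl mulrA divfK // /j.
  transitivity (a%:~R * d%:~R - b%:~R * c%:~R : C); [by rewrite detC|ring].
have u2 : t * u = d%:~R * t' - b%:~R.
  rewrite /u /t'; apply: (mulIf j0); rewrite divfK // mulrBl mulrA divfK // /j.
  transitivity ((a%:~R * d%:~R - b%:~R * c%:~R) * t); first by rewrite detC mul1r.
  ring.
have u3 : t' * j = a%:~R * t + b%:~R by rewrite divfK.
have ju : j * u = 1 by rewrite mulfV.
pose g w := theta t' (w * u) * e2pi (- (c%:~R * u * (w ^+ 2 / 2))).
have dg w : cder g w.
  apply: cderM.
    apply: (cder_comp (F := theta t')); first exact: cder_theta.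
    by apply: cderM; [exact: cder_id|exact: cder_const].
  apply: (cder_comp (F := @e2pi R)); first exact: cder_e2pi.
  apply: cderN; apply: cderM; first exact: cder_const.
  by apply: cderM; [apply: cderX; exact: cder_id|exact: cder_const].
have g0 : g 0 = 0 by rewrite /g mul0r theta0 mul0r.
have alg (A S E1 E2 E3 T : C) : E1 * E2 = S * E3 -> A * S = -1 -> A * E1 * T * E2 = -1 * (T * E3).
  move=> h1 h2; transitivity (A * (E1 * E2) * T); first by ring.
  rewrite h1; transitivity (A * S * (T * E3)); first by ring.
  by rewrite h2.
have g1 w : g (w + 1) = -1 * g w.
  rewrite /g; have -> : (w + 1) * u = w * u + (- c)%:~R * t' + a%:~R by rewrite u1 mulrNz; ring.
  rewrite theta_law // mulrNz sqrrN.
  have e3 : e2pi (- (c%:~R ^+ 2 * t' / 2) - - c%:~R * (w * u)) *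
      e2pi (- (c%:~R * u * ((w + 1) ^+ 2 / 2)))
     = (-1) ^ (- (a * c)) * e2pi (- (c%:~R * u * (w ^+ 2 / 2))).
    rewrite -(@e2pi_halfz (- (a * c)) (- (a%:~R * c%:~R / 2))); last by rewrite mulrNz intrM; field.
    by rewrite -!e2piD; congr e2pi; rewrite u1; field.
  have n1 : (-1 : C) != 0 by rewrite oppr_eq0 oner_eq0.
  have sg : (-1) ^ (- c + a) * (-1) ^ (- (a * c)) = -1 :> C.
    rewrite -expfzDr // (_ : - c + a - a * c = a + (- c) + a * (- c)); last by ring.
    by apply: (@sign_coprime a (- c) d b); rewrite -det; ring.
  exact: alg e3 sg.
have gt w : g (w + t) = -1 * e2pi (- (t / 2) - w) * g w.
  rewrite /g; have -> : (w + t) * u = w * u + d%:~R * t' + (- b)%:~R by rewrite mulrDl u2 mulrNz;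
      ring.
  rewrite theta_law //.
  have e3 : e2pi (- (d%:~R ^+ 2 * t' / 2) - d%:~R * (w * u)) *
      e2pi (- (c%:~R * u * ((w + t) ^+ 2 / 2)))
     = (-1) ^ (- (b * d)) * (e2pi (- (t / 2) - w) * e2pi (- (c%:~R * u * (w ^+ 2 / 2)))).
    rewrite -(@e2pi_halfz (- (b * d)) (- (b%:~R * d%:~R / 2))); last by rewrite mulrNz intrM; field.
    rewrite -!e2piD; congr e2pi.
    have k1 : d%:~R ^+ 2 * t' + c%:~R * t * (t * u) = t + b%:~R * d%:~R.
      rewrite u2; transitivity (d%:~R * (t' * j) - b%:~R * c%:~R * t); first by rewrite /j; ring.
      rewrite u3; transitivity ((a%:~R * d%:~R - b%:~R * c%:~R) * t + b%:~R * d%:~R); first by ring.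
      by rewrite detC mul1r.
    have k2 : d%:~R * u + c%:~R * t * u = 1 by transitivity (j * u) => //; rewrite /j; ring.
    transitivity (- (d%:~R ^+ 2 * t' + c%:~R * t * (t * u)) / 2 - w * (d%:~R * u + c%:~R * t * u) -
        c%:~R * u * (w ^+ 2 / 2)); first by field.
    by rewrite k1 k2; field.
  have n1 : (-1 : C) != 0 by rewrite oppr_eq0 oner_eq0.
  have sg : (-1) ^ (d - b) * (-1) ^ (- (b * d)) = -1 :> C.
    rewrite -expfzDr // (_ : d - b - b * d = d + (- b) + d * (- b)); last by ring.
    by apply: (@sign_coprime d (- b) a c); rewrite -det; ring.
  by rewrite (alg _ _ _ _ _ _ e3 sg); ring.
have cN1 : cabs (-1 : C) = 1 by rewrite cabsN cabs1.
have [k hk] := theta_unique ht dg cN1 cN1 g0 g1 gt.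
have kj : k = u.
  have d1 : cdiff g 0 (tpi * u).
    have l1 : cdiff (fun w => theta t' (w * u)) 0 (tpi * u).
      apply: (cdiff_comp (F := theta t')); first by rewrite mul0r; exact: cdiff_theta0.
      by have := cdiffM (cdiff_id (0 : C)) (cdiff_const u 0); rewrite mulr0 add0r mul1r.
    have [m hm] : cder (fun w => e2pi (- (c%:~R * u * (w ^+ 2 / 2)))) 0.
      apply: (cder_comp (F := @e2pi R)); first exact: cder_e2pi.
      apply: cderN; apply: cderM; first exact: cder_const.
      by apply: cderM; [apply: cderX; exact: cder_id|exact: cder_const].
    have := cdiffM l1 hm; rewrite mul0r theta0 mul0r add0r expr0n /= mul0r mulr0 oppr0 e2pi0 mulr1;
        exact.
  have d2 : cdiff g 0 (k * tpi).
    have := cdiffM (cdiff_const k 0) (cdiff_theta0 ht); rewrite mul0r addr0 => h.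
    by apply: cdiff_ext h; exists 1 => // w _; rewrite hk.
  by have := cdiff_unique d1 d2; rewrite mulrC => /(mulIf (tpi_ne0 R)).
have := hk z; rewrite kj /g => e.
have E0 := e2pi_ne0 (- (c%:~R * u * (z ^+ 2 / 2))).
apply: (mulIf E0); rewrite e.
transitivity (u * (e2pi (c%:~R * u * (z ^+ 2 / 2)) * e2pi (- (c%:~R * u * (z ^+ 2 / 2)))) *
    theta t z); last by rewrite /u; ring.
by rewrite -e2piD subrr e2pi0 mulr1.
Qed.

End ThetaMod.

(** * Modular forms for the full modular group *)

Section MForms.
Variable R : realType.
Notation C := (CC R).

(* Modular forms of weight k, with the transformation law under the two generators T and S; see
   [MF_all]. *)
Definition MF (k : int) (f : C -> C) :=
  [/\ (forall t : C, 0 < complex.Im t -> cder f t), (forall t : C, 0 < complex.Im t -> f (t + 1) =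
      f t),
      (forall t : C, 0 < complex.Im t -> f (- t^-1) = t ^ k * f t) &
      exists M Y : R, forall t : C, Y < complex.Im t -> cabs (f t) <= M].

Lemma cabsXz (x : C) (k : int) : cabs (x ^ k) = cabs x ^ k.
Proof. by case: k => n; rewrite ?NegzE -?exprnN ?cabsV ?cabsX // -exprnP cabsX. Qed.
Lemma Im_inv (t : C) : complex.Im (- t^-1) = complex.Im t / cabs t ^+ 2.
Proof.
by case: t => x y; rewrite cabs_sq /= opprK.
Qed.

Lemma Im_ne0 (t : C) : 0 < complex.Im t -> t != 0.
Proof. by apply: contraTneq => ->; rewrite /= ltxx. Qed.
Lemma Im_inv_gt0 (t : C) : 0 < complex.Im t -> 0 < complex.Im (- t^-1).
Proof. by move=> ht; rewrite Im_inv divr_gt0 // exprn_gt0 // cabs_gt0 Im_ne0. Qed.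

Lemma MF_disc k f : MF k f -> exists2 G, (forall q, cabs q < 1 -> cder G q) & forall t : C,
    0 < complex.Im t -> f t = G (e2pi t).
Proof. by move=> [h1 h2 _ [M [Y h3]]]; apply: (@qdisc R f M Y). Qed.

(** Taylor's estimate with no terms gives the maximum principle up to a constant factor. *)
Lemma weak_max (G : C -> C) (r M : R) w : 0 < r < 1 -> (forall q, cabs q < 1 -> cder G q) ->
  (forall q, cabs q = r -> cabs (G q) <= M) -> cabs w < r -> cabs (G w) <= M * (r / (r - cabs w)).
Proof.
move=> r01 dG bG wr; have [a ha] := taylor ltr01 dG; have [_ /(_ w wr 0%N)] := ha r r01 M bG.
by rewrite big_ord0 subr0 expr0 mulr1.
Qed.

Lemma disc_bd1 (G : C -> C) (r : R) : 0 <= r < 1 -> (forall q, cabs q < 1 -> cder G q) ->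
  exists2 M, 0 <= M & forall q, cabs q <= r -> cabs (G q) <= M.
Proof.
move=> /andP[r0 r1] dG; pose s := (1 + r) / 2; have s01 : 0 < s < 1 by rewrite /s; lra.
have [|M M0 bM] := @circle_bd R G s ltac:(lra).
  by move=> z zs; apply/cder_cont/dG; rewrite zs; lra.
have d0 : 0 < s - r by rewrite /s; lra.
exists (M * (s / (s - r))); first by rewrite mulr_ge0 // divr_ge0 //; lra.
move=> q qr; apply: le_trans (weak_max s01 dG bM _) _; first by rewrite /s; lra.
rewrite ler_wpM2l // ler_wpM2l //; first lra.
by rewrite lef_pV2 ?posrE //; lra.
Qed.

Lemma disc_lin (G : C -> C) : (forall q, cabs q < 1 -> cder G q) ->
  exists2 K, 0 <= K & forall q, cabs q <= 4^-1 -> cabs (G q - G 0) <= K * cabs q.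
Proof.
move=> dG; have [M M0 bM] := @disc_bd1 G 2^-1 ltac:(lra) dG.
have [a ha] := taylor ltr01 dG.
have [||_ hw] := ha 2^-1 _ M; [lra|by move=> z zs; apply: bM; rewrite zs|].
have a0 : a 0 = G 0.
  have := hw 0 ltac:(rewrite cabs0; lra) 1; rewrite big_ord1 expr0 mulr1 cabs0 mul0r expr1 mulr0
      mul0r.
  move=> h; apply/eqP; rewrite eq_sym -subr_eq0 -cabs_eq0 eq_le h cabs_ge0 //.
exists (4 * M); first by rewrite mulr_ge0.
move=> q q4; have := hw q ltac:(lra) 1; rewrite big_ord1 expr0 mulr1 a0 expr1 => h;
    apply: le_trans h _.
have d0 : 0 < 2^-1 - cabs q by lra.
have al (h c : R) : h != 0 -> h - c != 0 -> M * (c / h) * (h / (h - c)) = M * c / (h - c) by move=>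
    ? ?; field; apply/andP.
rewrite al ?invr_eq0 ?pnatr_eq0 ?(gt_eqF d0) //.
rewrite ler_pdivrMr //; have := mulr_ge0 M0 (cabs_ge0 q); have := cabs_ge0 q; nra.
Qed.

Lemma MF_cusp k f : MF k f -> exists a0, exists K Y : R, forall t : C, Y < complex.Im t ->
    0 < complex.Im t -> cabs (f t - a0) <= K * cabs (e2pi t).
Proof.
move=> /MF_disc[G dG fG]; have [K K0 hK] := disc_lin dG; exists (G 0), K, 1 => t ht h0.
rewrite fG //; apply: hK; rewrite cabs_e2pi -[leRHS](@lnK R) ?posrE // ler_expR.
rewrite lnV ?posrE // lerN2; have e4 : ln 4 <= 2 * pi * complex.Im t :> R.
  have e : 4 <= expR (2 : R).
    have := expR_ge1Dx (1 : R); have -> : (2 : R) = 1 + 1 by ring.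
    by rewrite expRD; nra.
  have p2 := pi_ge2 R.
  apply: le_trans (_ : 2 <= _); last by nra.
  by rewrite -ler_expR lnK // posrE.
exact: e4.
Qed.

(* While Im t < 1/2, moving Re t into [-1/2, 1/2] and applying S at least doubles Im t. *)
Lemma fund_height (n : nat) (Nn : C -> R) : (forall t : C, 0 < complex.Im t -> Nn (t + 1) = Nn t) ->
  (forall t : C, 0 < complex.Im t -> Nn (- t^-1) = Nn t) ->
  forall t : C, 0 < complex.Im t -> 2^-1 <= 2 ^+ n * complex.Im t -> exists2 t',
      2^-1 <= complex.Im t' & Nn t' = Nn t.
Proof.
move=> hT hS.
have hTn (t : C) (m : nat) : 0 < complex.Im t -> Nn (t + m%:R) = Nn t.
  move=> ht; elim: m => [|m IH]; first by rewrite addr0.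
  by rewrite -natr1 addrA hT // ImD Im_nat addr0.
have hTz (t : C) (m : int) : 0 < complex.Im t -> Nn (t - m%:~R) = Nn t.
  case: m => m ht; last by rewrite NegzE mulrNz opprK hTn.
  have ht' : 0 < complex.Im (t - m%:R) by rewrite ImD ImN Im_nat subr0.
  by rewrite -(hTn _ m ht') subrK.
elim: n => [|n IH] t ht hn; first by exists t => //; rewrite expr0 mul1r in hn.
case: (leP 2^-1 (complex.Im t)) => h; first by exists t.
pose m := Num.floor (complex.Re t + 2^-1); pose t1 := t - m%:~R.
have i1 : complex.Im t1 = complex.Im t by rewrite /t1 ImD ImN Im_int subr0.
have r1 : complex.Re t1 = complex.Re t - m%:~R by rewrite /t1 ReD ReN Re_int.
have f1 : m%:~R <= complex.Re t + 2^-1 by exact: floor_le.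
have f2 : complex.Re t + 2^-1 < m%:~R + 1 by rewrite -(intrD _ m 1); exact: floorD1_gt.
have rr : complex.Re t1 ^+ 2 <= 4^-1 by rewrite r1; nra.
have ht1 : 0 < complex.Im t1 by rewrite i1.
have ca : cabs t1 ^+ 2 <= 2^-1 by rewrite cabs_sq i1; nra.
have cp : 0 < cabs t1 ^+ 2 by rewrite exprn_gt0 // cabs_gt0 Im_ne0.
have im2 : 2 * complex.Im t <= complex.Im (- t1^-1).
  by rewrite Im_inv i1 ler_pdivlMr //; nra.
have [||t' h1 h2] := IH (- t1^-1); first by lra.
  apply: le_trans hn _; rewrite exprSr -mulrA; apply: ler_wpM2l => //; exact: exprn_ge0.
by exists t' => //; rewrite h2 hS // /t1 hTz.
Qed.

(* The function |f|^2 / (Im t)^n is invariant, hence bounded. *)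
Lemma MF_norm_bd (n : nat) f : MF (- n%:Z) f -> exists2 B : R, 0 <= B & forall t : C,
    0 < complex.Im t -> cabs (f t) ^+ 2 <= B * complex.Im t ^+ n.
Proof.
move=> hf; have [G dG fG] := MF_disc hf; have [_ hT hS _] := hf; have p0 := pi_gt0 R.
(* exp(-pi) is |q| at height 1/2, the height that [fund_height] reaches. *)
have [|M M0 hM] := @disc_bd1 G (expR (- pi)) _ dG.
  by rewrite expR_ge0 expR_lt1 oppr_lt0.
exists (M ^+ 2 * 2 ^+ n); first by rewrite mulr_ge0 ?sqr_ge0 // exprn_ge0.
move=> t ht; pose Nn (t : C) := cabs (f t) ^+ 2 / complex.Im t ^+ n.
have [N hN] : exists N, 2^-1 <= 2 ^+ N * complex.Im t.
  have [N /(_ N (leqnn _))] := pow2_small ht (B := 1) ler01; rewrite ltr_pdivrMr ?exprn_gt0 // => h.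
  by exists N; rewrite mulrC; lra.
have [||t' h1 h2] := @fund_height N Nn _ _ t ht hN.
- by move=> u hu; rewrite /Nn hT // ImD /= addr0.
- move=> u hu; have u0 := Im_ne0 hu; have cu : cabs u != 0 by rewrite cabs_eq0.
  rewrite /Nn hS // cabsM cabsXz Im_inv -exprnN exprMn exprVn -exprM mulnC exprM expr_div_n.
  have c2 : (cabs u ^+ 2) ^+ n != 0 by rewrite !expf_neq0.
  have i2 : complex.Im u ^+ n != 0 by rewrite expf_neq0 // gt_eqF.
  by field; rewrite c2 i2.
have i0 : 0 < complex.Im t' by lra.
rewrite -ler_pdivrMr ?exprn_gt0 // -/(Nn t) -h2 /Nn; apply: ler_pM;
    rewrite ?sqr_ge0 ?invr_ge0 ?exprn_ge0 ?(ltW i0) //.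
  rewrite lerXn2r ?nnegrE ?cabs_ge0 // fG //; apply: hM.
  rewrite cabs_e2pi ler_expR lerN2; nra.
rewrite -exprVn lerXn2r ?nnegrE ?invr_ge0 ?(ltW i0) // -[leRHS]invrK lef_pV2 ?posrE ?invr_gt0 //.
Qed.

Lemma circle_e2pi (q : C) : 0 < cabs q < 1 -> exists2 t : C, e2pi t = q & 0 < complex.Im t.
Proof.
move=> /andP[q0 q1]; have qn : q != 0 by rewrite -cabs_gt0.
by have [t ht] := e2pi_surj qn; exists t => //; rewrite -e2pi_lt1 ht.
Qed.

(** As Im t tends to 0, the bound of [MF_norm_bd] tends to 0. So [f] is small on circles |q| = r
    with r near 1, and then also inside them. *)
Lemma MF_neg (n : nat) f : MF (- n.+1%:Z) f -> forall t : C, 0 < complex.Im t -> f t = 0.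
Proof.
move=> hf t ht; have [B B0 hB] := MF_norm_bd hf; have [G dG fG] := MF_disc hf; have p0 := pi_gt0 R.
apply/eqP; rewrite -cabs_eq0 eq_le cabs_ge0 andbT; apply/ler_addgt0Pr => e e0; rewrite add0r fG //.
set w := e2pi t; have w1 : cabs w < 1 by rewrite e2pi_lt1.
pose y := Num.min (complex.Im t / 2) (Num.min 1 (e ^+ 2 * (complex.Im t / 2) ^+ 2 / (B + 1))).
pose e1 := e * (1 - expR (- (2 * pi * (complex.Im t / 2)))).
have d0 : 0 < 1 - expR (- (2 * pi * (complex.Im t / 2))).
  by rewrite subr_gt0 expR_lt1 oppr_lt0 !mulr_gt0 // invr_gt0.
have B1 : 0 < B + 1 by lra.
pose ee := e / 1 * (1 - expR (- (2 * pi * (complex.Im t / 2)))).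
have [y1 [y0 y11 yt yB]] : exists y : R, [/\ 0 < y, y <= 1, y <= complex.Im t / 2 &
   B * y <= (e * (1 - cabs w / expR (- (2 * pi * (complex.Im t / 2))))) ^+ 2].
  set c := e * _; have c0 : 0 < c.
    rewrite /c mulr_gt0 // subr_gt0 ltr_pdivrMr ?expR_gt0 // mul1r /w cabs_e2pi ltr_expR ltrN2.
    by rewrite ltr_pM2l ?mulr_gt0 //; lra.
  exists (Num.min 1 (Num.min (complex.Im t / 2) (c ^+ 2 / (B + 1)))).
  have c2 : 0 < c ^+ 2 by rewrite exprn_gt0.
  split; rewrite ?lt_min ?ge_min ?lexx ?orbT ?ltr01 ?divr_gt0 //.
  have : Num.min 1 (Num.min (complex.Im t / 2) (c ^+ 2 / (B + 1))) <= c ^+ 2 / (B + 1) by rewrite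
      !ge_min lexx !orbT.
  rewrite ler_pdivlMr //; set m := Num.min _ _; have m0 : 0 < m by rewrite !lt_min ltr01 !divr_gt0.
  by rewrite mulrDr mulr1 mulrC; lra.
pose r := expR (- (2 * pi * y1)).
have r01 : 0 < r < 1 by rewrite expR_gt0 expR_lt1 oppr_lt0 !mulr_gt0.
have rr : expR (- (2 * pi * (complex.Im t / 2))) <= r by rewrite ler_expR lerN2 ler_pM2l ?mulr_gt0.
set r' := expR _ in rr yB; have r'0 : 0 < r' by exact: expR_gt0.
have wr' : cabs w < r' by rewrite /w cabs_e2pi ltr_expR ltrN2 ltr_pM2l ?mulr_gt0 //; lra.
set c := e * _ in yB; have c0 : 0 < c by rewrite mulr_gt0 // subr_gt0 ltr_pdivrMr ?mul1r.
have bnd q : cabs q = r -> cabs (G q) <= c.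
  move=> qr; have [u uq hu] := circle_e2pi (q := q) ltac:(by rewrite qr).
  have iu : complex.Im u = y1.
    have : expR (- (2 * pi * complex.Im u)) = r by rewrite -cabs_e2pi uq.
    by move=> /expR_inj/oppr_inj/mulfI; apply; rewrite gt_eqF // mulr_gt0.
  rewrite -uq -fG //; have := hB u hu; rewrite iu => h.
  rewrite -(@ler_pXn2r _ 2) ?nnegrE ?cabs_ge0 ?(ltW c0) //; apply: le_trans h _; apply: le_trans yB.
  by rewrite ler_wpM2l // exprS ler_piMr ?(ltW y0) // exprn_ile1 // ltW.
apply: le_trans (weak_max r01 dG bnd _) _; first exact: lt_le_trans wr' rr.
have rw : 0 < r - cabs w by lra.
have k1 : c * r' = e * (r' - cabs w) by rewrite /c; field; rewrite gt_eqF.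
rewrite mulrA ler_pdivrMr //.
have : c * (r - r') <= e * (r - r').
  by rewrite ler_wpM2r ?subr_ge0 // /c ler_piMr ?(ltW e0) // gerBl divr_ge0 ?cabs_ge0 // ltW.
lra.
Qed.

(** By invariance every value is taken at height at least 1/2, where |q| <= exp(-pi) <= 1/4. So a
    bound for |G - G(0)| on |q| <= 1/4 holds on the whole disc, and then half of it holds on |q| <=
    1/4, by the vanishing at 0. Iteration leaves 0. *)
Lemma MF_0 f : MF 0 f -> exists c, forall t : C, 0 < complex.Im t -> f t = c.
Proof.
move=> hf; have [G dG fG] := MF_disc hf; have [_ hT hS _] := hf; have p0 := pi_gt0 R;
    have p2 := pi_ge2 R.
have e4 : expR (- pi) <= 4^-1 :> R.
  rewrite expRN lef_pV2 ?posrE ?expR_gt0 //; apply: le_trans (_ : expR 2 <= _);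
      last by rewrite ler_expR.
  have -> : (2 : R) = 1 + 1 by ring.
  by rewrite expRD; have := expR_ge1Dx (1 : R); nra.
exists (G 0) => t ht.
have contr S : (forall q, cabs q <= 4^-1 -> cabs (G q - G 0) <= S) -> forall q, cabs q < 1 ->
    cabs (G q - G 0) <= S.
  move=> hb q q1; case: (eqVneq q 0) => [->|q0]; first by apply: hb; rewrite cabs0.
  have [u uq hu] := circle_e2pi (q := q) ltac:(by rewrite cabs_gt0 q0).
  have [N hN] : exists N, 2^-1 <= 2 ^+ N * complex.Im u.
    have [N /(_ N (leqnn _))] := pow2_small hu (B := 1) ler01; rewrite ltr_pdivrMr ?exprn_gt0 // =>
        h.
    by exists N; rewrite mulrC; lra.
  have [||u' h1 h2] := @fund_height N (fun t => cabs (f t - G 0)) _ _ u hu hN.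
  - by move=> v hv; rewrite hT.
  - by move=> v hv; rewrite hS // expr0z mul1r.
  rewrite -uq -fG // -h2 fG; last lra.
  apply: hb; apply: le_trans e4; rewrite cabs_e2pi ler_expR lerN2; nra.
have [M M0 hM] := @disc_bd1 (fun q => G q - G 0) 4^-1 ltac:(lra) (fun q h => cderD (dG q h)
    (cder_const _ _)).
have step S : (forall q, cabs q <= 4^-1 -> cabs (G q - G 0) <= S) -> forall q, cabs q <= 4^-1 ->
    cabs (G q - G 0) <= S / 2.
  move=> hb q q4; have hb' := contr S hb.
  have dG' (x : C) : cabs x < 1 -> cder (fun q => G q - G 0) x by move=> h; apply: cderD;
      [exact: dG|exact: cder_const].
  have S0 : 0 <= S by apply: le_trans (hb 0 _); rewrite ?cabs_ge0 ?cabs0.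
  have [a ha] := taylor ltr01 dG'.
  (* With radius 7/8 the remainder at |q| <= 1/4 is at most (1/4) / (7/8 - 1/4) = 2/5 of [S]. *)
  have [||_ hw] := ha (7 / 8) _ S; [lra|by move=> z zr; apply: hb'; rewrite zr; lra|].
  have a0 : a 0 = 0.
    have := hw 0 ltac:(rewrite cabs0; lra) 1; rewrite big_ord1 expr0 mulr1 cabs0 mul0r expr1 mulr0
        mul0r subrr sub0r cabsN.
    by move=> h; apply/eqP; rewrite -cabs_eq0 eq_le h cabs_ge0.
  have := hw q ltac:(lra) 1; rewrite big_ord1 a0 mul0r subr0 expr1 => h; apply: le_trans h _.
  have d0 : 0 < 7 / 8 - cabs q by lra.
  have al (h c : R) : h != 0 -> h - c != 0 -> S * (c / h) * (h / (h - c)) = S * c / (h - c) by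
      move=> ? ?; field; apply/andP.
  rewrite al ?(gt_eqF d0) //.
  rewrite ler_pdivrMr //; have := cabs_ge0 q; nra.
have it n q : cabs q <= 4^-1 -> cabs (G q - G 0) <= M / 2 ^+ n.
  elim: n q => [|n IH] q q4; first by rewrite expr0 divr1; exact: hM.
  by have := step _ IH q q4; rewrite exprSr invfM mulrA.
have z q : cabs q <= 4^-1 -> cabs (G q - G 0) <= 0.
  move=> q4; apply/ler_addgt0Pr => e e0; rewrite add0r; have [N /(_ N (leqnn _)) hN] :=
      pow2_small e0 M0.
  by apply: le_trans (it N q q4) (ltW hN).
have w1 : cabs (e2pi t) < 1 by rewrite e2pi_lt1.
rewrite fG //; apply/eqP; rewrite -subr_eq0 -cabs_eq0 eq_le cabs_ge0 andbT; exact: contr z _ w1.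
Qed.

(** Applying S twice is the identity on H, but it contributes the factor (-1)^k. *)
Lemma MF_odd (k : int) f : MF k f -> (exists j, k = 2 * j + 1) -> forall t : C, 0 < complex.Im t ->
    f t = 0.
Proof.
move=> [_ _ hS _] [j kj] t ht; have t0 := Im_ne0 ht.
have := hS _ (Im_inv_gt0 ht); rewrite invrN invrK opprK hS // mulrA -expfzMl mulNr mulVf //
    (signz_odd _ kj) mulN1r.
move=> /eqP; rewrite -subr_eq0 opprK -mulr2n -mulr_natl mulf_eq0 pnatr_eq0 => /eqP//.
Qed.

Lemma MF_M k l f g : MF k f -> MF l g -> MF (k + l) (fun t => f t * g t).
Proof.
move=> [a1 a2 a3 [M [Y a4]]] [b1 b2 b3 [N [Z b4]]]; split.
- by move=> t ht; apply: cderM; [exact: a1|exact: b1].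
- by move=> t ht; rewrite a2 // b2.
- by move=> t ht; rewrite a3 // b3 // expfzDr ?Im_ne0 //; ring.
- exists (M * N), (Num.max Y Z) => t; rewrite gt_max => /andP[/a4 h1 /b4 h2].
  by rewrite cabsM; apply: ler_pM; rewrite ?cabs_ge0.
Qed.

Lemma MF_D k f g : MF k f -> MF k g -> MF k (fun t => f t + g t).
Proof.
move=> [a1 a2 a3 [M [Y a4]]] [b1 b2 b3 [N [Z b4]]]; split.
- by move=> t ht; apply: cderD; [exact: a1|exact: b1].
- by move=> t ht; rewrite a2 // b2.
- by move=> t ht; rewrite a3 // b3 // mulrDr.
- exists (M + N), (Num.max Y Z) => t; rewrite gt_max => /andP[/a4 h1 /b4 h2].
  by apply: le_trans (cabsD _ _) _; apply: lerD.
Qed.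

Lemma MF_c c : MF 0 (fun=> c).
Proof.
split=> [t _|t _|t _|]; [exact: cder_const|by []|by rewrite expr0z mul1r|].
by exists (cabs c), 0.
Qed.

Lemma MF_Z c k f : MF k f -> MF k (fun t => c * f t).
Proof. by move=> h; have := MF_M (MF_c c) h; rewrite add0r. Qed.
Lemma MF_X n k f : MF k f -> MF (k *+ n) (fun t => f t ^+ n).
Proof.
move=> h; elim: n => [|n IH]; first exact: MF_c.
have h' := MF_M h IH; rewrite -mulrS in h'.
by rewrite (_ : (fun t => f t ^+ n.+1) = (fun t => f t * f t ^+ n)) //; apply/funext => t;
    rewrite exprS.
Qed.

End MForms.

(** * The ring of modular forms *)

Section MRing.
Variable R : realType.
Notation C := (CC R).

Lemma expR_8 : expR (- 8) <= 256^-1 :> R.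
Proof.
rewrite expRN lef_pV2 ?posrE ?expR_gt0 //.
have -> : (8 : R) = 8%:R * 1 by rewrite mulr1.
rewrite expRM_natl; have h := expR_ge1Dx (1 : R).
have -> : 256 = 2 ^+ 8 :> R by ring.
by rewrite lerXn2r ?nnegrE ?expR_ge0 //; lra.
Qed.

Lemma ss_bd (z : C) : cabs (ss z) <= 2 * expR (pi * `|complex.Im z|).
Proof.
have p0 := pi_gt0 R.
have e (w : C) : cabs (e2pi w) <= expR (pi * `|complex.Im (2 * w)|).
  rewrite cabs_e2pi ler_expR ImM Re_nat Im_nat mul0r addr0 normrM ger0_norm //.
  have := ler_norm (- complex.Im w); rewrite normrN; nra.
apply: le_trans (cabsB _ _) _; have h1 := e (z / 2); have h2 := e (- (z / 2)); move: h1 h2.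
by rewrite mulrN ImN normrN [2 * (z / 2)]mulrC divfK ?pnatr_eq0 //; lra.
Qed.

Lemma q_small (t : C) : 2 <= complex.Im t -> cabs (e2pi t) <= 256^-1.
Proof.
move=> ht; apply: le_trans expR_8; rewrite cabs_e2pi ler_expR lerN2; have := pi_ge2 R; nra.
Qed.

(** |s|^2 |q| is at most 4 exp(2 pi (|Im z| - Im t)), which is small in this strip, so [theta_asym]
    applies. Near the cusp theta is thus comparable with [ss]. *)
Lemma tprod_near (t z : C) : 2 <= complex.Im t - `|complex.Im z| -> cabs (tprod t z - 1) <= 2^-1.
Proof.
move=> h; have n0 := normr_ge0 (complex.Im z); have p2 := pi_ge2 R.
have q1 := @q_small t ltac:(lra).
apply: theta_asym; [lra| |lra].
have s0 := cabs_ge0 (ss z); have sb := ss_bd z.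
have : cabs (ss z) ^+ 2 <= (2 * expR (pi * `|complex.Im z|)) ^+ 2 by rewrite lerXn2r ?nnegrE
    ?mulr_ge0 ?expR_ge0.
move=> h2; apply: le_trans (_ : 4 * expR (- 8) <= _); last by have := expR_8; lra.
apply: le_trans (_ : (2 * expR (pi * `|complex.Im z|)) ^+ 2 * cabs (e2pi t) <= _);
    first by rewrite ler_wpM2r ?cabs_ge0.
have ee (a b : R) : (2 * expR a) ^+ 2 * expR b = 4 * expR (a + a + b) by rewrite !expRD; ring.
rewrite cabs_e2pi ee.
by rewrite ler_pM2l // ler_expR; nra.
Qed.

Lemma theta_le (t z : C) : 2 <= complex.Im t - `|complex.Im z| -> cabs (theta t z) <= 3 *
    expR (pi * `|complex.Im z|).
Proof.
move=> /tprod_near h; rewrite /theta cabsM; have s := ss_bd z.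
have : cabs (tprod t z) <= 3 / 2 by have := cabsBB (tprod t z) 1; rewrite cabs1; lra.
move=> h2; have := ler_pM (cabs_ge0 _) (cabs_ge0 _) s h2; lra.
Qed.

Lemma theta_ge (t z : C) : 2 <= complex.Im t - `|complex.Im z| -> cabs (ss z) / 2 <=
    cabs (theta t z).
Proof.
move=> /tprod_near h; rewrite /theta cabsM; apply: ler_wpM2l; first exact: cabs_ge0.
by have := cabsBB 1 (tprod t z); rewrite cabs1 cabsC; lra.
Qed.

Opaque theta.

Lemma theta_S (t z : C) : 0 < complex.Im t -> theta (- t^-1) (z / t) = t^-1 *
    e2pi (z ^+ 2 / (2 * t)) * theta t z.
Proof.
move=> ht; have t0 := Im_ne0 ht; have h := @theta_mod R t z 0 (-1) 1 0 ht.
have e1 : (0%:~R * t + (-1)%:~R) / (1%:~R * t + 0%:~R) = - t^-1 by rewrite mulr0z mulrN1z mulr1z;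
    field.
have e2 : 1%:~R * t + 0%:~R = t by rewrite mulr0z mulr1z; ring.
rewrite e1 e2 in h; rewrite h //; last exact: Im_inv_gt0.
by congr (_ * e2pi _ * _); rewrite mulr1z; field.
Qed.

(* A constant multiple of 1 / Delta: the three half periods are permuted up to signs and exponential
   factors, and theta does not vanish there. *)
Definition invdelta (t : C) : C := e2pi t * (theta t 2^-1 * theta t (t / 2) * theta t ((t + 1) / 2))
    ^+ 4.

Lemma invdelta_cder (t : C) : 0 < complex.Im t -> cder invdelta t.
Proof.
move=> ht; apply: (@slice0 R (fun q => invdelta q.1.1) (t, 0, 0)).
have h0 := hol3_0 (t, 0, 0).
have hh : hol3 (fun q : C3 R => q.1.1 / 2) (t, 0, 0) by apply: hol3M => //; exact: hol3_const.
have h1 : hol3 (fun q : C3 R => (q.1.1 + 1) / 2) (t, 0, 0).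
  by apply: hol3M; [apply: hol3D => //|]; exact: hol3_const.
apply: hol3M; first exact: hol3_e2pi.
apply: hol3X; apply: hol3M; [apply: hol3M|]; apply: hol3_theta => //; exact: hol3_const.
Qed.

Lemma thetaB1 (t z : C) : theta t (z - 1) = - theta t z.
Proof. by rewrite -{2}[z](subrK 1) theta_1 opprK. Qed.
Lemma invdelta_T (t : C) : invdelta (t + 1) = invdelta t.
Proof.
rewrite /invdelta !theta_T e2pi_per (_ : (t + 1 + 1) / 2 = t / 2 + 1); last by field.
by rewrite theta_1; ring.
Qed.

Lemma invdelta_S (t : C) : 0 < complex.Im t -> invdelta (- t^-1) = t ^ (- 12%:Z) * invdelta t.
Proof.
move=> ht; have t0 := Im_ne0 ht; rewrite /invdelta.
have e1 : theta (- t^-1) 2^-1 = t^-1 * e2pi (t / 8) * theta t (t / 2).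
  have := theta_S (t / 2) ht; rewrite mulrAC divff // mul1r => ->.
  by congr (_ * e2pi _ * _); field.
have e2 : theta (- t^-1) (- t^-1 / 2) = - (t^-1 * e2pi (8 * t)^-1 * theta t 2^-1).
  rewrite (_ : - t^-1 / 2 = - 2^-1 / t); last by field.
  rewrite theta_S // thetaN mulrN; congr (- (_ * e2pi _ * _)); by field.
have e3 : theta (- t^-1) ((- t^-1 + 1) / 2) = - (t^-1 * e2pi ((t - 1) ^+ 2 / (8 * t)) * theta t
    ((t + 1) / 2)).
  rewrite (_ : (- t^-1 + 1) / 2 = ((t - 1) / 2) / t); last by field.
  rewrite theta_S // (_ : theta t ((t - 1) / 2) = - theta t ((t + 1) / 2)); last first.
    by rewrite -thetaB1; congr (theta t _); field.
  rewrite mulrN; congr (- (_ * e2pi _ * _)); by field.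
rewrite e1 e2 e3; set A := theta t (t / 2); set B := theta t 2^-1; set D := theta t _.
have -> : e2pi t = e2pi (- t^-1) * (e2pi (t / 8) * e2pi (8 * t)^-1 * e2pi ((t - 1) ^+ 2 / (8 * t)))
    ^+ 4.
  rewrite -!e2piD -e2piMn -e2piD.
  have -> : - t^-1 + 4%:R * (t / 8 + (8 * t)^-1 + (t - 1) ^+ 2 / (8 * t)) = t + (-1)%:~R by rewrite
      mulrN1z; field.
  by rewrite e2piD e2pi_int mulr1.
rewrite -exprnN; move: (e2pi (- t^-1)) (e2pi (t / 8)) (e2pi (8 * t)^-1)
    (e2pi ((t - 1) ^+ 2 / (8 * t))) => a b c d.
by field.
Qed.

Lemma invdelta_ne0 (t : C) : 0 < complex.Im t -> invdelta t != 0.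
Proof.
move=> ht; rewrite /invdelta; apply: mulf_neq0; first exact: e2pi_ne0.
apply: expf_neq0; apply: mulf_neq0; first apply: mulf_neq0.
- have -> : 2^-1 = (0%:~R * t + 1%:~R) / 2 by rewrite mulr0z mulr1z; field.
  by apply/eqP => /(theta_half ht)[l [m []]]; lia.
- have -> : t / 2 = (1%:~R * t + 0%:~R) / 2 by rewrite mulr0z mulr1z; field.
  by apply/eqP => /(theta_half ht)[l [m []]]; lia.
- have -> : (t + 1) / 2 = (1%:~R * t + 1%:~R) / 2 by rewrite mulr1z; field.
  by apply/eqP => /(theta_half ht)[l [m []]]; lia.
Qed.

(** A simple pole at the cusp: the fourth powers at the two half periods involving t grow like 1 /
    |q| each, and the prefactor q removes one of them. *)
Lemma invdelta_bd : exists2 K : R, 0 <= K & forall t : C, 4 < complex.Im t ->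
    cabs (invdelta t * e2pi t) <= K.
Proof.
exists (81 ^+ 3) => // t ht; have p2 := pi_ge2 R.
have h2 : complex.Im (2^-1 : C) = 0 by rewrite half_C.
have ih (z : C) : complex.Im (z / 2) = complex.Im z / 2 by rewrite half_C ImM /= mulr0 add0r.
have b1 : cabs (theta t 2^-1) <= 3.
  by have := @theta_le t 2^-1; rewrite h2 normr0 mulr0 expR0 mulr1; apply; lra.
have e (z : C) : complex.Im z = complex.Im t / 2 -> cabs (theta t z) ^+ 4 * cabs (e2pi t) <= 81.
  move=> hz; have z0 : `|complex.Im z| = complex.Im t / 2 by rewrite hz ger0_norm; lra.
  have := @theta_le t z; rewrite z0 => /(_ ltac:(lra)) h.
  have : cabs (theta t z) ^+ 4 <= (3 * expR (pi * (complex.Im t / 2))) ^+ 4.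
    by rewrite lerXn2r ?nnegrE ?cabs_ge0 ?mulr_ge0 ?expR_ge0.
  move=> h4; apply: le_trans (ler_wpM2r (cabs_ge0 _) h4) _.
  have ee (a b : R) : (3 * expR a) ^+ 4 * expR b = 81 * expR (a + a + a + a + b) by rewrite !expRD;
      ring.
  rewrite cabs_e2pi ee (_ : _ + _ = 0); last by field.
  by rewrite expR0 mulr1.
have b2 := e (t / 2) (ih t); have b3 := e ((t + 1) / 2) ltac:(by rewrite ih ImD /= addr0).
have b4 : cabs (theta t 2^-1) ^+ 4 <= 81.
  have -> : 81 = 3 ^+ 4 :> R by ring.
  by rewrite lerXn2r ?nnegrE ?cabs_ge0.
rewrite /invdelta; rewrite cabsM (cabsM (e2pi t)) cabsX (cabsM (theta t 2^-1 * _))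
    (cabsM (theta t 2^-1)) !exprMn.
set a := _ ^+ 4 in b4 *; set b := _ ^+ 4 in b2 *; set c := _ ^+ 4 in b3 *;
    set q := cabs (e2pi t) in b2 b3 *.
have -> : q * (a * b * c) * q = a * (b * q) * (c * q) by ring.
have [a0 b0 c0 q0] : [/\ 0 <= a, 0 <= b, 0 <= c & 0 <= q] by rewrite !exprn_ge0 ?cabs_ge0.
rewrite (_ : 81 ^+ 3 = 81 * 81 * 81); last by ring.
have ab : a * (b * q) <= 81 * 81 by apply: ler_pM => //; exact: mulr_ge0.
apply: (ler_pM (mulr_ge0 a0 (mulr_ge0 b0 q0)) (mulr_ge0 c0 q0) ab b3).
Qed.

Opaque invdelta.

(** The zero of [f] at the cusp compensates the pole of 1 / Delta, and the weight drops by 12. *)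
Lemma MF_cusp_div k f (K Y : R) : MF k f -> (forall t : C, Y < complex.Im t -> 0 < complex.Im t ->
    cabs (f t) <= K * cabs (e2pi t)) ->
  MF (k - 12%:Z) (fun t => f t * invdelta t).
Proof.
move=> [h1 h2 h3 _] cf; split.
- by move=> t ht; apply: cderM; [exact: h1|exact: invdelta_cder].
- by move=> t ht; rewrite h2 // invdelta_T.
- by move=> t ht; rewrite h3 // invdelta_S // expfzDr ?Im_ne0 //; ring.
- have [B B0 hB] := invdelta_bd; exists (K * B), (Num.max Y 4) => t; rewrite gt_max => /andP[tY t4].
  have q0 : 0 < cabs (e2pi t) by rewrite cabs_gt0 e2pi_ne0.
  have := cf t tY ltac:(lra); have := hB t t4; rewrite !cabsM => a b.
  have K0 : 0 <= K by rewrite -(pmulr_lge0 _ q0); apply: le_trans b; exact: cabs_ge0.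
  have := ler_wpM2r (cabs_ge0 (invdelta t)) b; have := ler_wpM2l K0 a;
      have := cabs_ge0 (invdelta t); nra.
Qed.

(** * Generation by two forms of weights 4 and 6 with given expansions *)

Section Struct.
Variables e4 e6 : C -> C.
Hypothesis m4 : MF 4%:Z e4.
Hypothesis m6 : MF 6%:Z e6.
Hypothesis c4 : exists K : R, forall t : C, 1 < complex.Im t -> cabs (e4 t - 1 - 240 * e2pi t) <=
    K * cabs (e2pi t) ^+ 2.
Hypothesis c6 : exists K : R, forall t : C, 1 < complex.Im t -> cabs (e6 t - 1 + 504 * e2pi t) <=
    K * cabs (e2pi t) ^+ 2.

Definition inring (f : C -> C) := exists p : {poly {poly C}}, forall t : C, 0 < complex.Im t ->
    f t = p.[e4 t, e6 t].

Lemma inring_c c : inring (fun=> c).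
Proof. by exists (c%:P%:P) => t _; rewrite !hornerE. Qed.
Lemma inring_D f g : inring f -> inring g -> inring (fun t => f t + g t).
Proof. by move=> [p hp] [q hq]; exists (p + q) => t ht; rewrite hp // hq // !hornerE. Qed.
Lemma inring_M f g : inring f -> inring g -> inring (fun t => f t * g t).
Proof. by move=> [p hp] [q hq]; exists (p * q) => t ht; rewrite hp // hq // !hornerE. Qed.
Lemma inring_4 : inring e4.
Proof. by exists 'X => t ht; rewrite hornerX hornerC. Qed.
Lemma inring_6 : inring e6.
Proof. by exists ('X%:P) => t ht; rewrite hornerC hornerX. Qed.
Lemma inring_X f n : inring f -> inring (fun t => f t ^+ n).
Proof. by move=> [p hp]; exists (p ^+ n) => t ht; rewrite hp // !hornerE. Qed.
Lemma inring_ext f g : (forall t : C, 0 < complex.Im t -> f t = g t) -> inring f -> inring g.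
Proof. by move=> h [p hp]; exists p => t ht; rewrite -h // hp. Qed.

(** Identifies the constant term found by [MF_cusp] with the value at q = 0. *)
Lemma cusp_val (F : C -> C) a (K Y : R) : cont1 F 0 ->
  (forall t : C, Y < complex.Im t -> 0 < complex.Im t -> cabs (F (e2pi t) - a) <= K * cabs (e2pi t))
      -> F 0 = a.
Proof.
move=> cF hK; have p0 := pi_gt0 R; apply/eqP; rewrite -subr_eq0 -cabs_eq0 eq_le cabs_ge0 andbT.
apply/ler_addgt0Pr => e e0; rewrite add0r; have [s s0 hs] := cF (e / 2) ltac:(lra).
have K1 : 0 < `|K| + 1 by have := normr_ge0 K; lra.
pose x := Num.min (Num.min (s / 2) 2^-1) (Num.min (expR (- (2 * pi * (Y + 1))))
    (e / 2 / (`|K| + 1))).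
have x0 : 0 < x.
  rewrite !lt_min expR_gt0 invr_gt0 ltr0n; do 2 rewrite divr_gt0 //=.
  by rewrite divr_gt0 //; lra.
have xs : x <= s / 2 by rewrite !ge_min lexx.
have xr : x <= 2^-1 by rewrite !ge_min lexx !orbT.
have xY : x <= expR (- (2 * pi * (Y + 1))) by rewrite !ge_min lexx !orbT.
have xK : x * (`|K| + 1) <= e / 2 by rewrite -ler_pdivlMr // !ge_min lexx !orbT.
have cx : cabs (x%:C%C : C) = x by rewrite cabs_real gtr0_norm.
have [t tq ht] := @circle_e2pi R x%:C%C ltac:(rewrite cx; lra).
have tY : Y < complex.Im t.
  move: xY; rewrite -cx -tq cabs_e2pi ler_expR lerN2 ler_pM2l ?mulr_gt0 //; lra.
have := hK t tY ht; rewrite tq cx => h1.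
have := hs x%:C%C; rewrite /d1 subr0 cx => /(_ ltac:(lra)) h2.
have := cabs_tri (F 0) (F x%:C%C) a; rewrite (cabsC (F 0) (F x%:C%C)) => h3.
have := ler_norm K; nra.
Qed.

Lemma disc_der (e : C -> C) k (b : C) : MF k e -> (exists K : R, forall t : C, 1 < complex.Im t ->
    cabs (e t - 1 - b * e2pi t) <= K * cabs (e2pi t) ^+ 2) ->
  exists G, [/\ cdiff G 0 b, G 0 = 1 & forall t : C, 0 < complex.Im t -> e t = G (e2pi t)].
Proof.
move=> /MF_disc[G dG eG] [K hK]; exists G; have p0 := pi_gt0 R.
pose r := expR (- (2 * pi)) : R; have r0 : 0 < r by exact: expR_gt0.
have r1 : r < 1 by rewrite expR_lt1; lra.
have K0 : 0 <= K.
  have /hK h : 1 < complex.Im ((0 : R) +i* 2)%C by rewrite /= ltr1n.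
  have := le_trans (cabs_ge0 _) h; rewrite pmulr_lge0 // exprn_gt0 // cabs_gt0 e2pi_ne0 //.
have q (q : C) : q != 0 -> cabs q < r -> cabs (G q - 1 - b * q) <= K * cabs q ^+ 2.
  move=> q0 qr; have [t tq ht] := @circle_e2pi R q ltac:(rewrite cabs_gt0 q0 /=; lra).
  rewrite -tq -eG //; apply: hK; move: qr; rewrite -tq cabs_e2pi /r ltr_expR ltrN2.
  by rewrite -{1}[2 * pi]mulr1 ltr_pM2l // mulr_gt0.
have G0 : G 0 = 1.
  apply: (@cusp_val G 1 (K + cabs b) 1); first by apply/cder_cont/dG; rewrite cabs0.
  move=> t t1 ht; rewrite -eG //; have := hK t t1.
  have q1 : cabs (e2pi t) < 1 by rewrite e2pi_lt1.
  have := cabsD (e t - 1 - b * e2pi t) (b * e2pi t); rewrite subrK cabsM expr2.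
  have : K * (cabs (e2pi t) * cabs (e2pi t)) <= K * cabs (e2pi t) by rewrite ler_wpM2l // ler_piMr
      ?cabs_ge0 // ltW.
  rewrite mulrDl; lra.
split => //; apply: (@cdiff_quad R _ _ _ r K) => // w; rewrite !subr0 G0 => wr.
case: (eqVneq w 0) => [->|w0]; first by rewrite G0 subrr mulr0 subrr cabs0 expr0n mulr0.
exact: q.
Qed.

Lemma disc46 : exists G H, [/\ cdiff G 0 240, G 0 = 1, cdiff H 0 (- 504), H 0 = 1 &
  forall t : C, 0 < complex.Im t -> e4 t = G (e2pi t) /\ e6 t = H (e2pi t)].
Proof.
have [G [dG G0 eG]] := disc_der m4 c4.
have c6' : exists K : R, forall t : C, 1 < complex.Im t -> cabs (e6 t - 1 - (- 504) * e2pi t) <= K *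
    cabs (e2pi t) ^+ 2.
  by have [K hK] := c6; exists K => t ht; rewrite mulNr opprK hK.
have [H [dH H0 eH]] := disc_der m6 c6'.
by exists G, H; split => // t ht; rewrite eG // eH.
Qed.

(** The coefficients of q in e4^3 and e6^2 differ by 720 + 1008 = 1728. *)
Lemma e46_ne : ~ (forall t : C, 0 < complex.Im t -> e4 t ^+ 3 = e6 t ^+ 2).
Proof.
move=> h; have [G [H [dG G0 dH H0 e]]] := disc46.
have d1 := cdiffM (cdiffM dG dG) dG; have d2 := cdiffM dH dH.
have d3 := cdiffD d1 (cdiffM (cdiff_const (-1) 0) d2).
have z q : cabs q < 1 -> 0 = G q * G q * G q + -1 * (H q * H q).
  move=> q1; case: (eqVneq q 0) => [->|q0]; first by rewrite G0 H0; ring.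
  have [t tq ht] := @circle_e2pi R q ltac:(by rewrite cabs_gt0 q0).
  have := h t ht; have [-> ->] := e t ht; rewrite tq => eh; transitivity (G q ^+ 3 - H q ^+ 2);
      [by rewrite eh subrr|ring].
have d5 : cdiff (fun q => G q * G q * G q + -1 * (H q * H q)) 0 0.
  apply: cdiff_ext (cdiff_const (0 : C) 0); exists 1 => // q; rewrite subr0; exact: z.
have := cdiff_unique d3 d5; rewrite G0 H0 => e0.
have : (1728 : C) = 0 by rewrite -[RHS]e0; ring.
by move/eqP; rewrite pnatr_eq0.
Qed.

(** e4^3 - e6^2 vanishes at the cusp, so dividing by Delta gives weight 0, hence a constant; it is
    not 0 by [e46_ne]. *)
Lemma invdelta_const : exists2 c, c != 0 & forall t : C, 0 < complex.Im t -> (e4 t ^+ 3 - e6 t ^+ 2)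
    * invdelta t = c.
Proof.
have mm : MF 12%:Z (fun t => e4 t ^+ 3 - e6 t ^+ 2).
  have h1 := MF_X 3 m4; have h2 := MF_Z (-1) (MF_X 2 m6).
  have := MF_D h1 h2; rewrite (_ : (fun t => e4 t ^+ 3 + -1 * e6 t ^+ 2) =
      (fun t => e4 t ^+ 3 - e6 t ^+ 2)) //.
  by apply/funext => t; rewrite mulN1r.
have [a [K [Y hK]]] := MF_cusp mm; have [G [H [dG G0 dH H0 e]]] := disc46.
have a0 : a = 0.
  have cc : cont1 (fun q => G q ^+ 3 - H q ^+ 2) 0.
    by apply: cder_cont; apply: cderD; last apply: cderN; apply: cderX; eexists; eassumption.
  have := @cusp_val (fun q => G q ^+ 3 - H q ^+ 2) a K Y cc; rewrite G0 H0 !expr1n subrr =>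
      <- // t tY ht.
  by have := hK t tY ht; have [-> ->] := e t ht.
have m0 : MF 0 (fun t => (e4 t ^+ 3 - e6 t ^+ 2) * invdelta t).
  have := @MF_cusp_div 12%:Z _ K Y mm; rewrite subrr; apply => t tY ht.
  by have := hK t tY ht; rewrite a0 subr0.
have [c hc] := MF_0 m0; exists c => //.
apply/eqP => c0; apply: e46_ne => t ht; have := hc t ht; rewrite c0 => /eqP.
by rewrite mulf_eq0 (negPf (invdelta_ne0 ht)) orbF subr_eq0 => /eqP.
Qed.

(** e4^i e6^j has constant term 1, so a multiple of it removes the constant term of [f]. The rest is
    divided by Delta, and [invdelta_const] expresses Delta by e4^3 - e6^2. *)
Lemma MF_step k f (i j : nat) : MF k f -> k = 4%:Z *+ i + 6%:Z *+ j -> exists c c0 h,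
    [/\ MF (k - 12%:Z) h &
  forall t : C, 0 < complex.Im t -> f t = c * (e4 t ^+ i * e6 t ^+ j) + h t *
      (c0 * (e4 t ^+ 3 - e6 t ^+ 2))].
Proof.
move=> mf kE; have [F dF fF] := MF_disc mf; have [G [H [dG G0 dH H0 e]]] := disc46;
    have [c0 n0 hc0] := invdelta_const.
have mg : MF k (fun t => f t + (- F 0) * (e4 t ^+ i * e6 t ^+ j)).
  by apply: MF_D => //; apply: MF_Z; rewrite kE; apply: MF_M; apply: MF_X.
have [a [K [Y hK]]] := MF_cusp mg.
have a0 : a = 0.
  have cc : cont1 (fun q => F q + (- F 0) * (G q ^+ i * H q ^+ j)) 0.
    apply: cder_cont; apply: cderD; first by apply: dF; rewrite cabs0.
    by apply: cderM; [exact: cder_const|apply: cderM; apply: cderX; eexists; eassumption].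
  have := @cusp_val _ a K Y cc; rewrite G0 H0 !expr1n !mulr1 subrr => <- // t tY ht.
  by have := hK t tY ht; have [-> ->] := e t ht; rewrite fF.
exists (F 0), (c0^-1), (fun t => (f t + (- F 0) * (e4 t ^+ i * e6 t ^+ j)) * invdelta t); split.
  by apply: (@MF_cusp_div k _ K Y mg) => t tY ht; have := hK t tY ht; rewrite a0 subr0.
move=> t ht; have := hc0 t ht; set A := e4 t ^+ 3 - _ => hA; have D0 := invdelta_ne0 ht.
have A0 : A != 0 by apply: contraNneq n0 => A0; rewrite -hA A0 mul0r.
by rewrite -hA; clearbody A; field; rewrite A0 D0.
Qed.

(* f^2 = c e4 and f^3 = d e6; comparing constant terms of c^3 e4^3 = d^2 e6^2 gives c^3 = d^2, so c
   <> 0 would force e4^3 = e6^2. *)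
Lemma MF_weight2 f : MF 2%:Z f -> forall t : C, 0 < complex.Im t -> f t = 0.
Proof.
move=> mf.
have [c [cu [h [mh hc]]]] := @MF_step _ _ 1 0 (MF_X 2 mf) erefl.
have [d [cv [h' [mh' hd]]]] := @MF_step _ _ 0 1 (MF_X 3 mf) erefl.
have h0 := @MF_neg R 7 h mh; have h0' := @MF_neg R 5 h' mh'.
have e1 (t : C) : 0 < complex.Im t -> f t ^+ 2 = c * e4 t.
  by move=> ht; rewrite hc // h0 // mul0r addr0 expr1 expr0 mulr1.
have e2 (t : C) : 0 < complex.Im t -> f t ^+ 3 = d * e6 t.
  by move=> ht; rewrite hd // h0' // mul0r addr0 expr1 expr0 mul1r.
have e3 (t : C) : 0 < complex.Im t -> c ^+ 3 * e4 t ^+ 3 = d ^+ 2 * e6 t ^+ 2.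
  by move=> ht; rewrite -!exprMn -e1 // -e2 // -!exprM mulnC.
have [G [H [dG G0 dH H0 e]]] := disc46.
have cd : c ^+ 3 = d ^+ 2.
  have cc : cont1 (fun q => c ^+ 3 * G q ^+ 3 - d ^+ 2 * H q ^+ 2) 0.
    by apply: cder_cont; apply: cderD; last apply: cderN; (apply: cderM; first exact: cder_const);
        apply: cderX; eexists; eassumption.
  apply/eqP; rewrite -subr_eq0; have := @cusp_val _ 0 0 0 cc; rewrite G0 H0 !expr1n !mulr1 => ->
      // t _ ht.
  have := e3 t ht; have [-> ->] := e t ht; move=> ->; by rewrite subrr subr0 cabs0 mul0r.
have c0 : c = 0.
  apply/eqP; apply: contraT => nc; exfalso; apply: e46_ne => t ht.
  by have := e3 t ht; rewrite -cd => /mulfI; apply; rewrite expf_neq0.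
by move=> t ht; have := e1 t ht; rewrite c0 mul0r => /eqP; rewrite expf_eq0 => /eqP.
Qed.

Theorem MF_ring k f : MF k f -> inring f.
Proof.
have [n] : exists n : nat, k < n%:Z by exists (`|k|).+1; lia.
elim: n k f => [|n IH] k f kn mf.
  case: k kn mf => // m _ mf; apply: inring_ext (inring_c 0) => t ht;
      by rewrite (@MF_neg R m f) // -NegzE.
case: k kn mf => [k|m] kn mf; last first.
  by apply: inring_ext (inring_c 0) => t ht; rewrite (@MF_neg R m f) // -NegzE.
have [x [kx|kx]] := par2 k; last first.
  by apply: inring_ext (inring_c 0) => t ht; rewrite (MF_odd mf) //; exists x.
have [k0|k0] := eqVneq k 0%N.
  by subst k; have [c hc] := MF_0 mf; apply: inring_ext (inring_c c) => t ht; rewrite hc.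
have [k2|k2] := eqVneq k 2%N.
  by subst k; apply: inring_ext (inring_c 0) => t ht; rewrite MF_weight2.
(* Weights 0 and 2 have just been settled, and every even k >= 4 has this form with j = 0 or 1. *)
have [i [j kE]] : exists i j : nat, k = (4 * i + 6 * j)%N.
  have [y [xy|xy]] := par2 x; first by exists `|y|%N, 0%N; lia.
  by exists `|y - 1|%N, 1%N; lia.
have ez (u v : nat) : u%:Z *+ v = (u * v)%N%:Z by rewrite PoszM -mulr_natr natz.
have kE' : k%:Z = 4%:Z *+ i + 6%:Z *+ j by rewrite !ez; lia.
have [c [c0 [h [mh hf]]]] := MF_step mf kE'.
have kn' : k%:Z - 12%:Z < n%:Z by move: kn; rewrite !ltz_nat; lia.
have hr := IH _ _ kn' mh.
apply: inring_ext (_ : inring (fun t => c * (e4 t ^+ i * e6 t ^+ j) + h t *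
    (c0 * (e4 t ^+ 3 + (-1) * e6 t ^+ 2)))).
  by move=> t ht; rewrite hf // mulN1r.
apply: inring_D; first by apply: inring_M; [exact: inring_c|apply: inring_M; apply: inring_X;
    [exact: inring_4|exact: inring_6]].
apply: inring_M => //; apply: inring_M; first exact: inring_c.
apply: inring_D; first by apply: inring_X; exact: inring_4.
by apply: inring_M; [exact: inring_c|apply: inring_X; exact: inring_6].
Qed.

End Struct.
End MRing.

(** * Taylor coefficients of theta *)

Section Jets.
Variable R : realType.
Notation C := (CC R).
Notation tpi := (tpi R).

Definition jpol (a b c d z : C) : C := a + b * z ^+ 2 + c * z ^+ 4 + d * z ^+ 6.
(* f(z) = a + b z^2 + c z^4 + d z^6 + O(z^8) for z <> 0. *)
Definition jet (f : C -> C) (a b c d : C) := exists K r : R, [/\ 0 <= K, 0 < r, r <= 1 &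
  forall z : C, z != 0 -> cabs z < r -> cabs (f z - jpol a b c d z) <= K * cabs z ^+ 8].

Lemma cabs_X1 (z x : C) n : cabs z <= 1 -> cabs (x * z ^+ n) <= cabs x.
Proof. by move=> h; rewrite cabsM cabsX ler_piMr ?cabs_ge0 // exprn_ile1 ?cabs_ge0. Qed.
Lemma jpol_bd a b c d (z : C) : cabs z <= 1 -> cabs (jpol a b c d z) <= cabs a + cabs b + cabs c +
    cabs d.
Proof.
move=> h; rewrite /jpol; have := cabs_X1 b 2 h; have := cabs_X1 c 4 h; have := cabs_X1 d 6 h.
have := cabsD (a + b * z ^+ 2 + c * z ^+ 4) (d * z ^+ 6); have := cabsD (a + b * z ^+ 2)
    (c * z ^+ 4).
have := cabsD a (b * z ^+ 2); lra.
Qed.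

Lemma jet_const (a : C) : jet (fun=> a) a 0 0 0.
Proof.
exists 0, 1; split => // z _ _; rewrite mul0r (_ : _ - _ = 0) ?cabs0 //; rewrite /jpol; ring.
Qed.

Lemma jetD f g a b c d a' b' c' d' : jet f a b c d -> jet g a' b' c' d' ->
  jet (fun z => f z + g z) (a + a') (b + b') (c + c') (d + d').
Proof.
move=> [K [r [K0 r0 r1 h]]] [L [s [L0 s0 s1 h']]]; exists (K + L), (Num.min r s); split.
- exact: addr_ge0.
- by rewrite lt_min r0.
- by rewrite ge_min r1.
move=> z z0; rewrite lt_min => /andP[zr zs]; have := h z z0 zr; have := h' z z0 zs.
have -> : f z + g z - jpol (a + a') (b + b') (c + c') (d + d') z = (f z - jpol a b c d z) +
    (g z - jpol a' b' c' d' z).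
  by rewrite /jpol; ring.
have := cabsD (f z - jpol a b c d z) (g z - jpol a' b' c' d' z); rewrite mulrDl; lra.
Qed.

Lemma jetM f g a b c d a' b' c' d' : jet f a b c d -> jet g a' b' c' d' ->
  jet (fun z => f z * g z) (a * a') (a * b' + b * a') (a * c' + b * b' + c * a') (a * d' + b * c' +
      c * b' + d * a').
Proof.
move=> [K [r [K0 r0 r1 h]]] [L [s [L0 s0 s1 h']]].
pose Mp := cabs a + cabs b + cabs c + cabs d; pose Mq := cabs a' + cabs b' + cabs c' + cabs d'.
pose e1 := b * d' + c * c' + d * b'; pose e2 := c * d' + d * c'; pose e3 := d * d'.
pose M3 := cabs e1 + cabs e2 + cabs e3 + cabs 0.
have [p0 q0 m0] : [/\ 0 <= Mp, 0 <= Mq & 0 <= M3] by rewrite !addr_ge0 ?cabs_ge0.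
exists (K * (Mq + L) + Mp * L + M3), (Num.min r s); split.
- by apply: addr_ge0 => //; apply: addr_ge0; apply: mulr_ge0 => //; apply: addr_ge0.
- by rewrite lt_min r0.
- by rewrite ge_min r1.
move=> z z0; rewrite lt_min => /andP[zr zs]; have hf := h z z0 zr; have hg := h' z z0 zs.
have z1 : cabs z <= 1 by lra.
have -> : f z * g z - jpol (a * a') (a * b' + b * a') (a * c' + b * b' + c * a') (a * d' + b * c' +
    c * b' + d * a') z =
  (f z - jpol a b c d z) * g z + jpol a b c d z * (g z - jpol a' b' c' d' z) + z ^+ 8 *
      jpol e1 e2 e3 0 z.
  by rewrite /jpol /e1 /e2 /e3; ring.
have gb : cabs (g z) <= Mq + L.
  have := jpol_bd a' b' c' d' z1; rewrite -/Mq => hq; have := cabsD (jpol a' b' c' d' z)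
      (g z - jpol a' b' c' d' z).
  rewrite addrC subrK => h2; have : L * cabs z ^+ 8 <= L by rewrite ler_piMr // exprn_ile1
      ?cabs_ge0.
  lra.
have z8 : 0 <= cabs z ^+ 8 by rewrite exprn_ge0 // cabs_ge0.
have t1 := ler_pM (cabs_ge0 _) (cabs_ge0 _) hf gb.
have t2 := ler_pM (cabs_ge0 _) (cabs_ge0 _) (jpol_bd a b c d z1) hg.
have t3 := ler_wpM2l z8 (jpol_bd e1 e2 e3 0 z1).
have trisum (x y w : C) : cabs (x + y + w) <= cabs x + cabs y + cabs w by have := cabsD (x + y) w;
    have := cabsD x y; lra.
apply: le_trans (trisum _ _ _) _; rewrite (cabsM (z ^+ 8)) cabsX (cabsM (f z - _))
    (cabsM (jpol _ _ _ _ z) (_ - _)).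
have -> : (K * (Mq + L) + Mp * L + M3) * cabs z ^+ 8 = K * cabs z ^+ 8 * (Mq + L) + Mp *
    (L * cabs z ^+ 8) + cabs z ^+ 8 * M3 by ring.
by apply: lerD => //; apply: lerD.
Qed.

Lemma jet_bd f a b c d : jet f a b c d -> exists M r : R, [/\ 0 <= M, 0 < r, r <= 1 & forall z : C,
    z != 0 -> cabs z < r -> cabs (f z) <= M].
Proof.
move=> [K [r [K0 r0 r1 h]]]; exists (K + (cabs a + cabs b + cabs c + cabs d)), r; split => //;
    first by rewrite !addr_ge0 ?cabs_ge0.
move=> z z0 zr; have z1 : cabs z <= 1 by lra.
have := h z z0 zr; have := jpol_bd a b c d z1; have := cabsD (f z - jpol a b c d z)
    (jpol a b c d z); rewrite subrK.
have : K * cabs z ^+ 8 <= K by rewrite ler_piMr // exprn_ile1 ?cabs_ge0.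
lra.
Qed.

Lemma jet_ext f g a b c d (r : R) : 0 < r -> (forall z : C, z != 0 -> cabs z < r -> f z = g z) ->
    jet f a b c d -> jet g a b c d.
Proof.
move=> r0 e [K [s [K0 s0 s1 h]]]; exists K, (Num.min r s); split => //; first by rewrite lt_min r0.
  by rewrite ge_min s1 orbT.
by move=> z z0; rewrite lt_min => /andP[zr zs]; rewrite -e // h.
Qed.

Lemma jet_eq f a b c d a' b' c' d' : a = a' -> b = b' -> c = c' -> d = d' -> jet f a b c d ->
    jet f a' b' c' d'.
Proof. by move=> -> -> -> ->. Qed.
Lemma jet_dil s f a b c d : s != 0 -> jet f a b c d -> jet (fun z => f (s * z)) a (s ^+ 2 * b)
    (s ^+ 4 * c) (s ^+ 6 * d).
Proof.
move=> s0 [K [r [K0 r0 r1 h]]]; have cs : 0 < cabs s by rewrite cabs_gt0.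
exists (K * cabs s ^+ 8), (Num.min 1 (r / cabs s)); split.
- by rewrite mulr_ge0 // exprn_ge0 // cabs_ge0.
- by rewrite lt_min ltr01 divr_gt0.
- by rewrite ge_min lexx.
move=> z z0; rewrite lt_min => /andP[_ zr].
have := h (s * z) ltac:(by rewrite mulf_neq0) ltac:(by rewrite cabsM mulrC -ltr_pdivlMr).
rewrite cabsM exprMn mulrA (_ : jpol a b c d (s * z) = jpol a (s ^+ 2 * b) (s ^+ 4 * c) (s ^+ 6 * d)
    z) //.
by rewrite /jpol; ring.
Qed.

Lemma jet_sq f a b c d : jet f a b c d -> jet (fun z => z ^+ 2 * f z) 0 a b c.
Proof.
move=> [K [r [K0 r0 r1 h]]]; exists (K + cabs d), r; split => //;
    first by rewrite addr_ge0 ?cabs_ge0.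
move=> z z0 zr; have -> : z ^+ 2 * f z - jpol 0 a b c z = (f z - jpol a b c d z) * z ^+ 2 + d *
    z ^+ 8 by rewrite /jpol; ring.
have z8 : 0 <= cabs z ^+ 8 by rewrite exprn_ge0 // cabs_ge0.
have z1 : cabs z <= 1 by lra.
have h1 := le_trans (cabs_X1 (f z - jpol a b c d z) 2 z1) (h z z0 zr).
have h2 : cabs (d * z ^+ 8) = cabs d * cabs z ^+ 8 by rewrite cabsM cabsX.
rewrite [leRHS]mulrDl; have := cabsD ((f z - jpol a b c d z) * z ^+ 2) (d * z ^+ 8); lra.
Qed.

Lemma jet_err f g a b c d (r K : R) : 0 < r -> (forall z : C, z != 0 -> cabs z < r ->
    cabs (g z - f z) <= K * cabs z ^+ 8) ->
  jet f a b c d -> jet g a b c d.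
Proof.
move=> r0 hK [L [s [L0 s0 s1 h]]]; exists (`|K| + L), (Num.min r s); split.
- by rewrite addr_ge0.
- by rewrite lt_min r0.
- by rewrite ge_min s1 orbT.
move=> z z0; rewrite lt_min => /andP[zr zs]; have := h z z0 zs; have h1 := hK z z0 zr;
    have := cabs_tri (g z) (f z) (jpol a b c d z).
have : K * cabs z ^+ 8 <= `|K| * cabs z ^+ 8 by rewrite ler_wpM2r ?exprn_ge0 ?cabs_ge0 // ler_norm.
rewrite mulrDl; lra.
Qed.

Lemma small_zero (d : C) (r K : R) : 0 < r -> (forall z : C, z != 0 -> cabs z < r -> cabs d <= K *
    cabs z) -> d = 0.
Proof.
move=> r0 h; apply/eqP; rewrite -cabs_eq0 eq_le cabs_ge0 andbT; apply/ler_addgt0Pr => e e0;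
    rewrite add0r.
have K1 : 0 < `|K| + 1 by have := normr_ge0 K; lra.
pose x := Num.min (r / 2) (e / (`|K| + 1)); have x0 : 0 < x by rewrite lt_min !divr_gt0.
have cx : cabs (x%:C%C : C) = x by rewrite cabs_real gtr0_norm.
have := h x%:C%C; rewrite cx -cabs_gt0 cx => /(_ x0 _) h1.
have xr : x <= r / 2 by rewrite ge_min lexx.
have xe : x * (`|K| + 1) <= e by rewrite -ler_pdivlMr // ge_min lexx orbT.
have := h1 ltac:(lra); have := ler_norm K; nra.
Qed.

(** The coefficients are peeled off one at a time, with a division by z^2 in between. *)
Lemma jet0 a b c d : jet (fun=> 0) a b c d -> [/\ a = 0, b = 0, c = 0 & d = 0].
Proof.
move=> [K [r [K0 r0 r1 h]]].
have step (d0 e1 e2 e3 : C) n : (0 < n)%N -> (forall z : C, z != 0 -> cabs z < r ->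
    cabs (d0 + z * (e1 * z + e2 * z ^+ 3 + e3 * z ^+ 5)) <= K * cabs z ^+ n) -> d0 = 0.
  move=> n0 hz; apply: (@small_zero _ r (K + (cabs e1 + cabs e2 + cabs e3))) => // z z0 zr.
  have z1 : cabs z <= 1 by lra.
  have := hz z z0 zr; have zn : cabs z ^+ n <= cabs z by case: n n0 {hz} => // n _;
      rewrite exprS ler_piMr ?cabs_ge0 // exprn_ile1 ?cabs_ge0.
  have := ler_wpM2l K0 zn; set w := e1 * z + _ + _ => k1 k2.
  have hw : cabs w <= cabs e1 + cabs e2 + cabs e3.
    rewrite /w; have := cabsD (e1 * z + e2 * z ^+ 3) (e3 * z ^+ 5);
        have := cabsD (e1 * z) (e2 * z ^+ 3).
    have := cabs_X1 e1 1 z1; have := cabs_X1 e2 3 z1; have := cabs_X1 e3 5 z1; rewrite expr1; lra.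
  have := cabsB (d0 + z * w) (z * w); rewrite addrK cabsM; have := ler_wpM2l (cabs_ge0 z) hw; lra.
have dv (x : C) n m z : z != 0 -> cabs (x * z ^+ m) <= K * cabs z ^+ (n + m) -> cabs x <= K *
    cabs z ^+ n.
  move=> z0; have cz : 0 < cabs z ^+ m by rewrite exprn_gt0 // cabs_gt0.
  by rewrite cabsM cabsX exprD mulrA ler_pM2r.
have a0 : a = 0.
  apply: (step a b c d 8) => // z z0 zr; have := h z z0 zr;
      rewrite sub0r cabsN (_ : jpol a b c d z = a + z * (b * z + c * z ^+ 3 + d * z ^+ 5)) //.
  by rewrite /jpol; ring.
have b0 : b = 0.
  apply: (step b c d 0 6) => // z z0 zr; apply: (dv _ 6 2) => //; have := h z z0 zr;
      rewrite sub0r cabsN (_ : jpol a b c d z = (b + z * (c * z + d * z ^+ 3 + 0 * z ^+ 5)) *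
      z ^+ 2) //.
  by rewrite /jpol a0; ring.
have c0 : c = 0.
  apply: (step c d 0 0 4) => // z z0 zr; apply: (dv _ 4 4) => //; have := h z z0 zr;
      rewrite sub0r cabsN (_ : jpol a b c d z = (c + z * (d * z + 0 * z ^+ 3 + 0 * z ^+ 5)) *
      z ^+ 4) //.
  by rewrite /jpol a0 b0; ring.
have d0 : d = 0.
  apply: (step d 0 0 0 2) => // z z0 zr; apply: (dv _ 2 6) => //; have := h z z0 zr;
      rewrite sub0r cabsN (_ : jpol a b c d z = (d + z * (0 * z + 0 * z ^+ 3 + 0 * z ^+ 5)) *
      z ^+ 6) //.
  by rewrite /jpol a0 b0 c0; ring.
by [].
Qed.

Lemma jet_unique f a b c d a' b' c' d' : jet f a b c d -> jet f a' b' c' d' ->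
    [/\ a = a', b = b', c = c' & d = d'].
Proof.
move=> h1 h2; have h3 := jetD h1 (jetM (jet_const (-1)) h2).
have := @jet_ext _ (fun=> 0) _ _ _ _ 1 ltr01 _ h3; rewrite !mul0r !addr0 !mulN1r =>
    /(_ _)/jet0 [z _ _|].
  by rewrite mulN1r subrr.
by move=> /eqP + /eqP + /eqP + /eqP; rewrite !subr_eq0 => /eqP-> /eqP-> /eqP-> /eqP->.
Qed.

(** This is sin(pi z) / (pi z), the part of theta(z) / (2 pi i z) that does not depend on t. *)
Definition gs (z : C) : C := ss z / (tpi * z).

Lemma cder_ss (z : C) : cder (@ss R) z.
Proof.
have h : hol3 (fun q : C3 R => ss q.1.1) (z, 0, 0) by apply: hol3_ss; exact: hol3_0.
exact: (slice0 h).
Qed.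

Lemma taylor0 (f : C -> C) : (forall z, cder f z) -> exists (a : nat -> C) (M : R), 0 <= M /\
  forall N w, cabs w < 4^-1 -> cabs (f w - \sum_(n < N) a n * w ^+ n) <= (M * 2 ^+ N * 2) *
      cabs w ^+ N.
Proof.
move=> df; have [a ha] := taylor ltr01 (fun z (_ : cabs z < 1) => df z).
have [|M M0 bM] := @circle_bd R f 2^-1 ltac:(lra).
  by move=> z _; exact/cder_cont/df.
have [|_ hw] := ha 2^-1 ltac:(lra) M; first exact: bM.
exists a, M; split => // N w w4; apply: le_trans (hw w ltac:(lra) N) _;
    rewrite invrK exprMn -!mulrA ler_wpM2l //.
have w0 : 0 <= cabs w ^+ N by rewrite exprn_ge0 ?cabs_ge0.
have u0 : 0 <= 2 ^+ N :> R by rewrite exprn_ge0.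
have -> : 2 ^+ N * (2 * cabs w ^+ N) = (cabs w ^+ N * 2 ^+ N) * 2 by ring.
rewrite mulrA ler_wpM2l ?mulr_ge0 // ler_pdivrMr; lra.
Qed.

Lemma jet_gs0 : exists b c d, jet gs 1 b c d.
Proof.
have [a [M [M0 E]]] := taylor0 cder_ss.
have a1 : a 1%N = tpi.
  have e0 : a 0%N = 0.
    have := E 1%N 0 ltac:(rewrite cabs0; lra); rewrite big_ord1 ss0 cabs0 expr1 mulr0 expr0 mulr1
        sub0r cabsN.
    by move=> h; apply/eqP; rewrite -cabs_eq0 eq_le h cabs_ge0.
  apply: cdiff_unique (cdiff_ss0 R); apply: (@cdiff_quad R _ _ _ 4^-1 (M * 2 ^+ 2 * 2)).
  - by rewrite invr_gt0.
  - by rewrite !mulr_ge0.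
  move=> w; rewrite !subr0 ss0 subr0 => wr; have := E 2%N w wr.
  by rewrite !big_ord_recl big_ord0 /= e0 mul0r add0r addr0 expr1.
exists (a 3%N / tpi), (a 5%N / tpi), (a 7%N / tpi); exists (M * 2 ^+ 9 * 2 / cabs tpi), (4^-1);
    split; try lra.
  by rewrite divr_ge0 ?cabs_ge0 // !mulr_ge0 // exprn_ge0.
move=> z z0 zr; have P0 := tpi_ne0 R.
have e1 := E 9%N z zr; have e2 := E 9%N (- z) ltac:(by rewrite cabsN).
(* [ss] is odd, so antisymmetrizing its expansion removes the even powers; order 9 then leaves z,
   z^3, z^5 and z^7. *)
have -> : gs z - jpol 1 (a 3%N / tpi) (a 5%N / tpi) (a 7%N / tpi) z =
  ((ss z - \sum_(n < 9) a n * z ^+ n) - (ss (- z) - \sum_(n < 9) a n * (- z) ^+ n)) / (2 * tpi * z).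
  rewrite /gs /jpol ssN !big_ord_recr !big_ord0 /= a1; field; by rewrite P0 z0.
rewrite cabsM cabsV !cabsM cabs_nat; have cz : 0 < cabs z by rewrite cabs_gt0.
have cP : 0 < cabs tpi by rewrite cabs_gt0.
rewrite ler_pdivrMr ?mulr_gt0 //; have -> : M * 2 ^+ 9 * 2 / cabs tpi * cabs z ^+ 8 *
    (2 * cabs tpi * cabs z) = 2 * (M * 2 ^+ 9 * 2 * cabs z ^+ 9).
  by rewrite [cabs z ^+ 9]exprSr; field; rewrite gt_eqF.
apply: le_trans (cabsB _ _) _; rewrite cabsN in e2; lra.
Qed.

Lemma ss_dup (z : C) : ss (2 * z) ^+ 2 = ss z ^+ 2 * (4 + ss z ^+ 2).
Proof.
rewrite !ss2 (e2piMn z 2%N) !e2piN (e2piMn z 2%N); have := e2pi_ne0 z; move: (e2pi z) => x x0.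
by field.
Qed.

(* The coefficients are forced by the duplication formula [ss_dup]. *)
Lemma jet_gs : jet gs 1 (tpi ^+ 2 / 24) (tpi ^+ 4 / 1920) (tpi ^+ 6 / (504 * 640)).
Proof.
have [b [c [d h]]] := jet_gs0; have P0 := tpi_ne0 R.
have hW := jetM h h; have hd := jet_dil (s := 2) ltac:(by rewrite pnatr_eq0) hW.
have h1 := jetM (jet_const 4) hd.
have h2 := jetM hW (jetD (jet_const 4) (jetM (jet_const (tpi ^+ 2)) (jet_sq hW))).
have h3 := @jet_ext _ (fun z => 4 * (gs (2 * z) * gs (2 * z))) _ _ _ _ 1 ltr01 _ h2.
have [|_ eb ec ed] := jet_unique h1 (h3 _).
  move=> z z0 _; rewrite /gs; have hh := ss_dup z.
  transitivity (ss z ^+ 2 * (4 + ss z ^+ 2) / (tpi ^+ 2 * z ^+ 2)); first by field; rewrite P0 z0.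
  by rewrite -hh; field; rewrite P0 z0.
have c2 : (2 : C) != 0 by rewrite pnatr_eq0.
have b' : b = tpi ^+ 2 / 24.
  have : b * 24 = tpi ^+ 2 by apply/eqP; rewrite -subr_eq0; apply/eqP; move/eqP: eb;
      rewrite -subr_eq0 => /eqP <-; ring.
  by move=> <-; rewrite mulfK // pnatr_eq0.
have c' : c = tpi ^+ 4 / 1920.
  have : c * 120 = 4 * b * tpi ^+ 2 - 60 * b ^+ 2.
    by apply/eqP; rewrite -subr_eq0; apply/eqP; move/eqP: ec; rewrite -subr_eq0 => /eqP <-; ring.
  by rewrite b' => e; apply: (@mulIf _ (120 : C)); rewrite ?pnatr_eq0 // e; field.
have d' : d = tpi ^+ 6 / (504 * 640).
  have : d * 504 = tpi ^+ 2 * (4 * c + 6 * b ^+ 2) - 504 * b * c.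
    by apply/eqP; rewrite -subr_eq0; apply/eqP; move/eqP: ed; rewrite -subr_eq0 => /eqP <-; ring.
  by rewrite b' c' => e; apply: (@mulIf _ (504 : C)); rewrite ?pnatr_eq0 // e; field.
by rewrite -b' -c' -d'.
Qed.

(** The coefficients of w^2 and w^3 in exp w are forced by exp(2 w) = exp(w)^2, compared through
    jets in z with w = z^2. *)
Lemma jet_exp (k : C) : jet (fun z => cexp (k * z ^+ 2)) 1 k (k ^+ 2 / 2) (k ^+ 3 / 6).
Proof.
have [a [M [M0 E]]] := taylor0 (@cder_cexp R).
have a0 : a 0%N = 1.
  have := E 1%N 0 ltac:(rewrite cabs0; lra); rewrite big_ord1 cexp0 cabs0 expr1 mulr0 expr0 mulr1.
  by move=> h; apply/eqP; rewrite eq_sym -subr_eq0 -cabs_eq0 eq_le h cabs_ge0.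
have a1 : a 1%N = 1.
  rewrite -cexp0; apply: cdiff_unique (cdiff_cexp 0);
      apply: (@cdiff_quad R _ _ _ 4^-1 (M * 2 ^+ 2 * 2)).
  - by rewrite invr_gt0.
  - by rewrite !mulr_ge0.
  move=> w; rewrite !subr0 => wr; have := E 2%N w wr.
  by rewrite !big_ord_recl big_ord0 /= a0 mul1r cexp0 addr0 expr0 expr1 opprD addrA.
have J (l : C) : l != 0 -> jet (fun z => cexp (l * z ^+ 2)) 1 l (l ^+ 2 * a 2%N) (l ^+ 3 * a 3%N).
  move=> l0; have cl : 0 < cabs l by rewrite cabs_gt0.
  exists (M * 2 ^+ 4 * 2 * cabs l ^+ 4), (Num.min 2^-1 (4^-1 / cabs l)); split.
  - by rewrite !mulr_ge0 ?exprn_ge0 ?cabs_ge0.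
  - by rewrite lt_min; apply/andP; split; [lra|apply: divr_gt0 => //; lra].
  - by rewrite ge_min; apply/orP; left; lra.
  move=> z z0; rewrite lt_min => /andP[z2]; rewrite ltr_pdivlMr // => zl.
  have lz : cabs (l * z ^+ 2) < 4^-1.
    by apply: le_lt_trans zl; rewrite cabsM cabsX mulrC ler_wpM2r ?(ltW cl) // expr2 ler_piMr
        ?cabs_ge0 //; lra.
  have := E 4%N _ lz; rewrite !big_ord_recr big_ord0 /= a0 a1 => h.
  have -> : M * 2 ^+ 4 * 2 * cabs l ^+ 4 * cabs z ^+ 8 = M * 2 ^+ 4 * 2 * cabs (l * z ^+ 2) ^+ 4 by
      rewrite cabsM cabsX; ring.
  by move: h; rewrite (_ : 0 + _ + _ + _ + _ = jpol 1 l (l ^+ 2 * a 2%N) (l ^+ 3 * a 3%N) z) //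
      /jpol; ring.
have j1 := J 1 (oner_neq0 _); have j2 := J 2 ltac:(by rewrite pnatr_eq0).
have j3 := @jet_ext _ (fun z => cexp (2 * z ^+ 2)) _ _ _ _ 1 ltr01 _ (jetM j1 j1).
have [|_ _ e2 e3] := jet_unique j2 (j3 _).
  by move=> z _ _; rewrite -cexpD; congr cexp; ring.
have a2 : a 2%N = 2^-1.
  apply: (@mulIf _ (2 : C)); rewrite ?pnatr_eq0 // mulVf ?pnatr_eq0 //; apply/eqP;
      rewrite -subr_eq0; apply/eqP.
  by move/eqP: e2; rewrite -subr_eq0 => /eqP <-; ring.
have a3 : a 3%N = 6^-1.
  apply: (@mulIf _ (6 : C)); rewrite ?pnatr_eq0 // mulVf ?pnatr_eq0 //.
  have : a 3%N * 6 = 2 * a 2%N by apply/eqP; rewrite -subr_eq0; apply/eqP; move/eqP: e3;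
      rewrite -subr_eq0 => /eqP <-; ring.
  by rewrite a2 mulfV ?pnatr_eq0.
have [->|k0] := eqVneq k 0; last by rewrite -a2 -a3; exact: J.
have := @jet_ext _ (fun z => cexp (0 * z ^+ 2)) _ _ _ _ 1 ltr01 _ (jet_const 1);
    rewrite !expr0n !mul0r; apply => z _ _.
by rewrite mul0r cexp0.
Qed.

Definition ps (u : nat -> C) i N : C := \sum_(n < N) u n ^+ i.
Lemma psS u i N : ps u i N.+1 = ps u i N + u N ^+ i.
Proof. by rewrite /ps big_ord_recr. Qed.

(* The elementary symmetric functions in terms of the power sums (Newton). *)
Definition el2 (p1 p2 : C) : C := (p1 ^+ 2 - p2) / 2.
Definition el3 (p1 p2 p3 : C) : C := (p1 ^+ 3 - 3 * p1 * p2 + 2 * p3) / 6.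

(** The coefficients of the product of the 1 - w u_n are elementary symmetric functions. The
    quantity [B N] dominates the first three of them and the remainder together, so that one
    induction on [N] suffices and the final bound does not depend on [N]. *)
Lemma pprod_jet (u : nat -> C) (K r : R) : 0 <= K -> 0 <= r < 1 ->
    (forall n, cabs (u n) <= K * r ^+ n) ->
  exists2 B : R, 0 <= B & forall N w, cabs w <= 1 ->
   cabs (pprod (fun n => - w * u n) N - (1 - ps u 1 N * w + el2 (ps u 1 N) (ps u 2 N) * w ^+ 2 - el3
       (ps u 1 N) (ps u 2 N) (ps u 3 N) * w ^+ 3)) <= B * cabs w ^+ 4.
Proof.
move=> K0 r01 hu; pose B N := expR (\sum_(n < N) (2 * K) * r ^+ n).
exists (expR (2 * K / (1 - r))); first exact: expR_ge0.
have BS N : B N * (1 + 2 * cabs (u N)) <= B N.+1.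
  rewrite /B big_ord_recr /= expRD ler_wpM2l ?expR_ge0 //; apply: le_trans (expR_ge1Dx _).
  by rewrite lerD2l -mulrA ler_wpM2l.
have B0 N : 0 <= B N by exact: expR_ge0.
suff h N : [/\ cabs (ps u 1 N) <= B N, cabs (el2 (ps u 1 N) (ps u 2 N)) <= B N,
    cabs (el3 (ps u 1 N) (ps u 2 N) (ps u 3 N)) <= B N &
   forall w, cabs w <= 1 -> cabs (pprod (fun n => - w * u n) N - (1 - ps u 1 N * w + el2 (ps u 1 N)
       (ps u 2 N) * w ^+ 2 - el3 (ps u 1 N) (ps u 2 N) (ps u 3 N) * w ^+ 3)) <= B N * cabs w ^+ 4].
  move=> N w w1; have [_ _ _ hN] := h N; apply: le_trans (hN w w1) _;
      rewrite ler_wpM2r ?exprn_ge0 ?cabs_ge0 //.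
  by apply: expR_sum_le => //; rewrite mulr_ge0.
elim: N => [|N [h1 h2 h3 h4]].
  have p0 i : ps u i 0 = 0 by rewrite /ps big_ord0.
  have l2 : el2 0 0 = 0 by rewrite /el2; ring.
  have l3 : el3 0 0 0 = 0 by rewrite /el3; ring.
  rewrite !p0 l2 l3 cabs0; split => // w _; rewrite /pprod big_ord0 (_ : _ - _ = 0); last by ring.
  by rewrite cabs0 mulr_ge0 // exprn_ge0 ?cabs_ge0.
have := BS N; set x := u N; set b := B N; set b' := B N.+1 => hb.
have s2 : el2 (ps u 1 N.+1) (ps u 2 N.+1) = el2 (ps u 1 N) (ps u 2 N) + x * ps u 1 N by rewrite /el2
    !psS -/x; field.
have s3 : el3 (ps u 1 N.+1) (ps u 2 N.+1) (ps u 3 N.+1) = el3 (ps u 1 N) (ps u 2 N) (ps u 3 N) + x *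
    el2 (ps u 1 N) (ps u 2 N).
  by rewrite /el3 /el2 !psS -/x; field.
have s1 : ps u 1 N.+1 = ps u 1 N + x by rewrite psS expr1.
rewrite s2 s3 s1; move: h1 h2 h3 h4; move: (ps u 1 N) (el3 (ps u 1 N) (ps u 2 N) (ps u 3 N))
    (el2 (ps u 1 N) (ps u 2 N)) => e1 e3 e2; rewrite -/b => h1 h2 h3 h4.
have x0 := cabs_ge0 x; have b0 : 0 <= b := B0 N; have b1 : 1 <= b.
  rewrite /b /B -expR0 ler_expR; apply: sumr_ge0 => i _; have /andP[r0 _] := r01.
  by rewrite !mulr_ge0 // exprn_ge0.
have c2 (y : C) : cabs y <= b -> cabs (x * y) <= b * cabs x by move=> hy;
    rewrite cabsM mulrC ler_wpM2r.
split.
- have := cabsD e1 x; have : cabs x <= b * cabs x by rewrite ler_peMl.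
  nra.
- have := cabsD e2 (x * e1); have := c2 _ h1; nra.
- have := cabsD e3 (x * e2); have := c2 _ h2; nra.
move=> w w1; have := h4 w w1; rewrite pprodS -/x; move: (pprod _ N) => p; set E := p - _ => hE.
have -> : p * (1 + - w * x) - (1 - (e1 + x) * w + (e2 + x * e1) * w ^+ 2 - (e3 + x * e2) * w ^+ 3) =
    E - E * x * w + x * e3 * w ^+ 4 by rewrite /E; ring.
have t1 : cabs (E * x * w) <= cabs E * cabs x by rewrite -cabsM; exact: (cabs_X1 (E * x) 1 w1).
have t2 := cabsD (E - E * x * w) (x * e3 * w ^+ 4); have t3 := cabsB E (E * x * w).
rewrite (cabsM (x * e3)) cabsX in t2; have t4 := c2 _ h3; have w4 : 0 <= cabs w ^+ 4 by rewrite
    exprn_ge0 ?cabs_ge0.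
move: hb w4 hE t1 t2 t3 t4; move: (cabs w ^+ 4) (cabs E) (cabs x) x0 => W e y y0 hb w4 hE t1 t2 t3
    t4.
have k1 := ler_wpM2r w4 hb; have k2 := ler_wpM2r w4 t4; have k3 := ler_wpM2r y0 hE; lra.
Qed.

Section Theta.
Variables (t S1 S2 S3 : C).
Hypothesis ht : 0 < complex.Im t.
Hypothesis c1 : ccvg (ps (Qn (e2pi t)) 1) S1.
Hypothesis c2 : ccvg (ps (Qn (e2pi t)) 2) S2.
Hypothesis c3 : ccvg (ps (Qn (e2pi t)) 3) S3.

Lemma tprod_jet : exists2 B : R, 0 <= B & forall z, cabs (ss z ^+ 2) <= 1 ->
  cabs (tprod t z - (1 - S1 * ss z ^+ 2 + el2 S1 S2 * (ss z ^+ 2) ^+ 2 - el3 S1 S2 S3 *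
      (ss z ^+ 2) ^+ 3)) <= B * cabs (ss z ^+ 2) ^+ 4.
Proof.
have q1 : cabs (e2pi t) < 1 by rewrite e2pi_lt1.
have q01 : 0 <= cabs (e2pi t) < 1 by rewrite cabs_ge0.
have K0 : 0 <= cabs (e2pi t) / (1 - cabs (e2pi t)) ^+ 2 by rewrite divr_ge0 ?sqr_ge0 ?cabs_ge0.
have [B B0 hB] := pprod_jet K0 q01 (fun n => Qn_bd n q1); exists B => // z z1.
set w := ss z ^+ 2 in z1 *.
apply: (ccvg_le (u := fun N => pprod (tfac t z) N - (1 - ps (Qn (e2pi t)) 1 N * w +
    el2 (ps (Qn (e2pi t)) 1 N) (ps (Qn (e2pi t)) 2 N) * w ^+ 2 - el3 (ps (Qn (e2pi t)) 1 N)
    (ps (Qn (e2pi t)) 2 N) (ps (Qn (e2pi t)) 3 N) * w ^+ 3))).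
  by exists 0%N => n _; exact: hB.
have cw (u : nat -> C) l (y : C) : ccvg u l -> ccvg (fun n => u n * y) (l * y) by move=> h;
    apply: ccvgM => //; exact: ccvg_const.
apply: ccvgB; first exact: tprod_cvg.
apply: ccvgB; last first.
  apply: (cw); apply: (cw); apply: ccvgD; last exact: ccvgZ.
  apply: ccvgB; last by apply: ccvgM => //; exact: ccvgZ.
  apply: (ccvg_ext (u := fun n => ps (Qn (e2pi t)) 1 n * (ps (Qn (e2pi t)) 1 n * ps (Qn (e2pi t)) 1
      n))) => [n|]; first by ring.
  by rewrite (_ : S1 ^+ 3 = S1 * (S1 * S1)); [do 2 apply: ccvgM => //|ring].
apply: ccvgD; last first.
  apply: (cw); apply: (cw); apply: ccvgB => //.
  apply: (ccvg_ext (u := fun n => ps (Qn (e2pi t)) 1 n * ps (Qn (e2pi t)) 1 n)) => [n|];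
      first by rewrite expr2.
  by rewrite expr2; exact: ccvgM.
apply: ccvgB; [exact: ccvg_const|exact: cw].
Qed.

(** [jA], [jB], [jD] are the coefficients of z^2, z^4, z^6 in theta(z) / (2 pi i z), expressed by
    power sums of the Q_n. *)
Definition jA : C := tpi ^+ 2 / 24 - S1 * tpi ^+ 2.
Definition jB : C := tpi ^+ 4 / 1920 - S1 * tpi ^+ 4 / 8 + el2 S1 S2 * tpi ^+ 4.
Definition jD : C := tpi ^+ 6 / (504 * 640) - tpi ^+ 6 * S1 * (13 / 1920) + tpi ^+ 6 * el2 S1 S2 *
    (5 / 24) - el3 S1 S2 S3 * tpi ^+ 6.

Lemma sq_le1 (L x : R) : 0 <= L -> 0 <= x -> x * (L + 1) < 1 -> L * x ^+ 2 <= 1.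
Proof. by move=> L0 x0 h; rewrite expr2; nra. Qed.
Lemma theta_jet : jet (fun z => theta t z / (tpi * z)) 1 jA jB jD.
Proof.
have P0 := tpi_ne0 R; have hg := jet_gs; have [B B0 hB] := tprod_jet.
have hW := jetM hg hg; have hw := jetM (jet_const (tpi ^+ 2)) (jet_sq hW).
have hw2 := jetM hw hw; have hw3 := jetM hw hw2.
have wE z : z != 0 -> tpi ^+ 2 * (z ^+ 2 * (gs z * gs z)) = ss z ^+ 2 by move=> z0; rewrite /gs;
    field; rewrite P0 z0.
have hF := jetD (jetD (jetD (jet_const 1) (jetM (jet_const (- S1)) hw))
    (jetM (jet_const (el2 S1 S2)) hw2)) (jetM (jet_const (- el3 S1 S2 S3)) hw3).
have [M [r [M0 r0 r1 hM]]] := jet_bd hW.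
have P2 : 0 <= cabs tpi ^+ 2 by rewrite exprn_ge0 ?cabs_ge0.
have L0 : 0 <= cabs tpi ^+ 2 * M by rewrite mulr_ge0.
have wb z : z != 0 -> cabs z < r -> cabs (ss z ^+ 2) <= cabs tpi ^+ 2 * M * cabs z ^+ 2.
  move=> z0 zr; rewrite -(wE z z0) (cabsM (tpi ^+ 2)) (cabsM (z ^+ 2)) !cabsX -mulrA ler_wpM2l //
      mulrC ler_wpM2r ?exprn_ge0 ?cabs_ge0 //.
  exact: hM.
have h1 : jet (tprod t) 1 (- S1 * tpi ^+ 2) (- S1 * tpi ^+ 4 / 12 + el2 S1 S2 * tpi ^+ 4)
    (- S1 * tpi ^+ 6 / 360 + el2 S1 S2 * tpi ^+ 6 / 6 - el3 S1 S2 S3 * tpi ^+ 6).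
  have r2 : 0 < Num.min r (cabs tpi ^+ 2 * M + 1)^-1 by rewrite lt_min r0 invr_gt0 ltr_wpDl.
  apply: (jet_err r2 (K := B * (cabs tpi ^+ 2 * M) ^+ 4)) (jet_eq _ _ _ _ hF); last first.
  - by field.
  - by field.
  - by ring.
  - by ring.
  move=> z z0; rewrite lt_min => /andP[zr]; rewrite -[X in _ < X]mul1r ltr_pdivlMr;
      last by rewrite ltr_wpDl.
  move=> zM; rewrite !wE //; have w1 := wb z z0 zr; have cz := cabs_ge0 z.
  have w2 : cabs (ss z ^+ 2) <= 1.
    exact: le_trans w1 (sq_le1 L0 cz zM).
  have := hB z w2; move: w1 w2; set w := ss z ^+ 2 => w1 w2;
      rewrite (_ : 1 + _ + _ + _ = 1 - S1 * w + el2 S1 S2 * w ^+ 2 - el3 S1 S2 S3 * w ^+ 3);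
      last by ring.
  move=> h; apply: le_trans h _; rewrite (exprM _ 2 4) -mulrA -exprMn ler_wpM2l //.
  by rewrite lerXn2r // nnegrE ?cabs_ge0 //; apply: le_trans w1; exact: cabs_ge0.
have e := @jet_ext _ (fun z => theta t z / (tpi * z)) _ _ _ _ 1 ltr01 _ (jetM hg h1).
apply: jet_eq (e _).
- by rewrite mul1r.
- by rewrite /jA; ring.
- by rewrite /jB; field.
- by rewrite /jD; field.
- by move=> z z0 _; rewrite /gs /theta mulrAC.
Qed.

End Theta.

(* The jets of theta(-1/t, z/t) and theta(t, z) differ by the exponential factor of the S-law, which
   only affects the z^2 coefficient of log (theta / z); its z^4 and z^6 coefficients are the
   Eisenstein series. *)
Lemma eisenstein_S (t S1 S2 S3 S1' S2' S3' : C) : 0 < complex.Im t ->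
  ccvg (ps (Qn (e2pi t)) 1) S1 -> ccvg (ps (Qn (e2pi t)) 2) S2 -> ccvg (ps (Qn (e2pi t)) 3) S3 ->
  ccvg (ps (Qn (e2pi (- t^-1))) 1) S1' -> ccvg (ps (Qn (e2pi (- t^-1))) 2) S2' ->
      ccvg (ps (Qn (e2pi (- t^-1))) 3) S3' ->
  1 + 240 * (S1' + 6 * S2') = t ^+ 4 * (1 + 240 * (S1 + 6 * S2)) /\
  1 - 504 * (S1' + 30 * S2' + 120 * S3') = t ^+ 6 * (1 - 504 * (S1 + 30 * S2 + 120 * S3)).
Proof.
move=> ht c1 c2 c3 d1 d2 d3; have t0 := Im_ne0 ht; have P0 := tpi_ne0 R.
have ti : t^-1 != 0 by rewrite invr_eq0.
have j1 := jetM (jet_exp (tpi / (2 * t))) (theta_jet ht c1 c2 c3).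
have j2 := jet_dil ti (theta_jet (Im_inv_gt0 ht) d1 d2 d3).
have [|_ eA eB eD] := jet_unique j2 (@jet_ext _ (fun z => theta (- t^-1) (t^-1 * z) /
    (tpi * (t^-1 * z))) _ _ _ _ 1 ltr01 _ j1).
  move=> z z0 _; rewrite [t^-1 * z]mulrC theta_S // (_ : e2pi _ = cexp (tpi / (2 * t) * z ^+ 2));
      last first.
    by rewrite /e2pi; congr cexp; rewrite -/tpi; field.
  by field; rewrite P0 z0 t0.
(* B - A^2 / 2 and D - A B + A^3 / 3 are the coefficients of z^4 and z^6 in the logarithm of the
   jet; the scalar factors normalize the constant terms to 1. *)
have l4 (p1 p2 : C) : 1 + 240 * (p1 + 6 * p2) = - (2880 / tpi ^+ 4) * (jB p1 p2 - jA p1 ^+ 2 / 2).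
  by rewrite /jB /jA /el2; field.
have l6 (p1 p2 p3 : C) : 1 - 504 * (p1 + 30 * p2 + 120 * p3) = (504 * 360 / tpi ^+ 6) *
    (jD p1 p2 p3 - jA p1 * jB p1 p2 + jA p1 ^+ 3 / 3).
  by rewrite /jD /jB /jA /el2 /el3; field.
rewrite !l4 !l6; move: eA eB eD; move: (jA S1) (jB S1 S2) (jD S1 S2 S3) (jA S1') (jB S1' S2')
    (jD S1' S2' S3') => A B D A' B' D' eA eB eD.
have kA : A' = t ^+ 2 * (1 * A + tpi / (2 * t) * 1) by rewrite -eA; field.
have kB : B' = t ^+ 4 * (1 * B + tpi / (2 * t) * A + (tpi / (2 * t)) ^+ 2 / 2 * 1) by rewrite -eB;
    field.
have kD : D' = t ^+ 6 * (1 * D + tpi / (2 * t) * B + (tpi / (2 * t)) ^+ 2 / 2 * A + (tpi / (2 * t))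
    ^+ 3 / 6 * 1) by rewrite -eD; field.
by rewrite kA kB kD; split; field; rewrite P0 t0.
Qed.

End Jets.

(** * Eisenstein series *)

Section Eis.
Variable R : realType.
Notation C := (CC R).

(** Write r = s x with r < s < 1: one factor n + 1 is absorbed by x^n, the other k by s^n through
    the induction hypothesis. *)
Lemma natpow_geo_bd k (r : R) : 0 <= r < 1 -> exists2 K : R, 0 <= K & forall n, n.+1%:R ^+ k *
    r ^+ n <= K.
Proof.
elim: k r => [|k IH] r /andP[r0 r1].
  by exists 1 => // n; rewrite expr0 mul1r exprn_ile1 // ltW.
pose s := (1 + r) / 2; have s0 : 0 < s by rewrite /s; lra.
have [|K K0 hK] := IH s; first by rewrite /s; lra.
pose x := r / s; have x01 : 0 <= x < 1 by rewrite /x divr_ge0 ?(ltW s0) //= ltr_pdivrMr // /s; lra.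
have /andP[x0 x1] := x01.
have lin n : n.+1%:R * x ^+ n <= (1 - x)^-1.
  have := @sum_geo_le R x 0 n.+1 x01; rewrite expr0 mul1r; apply: le_trans.
  rewrite big_mkord mulr_natl -[X in _ *+ X](card_ord n.+1) -sumr_const.
  apply: ler_sum => i _; apply: ler_wiXn2l => //; [exact: ltW|by rewrite -ltnS].
exists (K / (1 - x)); first by rewrite divr_ge0 // subr_ge0 ltW.
move=> n; have -> : r = s * x by rewrite /x mulrC divfK // gt_eqF.
rewrite exprSr exprMn mulrACA; apply: ler_pM => //; rewrite mulr_ge0 ?exprn_ge0 //; exact: ltW.
Qed.

Lemma natpow_geo_small k (r e : R) : 0 <= r < 1 -> 0 < e -> exists N, forall n, (N <= n)%N ->
    n.+1%:R ^+ k * r ^+ n < e.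
Proof.
move=> /andP[r0 r1] e0; pose s := (1 + r) / 2; have s0 : 0 < s by rewrite /s; lra.
pose x := r / s; have x01 : 0 <= x < 1 by rewrite /x divr_ge0 ?(ltW s0) //= ltr_pdivrMr // /s; lra.
have [K K0 hK] := natpow_geo_bd k x01; have K1 : 0 < K + 1 by lra.
have [|N hN] := @exprn_small R s (e / (K + 1)) _ (divr_gt0 e0 K1); first by rewrite /s; lra.
exists N => n nN; have -> : r = x * s by rewrite /x divfK // gt_eqF.
rewrite exprMn mulrA; apply: le_lt_trans (_ : K * s ^+ n < _).
  by rewrite ler_wpM2r ?hK // exprn_ge0 // ltW.
have := hN n nN; rewrite ltr_pdivlMr // => h; have : 0 <= s ^+ n by rewrite exprn_ge0 // ltW.
nra.
Qed.

Lemma cder_psum (c : nat -> C) N (q : C) : cder (fun q => \sum_(n < N) c n * q ^+ n) q.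
Proof.
elim: N => [|N IH].
  by apply: cder_ext (cder_const 0 q); exists 1 => // w _; rewrite big_ord0.
apply: cder_ext (cderD IH (cderM (cder_const (c N) q) (cderX N (cder_id q)))); exists 1 => // w _.
by rewrite big_ord_recr.
Qed.

Lemma psum_bd (c : nat -> C) (K r s : R) q : 0 <= K -> 0 <= r -> r < s ->
    (forall n, cabs (c n) * s ^+ n <= K) -> cabs q <= r ->
  (forall n, cabs (c n * q ^+ n) <= K * (r / s) ^+ n) /\ forall N, cabs (\sum_(n < N) c n * q ^+ n)
      <= K / (1 - r / s).
Proof.
move=> K0 r0 rs hK qr; have s0 : 0 < s by lra.
have x01 : 0 <= r / s < 1 by rewrite divr_ge0 ?(ltW s0) //= ltr_pdivrMr // mul1r.
have t n : cabs (c n * q ^+ n) <= K * (r / s) ^+ n.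
  rewrite cabsM cabsX; apply: le_trans (_ : cabs (c n) * r ^+ n <= _).
    by rewrite ler_wpM2l ?cabs_ge0 // lerXn2r ?nnegrE ?cabs_ge0.
  have -> : cabs (c n) * r ^+ n = cabs (c n) * s ^+ n * (r / s) ^+ n.
    by rewrite -mulrA -exprMn [s * _]mulrC divfK // gt_eqF.
  by rewrite ler_wpM2r // exprn_ge0 //; have /andP[] := x01.
split => // N; apply: le_trans (cabs_sum _ _ _) _;
    apply: (@le_trans _ _ (\sum_(n < N) K * (r / s) ^+ n)); first by apply: ler_sum => i _;
    exact: t.
rewrite -mulr_sumr; apply: ler_wpM2l => //; rewrite -(big_mkord xpredT (fun n => (r / s) ^+ n)).
by have := @sum_geo_le R (r / s) 0 N x01; rewrite expr0 mul1r.
Qed.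

Definition psum (c : nat -> C) (q : C) : C :=
    xget 0 [set l | ccvg (fun N => \sum_(n < N) c n * q ^+ n) l].

Section Pser.
Variable c : nat -> C.
Hypothesis hc : forall r : R, 0 <= r < 1 -> exists2 K : R, 0 <= K & forall n, cabs (c n) * r ^+ n <=
    K.

Lemma psum_cvg q : cabs q < 1 -> ccvg (fun N => \sum_(n < N) c n * q ^+ n) (psum c q).
Proof.
move=> q1; have q0 := cabs_ge0 q; pose s := (1 + cabs q) / 2.
have [|K K0 hK] := hc (r := s); first by rewrite /s; lra.
have [|t _] := @psum_bd c K (cabs q) s q K0 q0 _ hK (lexx _); first by rewrite /s; lra.
have s0 : 0 < s by rewrite /s; lra.
have x01 : 0 <= cabs q / s < 1 by rewrite divr_ge0 ?(ltW s0) //= ltr_pdivrMr // /s; lra.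
have [n|l hl _] := @ccvg_geo R (fun N => \sum_(n < N) c n * q ^+ n) K _ K0 x01.
  by rewrite big_ord_recr /= addrAC subrr add0r.
by rewrite /psum; case: xgetP => [l' -> //|/(_ l)].
Qed.

Lemma psum_cder q : cabs q < 1 -> cder (psum c) q.
Proof.
move=> q1; have q0 := cabs_ge0 q; pose rho := (1 - cabs q) / 4; pose r := cabs q + rho;
    pose s := r + rho.
have [|K K0 hK] := hc (r := s); first by rewrite /s /r /rho; lra.
have near z : cabs (z - q) < rho -> cabs z <= r by have := cabsD (z - q) q; rewrite subrK /r; lra.
have [r0 rs] : 0 <= r /\ r < s by rewrite /s /r /rho; lra.
apply: (@vitali1 R (fun N q => \sum_(n < N) c n * q ^+ n) _ q rho (K / (1 - r / s))).
- by rewrite /rho; lra.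
- by move=> n z _; exact: cder_psum.
- by move=> n z /near zr; have [_] := psum_bd K0 r0 rs hK zr; apply.
- by move=> z /near zr; apply: psum_cvg; move: zr; rewrite /r /rho; lra.
Qed.

Lemma psum_quad : exists2 K : R, 0 <= K & forall q, cabs q <= 2^-1 ->
    cabs (psum c q - c 0%N - c 1%N * q) <= K * cabs q ^+ 2.
Proof.
have [|K K0 hK] := hc (r := 3 / 4); first by lra.
exists (K * 16 / 9 * 3); first by lra.
move=> q q2; pose c' n := c n.+2.
have hK' n : cabs (c' n) * (3 / 4) ^+ n <= K * 16 / 9.
  have := hK n.+2; rewrite -addn2 exprD mulrA addn2 -/(c' n); lra.
have [_ hb] := @psum_bd c' (K * 16 / 9) 2^-1 (3 / 4) q ltac:(lra) ltac:(lra) ltac:(lra) hK' q2.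
apply: (ccvg_le (u := fun N => \sum_(n < N + 2) c n * q ^+ n - c 0%N - c 1%N * q)); last first.
  apply: ccvgB; last exact: ccvg_const.
  apply: ccvgB; last exact: ccvg_const.
  by apply: (ccvg_shift (u := fun N => \sum_(n < N) c n * q ^+ n)); apply: psum_cvg; lra.
exists 0%N => N _; rewrite addn2 !big_ord_recl /=.
rewrite (eq_bigr (fun i : 'I_N => q ^+ 2 * (c' i * q ^+ i))); last by move=> i _;
    rewrite /bump /= !add1n /c' !exprS expr0; ring.
rewrite -mulr_sumr expr0 mulr1 /bump /= addn0 expr1 (_ : _ - _ - _ = q ^+ 2 * \sum_(i < N) c' i *
    q ^+ i); last by ring.
rewrite cabsM cabsX mulrC ler_wpM2r ?exprn_ge0 ?cabs_ge0 //; apply: le_trans (hb N) _.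
have -> : (1 - 2^-1 / (3 / 4) : R) = 3^-1 by field.
by rewrite invrK.
Qed.

End Pser.

Lemma sigma_sum k m N : (0 < m <= N)%N -> sigma k m = (\sum_(d < N | d.+1 %| m) d.+1 ^ k)%N.
Proof.
move=> /andP[m0 mN]; rewrite /sigma -(big_mkord (fun d => d.+1 %| m)%N (fun d => d.+1 ^ k)%N).
rewrite -(big_add1 _ _ 0 N.+1 (fun d => d %| m)%N (fun d => d ^ k)%N) /= /index_iota subSS subn0.
rewrite -[RHS]big_filter; apply: perm_big; apply: uniq_perm.
- exact: divisors_uniq.
- by rewrite filter_uniq ?iota_uniq.
move=> d; rewrite -dvdn_divisors // mem_filter mem_iota add1n ltnS; case: (boolP (d %| m)%N) =>
    //= dm.
by rewrite (dvdn_gt0 m0 dm) /= (leq_trans (dvdn_leq m0 dm) mN).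
Qed.

Lemma sigma_le k m : (sigma k m.+1 <= m.+1 ^ k.+1)%N.
Proof.
rewrite (@sigma_sum k m.+1 m.+1) ?leqnn //.
apply: leq_trans (_ : \sum_(d < m.+1) m.+1 ^ k <= _)%N.
  rewrite big_mkcond; apply: leq_sum => d _; case: ifP => // _.
  by case: k => [|k]; rewrite ?expn0 // leq_exp2r.
by rewrite sum_nat_const card_ord expnS.
Qed.

Definition sgc k (n : nat) : C := if n is 0%N then 0 else (sigma k n)%:R.
Lemma sgc_bd k (r : R) : 0 <= r < 1 -> exists2 K : R, 0 <= K & forall n, cabs (sgc k n) * r ^+ n <=
    K.
Proof.
move=> r01; have [K K0 hK] := natpow_geo_bd k.+1 r01; exists K => // -[|n];
    [by rewrite cabs0 mul0r|apply: le_trans (hK n.+1); rewrite cabs_nat].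
apply: ler_wpM2r; first by apply: exprn_ge0; have /andP[] := r01.
by rewrite -natrX ler_nat; apply: leq_trans (sigma_le k n) _; rewrite leq_exp2r.
Qed.

Lemma sgc0 k : sgc k 0 = 0.
Proof. by []. Qed.
Lemma sgc1 k : sgc k 1 = 1.
Proof. by rewrite /sgc /sigma (_ : divisors 1 = [:: 1%N]) // big_seq1 exp1n. Qed.

Definition ES k (q : C) : C := psum (sgc k) q.

Lemma ES_cvg k q : cabs q < 1 -> ccvg (fun N => \sum_(j < N) (sigma k j.+1)%:R * q ^+ j.+1)
    (ES k q).
Proof.
move=> q1; apply: ccvg_ext (ccvg_shift 1 (psum_cvg (sgc_bd k) q1)) => N.
by rewrite addn1 big_ord_recl sgc0 mul0r add0r.
Qed.

Lemma reindex_mul (D N : nat) (F : nat -> C) : (0 < D)%N ->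
  \sum_(j < N | (D %| j.+1)%N) F j.+1 = \sum_(n < N | (n.+1 * D <= N)%N) F (n.+1 * D)%N.
Proof.
move=> D0; transitivity (\sum_(j < N) \sum_(n < N | (n.+1 * D == j.+1)%N) F j.+1).
  rewrite big_mkcond; apply: eq_bigr => j _; case: ifP => h.
    have /dvdnP[n e] := h; have n0 : (0 < n)%N by case: n e.
    have nN : (n.-1 < N)%N by rewrite prednK //; apply: leq_trans (ltn_ord j); rewrite e leq_pmulr.
    rewrite (big_pred1 (Ordinal nN)) // => i; rewrite e eqn_pmul2r // -[RHS]/(val i == n.-1).
    by rewrite -{1}(prednK n0) eqSS.
  rewrite big_pred0 // => i; apply/eqP => e; move: h; rewrite -e dvdn_mull //.
rewrite (exchange_big_dep xpredT) //= [RHS]big_mkcond; apply: eq_bigr => n _; case: ifP => h.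
  have m0 : (0 < n.+1 * D)%N by rewrite muln_gt0.
  have mN : ((n.+1 * D).-1 < N)%N by rewrite prednK.
  rewrite (big_pred1 (Ordinal mN)) /= ?prednK // => i; rewrite -[RHS]/(val i == (n.+1 * D).-1)
      -[RHS]eqSS prednK // eq_sym //.
rewrite big_pred0 // => j; apply/eqP => e; move: h; rewrite e ltn_ord //.
Qed.

(** Writing j + 1 = n d turns divisor sums into a sum over the lattice points under a hyperbola. *)
Lemma sigma_double k N (q : C) : \sum_(j < N) (sigma k j.+1)%:R * q ^+ j.+1 =
  \sum_(d < N) \sum_(n < N | (n.+1 * d.+1 <= N)%N) d.+1%:R ^+ k * (q ^+ n.+1) ^+ d.+1.
Proof.
transitivity (\sum_(j < N) \sum_(d < N | (d.+1 %| j.+1)%N) (d.+1%:R ^+ k * q ^+ j.+1 : C)).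
  apply: eq_bigr => j _; rewrite (@sigma_sum k j.+1 N) ?ltn_ord // natr_sum mulr_suml.
  by apply: eq_bigr => d _; rewrite natrX.
rewrite (exchange_big_dep xpredT) //=; apply: eq_bigr => d _.
rewrite (@reindex_mul d.+1 N (fun m => d.+1%:R ^+ k * q ^+ m)) //.
by apply: eq_bigr => n _; rewrite exprM.
Qed.

(** The sum of the [A n] runs over all d, that of sigma over n d <= N. Both are compared with the
    sum over a square of side N; each difference is of order N^(k + 2) |q|^N. *)
Lemma eis_double k (q : C) (A : nat -> C) S (K : R) : cabs q < 1 -> 0 <= K ->
  (forall n N, cabs (A n - \sum_(d < N) d.+1%:R ^+ k * (q ^+ n.+1) ^+ d.+1) <= K *
      (N.+1%:R ^+ k * cabs q ^+ N)) ->
  ccvg (fun N => \sum_(n < N) A n) S -> ES k q = S.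
Proof.
move=> q1 K0 hA hS; have q0 := cabs_ge0 q; apply: ccvg_unique (ES_cvg k q1) _.
apply: (ccvg_ext (u := fun N => \sum_(n < N) A n - (\sum_(n < N) A n - \sum_(j < N)
    (sigma k j.+1)%:R * q ^+ j.+1))) => [N|].
  by rewrite opprB addrC subrK.
rewrite -[S]subr0; apply: ccvgB => // e e0.
have K1 : 0 < K + 1 by lra.
have [|N hN] := @natpow_geo_small k.+2 (cabs q) (e / (K + 1)) _ (divr_gt0 e0 K1);
    first by rewrite q0.
exists N => n nN; rewrite subr0 sigma_double; have := hN n nN; rewrite ltr_pdivlMr // => h.
apply: le_lt_trans h; rewrite mulrDr mulr1.
set X := n.+1%:R ^+ k.+2 * cabs q ^+ n.
have n1 : 1 <= n.+1%:R :> R by rewrite ler1n.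
have nn : n%:R <= n.+1%:R :> R by rewrite ler_nat.
pose S2 := \sum_(m < n) \sum_(d < n) d.+1%:R ^+ k * (q ^+ m.+1) ^+ d.+1.
apply: le_trans (cabs_tri _ S2 _) _; apply: lerD.
  rewrite /S2 -sumrB; apply: le_trans (cabs_sum _ _ _) _.
  apply: (@le_trans _ _ (\sum_(i < n) K * (n.+1%:R ^+ k * cabs q ^+ n))); first by apply: ler_sum =>
      i _; exact: hA.
  rewrite sumr_const card_ord -[_ *+ n]mulr_natr (_ : K * (n.+1%:R ^+ k * cabs q ^+ n) * n%:R =
      n.+1%:R ^+ k * cabs q ^+ n * K * n%:R); last by ring.
  rewrite (_ : X * K = n.+1%:R ^+ k * cabs q ^+ n * K * n.+1%:R ^+ 2); last by rewrite /X !exprS;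
      ring.
  by apply: ler_wpM2l; [rewrite !mulr_ge0 ?exprn_ge0|rewrite expr2; nra].
have t (m d : nat) : (d < n)%N -> ~~ (m.+1 * d.+1 <= n)%N ->
    cabs (d.+1%:R ^+ k * (q ^+ m.+1) ^+ d.+1) <= n.+1%:R ^+ k * cabs q ^+ n.
  rewrite -ltnNge => dn md; rewrite cabsM !cabsX cabs_nat; apply: ler_pM; rewrite ?exprn_ge0 //.
    by rewrite lerXn2r ?nnegrE // ler_nat ltnS ltnW.
  by rewrite -exprM; apply: ler_wiXn2l => //; [exact: ltW|exact: ltnW].
rewrite /S2 exchange_big /= -sumrB; apply: le_trans (cabs_sum _ _ _) _.
apply: le_trans (_ : \sum_(i < n) n%:R * (n.+1%:R ^+ k * cabs q ^+ n) <= _).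
  apply: ler_sum => d _; rewrite (bigID (fun m : 'I_n => (m.+1 * d.+1 <= n)%N)) /= addrAC subrr
      add0r.
  apply: le_trans (cabs_sum _ _ _) _; apply:
      (@le_trans _ _ (\sum_(i < n | ~~ (i.+1 * d.+1 <= n)%N) n.+1%:R ^+ k * cabs q ^+ n)).
    by apply: ler_sum => i hi; exact: t.
  rewrite big_mkcond (_ : n%:R * _ = \sum_(i < n) n.+1%:R ^+ k * cabs q ^+ n);
      last by rewrite sumr_const card_ord mulr_natl.
  apply: ler_sum => i _.
  by case: ifP => // _; rewrite mulr_ge0 ?exprn_ge0.
rewrite sumr_const card_ord -[_ *+ n]mulr_natl mulrA /X (_ : n.+1%:R ^+ k.+2 * cabs q ^+ n =
    n.+1%:R * n.+1%:R * (n.+1%:R ^+ k * cabs q ^+ n)).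
  by rewrite ler_wpM2r ?mulr_ge0 ?exprn_ge0 //; apply: ler_pM.
by rewrite !exprS; ring.
Qed.

(* A_k(x) is the closed form of \sum_(d >= 1) d^k x^d. *)
Definition A0 (x : C) : C := x / (1 - x).
Definition A1 (x : C) : C := x / (1 - x) ^+ 2.
Definition A2 (x : C) : C := x * (1 + x) / (1 - x) ^+ 3.
Definition A3 (x : C) : C := A1 x + 6 * A1 x ^+ 2.
Definition A4 (x : C) : C := x * (1 + 11 * x + 11 * x ^+ 2 + x ^+ 3) / (1 - x) ^+ 5.
Definition A5 (x : C) : C := A1 x + 30 * A1 x ^+ 2 + 120 * A1 x ^+ 3.

(** The tail is x^N times the sum of (N + d)^3 x^d, expanded by the binomial theorem. *)
Lemma pow3_sum (x : C) N : 1 - x != 0 -> A3 x - \sum_(d < N) d.+1%:R ^+ 3 * x ^+ d.+1 =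
  x ^+ N * (N%:R ^+ 3 * A0 x + 3 * N%:R ^+ 2 * A1 x + 3 * N%:R * A2 x + A3 x).
Proof.
move=> x1; elim: N => [|N IH]; first by rewrite big_ord0; ring.
rewrite big_ord_recr /= opprD addrA IH -natr1 [x ^+ N.+1]exprS /A0 /A2 /A3 /A1; field; exact: x1.
Qed.

Lemma pow5_sum (x : C) N : 1 - x != 0 -> A5 x - \sum_(d < N) d.+1%:R ^+ 5 * x ^+ d.+1 =
  x ^+ N * (N%:R ^+ 5 * A0 x + 5 * N%:R ^+ 4 * A1 x + 10 * N%:R ^+ 3 * A2 x + 10 * N%:R ^+ 2 *
      A3 x + 5 * N%:R * A4 x + A5 x).
Proof.
move=> x1; elim: N => [|N IH]; first by rewrite big_ord0; ring.
rewrite big_ord_recr /= opprD addrA IH -natr1 [x ^+ N.+1]exprS /A0 /A2 /A3 /A4 /A5 /A1; field;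
    exact: x1.
Qed.

Lemma A_bd (r : R) : 0 <= r < 1 -> exists2 B : R, 0 <= B & forall x : C, cabs x <= r ->
  [/\ 1 - x != 0, cabs (A0 x) <= B, cabs (A1 x) <= B, cabs (A2 x) <= B &
      [/\ cabs (A3 x) <= B, cabs (A4 x) <= B & cabs (A5 x) <= B]].
Proof.
move=> /andP[r0 r1]; pose i := (1 - r)^-1; have i1 : 1 <= i by rewrite /i -invr1 lef_pV2 ?posrE
    ?ltr01 //; lra.
have i0 : 0 <= i by lra.
(* 151 = 1 + 30 + 120 is the coefficient sum of [A5], the largest of the six, and no denominator
   exceeds the sixth power of 1 - x. *)
exists (151 * i ^+ 6); first by rewrite mulr_ge0 // exprn_ge0.
have up n m (y : R) : 0 <= y -> y <= m -> (n <= 6)%N -> y * i ^+ n <= m * i ^+ 6.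
  by move=> y0 ym n6; apply: ler_pM => //; [exact: exprn_ge0|apply: ler_weXn2l].
move=> x xr; have c0 := cabs_ge0 x; have d : 1 - r <= cabs (1 - x) by have := cabsBB 1 x;
    rewrite cabs1; lra.
have d0 : 0 < cabs (1 - x) by lra.
have dn : 1 - x != 0 by rewrite -cabs_gt0.
have iv : cabs (1 - x)^-1 <= i by rewrite cabsV /i lef_pV2 ?posrE //; lra.
have ivn n : cabs ((1 - x) ^- n) <= i ^+ n by rewrite -exprVn cabsX lerXn2r ?nnegrE ?cabs_ge0.
have xn n : cabs (x ^+ n) <= 1 by rewrite cabsX exprn_ile1 //; lra.
have gen n m (y : C) : cabs y <= m -> (n <= 6)%N -> cabs (y / (1 - x) ^+ n) <= m * i ^+ 6.
  move=> ym n6; rewrite cabsM; apply: le_trans (up n m (cabs y) (cabs_ge0 _) ym n6).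
  by rewrite ler_wpM2l ?cabs_ge0.
have i6 : 0 <= i ^+ 6 by rewrite exprn_ge0.
have a1 : cabs (A1 x) <= 1 * i ^+ 6 by apply: gen => //; rewrite -(expr1 x).
have a0 : cabs (A0 x) <= 1 * i ^+ 6 by rewrite /A0 -[1 - x]expr1; apply: gen => //;
    rewrite -(expr1 x).
have sq n : (0 < n)%N -> (n.*2 <= 6)%N -> cabs (A1 x ^+ n) <= 1 * i ^+ 6.
  by move=> n0 n6; rewrite /A1 expr_div_n -exprM mul2n; apply: gen.
split => //; try lra.
  apply: (le_trans (gen 3%N 2 _ _ _)) => //; last lra.
  have := cabsD x (x ^+ 2); rewrite (_ : x * (1 + x) = x + x ^+ 2); last by ring.
  have := xn 2%N; lra.
split.
- have := cabsD (A1 x) (6 * A1 x ^+ 2); rewrite -/(A3 x) cabsM cabs_nat; have := sq 2%N isT isT;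
      lra.
- apply: (le_trans (gen 5%N 24 _ _ _)) => //; last lra.
  rewrite cabsM; have := xn 1%N; rewrite expr1 => x1.
  have b : cabs (1 + 11 * x + 11 * x ^+ 2 + x ^+ 3) <= 24.
    have := cabsD (1 + 11 * x + 11 * x ^+ 2) (x ^+ 3); have := cabsD (1 + 11 * x) (11 * x ^+ 2);
        have := cabsD 1 (11 * x).
    rewrite !(cabsM 11) cabs_nat cabs1; have := xn 2%N; have := xn 3%N; lra.
  by have := ler_pM c0 (cabs_ge0 _) x1 b; rewrite mul1r.
- have := cabsD (A1 x + 30 * A1 x ^+ 2) (120 * A1 x ^+ 3); have := cabsD (A1 x) (30 * A1 x ^+ 2);
      rewrite -/(A5 x) !(cabsM _ (A1 x ^+ _)) !cabs_nat.
  have := sq 2%N isT isT; have := sq 3%N isT isT; lra.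
Qed.

Lemma ps_cvg (q : C) k : cabs q < 1 -> exists S, ccvg (ps (Qn q) k.+1) S.
Proof.
move=> q1; have q01 : 0 <= cabs q < 1 by rewrite cabs_ge0.
pose K := cabs q / (1 - cabs q) ^+ 2; have K0 : 0 <= K by rewrite divr_ge0 ?sqr_ge0 ?cabs_ge0.
have [n|S hS _] := @ccvg_geo R (ps (Qn q) k.+1) (K ^+ k.+1) (cabs q) (exprn_ge0 _ K0) q01;
    last by exists S.
rewrite psS addrAC subrr add0r cabsX; have := Qn_bd n q1; rewrite -/K => h.
apply: le_trans (_ : (K * cabs q ^+ n) ^+ k.+1 <= _).
  by rewrite lerXn2r // nnegrE ?cabs_ge0 //; exact: le_trans (cabs_ge0 _) h.
rewrite exprMn ler_wpM2l ?exprn_ge0 // exprS ler_piMr ?exprn_ge0 ?cabs_ge0 //.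
by rewrite exprn_ile1 ?exprn_ge0 ?exprn_ile1 ?cabs_ge0 // ltW.
Qed.

(** Summing over d first gives A_3 and A_5 at the powers of q. These are polynomials in A_1, and
    A_1(q^(n + 1)) is [Qn q n]; this ties the Eisenstein series to the Taylor coefficients of
    theta. *)
Lemma ES_ps (q : C) S1 S2 S3 : cabs q < 1 -> ccvg (ps (Qn q) 1) S1 -> ccvg (ps (Qn q) 2) S2 ->
    ccvg (ps (Qn q) 3) S3 ->
  ES 3 q = S1 + 6 * S2 /\ ES 5 q = S1 + 30 * S2 + 120 * S3.
Proof.
move=> q1 c1 c2 c3; have q0 := cabs_ge0 q; have q01 : 0 <= cabs q < 1 by rewrite q0.
have [B B0 hB] := A_bd q01; have qn n : cabs (q ^+ n.+1) <= cabs q.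
  by rewrite cabsX exprS ler_piMr // exprn_ile1 // ltW.
have n1 (N : nat) : 1 <= N.+1%:R :> R by rewrite ler1n.
have pw (N i j : nat) : (i <= j)%N -> cabs ((N%:R : C) ^+ i) <= N.+1%:R ^+ j.
  move=> ij; rewrite cabsX cabs_nat; apply: le_trans (_ : N.+1%:R ^+ i <= _).
    by rewrite lerXn2r ?nnegrE // ler_nat.
  by apply: ler_weXn2l.
have xN n N : cabs ((q ^+ n.+1) ^+ N) <= cabs q ^+ N by rewrite cabsX lerXn2r ?nnegrE ?cabs_ge0 ?qn.
have tm (N i j m : nat) (y : C) : (i <= j)%N -> cabs y <= B -> cabs (m%:R * N%:R ^+ i * y) <= m%:R *
    (B * N.+1%:R ^+ j).
  move=> ij yB; rewrite !cabsM cabs_nat -mulrA ler_wpM2l // mulrC; apply: ler_pM;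
      rewrite ?cabs_ge0 //; exact: pw.
split.
- apply: (@eis_double 3 q (fun n => A3 (q ^+ n.+1)) _ (B * 8)) => //; first by rewrite mulr_ge0.
  + move=> n N; have [x1 a0 a1 a2 [a3 _ _]] := hB _ (qn n); rewrite pow3_sum // cabsM mulrC.
    have -> : B * 8 * (N.+1%:R ^+ 3 * cabs q ^+ N) = 8 * (B * N.+1%:R ^+ 3) * cabs q ^+ N by ring.
    apply: ler_pM; rewrite ?cabs_ge0 //.
    have := tm N 3%N 3%N 1%N _ isT a0; have := tm N 2%N 3%N 3%N _ isT a1;
        have := tm N 1%N 3%N 3%N _ isT a2; have := tm N 0%N 3%N 1%N _ isT a3.
    rewrite expr0 expr1 !mul1r => h1 h2 h3 h4.
    set u := cabs (_ + _).
    have := cabsD (N%:R ^+ 3 * A0 (q ^+ n.+1) + 3 * N%:R ^+ 2 * A1 (q ^+ n.+1) + 3 * N%:R *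
        A2 (q ^+ n.+1)) (A3 (q ^+ n.+1)).
    have := cabsD (N%:R ^+ 3 * A0 (q ^+ n.+1) + 3 * N%:R ^+ 2 * A1 (q ^+ n.+1))
        (3 * N%:R * A2 (q ^+ n.+1)).
    have := cabsD (N%:R ^+ 3 * A0 (q ^+ n.+1)) (3 * N%:R ^+ 2 * A1 (q ^+ n.+1)).
    rewrite -/u; lra.
  + apply: (ccvg_ext (u := fun N => ps (Qn q) 1 N + 6 * ps (Qn q) 2 N)) => [N|];
        last by apply: ccvgD => //; exact: ccvgZ.
    by rewrite /ps mulr_sumr -big_split; apply: eq_bigr => n _; rewrite expr1.
- apply: (@eis_double 5 q (fun n => A5 (q ^+ n.+1)) _ (B * 32)) => //; first by rewrite mulr_ge0.
  + move=> n N; have [x1 a0 a1 a2 [a3 a4 a5]] := hB _ (qn n); rewrite pow5_sum // cabsM mulrC.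
    have -> : B * 32 * (N.+1%:R ^+ 5 * cabs q ^+ N) = 32 * (B * N.+1%:R ^+ 5) * cabs q ^+ N by ring.
    apply: ler_pM; rewrite ?cabs_ge0 //.
    have := tm N 5%N 5%N 1%N _ isT a0; have := tm N 4%N 5%N 5%N _ isT a1;
        have := tm N 3%N 5%N 10%N _ isT a2; have := tm N 2%N 5%N 10%N _ isT a3.
    have := tm N 1%N 5%N 5%N _ isT a4; have := tm N 0%N 5%N 1%N _ isT a5.
    rewrite expr0 expr1 !mul1r => h1 h2 h3 h4 h5 h6.
    set u := cabs (_ + _).
    have := cabsD (N%:R ^+ 5 * A0 (q ^+ n.+1) + 5 * N%:R ^+ 4 * A1 (q ^+ n.+1) + 10 * N%:R ^+ 3 *
        A2 (q ^+ n.+1) + 10 * N%:R ^+ 2 * A3 (q ^+ n.+1) + 5 * N%:R * A4 (q ^+ n.+1))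
        (A5 (q ^+ n.+1)).
    have := cabsD (N%:R ^+ 5 * A0 (q ^+ n.+1) + 5 * N%:R ^+ 4 * A1 (q ^+ n.+1) + 10 * N%:R ^+ 3 *
        A2 (q ^+ n.+1) + 10 * N%:R ^+ 2 * A3 (q ^+ n.+1)) (5 * N%:R * A4 (q ^+ n.+1)).
    have := cabsD (N%:R ^+ 5 * A0 (q ^+ n.+1) + 5 * N%:R ^+ 4 * A1 (q ^+ n.+1) + 10 * N%:R ^+ 3 *
        A2 (q ^+ n.+1)) (10 * N%:R ^+ 2 * A3 (q ^+ n.+1)).
    have := cabsD (N%:R ^+ 5 * A0 (q ^+ n.+1) + 5 * N%:R ^+ 4 * A1 (q ^+ n.+1))
        (10 * N%:R ^+ 3 * A2 (q ^+ n.+1)).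
    have := cabsD (N%:R ^+ 5 * A0 (q ^+ n.+1)) (5 * N%:R ^+ 4 * A1 (q ^+ n.+1)).
    rewrite -/u; lra.
  + apply: (ccvg_ext (u := fun N => ps (Qn q) 1 N + 30 * ps (Qn q) 2 N + 120 * ps (Qn q) 3 N)) =>
        [N|].
      by rewrite /ps !mulr_sumr -!big_split; apply: eq_bigr => n _; rewrite expr1.
    by apply: ccvgD; [apply: ccvgD => //|]; exact: ccvgZ.
Qed.

Definition e4 (t : C) : C := 1 + 240 * ES 3 (e2pi t).
Definition e6 (t : C) : C := 1 - 504 * ES 5 (e2pi t).

Lemma eis_mod (t : C) : 0 < complex.Im t -> e4 (- t^-1) = t ^+ 4 * e4 t /\ e6 (- t^-1) = t ^+ 6 *
    e6 t.
Proof.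
move=> ht; have ht' := Im_inv_gt0 ht; have q1 : cabs (e2pi t) < 1 by rewrite e2pi_lt1.
have q1' : cabs (e2pi (- t^-1)) < 1 by rewrite e2pi_lt1.
have [S1 c1] := ps_cvg 0 q1; have [S2 c2] := ps_cvg 1 q1; have [S3 c3] := ps_cvg 2 q1.
have [S1' d1] := ps_cvg 0 q1'; have [S2' d2] := ps_cvg 1 q1'; have [S3' d3] := ps_cvg 2 q1'.
have [h3 h5] := ES_ps q1 c1 c2 c3; have [h3' h5'] := ES_ps q1' d1 d2 d3.
by rewrite /e4 /e6 h3 h5 h3' h5'; exact: eisenstein_S.
Qed.

Lemma cder_ES k (t : C) : 0 < complex.Im t -> cder (fun t => ES k (e2pi t)) t.
Proof.
by move=> ht; apply: cder_comp (cder_e2pi t); apply: psum_cder; [exact: sgc_bd|rewrite e2pi_lt1].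
Qed.

Lemma q_half (t : C) : 1 < complex.Im t -> cabs (e2pi t) <= 2^-1.
Proof.
move=> ht; rewrite cabs_e2pi expRN lef_pV2 ?posrE ?expR_gt0 //; apply: le_trans (expR_ge1Dx _).
have := pi_ge2 R; nra.
Qed.

Lemma ES_bd k : exists M : R, forall t : C, 1 < complex.Im t -> cabs (ES k (e2pi t)) <= M.
Proof.
have [M _ hM] := @disc_bd1 R (ES k) 2^-1 ltac:(lra) (psum_cder (sgc_bd k)).
by exists M => t /q_half; exact: hM.
Qed.

Lemma MF_e4 : MF 4%:Z e4.
Proof.
split.
- by move=> t ht; apply: cderD; [exact: cder_const|apply: cderM;
      [exact: cder_const|exact: cder_ES]].
- by move=> t _; rewrite /e4 e2pi_per.
- by move=> t ht; have [] := eis_mod ht.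
- have [M hM] := ES_bd 3; exists (1 + 240 * M), 1 => t /hM h; apply: le_trans (cabsD _ _) _.
  by rewrite cabsM cabs1 cabs_nat; lra.
Qed.

Lemma MF_e6 : MF 6%:Z e6.
Proof.
split.
- move=> t ht; apply: cderD; [exact: cder_const|apply: cderN; apply: cderM;
      [exact: cder_const|exact: cder_ES]].
- by move=> t _; rewrite /e6 e2pi_per.
- by move=> t ht; have [] := eis_mod ht.
- have [M hM] := ES_bd 5; exists (1 + 504 * M), 1 => t /hM h; apply: le_trans (cabsB _ _) _.
  by rewrite cabsM cabs1 cabs_nat; lra.
Qed.

Lemma e4_exp : exists K : R, forall t : C, 1 < complex.Im t -> cabs (e4 t - 1 - 240 * e2pi t) <= K *
    cabs (e2pi t) ^+ 2.
Proof.
have [K _ hK] := psum_quad (sgc_bd 3); exists (240 * K) => t /q_half/hK;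
    rewrite sgc0 sgc1 subr0 mul1r => h.
have -> : e4 t - 1 - 240 * e2pi t = 240 * (ES 3 (e2pi t) - e2pi t) by rewrite /e4; ring.
by rewrite cabsM cabs_nat -mulrA ler_wpM2l.
Qed.

Lemma e6_exp : exists K : R, forall t : C, 1 < complex.Im t -> cabs (e6 t - 1 + 504 * e2pi t) <= K *
    cabs (e2pi t) ^+ 2.
Proof.
have [K _ hK] := psum_quad (sgc_bd 5); exists (504 * K) => t /q_half/hK;
    rewrite sgc0 sgc1 subr0 mul1r => h.
have -> : e6 t - 1 + 504 * e2pi t = - (504 * (ES 5 (e2pi t) - e2pi t)) by rewrite /e6; ring.
by rewrite cabsN cabsM cabs_nat -mulrA; apply: ler_wpM2l; [exact: ler0n|exact: h].
Qed.

Lemma MF_gen k f : MF k f -> exists p : {poly {poly C}}, forall t : C, 0 < complex.Im t ->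
    f t = p.[e4 t, e6 t].
Proof. exact: (MF_ring MF_e4 MF_e6 e4_exp e6_exp). Qed.

End Eis.

(** * Weak Jacobi forms in coordinates *)

Section JSpace.
Variable R : realType.
Notation C := (CC R).
Notation C3 := (C3 R).
Opaque theta.

Definition jc (g d : int) (t : C) : C := g%:~R * t + d%:~R.
Definition mob (a b g d : int) (t : C) : C := (a%:~R * t + b%:~R) / jc g d t.

Lemma Im_div (z w : C) : complex.Im (z / w) = (complex.Im z * complex.Re w - complex.Re z *
    complex.Im w) / cabs w ^+ 2.
Proof. by case: z w => x y [u v]; rewrite ImM cabs_sq /=; ring. Qed.
Lemma jc_ne0 (a b g d : int) (t : C) : 0 < complex.Im t -> a * d - b * g = 1 -> jc g d t != 0.
Proof.
move=> ht det; apply/eqP => j0; have := congr1 (@complex.Im R) j0;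
    have := congr1 (@complex.Re R) j0.
rewrite /jc !ReD !ImD !ReM !ImM !Re_int !Im_int !mul0r !subr0 !addr0 => e1 e2.
have g0 : g = 0 by apply/eqP; move/eqP: e2; rewrite mulf_eq0 (gt_eqF ht) orbF intr_eq0.
move: e1 det; rewrite g0 mulr0z mul0r add0r => /eqP; rewrite intr_eq0 => /eqP ->.
by rewrite !mulr0 subrr.
Qed.

Lemma mob_im (a b g d : int) (t : C) : 0 < complex.Im t -> a * d - b * g = 1 -> 0 < complex.Im
    (mob a b g d t).
Proof.
move=> ht det; have j0 := jc_ne0 ht det; rewrite /mob Im_div divr_gt0 ?exprn_gt0 ?cabs_gt0 //.
rewrite /jc !ReD !ImD !ReM !ImM !Re_int !Im_int !mul0r !subr0 !addr0.
have dR : a%:~R * d%:~R - b%:~R * g%:~R = 1 :> R by rewrite -!intrM -intrB det.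
rewrite (_ : _ - _ = (a%:~R * d%:~R - b%:~R * g%:~R) * complex.Im t); last by ring.
by rewrite dR mul1r.
Qed.

Lemma MF_all k (f : C -> C) : MF k f -> forall (a b g d : int) (t : C), a * d - b * g = 1 ->
    0 < complex.Im t ->
  f (mob a b g d t) = jc g d t ^ k * f t.
Proof.
move=> mf; have [_ hT hS _] := mf.
have [x [kx|kx]] := par2 k; last first.
  have z (u : C) : 0 < complex.Im u -> f u = 0 by move=> hu; apply: (MF_odd mf) => //; exists x.
  by move=> a b g d t det ht; rewrite !z ?mulr0 //; exact: mob_im.
have hTn (t : C) (m : nat) : 0 < complex.Im t -> f (t + m%:R) = f t.
  move=> ht; elim: m => [|m IH]; first by rewrite addr0.
  by rewrite -natr1 addrA hT // ImD Im_nat addr0.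
have hTz (t : C) (m : int) : 0 < complex.Im t -> f (t + m%:~R) = f t.
  case: m => m ht; first exact: hTn.
  have ht' : 0 < complex.Im (t + (Negz m)%:~R) by rewrite ImD Im_int addr0.
  by rewrite -(hTn _ m.+1 ht') NegzE mulrNz subrK.
have sq1 (e : C) : e = 1 \/ e = -1 -> e ^ k = 1 by case=> ->; [rewrite exp1rz|exact: signz_even kx].
move=> a b g d; have [n] := ubnP `|g|%N; elim: n a b g d => // n IH a b g d gn t det ht.
have j0 := jc_ne0 ht det.
case: (eqVneq g 0) => [g0|g0].
  have ad : a * d = 1 by rewrite g0 mulr0 subr0 in det.
  have [[a1 d1]|[a1 d1]] : (a = 1 /\ d = 1) \/ (a = -1 /\ d = -1).
    have : (a == 1) || (a == -1).
      have : (`|a| * `|d| = 1)%N by rewrite -abszM ad.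
      by move/eqP; rewrite muln_eq1 => /andP[/eqP h _]; lia.
    by case/orP => /eqP a1; move: ad; rewrite a1; [left|right]; lia.
    rewrite /mob /jc g0 a1 d1 mulr0z mul0r add0r mulr1z divr1 mul1r hTz // exp1rz mul1r //.
  rewrite /mob /jc g0 a1 d1 mulr0z mul0r add0r !mulrN1z (_ : _ / -1 = t + (- b)%:~R).
    by rewrite hTz // (sq1 (-1)) ?mul1r //; right.
  by rewrite invrN invr1 mulrN1 mulrNz; ring.
(* Euclid's algorithm on the bottom row: a translation of t reduces d modulo g, and S then makes the
   remainder the new lower left entry. *)
pose q := (d %/ g)%Z; pose d' := (d %% g)%Z; have dE : d = q * g + d' by exact: divz_eq.
have d'g : (`|d'| < `|g|)%N.
  have := modz_ge0 d g0; have := ltz_mod d g0; rewrite -/d'; lia.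
have dC : d%:~R = q%:~R * g%:~R + d'%:~R :> C by rewrite {1}dE intrD intrM.
clearbody d' q; pose t' := t + q%:~R; have ht' : 0 < complex.Im t' by rewrite /t' ImD Im_int addr0.
pose b' := b - q * a; have det' : b' * (- g) - (- a) * d' = 1 by rewrite -det dE /b'; ring.
have ht2 := Im_inv_gt0 ht'; have t0 := Im_ne0 ht'.
have := IH b' (- a) d' (- g) ltac:(lia) (- t'^-1) det' ht2.
have jE : jc d' (- g) (- t'^-1) = - (jc g d t / t').
  rewrite /jc dC mulrNz (_ : g%:~R * t + _ = g%:~R * t' + d'%:~R); last by rewrite /t'; ring.
  by field.
have mE : mob b' (- a) d' (- g) (- t'^-1) = mob a b g d t.
  rewrite /mob jE (_ : _ + _ = - ((a%:~R * t + b%:~R) / t')); first by field; rewrite j0 t0.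
  by rewrite /b' mulrNz intrB intrM /t'; field.
rewrite mE jE hS // => ->; rewrite hTz // mulrA; congr (_ * _).
have -> : - (jc g d t / t') = (-1) * (jc g d t / t') by rewrite mulN1r.
rewrite expfzMl (sq1 (-1)); last by right.
by rewrite mul1r -expfzMl divfK.
Qed.

(** Twice the quadratic form; [bq] is the bilinear form, and [qz] is the value on lattice vectors,
    which gives the sign in the elliptic law. *)
Definition qf (a b c : nat) (x y : C) : C := a%:R * x ^+ 2 + b%:R * (x + y) ^+ 2 + c%:R * y ^+ 2.
Definition bq (a b c : nat) (u v x y : C) : C := a%:R * u * x + b%:R * (u + v) * (x + y) + c%:R *
    v * y.
Definition qz (a b c : nat) (u v : int) : int := a%:Z * u ^+ 2 + b%:Z * (u + v) ^+ 2 + c%:Z *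
    v ^+ 2.

Definition Jmod a b c k (f : C3 -> C) := forall (al be ga de : int) (t x y : C), al * de - be * ga =
    1 -> 0 < complex.Im t ->
  f (mob al be ga de t, x / jc ga de t, y / jc ga de t) =
  jc ga de t ^ k * e2pi (ga%:~R / jc ga de t * (qf a b c x y / 2)) * f (t, x, y).
Definition Jell a b c (f : C3 -> C) := forall (u v m n : int) (t x y : C), 0 < complex.Im t ->
  f (t, x + u%:~R * t + m%:~R, y + v%:~R * t + n%:~R) =
  (-1) ^ (qz a b c u v + qz a b c m n) * e2pi (- (t * (qf a b c u%:~R v%:~R / 2)) - bq a b c u%:~R
      v%:~R x y) * f (t, x, y).
(* Locally uniform boundedness at the cusp replaces the Fourier expansion; see [fourier_cusp] and
   [cusp_fourier]. *)
Definition Jcusp (f : C3 -> C) := forall K : R, exists M Y : R, forall t x y : C,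
    Y < complex.Im t -> cabs x <= K -> cabs y <= K ->
  cabs (f (t, x, y)) <= M.
Definition J a b c (k : int) (f : C3 -> C) := [/\ forall p, inH p -> hol3 f p, Jmod a b c k f,
    Jell a b c f & Jcusp f].

Lemma J_ext a b c k f g : (forall p, inH p -> f p = g p) -> J a b c k f -> J a b c k g.
Proof.
move=> e [h1 h2 h3 h4]; split.
- move=> p hp; apply: hol3_ext (h1 p hp); exists (complex.Im p.1.1) => // q /inH_near; exact: e.
- by move=> al be ga de t x y det ht; rewrite -!e ?h2 //; exact: mob_im.
- by move=> u v m n t x y ht; rewrite -!e ?h3.
- move=> K; have [M [Y h]] := h4 K; exists M, (Num.max Y 0) => t x y; rewrite gt_max =>
      /andP[tY t0] hx hy.
  by rewrite -e // h.
Qed.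

Lemma JcuspM f g : Jcusp f -> Jcusp g -> Jcusp (fun p => f p * g p).
Proof.
move=> hf hg K; have [M [Y h]] := hf K; have [M' [Y' h']] := hg K; exists (M * M'),
    (Num.max Y Y') => t x y.
by rewrite gt_max => /andP[tY tY'] hx hy; rewrite cabsM ler_pM ?cabs_ge0 ?h ?h'.
Qed.

Lemma Jcusp_D f g : Jcusp f -> Jcusp g -> Jcusp (fun p => f p + g p).
Proof.
move=> hf hg K; have [M [Y h]] := hf K; have [M' [Y' h']] := hg K; exists (M + M'),
    (Num.max Y Y') => t x y.
by rewrite gt_max => /andP[tY tY'] hx hy; apply: le_trans (cabsD _ _) _; rewrite lerD ?h ?h'.
Qed.

Lemma J_M a b c k f a' b' c' l g : J a b c k f -> J a' b' c' l g -> J (a + a') (b + b') (c + c')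
    (k + l) (fun p => f p * g p).
Proof.
move=> [h1 h2 h3 h4] [i1 i2 i3 i4]; split.
- by move=> p hp; apply: hol3M; [exact: h1|exact: i1].
- move=> al be ga de t x y det ht; rewrite h2 // i2 // expfzDr ?(jc_ne0 ht det) //.
  rewrite (_ : ga%:~R / jc ga de t * (qf (a + a') (b + b') (c + c') x y / 2) = ga%:~R / jc ga de t *
      (qf a b c x y / 2) + ga%:~R / jc ga de t * (qf a' b' c' x y / 2)); last by rewrite /qf !natrD;
      ring.
  by rewrite e2piD; ring.
- move=> u v m n t x y ht; rewrite h3 // i3 //.
  rewrite (_ : qz (a + a') (b + b') (c + c') u v + qz (a + a') (b + b') (c + c') m n =
      (qz a b c u v + qz a b c m n) + (qz a' b' c' u v + qz a' b' c' m n)); last first.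
    by rewrite /qz !PoszD; ring.
  rewrite [(-1) ^ (_ + (qz a' b' c' u v + _))]expfzDr ?oppr_eq0 ?oner_eq0 //.
  rewrite (_ : - (t * (qf (a + a') (b + b') (c + c') u%:~R v%:~R / 2)) - bq (a + a') (b + b')
      (c + c') u%:~R v%:~R x y =
    (- (t * (qf a b c u%:~R v%:~R / 2)) - bq a b c u%:~R v%:~R x y) +
        (- (t * (qf a' b' c' u%:~R v%:~R / 2)) - bq a' b' c' u%:~R v%:~R x y));
        last by rewrite /qf /bq !natrD; ring.
  rewrite [e2pi (_ + (_ - bq a' b' c' _ _ _ _))]e2piD; ring.
- exact: JcuspM.
Qed.

Lemma J_D a b c k f g : J a b c k f -> J a b c k g -> J a b c k (fun p => f p + g p).
Proof.
move=> [h1 h2 h3 h4] [i1 i2 i3 i4]; split.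
- by move=> p hp; apply: hol3D; [exact: h1|exact: i1].
- by move=> al be ga de t x y det ht; rewrite h2 // i2 // mulrDr.
- by move=> u v m n t x y ht; rewrite h3 // i3 // mulrDr.
- exact: Jcusp_D.
Qed.

Lemma J_of_MF k f : MF k f -> J 0 0 0 k (fun p => f p.1.1).
Proof.
move=> mf; have [f1 f2 f3 [M [Y f4]]] := mf; split.
- by move=> p hp; apply: hol3_comp1 (hol3_0 p); exact: f1.
- move=> al be ga de t x y det ht /=; rewrite (MF_all mf) // (_ : qf _ _ _ _ _ = 0);
      last by rewrite /qf; ring.
  by rewrite mul0r mulr0 e2pi0 mulr1.
- move=> u v m n t x y ht /=; rewrite (_ : qf _ _ _ _ _ = 0); last by rewrite /qf; ring.
  rewrite (_ : bq _ _ _ _ _ _ _ = 0); last by rewrite /bq; ring.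
  rewrite (_ : qz _ _ _ _ _ + _ = 0); last by rewrite /qz; ring.
  by rewrite mul0r mulr0 subr0 oppr0 e2pi0 expr0z !mul1r.
- by move=> K; exists M, Y => t x y tY _ _; exact: f4.
Qed.

Lemma J_MF a b c k l f g : MF k g -> J a b c l f -> J a b c (k + l) (fun p => g p.1.1 * f p).
Proof. by move=> /J_of_MF mg hf; have := J_M mg hf. Qed.
Lemma J_Z a b c k f (z : C) : J a b c k f -> J a b c k (fun p => z * f p).
Proof. by move=> hf; have := J_MF (MF_c z) hf; rewrite add0r. Qed.

(** u^2 and u have the same parity, so the sign of the lattice law is the one of theta. *)
Lemma qz_par (u v m n : int) : (-1) ^ (qz 1 0 0 u v + qz 1 0 0 m n) = (-1) ^ (u + m) :> C.
Proof.
have sq (w : int) : (-1) ^ (w ^+ 2) = (-1) ^ w :> C.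
  have [x [->|->]] := par2 w.
    by rewrite (@signz_even R _ (2 * x ^+ 2)) ?(@signz_even R _ x) //; ring.
  by rewrite (@signz_odd R _ (2 * x ^+ 2 + 2 * x)) ?(@signz_odd R _ x) //; ring.
have m1 : (-1 : C) != 0 by rewrite oppr_eq0 oner_eq0.
by rewrite (_ : qz 1 0 0 u v + qz 1 0 0 m n = u ^+ 2 + m ^+ 2);
    [rewrite !expfzDr // !sq|rewrite /qz; ring].
Qed.

Lemma theta_cusp (K : R) : exists M Y : R, forall t z : C, Y < complex.Im t -> cabs z <= K ->
    cabs (theta t z) <= M.
Proof.
exists (3 * expR (pi * `|K|)), (`|K| + 2) => t z ht hz; have h := cabs_Im z; have p0 := pi_gt0 R;
    have := ler_norm K => hK.
apply: le_trans (theta_le _) _; first by lra.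
by rewrite ler_pM2l // ler_expR ler_pM2l //; lra.
Qed.

Lemma J_theta : J 1 0 0 (-1) (fun p => theta p.1.1 p.1.2).
Proof.
split.
- by move=> p hp; apply: hol3_theta => //; [exact: hol3_0|exact: hol3_1].
- move=> al be ga de t x y det ht /=; rewrite /mob theta_mod //; last by exact: (jc_ne0 ht det).
    rewrite -exprN1 (_ : qf 1 0 0 x y = x ^+ 2) //; rewrite /qf; ring.
  exact: mob_im.
- move=> u v m n t x y ht /=; rewrite theta_law // qz_par; congr (_ * e2pi _ * _).
  by rewrite /qf /bq; field.
- move=> K; have [M [Y h]] := theta_cusp K; exists M, Y => t x y tY hx _; exact: h.
Qed.

(** The three linear forms x, x + y, y are on an equal footing up to sign: exchanging x and y
    exchanges a and c, and replacing x by -x - y exchanges a and b. *)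
Definition swap_xy (f : C3 -> C) : C3 -> C := fun p => f (p.1.1, p.2, p.1.2).
Definition flip_x (f : C3 -> C) : C3 -> C := fun p => f (p.1.1, - p.1.2 - p.2, p.2).
Lemma J_swap_xy a b c k f : J a b c k f -> J c b a k (swap_xy f).
Proof.
move=> [h1 h2 h3 h4]; split.
- move=> p hp; apply: (@hol3_comp3 R f (fun q => q.1.1) (fun q => q.2) (fun q => q.1.2));
      [exact: h1|exact: hol3_0|exact: hol3_2|exact: hol3_1].
- move=> al be ga de t x y det ht; rewrite /swap_xy /= h2 // (_ : qf a b c y x = qf c b a x y) //;
      rewrite /qf; ring.
- move=> u v m n t x y ht; rewrite /swap_xy /= h3 //; congr (_ ^ _ * e2pi _ * _);
      rewrite /qz /qf /bq; ring.
- by move=> K; have [M [Y h]] := h4 K; exists M, Y => t x y tY hx hy; exact: h.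
Qed.

Lemma J_flip_x a b c k f : J a b c k f -> J b a c k (flip_x f).
Proof.
move=> [h1 h2 h3 h4]; split.
- move=> p hp; apply: (@hol3_comp3 R f (fun q => q.1.1) (fun q => - q.1.2 - q.2) (fun q => q.2));
      [exact: h1|exact: hol3_0| |exact: hol3_2].
  by apply: hol3D; apply: hol3N; [exact: hol3_1|exact: hol3_2].
- move=> al be ga de t x y det ht; rewrite /flip_x /= -mulNr -mulrBl h2 //
      (_ : qf a b c (- x - y) y = qf b a c x y) //; rewrite /qf; ring.
- move=> u v m n t x y ht; rewrite /flip_x /=.
  have -> : - (x + u%:~R * t + m%:~R) - (y + v%:~R * t + n%:~R) = (- x - y) + (- u - v)%:~R * t +
      (- m - n)%:~R.
    by rewrite !intrD !mulrNz; ring.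
  rewrite h3 //; congr (_ ^ _ * e2pi _ * _); rewrite /qz /qf /bq ?intrD ?mulrNz; ring.
- move=> K; have [M [Y h]] := h4 (`|K| + `|K|); exists M, Y => t x y tY hx hy; apply: h => //.
    by apply: le_trans (cabsB _ _) _; rewrite cabsN; have := ler_norm K; lra.
  by have := ler_norm K; have := normr_ge0 K; lra.
Qed.

Lemma J_res a b c k f : J a b c k f -> J 0 0 (b + c) k (fun p => f (p.1.1, 0, p.2)).
Proof.
move=> [h1 h2 h3 h4]; split.
- move=> p hp; apply: (@hol3_comp3 R f (fun q => q.1.1) (fun q => 0) (fun q => q.2));
      [exact: h1|exact: hol3_0|exact: hol3_const|exact: hol3_2].
- move=> al be ga de t x y det ht /=; have := h2 al be ga de t 0 y det ht; rewrite mul0r => ->.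
  by rewrite (_ : qf a b c 0 y = qf 0 0 (b + c) x y) // /qf natrD; ring.
- move=> u v m n t x y ht /=; have := h3 0 v 0 n t 0 y ht; rewrite mulr0z mul0r !addr0 => ->.
  congr (_ ^ _ * e2pi _ * _); rewrite /qz /qf /bq ?natrD ?PoszD; ring.
- move=> K; have [M [Y h]] := h4 `|K|; exists M, Y => t x y tY hx hy /=; apply: h => //;
      first by rewrite cabs0.
  by have := ler_norm K; lra.
Qed.

Lemma J_theta_y : J 0 0 1 (-1) (fun p => theta p.1.1 p.2).
Proof. exact: (J_swap_xy J_theta). Qed.
Lemma J_theta_xy : J 0 1 0 (-1) (fun p => theta p.1.1 (p.1.2 + p.2)).
Proof.
have := J_Z (-1) (J_flip_x J_theta); apply: J_ext => p _;
    rewrite /flip_x /= (_ : - p.1.2 - p.2 = - (p.1.2 + p.2)) ?thetaN ?mulN1r ?opprK //.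
by rewrite opprD.
Qed.

End JSpace.

(** * Division by theta *)

Section JDiv.
Variable R : realType.
Notation C := (CC R).
Notation tpi := (tpi R).
Notation C3 := (C3 R).
Opaque theta.

(** [v] is the value at [p] of a holomorphic quotient of [f] by theta near [p]. Such values are
    unique, so the local quotients glue to [fquot]. *)
Definition quot_at (f : C3 -> C) (p : C3) (v : C) := exists (G : C3 -> C) (r : R),
    [/\ 0 < r, v = G p &
  forall q, d3 p q < r -> hol3 G q /\ f q = theta q.1.1 q.1.2 * G q].

Lemma d3_x (t x y w : C) : d3 (t, x, y) (t, w, y) = cabs (w - x).
Proof. by rewrite /d3 /= !subrr cabs0 add0r addr0. Qed.

Lemma quot_unique f p v w : inH p -> quot_at f p v -> quot_at f p w -> v = w.
Proof.
case: p => [[t x] y] ht [G [r [r0 -> hG]]] [G' [r' [r0' -> hG']]].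
have s0 : 0 < Num.min r r' by rewrite lt_min r0.
have [h1 _] := hG (t, x, y) ltac:(by rewrite d3xx); have [h2 _] :=
    hG' (t, x, y) ltac:(by rewrite d3xx).
have c1 := cder_cont (slice1 h1); have c2 := cder_cont (slice1 h2); rewrite /= in c1 c2.
pose F (g : C3 -> C) (w : C) := if cabs (w - x) < Num.min r r' then g (t, w, y) else 0.
have cF g : cont1 (fun w => g (t, w, y)) x -> cont1 (F g) x.
  move=> cg; apply: (cont_ext (@d1xx R)) cg; exists (Num.min r r') => // q; by rewrite /d1 /F => ->.
have := @cont_eq_dense R t (F G) (F G') x ht (cF _ c1) (cF _ c2); rewrite /F subrr cabs0 s0;
    apply=> z tz.
case: ifP => //; rewrite lt_min => /andP[zr zr'].
have [_ e1] := hG (t, z, y) ltac:(by rewrite d3_x); have [_ e2] :=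
    hG' (t, z, y) ltac:(by rewrite d3_x).
by move: e2; rewrite e1 /= => /(mulfI tz).
Qed.

Definition fquot (f : C3 -> C) (p : C3) : C := xget 0 [set v | quot_at f p v].

Lemma quot_near f p (G : C3 -> C) (r : R) q : (forall q, d3 p q < r -> hol3 G q /\
    f q = theta q.1.1 q.1.2 * G q) ->
  d3 p q < r -> quot_at f q (G q).
Proof.
move=> hG qr; exists G, (r - d3 p q); split => //; first by rewrite subr_gt0.
by move=> u hu; apply: hG; have := d3_tri p q u; lra.
Qed.

Lemma fquotP f : (forall p, inH p -> exists v, quot_at f p v) ->
  (forall p, inH p -> hol3 (fquot f) p) /\ (forall p, inH p -> f p = theta p.1.1 p.1.2 * fquot f p).
Proof.
move=> ex; have fq p v : inH p -> quot_at f p v -> fquot f p = v.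
  move=> hp hv; rewrite /fquot; case: xgetP => [w _ hw|/(_ v)//]; exact: quot_unique hw hv.
split=> p hp; have [v [G [r [r0 vG hG]]]] := ex p hp; have im0 : 0 < complex.Im p.1.1 := hp.
  have [hGp _] := hG p ltac:(by rewrite d3xx); apply: hol3_ext hGp;
      exists (Num.min r (complex.Im p.1.1)); first by rewrite lt_min r0.
  move=> q; rewrite lt_min => /andP[qr qi]; symmetry; apply: fq; first exact: inH_near qi.
  exact: quot_near hG qr.
have [_ ->] := hG p ltac:(by rewrite d3xx); rewrite (fq p (G p)) //.
by apply: quot_near hG _; rewrite d3xx.
Qed.

(** Away from the zeros of theta the quotient is evident. Near x = l t + m, numerator and
    denominator are translated to x = 0 by their elliptic laws and divided by x there, after which
    the denominator equals 2 pi i on x = 0. *)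
Lemma J_quot_ex a b c k f : J a b c k f -> (forall t y : C, 0 < complex.Im t -> f (t, 0, y) = 0) ->
  forall p, inH p -> exists v, quot_at f p v.
Proof.
move=> [h1 _ h3 _] f0 [[t0 x0] y0] ht; have im0 : 0 < complex.Im t0 := ht.
have hth (p : C3) : inH p -> hol3 (fun q : C3 => theta q.1.1 q.1.2) p by move=> hp;
    apply: hol3_theta => //; [exact: hol3_0|exact: hol3_1].
have [tz|tnz] := eqVneq (theta t0 x0) 0; last first.
  have ct := hol3_cont (hth _ ht); have [r r0 hr] := cont_ne0 ct tnz.
  exists (f (t0, x0, y0) / theta t0 x0), (fun q => f q / theta q.1.1 q.1.2),
      (Num.min r (complex.Im t0)); split => //; first by rewrite lt_min r0.
  move=> q; rewrite lt_min => /andP[qr qi]; have hq : inH q by apply: inH_near qi.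
  have n0 : theta q.1.1 q.1.2 != 0.
    by rewrite -cabs_gt0; apply: lt_le_trans (hr q qr); rewrite divr_gt0 // cabs_gt0.
  split; last by rewrite mulrC divfK.
  by apply: hol3M; [exact: h1|apply: hol3V => //; exact: hth].
have [l [m xE]] := theta_zero im0 tz.
have [F hF eF] := hol3_div_x h1 f0.
have [Th hTh eTh] := hol3_div_x hth (fun t y _ => theta0 t).
have T0 (t y : C) : 0 < complex.Im t -> Th (t, 0, y) = tpi.
  move=> hT; apply: (@cdiff_unique R (theta t) 0); last exact: cdiff_theta0.
  exists (fun w => Th (t, w, y)); split => //; first exact: (cder_cont (slice1 (hTh (t, 0, y) hT))).
  by exists 1 => // w _; rewrite theta0 !subr0 mulrC; exact: eTh.
pose sx (q : C3) : C := q.1.2 - l%:~R * q.1.1 - m%:~R.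
pose S (q : C3) : C3 := (q.1.1, sx q, q.2).
pose ef (q : C3) : C := (-1) ^ (qz a b c l 0 + qz a b c m 0) *
    e2pi (- (q.1.1 * (qf a b c l%:~R 0%:~R / 2)) - bq a b c l%:~R 0%:~R (sx q) q.2).
pose et (q : C3) : C := (-1) ^ (l + m) * e2pi (- (l%:~R ^+ 2 * q.1.1 / 2) - l%:~R * sx q).
have hsx p : hol3 sx p.
  by apply: hol3D; [apply: hol3D; [exact: hol3_1|apply: hol3N; apply: hol3M;
      [exact: hol3_const|exact: hol3_0]]|exact: hol3_const].
have hS G (p : C3) : hol3 G (S p) -> hol3 (fun q => G (S q)) p.
  by move=> hG; apply: (@hol3_comp3 R G (fun q => q.1.1) sx (fun q => q.2));
      [exact: hG|exact: hol3_0|exact: hsx|exact: hol3_2].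
have hef p : hol3 ef p.
  apply: hol3M; [exact: hol3_const|apply: hol3_e2pi; apply: hol3D; apply: hol3N].
    by apply: hol3M; [exact: hol3_0|exact: hol3_const].
  apply: hol3D; [apply: hol3D|]; apply: hol3M; try exact: hol3_const; try exact: hsx;
      try exact: hol3_2.
  by apply: hol3D; [exact: hsx|exact: hol3_2].
have het p : hol3 et p.
  apply: hol3M; [exact: hol3_const|apply: hol3_e2pi; apply: hol3D; apply: hol3N].
    by apply: hol3M; [apply: hol3M; [exact: hol3_const|exact: hol3_0]|exact: hol3_const].
  by apply: hol3M; [exact: hol3_const|exact: hsx].
have m1 : (-1 : C) != 0 by rewrite oppr_eq0 oner_eq0.
have et0 q : et q != 0 by rewrite mulf_neq0 ?e2pi_ne0 // expfz_neq0.
have fE q : inH q -> f q = ef q * (sx q * F (S q)).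
  case: q => [[t x] y] hq; rewrite -eF // /ef /S /=.
  have := h3 l 0 m 0 t (sx (t, x, y)) y hq; rewrite !mulr0z mul0r !addr0 => <-.
  by congr (f (_, _, _)); rewrite /sx /=; ring.
have tE q : inH q -> theta q.1.1 q.1.2 = et q * (sx q * Th (S q)).
  case: q => [[t x] y] hq; rewrite -(eTh t _ y) // /et /S /= -theta_law //.
  by congr theta; rewrite /sx /=; ring.
have x0' : sx (t0, x0, y0) = 0 by rewrite /sx /= xE; ring.
have Tn : Th (S (t0, x0, y0)) != 0 by rewrite /S x0' /= T0 // tpi_ne0.
have cT : cont3 (fun q => Th (S q)) (t0, x0, y0) by apply: hol3_cont; apply: hS; exact: hTh.
have [r r0 hr] := cont_ne0 cT Tn.
pose G (q : C3) : C := ef q * F (S q) / (et q * Th (S q)).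
exists (G (t0, x0, y0)), G, (Num.min r (complex.Im t0)); split => //; first by rewrite lt_min r0.
move=> q; rewrite lt_min => /andP[qr qi]; have hq : inH q by apply: inH_near qi.
have n0 : Th (S q) != 0.
  by rewrite -cabs_gt0; apply: lt_le_trans (hr q qr); rewrite divr_gt0 // cabs_gt0.
split.
  apply: hol3M; first by apply: hol3M; [exact: hef|apply: hS; exact: hF].
  by apply: hol3V; [apply: hol3M; [exact: het|apply: hS; exact: hTh]|rewrite mulf_neq0].
rewrite fE // tE // /G; move: (et0 q) n0; move: (et q) (Th (S q)) (ef q) (F (S q)) (sx q) =>
    e1 e2 e3 e4 e5 n1 n2.
by field; rewrite n1 n2.
Qed.

Lemma weak_max_entire (G : C -> C) (r M : R) w : 0 < r -> (forall q, cder G q) ->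
  (forall q, cabs q = r -> cabs (G q) <= M) -> cabs w < r -> cabs (G w) <= M * (r / (r - cabs w)).
Proof.
move=> r0 dG bG wr; have r1 : 0 < r + 1 by lra.
have [a ha] := taylor r1 (fun q _ => dG q); have [_ /(_ w wr 0%N)] := ha r ltac:(lra) M bG.
by rewrite big_ord0 subr0 expr0 mulr1.
Qed.

Lemma ss_zero (z : C) : ss z = 0 -> exists n : int, z = n%:~R.
Proof.
move=> /eqP; rewrite /ss subr_eq0 => /eqP /e2pi_eq[n e]; exists n; apply: (@addrI _ (- (z / 2))).
by rewrite -e; field.
Qed.

(** Where theta is nonzero, the laws of [g] follow by dividing those of [f] by those of theta, and
    density extends them. The bound at the cusp needs a contour that avoids the zeros of theta. *)
Lemma J_div a b c k f : J a.+1 b c k f -> (forall t y : C, 0 < complex.Im t -> f (t, 0, y) = 0) ->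
  exists2 g, J a b c (k + 1) g & forall p, inH p -> f p = theta p.1.1 p.1.2 * g p.
Proof.
move=> Jf f0; have [h1 h2 h3 h4] := Jf; have [i1 i2 i3 i4] := J_theta R.
have [g1 gE] := fquotP (J_quot_ex Jf f0); set g := fquot f in g1 gE; exists g => //; split => //.
- move=> al be ga de t x y det ht; have j0 := jc_ne0 ht det; have hm := mob_im ht det.
  apply: (@cont_eq_dense R t (fun x => g (mob al be ga de t, x / jc ga de t, y / jc ga de t))
    (fun x => jc ga de t ^ (k + 1) * e2pi (ga%:~R / jc ga de t * (qf a b c x y / 2)) * g (t, x, y))
        x ht).
  + apply: cder_cont; apply: (@cder_comp R (fun z => g (mob al be ga de t, z, y / jc ga de t))
        (fun x => x / jc ga de t)).
      exact: (slice1 (g1 (mob al be ga de t, x / jc ga de t, y / jc ga de t) hm)).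
    by apply: cderM; [exact: cder_id|exact: cder_const].
  + apply: cder_cont; apply: cderM; last exact: (slice1 (g1 (t, x, y) ht)).
    apply: cderM; first exact: cder_const.
    apply: (@cder_comp R (@e2pi R)); first exact: cder_e2pi.
    apply: cderM; first exact: cder_const.
    apply: cderM; last exact: cder_const.
    apply: cderD; last exact: cder_const.
    apply: cderD; (apply: cderM; first exact: cder_const); apply: cderX; first exact: cder_id.
    by apply: cderD; [exact: cder_id|exact: cder_const].
  move=> w tw; have := h2 al be ga de t w y det ht; have := i2 al be ga de t w y det ht.
  rewrite gE //= => it; rewrite it gE //= => hf.
  have e0 : e2pi (ga%:~R / jc ga de t * (qf 1 0 0 w y / 2)) != 0 by exact: e2pi_ne0.
  apply: (@mulfI _ (jc ga de t ^ (-1) * e2pi (ga%:~R / jc ga de t * (qf 1 0 0 w y / 2)) *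
      theta t w)).
    by apply: mulf_neq0 => //; apply: mulf_neq0 => //; exact: expfz_neq0.
  rewrite hf (_ : qf a.+1 b c w y = qf 1 0 0 w y + qf a b c w y); last by rewrite /qf -add1n natrD;
      ring.
  rewrite mulrDl mulrDr e2piD expfzDr // (_ : jc ga de t ^ 1 = jc ga de t) //.
  have : jc ga de t ^ (-1) * jc ga de t = 1 by rewrite exprN1 mulVf.
  move: (jc ga de t) (jc ga de t ^ k) (jc ga de t ^ (-1)) (g (t, w, y)) (theta t w) (e2pi _)
      (e2pi _) => j jk j1 gg th e2 e1 jj.
  transitivity (jk * (e1 * e2) * (th * gg) * (j1 * j)); first by rewrite jj mulr1.
  by ring.
- move=> u v m n t x y ht.
  apply: (@cont_eq_dense R t (fun x => g (t, x + u%:~R * t + m%:~R, y + v%:~R * t + n%:~R))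
    (fun x => (-1) ^ (qz a b c u v + qz a b c m n) * e2pi (- (t * (qf a b c u%:~R v%:~R / 2)) - bq a
        b c u%:~R v%:~R x y) * g (t, x, y)) x ht).
  + apply: cder_cont; apply: (@cder_comp R (fun z => g (t, z, y + v%:~R * t + n%:~R))
        (fun x => x + u%:~R * t + m%:~R)).
      exact: (slice1 (g1 (t, x + u%:~R * t + m%:~R, y + v%:~R * t + n%:~R) ht)).
    by apply: cderD; [apply: cderD; [exact: cder_id|exact: cder_const]|exact: cder_const].
  + apply: cder_cont; apply: cderM; last exact: (slice1 (g1 (t, x, y) ht)).
    apply: cderM; first exact: cder_const.
    apply: (@cder_comp R (@e2pi R)); first exact: cder_e2pi.
    apply: cderD; first exact: cder_const.
    apply: cderN; apply: cderD; last exact: cder_const.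
    apply: cderD; (apply: cderM; first exact: cder_const); first exact: cder_id.
    by apply: cderD; [exact: cder_id|exact: cder_const].
  move=> w tw; have := h3 u v m n t w y ht; have := i3 u v m n t w y ht.
  rewrite gE //= => it; rewrite it gE //= => hf.
  have m1 : (-1 : C) != 0 by rewrite oppr_eq0 oner_eq0.
  apply: (@mulfI _ ((-1) ^ (qz 1 0 0 u v + qz 1 0 0 m n) * e2pi (- (t * (qf 1 0 0 u%:~R v%:~R / 2))
      - bq 1 0 0 u%:~R v%:~R w y) * theta t w)).
    by apply: mulf_neq0 => //; apply: mulf_neq0; [exact: expfz_neq0|exact: e2pi_ne0].
  rewrite hf (_ : qz a.+1 b c u v + qz a.+1 b c m n = (qz 1 0 0 u v + qz 1 0 0 m n) +
      (qz a b c u v + qz a b c m n)); last first.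
    by rewrite /qz -add1n PoszD; ring.
  rewrite (_ : - (t * (qf a.+1 b c u%:~R v%:~R / 2)) - bq a.+1 b c u%:~R v%:~R w y =
    (- (t * (qf 1 0 0 u%:~R v%:~R / 2)) - bq 1 0 0 u%:~R v%:~R w y) +
        (- (t * (qf a b c u%:~R v%:~R / 2)) - bq a b c u%:~R v%:~R w y)); last first.
    by rewrite /qf /bq -add1n natrD; ring.
  rewrite [e2pi (_ + (_ - bq a b c _ _ _ _))]e2piD [(-1) ^ (_ + (qz a b c u v + _))]expfzDr //.
  by ring.
- move=> K; have [n nK] : exists n : nat, `|K| + 1 <= n%:R by exists (Num.bound (`|K| + 1));
      apply/ltW/archi_boundP; have := normr_ge0 K; lra.
  (* [ss] vanishes only at integers, hence not on this circle. There [theta_ge] bounds theta from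
     below uniformly in t, and [weak_max_entire] moves the bound for [g] inside. *)
  pose r := n%:R + 2^-1 : R; have K0 := normr_ge0 K; have r0 : 0 < r by rewrite /r; lra.
  have sn (z : C) : cabs z = r -> ss z != 0.
    move=> zr; apply/eqP => /ss_zero[m zm]; move: zr; rewrite zm intC cabs_real /r => e.
    have em : (`|m|%N)%:R = n%:R + 2^-1 :> R by rewrite natr_absz -e intr_norm.
    have : (2 * `|m|)%N%:R = (2 * n)%N.+1%:R :> R by rewrite natrM em -[(2 * n)%N.+1%:R]natr1 natrM;
        field.
    by move/eqP; rewrite eqr_nat; lia.
  have [z zr|B B0 hB] := @circle_bd R (fun z => (ss z)^-1) r r0.
    by apply: contV; [exact/cder_cont/cder_ss|exact: sn].
  have [M [Y hM]] := h4 r; have [M' [Y' hM']] := h4 `|K|.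
  exists (`|M| * (2 * B) * (r / (r - `|K|))), (Num.max (Num.max Y (r + 2)) 0) => t x y;
      rewrite !gt_max => /andP[/andP[tY tr] t0] hx hy.
  have hK := ler_norm K; have dr : 0 < r - `|K| by rewrite /r; lra.
  have dg z : cder (fun z => g (t, z, y)) z by exact: (slice1 (g1 (t, z, y) t0)).
  have bnd z : cabs z = r -> cabs (g (t, z, y)) <= `|M| * (2 * B).
    move=> zr; have s0 := sn z zr; have := hB z zr; rewrite cabsV => hb.
    have cs : 0 < cabs (ss z) by rewrite cabs_gt0.
    have tg : cabs (ss z) / 2 <= cabs (theta t z) by apply: theta_ge; have := cabs_Im z; lra.
    have fb : cabs (f (t, z, y)) <= `|M|.
      by apply: le_trans (hM t z y tY _ _) (ler_norm _); rewrite ?zr //; rewrite /r in dr *; lra.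
    move: fb; rewrite gE //= cabsM => fb.
    have hb1 : 1 <= B * cabs (ss z) by rewrite -ler_pdivrMr // div1r.
    have g0 := cabs_ge0 (g (t, z, y)).
    have q1 : cabs (ss z) / 2 * cabs (g (t, z, y)) <= `|M| by apply: le_trans fb; rewrite ler_wpM2r.
    have := ler_wpM2r g0 hb1; have := ler_wpM2l B0 q1; lra.
  have xr : cabs x < r by rewrite /r; lra.
  apply: le_trans (weak_max_entire r0 dg bnd xr) _; apply: ler_wpM2l; first by rewrite !mulr_ge0.
  apply: ler_wpM2l; first exact: ltW.
  by rewrite lef_pV2 ?posrE //; lra.
Qed.

(* As a function of x, f obeys the quasi-periodicity of theta, which forces the zero at x = 0. *)
Lemma J_vanish c k f : J 1 0 c k f -> forall t y : C, 0 < complex.Im t -> f (t, 0, y) = 0.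
Proof.
move=> [h1 _ h3 _] t y ht; apply: (@theta_law_zero R t (fun x => f (t, x, y))) => //.
- by move=> z; exact: (slice1 (h1 (t, z, y) ht)).
- move=> z; have := h3 0 0 1 0 t z y ht; rewrite !mulr0z !mul0r !addr0 mulr1z => ->.
  rewrite (_ : qz 1 0 c 0 0 + qz 1 0 c 1 0 = 1); last by rewrite /qz; ring.
  rewrite (_ : qf 1 0 c 0 0 = 0); last by rewrite /qf; ring.
  rewrite (_ : bq 1 0 c 0 0 z y = 0); last by rewrite /bq; ring.
  by rewrite mul0r mulr0 subr0 oppr0 e2pi0 mulr1 expr1z mulN1r.
- move=> z; have := h3 1 0 0 0 t z y ht; rewrite !mulr0z !mulr1z !mul0r !addr0 mul1r => ->.
  rewrite (_ : qz 1 0 c 1 0 + qz 1 0 c 0 0 = 1); last by rewrite /qz; ring.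
  rewrite expr1z mulN1r; congr (- e2pi _ * _); rewrite /qf /bq; ring.
Qed.

(** In index 0 the elliptic law is plain periodicity, so Liouville's theorem makes the form constant
    in x and in y. *)
Lemma J000 k f : J 0 0 0 k f -> MF k (fun t => f (t, 0, 0)) /\ forall t x y : C, 0 < complex.Im t ->
    f (t, x, y) = f (t, 0, 0).
Proof.
move=> [h1 h2 h3 h4]; split; last first.
  have per u v m n (t x y : C) : 0 < complex.Im t -> f (t, x + u%:~R * t + m%:~R, y + v%:~R * t +
      n%:~R) = f (t, x, y).
    move=> ht; rewrite h3 // (_ : qz 0 0 0 _ _ + _ = 0); last by rewrite /qz; ring.
    rewrite (_ : qf 0 0 0 _ _ = 0); last by rewrite /qf; ring.
    rewrite (_ : bq 0 0 0 _ _ x y = 0); last by rewrite /bq; ring.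
    by rewrite mul0r mulr0 subr0 oppr0 e2pi0 expr0z !mul1r.
  move=> t x y ht; transitivity (f (t, 0, y)).
    apply: (@ell_liouville R t (fun x => f (t, x, y))) => // z;
        first exact: (slice1 (h1 (t, z, y) ht)).
    - by have := per 0 0 1 0 t z y ht; rewrite !mulr0z !mul0r !addr0 mulr1z => ->.
    - by have := per 1 0 0 0 t z y ht; rewrite !mulr0z !mul0r !addr0 mulr1z mul1r => ->.
  apply: (@ell_liouville R t (fun y => f (t, 0, y))) => // z;
      first exact: (slice2 (h1 (t, 0, z) ht)).
  - by have := per 0 0 0 1 t 0 z ht; rewrite !mulr0z !mul0r !addr0 mulr1z => ->.
  - by have := per 0 1 0 0 t 0 z ht; rewrite !mulr0z !mul0r !addr0 mulr1z mul1r => ->.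
have q0 : qf 0 0 0 0 0 = 0 :> C by rewrite /qf; ring.
split.
- by move=> t ht; exact: (slice0 (h1 (t, 0, 0) ht)).
- move=> t ht; have := h2 1 1 0 1 t 0 0 erefl ht; rewrite q0 /mob /jc !mulr1z mulr0z !mul0r add0r
      !divr1 mul1r => ->.
  by rewrite exp1rz e2pi0 !mul1r.
- move=> t ht; have := h2 0 (-1) 1 0 t 0 0 erefl ht; rewrite q0 /mob /jc mulr1z !mulr0z !mul0r mulr0
      add0r addr0 mul1r e2pi0 mulr1.
  by rewrite mulrN1z mulN1r.
- by have [M [Y h]] := h4 0; exists M, Y => t tY; apply: h; rewrite ?cabs0.
Qed.

End JDiv.

(** * Forms of weight zero from points of order two *)

Section Units.
Variable R : realType.
Notation C := (CC R).
Notation C3 := (C3 R).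
Opaque theta.

Definition hp (p r : int) (t : C) : C := (p%:~R * t + r%:~R) / 2.
(* theta translated by the point (p t + r) / 2 of order two; [theta2z_mod] says that SL2(Z) permutes
   these functions according to (p, r) mod 2. *)
Definition theta2z (p r : int) (t z : C) : C := e2pi (p%:~R * z / 2) * theta t (z + hp p r t) /
    theta t (hp p r t).

Definition oddz (n : int) : bool := odd `|n|%N.
Lemma oddzP (n : int) : exists x : int, n = 2 * x + (oddz n)%:Z.
Proof.
have [x [e|e]] := par2 n; exists x; rewrite {1}e /oddz; first by rewrite (_ : odd _ = false) ?addr0
    //; lia.
by rewrite (_ : odd _ = true) //; lia.
Qed.

Lemma hp_ne0 (p r : int) (t : C) : 0 < complex.Im t -> oddz p || oddz r -> theta t (hp p r t) != 0.
Proof. by move=> ht o; apply/eqP => /(theta_half ht)[l [m [e1 e2]]]; move: o; rewrite /oddz e1 e2;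
    lia. Qed.

Lemma theta2z_shift (p r l m : int) (t z : C) : 0 < complex.Im t -> oddz p || oddz r ->
    theta2z (p + 2 * l) (r + 2 * m) t z = theta2z p r t z.
Proof.
move=> ht o; have n0 := hp_ne0 ht o; rewrite /theta2z.
have hE : hp (p + 2 * l) (r + 2 * m) t = hp p r t + l%:~R * t + m%:~R by rewrite /hp !intrD !intrM;
    field.
rewrite hE !addrA !theta_law //.
have -> : e2pi ((p + 2 * l)%:~R * z / 2) = e2pi (p%:~R * z / 2) * e2pi (l%:~R * z).
  by rewrite -e2piD; congr e2pi; rewrite intrD intrM; field.
have -> : - (l%:~R ^+ 2 * t / 2) - l%:~R * (z + hp p r t) = (- (l%:~R ^+ 2 * t / 2) - l%:~R *
    hp p r t) + (- (l%:~R * z)) by ring.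
rewrite [e2pi (_ + - (l%:~R * z))]e2piD e2piN; have s0 : (-1) ^ (l + m) != 0 :> C by rewrite
    expfz_neq0 // oppr_eq0 oner_eq0.
have := e2pi_ne0 (l%:~R * z); have := e2pi_ne0 (- (l%:~R ^+ 2 * t / 2) - l%:~R * hp p r t);
    move: n0 s0.
move: (theta t (hp p r t)) (theta t (z + hp p r t)) ((-1) ^ (l + m)) (e2pi (l%:~R * z))
    (e2pi (- _ - _)) (e2pi (p%:~R * z / 2)) => a b s e1 e2 e3 n0 s0 n2 n1.
by field; rewrite n0 s0 n1 n2.
Qed.

Definition theta2 (p r : bool) (t z : C) : C := theta2z p r t z.
Lemma oddz_b (b : bool) : oddz b = b.
Proof. by case: b. Qed.
Lemma theta2z_T (p r : int) (t z : C) : 0 < complex.Im t -> oddz p || oddz r -> theta2z p r t z =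
    theta2 (oddz p) (oddz r) t z.
Proof.
move=> ht o; have [x px] := oddzP p; have [y ry] := oddzP r.
by rewrite {1}px {1}ry addrC [2 * y + _]addrC theta2z_shift // !oddz_b.
Qed.

(** The half period of (p, r) at the image of t is that of (p', r') at t divided by the automorphy
    factor, where (p', r') is the row (p, r) times the matrix. The normalization by the value at the
    half period cancels the weight of theta. *)
Lemma theta2z_mod (p r al be ga de : int) (t z : C) : 0 < complex.Im t -> al * de - be * ga = 1 ->
    oddz p || oddz r ->
  theta2z p r (mob al be ga de t) (z / jc ga de t) =
  e2pi (ga%:~R / jc ga de t * (z ^+ 2 / 2)) * theta2z (p * al + r * ga) (p * be + r * de) t z.
Proof.
move=> ht det o; have j0 := jc_ne0 ht det; have hm := mob_im ht det; rewrite /theta2z.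
have n0 := hp_ne0 hm o.
set p' := p * al + r * ga; set r' := p * be + r * de; set j := jc ga de t in j0 *.
have detC : al%:~R * de%:~R - be%:~R * ga%:~R = 1 :> C by rewrite -!intrM -intrB det.
have hE : hp p r (mob al be ga de t) = hp p' r' t / j.
  rewrite /hp /mob -/j /p' /r' !intrD !intrM (_ : r%:~R = r%:~R * j / j); last by rewrite mulfK.
  by rewrite /j /jc; move: j0; rewrite /j /jc => j0; field.
have thm w : theta (mob al be ga de t) (w / j) = j^-1 * e2pi (ga%:~R / j * (w ^+ 2 / 2)) *
    theta t w by rewrite /mob /j /jc theta_mod.
move: n0; rewrite hE -mulrDl !thm => n0.
have n1 : theta t (hp p' r' t) != 0 by apply: contraNneq n0 => ->; rewrite mulr0.
have -> : e2pi (ga%:~R / j * ((z + hp p' r' t) ^+ 2 / 2)) =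
  e2pi (ga%:~R / j * (z ^+ 2 / 2)) * e2pi (ga%:~R / j * (hp p' r' t ^+ 2 / 2)) *
      e2pi (ga%:~R / j * z * hp p' r' t).
  by rewrite -!e2piD; congr e2pi; field.
have -> : e2pi (p'%:~R * z / 2) = e2pi (p%:~R * (z / j) / 2) * e2pi (ga%:~R / j * z * hp p' r' t).
  rewrite -e2piD; congr e2pi.
  have kk : p'%:~R * j = p%:~R + ga%:~R * (p'%:~R * t + r'%:~R).
    transitivity (p%:~R * (al%:~R * de%:~R - be%:~R * ga%:~R) + ga%:~R * (p'%:~R * t + r'%:~R));
        last by rewrite detC mulr1.
    by rewrite /p' /r' /j /jc !intrD !intrM; ring.
  rewrite /hp; transitivity (p'%:~R * j * z / (2 * j)); first by field.
  by rewrite kk; field.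
have := e2pi_ne0 (ga%:~R / j * (hp p' r' t ^+ 2 / 2)); move: n1 j0.
clear hE thm n0 detC; clearbody j p' r'.
move: (theta t (hp p' r' t)) (theta t (z + hp p' r' t)) (e2pi _) (e2pi _) (e2pi _) (e2pi _) =>
    th1 th2 e1 e2 e3 e4 n1 n2 n3.
by field; rewrite ?n1 ?n2 ?n3.
Qed.

Lemma theta2z_ell (p r l m : int) (t z : C) : 0 < complex.Im t ->
  theta2z p r t (z + l%:~R * t + m%:~R) = (-1) ^ (l + m) * (-1) ^ (p * m + r * l) *
      e2pi (- (l%:~R ^+ 2 * t / 2) - l%:~R * z) * theta2z p r t z.
Proof.
move=> ht; rewrite /theta2z (_ : z + l%:~R * t + m%:~R + hp p r t = z + hp p r t + l%:~R * t +
    m%:~R); last by ring.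
rewrite theta_law // -(@e2pi_halfz R (p * m + r * l) ((p * m + r * l)%:~R / 2)); last by field.
have -> : e2pi (p%:~R * (z + l%:~R * t + m%:~R) / 2) *
    ((-1) ^ (l + m) * e2pi (- (l%:~R ^+ 2 * t / 2) - l%:~R * (z + hp p r t)) * theta t
    (z + hp p r t)) =
  (-1) ^ (l + m) * (e2pi (p%:~R * (z + l%:~R * t + m%:~R) / 2) *
      e2pi (- (l%:~R ^+ 2 * t / 2) - l%:~R * (z + hp p r t))) * theta t (z + hp p r t) by ring.
have -> : e2pi (p%:~R * (z + l%:~R * t + m%:~R) / 2) * e2pi (- (l%:~R ^+ 2 * t / 2) - l%:~R *
    (z + hp p r t)) =
  e2pi ((p * m + r * l)%:~R / 2) * e2pi (- (l%:~R ^+ 2 * t / 2) - l%:~R * z) * e2pi (p%:~R * z / 2)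
      * e2pi ((- r * l)%:~R).
  by rewrite -!e2piD; congr e2pi; rewrite /hp !(intrD, intrM, mulrNz); field.
by rewrite e2pi_int mulr1; ring.
Qed.

Lemma ss_ge (z : C) : expR (pi * `|complex.Im z|) - expR (- (pi * `|complex.Im z|)) <= cabs (ss z).
Proof.
have e (w : C) : cabs (e2pi w) = expR (- (pi * complex.Im (2 * w))).
  by rewrite cabs_e2pi ImM Re_nat Im_nat mul0r addr0; congr expR; ring.
have h2 (w : C) : 2 * (w / 2) = w by rewrite mulrC divfK // pnatr_eq0.
have := cabsBB (e2pi (z / 2)) (e2pi (- (z / 2))); have := cabsBB (e2pi (- (z / 2))) (e2pi (z / 2)).
rewrite [in X in X -> _]cabsC -/(ss z) !e mulrN h2 ImN mulrN opprK.
by case: (lerP 0 (complex.Im z)) => h; [rewrite ger0_norm|rewrite ltr0_norm // mulrN opprK]; lra.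
Qed.

(** For bounded z, numerator and denominator both have size about exp(pi |Im w|) at the half period
    w. For p = 0 one has w = 1/2, and the denominator stays away from 0 because |ss(1/2)| = 2. *)
Lemma theta2_bd (p r : bool) (K : R) : p || r -> exists M Y : R, forall t z : C, Y < complex.Im t ->
    cabs z <= K -> cabs (theta2 p r t z) <= M.
Proof.
move=> o; have p0 := pi_gt0 R; have p2 := pi_ge2 R; pose k : R := `|K|; have k0 : 0 <= k :=
    normr_ge0 K.
exists (expR (pi * k) * (3 * expR (pi * k) * 4)), (2 * k + 8) => t z ht hz0.
have hz : cabs z <= k by apply: le_trans hz0 (ler_norm _).
have hi := cabs_Im z; have i0 : 0 < complex.Im t by lra.
have ih (v : C) : complex.Im (v / 2) = complex.Im v / 2 by rewrite half_C ImM /= mulr0 add0r.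
pose w := hp p r t; have iw : complex.Im w = p%:R * complex.Im t / 2.
  by rewrite /w /hp ih ImD ImM Re_int !Im_int mul0r !addr0.
have pr : 0 <= (p%:R : R) <= 1 by case: (p) => /=; lra.
have aw : `|complex.Im w| = p%:R * complex.Im t / 2 by rewrite iw ger0_norm //; nra.
rewrite /theta2 /theta2z -/w cabsM cabsM -mulrA; apply: ler_pM;
    rewrite ?cabs_ge0 ?mulr_ge0 ?cabs_ge0 //.
  rewrite cabs_e2pi ler_expR (_ : complex.Im _ = p%:R * complex.Im z / 2); last first.
    by rewrite ih ImM Re_int Im_int mul0r addr0.
  have := ler_norm (- complex.Im z); rewrite normrN => h.
  have hh : p%:R * (- complex.Im z) <= k by case: (p); rewrite ?mul1r ?mul0r //; lra.
  have := ler_wpM2l (ltW p0) hh; lra.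
have n1 : cabs (theta t (z + w)) <= 3 * expR (pi * k) * expR (pi * `|complex.Im w|).
  have b : `|complex.Im (z + w)| <= k + `|complex.Im w| by rewrite ImD;
      apply: le_trans (ler_normD _ _) _; lra.
  apply: le_trans (theta_le _) _; first by rewrite aw in b; nra.
  by rewrite -mulrA ler_pM2l // -expRD ler_expR -mulrDr ler_pM2l.
have n2 : expR (pi * `|complex.Im w|) / 4 <= cabs (theta t w).
  apply: le_trans (theta_ge _); last by rewrite aw; nra.
  have [pE|pE] : p = true \/ p = false by case: (p); [left|right].
    rewrite pE mul1r in aw.
    have := ss_ge w; have : expR (- (pi * `|complex.Im w|)) <= 2^-1.
      rewrite expRN lef_pV2 ?posrE ?expR_gt0 //; apply: le_trans (expR_ge1Dx _); rewrite aw; nra.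
    have : 1 <= expR (pi * `|complex.Im w|) by rewrite -expR0 ler_expR aw; nra.
    lra.
  have rE : r = true by move: o; rewrite pE.
  rewrite aw /w pE rE (_ : (false%:R : R) = 0) // !mul0r mulr0 expR0 -[hp _ _ _]/(hp 0 1 t).
  have -> : hp 0 1 t = 2^-1 by rewrite /hp; field.
  have -> : ss (2^-1 : C) = 2 * e2pi (4^-1).
    rewrite /ss (_ : 2^-1 / 2 = 4^-1); last by field.
    have e : e2pi (- 4^-1 : C) = - e2pi (4^-1).
      have := @e2pi_2 R (2^-1) ltac:(by field).
      rewrite (_ : 2^-1 = 4^-1 + 4^-1 :> C); last by field.
      by rewrite e2piD e2piN => h; apply: (@mulIf _ (e2pi (4^-1)));
          [exact: e2pi_ne0|rewrite mulVf ?e2pi_ne0 // mulNr h opprK].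
    by rewrite e; ring.
  rewrite cabsM cabs_nat cabs_e2pi (_ : complex.Im (4^-1 : C) = 0); last first.
    by rewrite -[4^-1](_ : 2^-1 * 2^-1 = _); [rewrite half_C ImM /= !mulr0 mul0r addr0|field].
  by rewrite mulr0 oppr0 expR0; lra.
have e0 : 0 < expR (pi * `|complex.Im w|) by exact: expR_gt0.
have t0 : 0 < cabs (theta t w) by apply: lt_le_trans n2; rewrite divr_gt0.
rewrite cabsV ler_pdivrMr //; have b0 : 0 <= 3 * expR (pi * k) by rewrite mulr_ge0 ?expR_ge0.
apply: le_trans n1 _; move: n2 b0; move: (expR (pi * `|_|)) (3 * _) (cabs _) => x y v n2 b0.
by have := ler_wpM2l b0 n2; lra.
Qed.

(* n is the index, and chi = true when the elliptic law carries the character (-1)^(p m + r l)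
   attached to the point of order two. *)
Definition slot (n : nat) (chi : bool) (F : bool -> bool -> C -> C -> C) :=
  [/\ forall p r (q : C3) (f : C3 -> C), p || r -> inH q -> hol3 f q ->
      hol3 (fun q => F p r q.1.1 (f q)) q,
      forall (p r : bool) (al be ga de : int) (t z : C), p || r -> 0 < complex.Im t ->
          al * de - be * ga = 1 ->
        F p r (mob al be ga de t) (z / jc ga de t) = e2pi (ga%:~R / jc ga de t *
            (n%:R * z ^+ 2 / 2)) *
          F (p && oddz al (+) r && oddz ga) (p && oddz be (+) r && oddz de) t z,
      forall (p r : bool) (l m : int) (t z : C), 0 < complex.Im t -> p || r ->
        F p r t (z + l%:~R * t + m%:~R) = (-1) ^ (n%:Z * (l + m)) * (-1) ^
            (chi%:Z * (p%:Z * m + r%:Z * l)) *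
          e2pi (- (n%:R * l%:~R ^+ 2 * t / 2) - n%:R * l%:~R * z) * F p r t z,
      forall (p r : bool) (K : R), p || r -> exists M Y : R, forall t z : C, Y < complex.Im t ->
          cabs z <= K -> cabs (F p r t z) <= M
    & forall (p r : bool) (t : C), p || r -> 0 < complex.Im t -> F p r t 0 = 1].

Lemma oddzD (x y : int) : oddz (x + y) = oddz x (+) oddz y.
Proof. rewrite /oddz; lia. Qed.
Lemma oddzM (x y : int) : oddz (x * y) = oddz x && oddz y.
Proof. by rewrite /oddz abszM oddM. Qed.
Lemma oddz_det (al be ga de : int) : al * de - be * ga = 1 -> (oddz al && oddz de) (+) (oddz be &&
    oddz ga).
Proof. by move=> det; rewrite -!oddzM; move: det; rewrite /oddz; lia. Qed.

Lemma sgn_eq (x y z : int) : x = y + 2 * z -> (-1) ^ x = (-1) ^ y :> C.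
Proof.
by move=> ->; rewrite expfzDr ?oppr_eq0 ?oner_eq0 // (@signz_even R (2 * z) z) ?mulr1.
Qed.

Lemma slot_theta2 : slot 1 true theta2.
Proof.
split.
- move=> p r q f o hq hf; apply: hol3M; last first.
    apply: hol3V; last by apply: hp_ne0 => //; rewrite !oddz_b.
    apply: hol3_theta => //; first exact: hol3_0.
    by apply: hol3M; [apply: hol3D; [apply: hol3M; [exact: hol3_const|exact: hol3_0]|exact:
        hol3_const]|exact: hol3_const].
  apply: hol3M.
    by apply: hol3_e2pi; apply: hol3M; [apply: hol3M; [exact: hol3_const|exact: hf]|exact:
        hol3_const].
  apply: hol3_theta => //; first exact: hol3_0.
  apply: hol3D => //.
  by apply: hol3M; [apply: hol3D; [apply: hol3M; [exact: hol3_const|exact: hol3_0]|exact: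
      hol3_const]|exact: hol3_const].
- move=> p r al be ga de t z o ht det; rewrite {1}/theta2 theta2z_mod ?oddz_b // mul1r theta2z_T //.
    by rewrite !oddzD !oddzM !oddz_b.
  have := oddz_det det; rewrite !oddzD !oddzM !oddz_b; move: o.
  by case: p; case: r => //= _; case: (oddz al); case: (oddz be); case: (oddz ga); case: (oddz de).
- move=> p r l m t z ht o; rewrite /theta2 theta2z_ell // !mul1r; congr (_ ^ _ * _ * e2pi _ * _).
- by move=> p r K o; exact: theta2_bd.
- move=> p r t o ht; rewrite /theta2 /theta2z mulr0 mul0r e2pi0 mul1r add0r divff //;
      apply: hp_ne0 => //; rewrite !oddz_b //.
Qed.

Lemma slotM n n' chi chi' F G : slot n chi F -> slot n' chi' G -> slot (n + n') (chi (+) chi')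
    (fun p r t z => F p r t z * G p r t z).
Proof.
move=> [h1 h2 h3 h4 h5] [i1 i2 i3 i4 i5]; split.
- by move=> p r q f o hq hf; apply: hol3M; [exact: h1|exact: i1].
- move=> p r al be ga de t z o ht det; rewrite h2 // i2 //.
  rewrite (_ : ga%:~R / jc ga de t * ((n + n')%:R * z ^+ 2 / 2) = ga%:~R / jc ga de t *
      (n%:R * z ^+ 2 / 2) + ga%:~R / jc ga de t * (n'%:R * z ^+ 2 / 2)); last by rewrite natrD;
      ring.
  by rewrite e2piD; ring.
- move=> p r l m t z ht o; rewrite h3 // i3 //; have m1 : (-1 : C) != 0 by rewrite oppr_eq0
      oner_eq0.
  have s : (-1) ^ ((chi (+) chi')%:Z * (p%:Z * m + r%:Z * l)) = (-1) ^
      (chi%:Z * (p%:Z * m + r%:Z * l)) * (-1) ^ (chi'%:Z * (p%:Z * m + r%:Z * l)) :> C.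
    rewrite -expfzDr //; case: (chi); case: (chi') => //=; rewrite ?mul0r ?mul1r ?addr0 ?add0r //.
    by rewrite expr0z (@signz_even R _ (p%:Z * m + r%:Z * l)) // mulr_natl mulr2n.
  rewrite s (_ : (n + n')%N%:Z * (l + m) = n%:Z * (l + m) + n'%:Z * (l + m)); last by rewrite PoszD;
      ring.
  rewrite (expfzDr (n%:Z * (l + m))) //.
  rewrite (_ : - ((n + n')%:R * l%:~R ^+ 2 * t / 2) - (n + n')%:R * l%:~R * z =
      (- (n%:R * l%:~R ^+ 2 * t / 2) - n%:R * l%:~R * z) + (- (n'%:R * l%:~R ^+ 2 * t / 2) - n'%:R *
      l%:~R * z)); last by rewrite natrD; ring.
  by rewrite (e2piD (- (n%:R * l%:~R ^+ 2 * t / 2) - n%:R * l%:~R * z)); ring.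
- move=> p r K o; have [M [Y h]] := h4 p r K o; have [M' [Y' h']] := i4 p r K o; exists (M * M'),
      (Num.max Y Y') => t z.
  by rewrite gt_max => /andP[tY tY'] hz; rewrite cabsM; apply: ler_pM; rewrite ?cabs_ge0 ?h ?h'.
- by move=> p r t o ht; rewrite h5 // i5 // mulr1.
Qed.

Lemma slot_1 : slot 0 false (fun _ _ _ _ => 1).
Proof.
split=> //.
- by move=> p r q f _ _ _; exact: hol3_const.
- by move=> p r al be ga de t z _ _ _; rewrite !mul0r mulr0 e2pi0 mulr1.
- by move=> p r l m t z _ _; rewrite !mul0r subr0 oppr0 e2pi0 !expr0z !mulr1.
- by move=> p r K o; exists 1, 0 => t z _ _; rewrite cabs1.
Qed.

(* The product over the two other points of order two. *)
Definition theta2U (p r : bool) (t z : C) : C := theta2 r (p (+) r) t z * theta2 (p (+) r) p t z.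
(** The three points of order two add up to 0, so the characters of two of them multiply to that of
    the third. A matrix that moves the third point permutes the pair of the others accordingly. *)
Lemma slot_theta2U : slot 2 true theta2U.
Proof.
have [h1 h2 h3 h4 h5] := slot_theta2; have o1 p r : p || r -> r || (p (+) r) by case: p; case: r.
have o2 p r : p || r -> (p (+) r) || p by case: p; case: r.
split.
- by move=> p r q f o hq hf; apply: hol3M; [apply: h1 => //; exact: o1|apply: h1 => //; exact: o2].
- move=> p r al be ga de t z o ht det; rewrite /theta2U !h2 ?o1 ?o2 //.
  rewrite (_ : ga%:~R / jc ga de t * (2 * z ^+ 2 / 2) = ga%:~R / jc ga de t * (1 * z ^+ 2 / 2) +
      ga%:~R / jc ga de t * (1 * z ^+ 2 / 2)); last by field; exact: (jc_ne0 ht det).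
  rewrite e2piD mulrACA; congr (_ * _); have := oddz_det det; move: o.
  by case: p; case: r => // _; case: (oddz al); case: (oddz be); case: (oddz ga); case: (oddz de) =>
      //= _; rewrite mulrC.
- move=> p r l m t z ht o; rewrite /theta2U !h3 ?o1 ?o2 //.
  rewrite (_ : - (2 * l%:~R ^+ 2 * t / 2) - 2 * l%:~R * z = (- (1 * l%:~R ^+ 2 * t / 2) - 1 *
      l%:~R * z) + (- (1 * l%:~R ^+ 2 * t / 2) - 1 * l%:~R * z)); last by field.
  rewrite (e2piD (- (1 * l%:~R ^+ 2 * t / 2) - 1 * l%:~R * z)).
  have m1 : (-1 : C) != 0 by rewrite oppr_eq0 oner_eq0.
  have s2 : (-1) ^ (1%:Z * (l + m)) * (-1) ^ (1%:Z * (l + m)) = (-1) ^ (2%:Z * (l + m)) :> C by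
      rewrite -expfzDr //; congr (_ ^ _); ring.
  have s3 : (-1) ^ (true%:Z * (r%:Z * m + (p (+) r)%:Z * l)) * (-1) ^
      (true%:Z * ((p (+) r)%:Z * m + p%:Z * l)) = (-1) ^ (true%:Z * (p%:Z * m + r%:Z * l)) :> C.
    rewrite -expfzDr //; apply: (@sgn_eq _ _ ((p%:Z + r%:Z - 1) * 0 +
        (if p then if r then 0 else l else m))).
    by move: o; case: p; case: r => //= _; ring.
  by rewrite -s2 -s3; ring.
- move=> p r K o; have [M [Y h]] := h4 _ _ K (o1 _ _ o); have [M' [Y' h']] := h4 _ _ K (o2 _ _ o);
      exists (M * M'), (Num.max Y Y') => t z.
  by rewrite gt_max => /andP[tY tY'] hz; rewrite /theta2U cabsM;
      apply: (ler_pM (cabs_ge0 _) (cabs_ge0 _)); [exact: h|exact: h'].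
- by move=> p r t o ht; rewrite /theta2U !h5 ?o1 ?o2 // mulr1.
Qed.

(** Indices 1 and 2 come from [theta2] and [theta2U]; the square of [theta2] adds 2 and does not
    affect the character. *)
Lemma slot_true n : exists F, slot n.+1 true F.
Proof.
suff h : (exists F, slot n.+1 true F) /\ exists F, slot n.+2 true F by have [] := h.
elim: n => [|n [[F hF] [G hG]]]; first by split; [exists theta2; exact: slot_theta2|exists theta2U;
    exact: slot_theta2U].
by split; [exists G|eexists; exact: (slotM (slotM slot_theta2 slot_theta2) hF)].
Qed.

(** Indices 2 and 3 are products of two factors with the character. The exclusion of index 1 is
    forced by [J_vanish]. *)
Lemma slot_false n : n <> 1%N -> exists F, slot n false F.
Proof.
move=> n1; suff h m : (exists F, slot m.+2 false F) /\ exists F, slot m.+3 false F.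
  case: n n1 => [|[|n]] // _; first by eexists; exact: slot_1.
  by have [] := h n.
elim: m => [|m [[F hF] hG]].
  by split; eexists; [exact: (slotM slot_theta2 slot_theta2)|exact:
      (slotM slot_theta2 slot_theta2U)].
by split => //; eexists; exact: (slotM (slotM slot_theta2 slot_theta2) hF).
Qed.

Definition sum_half (G : bool -> bool -> C) : C := G false true + G true false + G true true.

(* Average over the three points of order two. *)
Lemma unit_ex a b c chi F G H : slot a chi F -> slot b chi G -> slot c chi H ->
  exists2 u, J a b c 0 u & forall t : C, 0 < complex.Im t -> u (t, 0, 0) = 1.
Proof.
move=> [h1 h2 h3 h4 h5] [i1 i2 i3 i4 i5] [j1 j2 j3 j4 j5].
pose W p r (q : C3) := F p r q.1.1 q.1.2 * G p r q.1.1 (q.1.2 + q.2) * H p r q.1.1 q.2.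
have k1 p r q : p || r -> inH q -> hol3 (W p r) q.
  move=> o hq; apply: hol3M; [apply: hol3M|]; [apply: h1|apply: i1|apply: j1] => //;
      [exact: hol3_1|exact: hol3D (hol3_1 _) (hol3_2 _)|exact: hol3_2].
have k2 (p r : bool) (al be ga de : int) (t x y : C) : p || r -> 0 < complex.Im t -> al * de - be *
    ga = 1 ->
   W p r (mob al be ga de t, x / jc ga de t, y / jc ga de t) = e2pi (ga%:~R / jc ga de t *
       (qf a b c x y / 2)) *
     W (p && oddz al (+) r && oddz ga) (p && oddz be (+) r && oddz de) (t, x, y).
  move=> o ht det; rewrite /W /= -mulrDl h2 // i2 // j2 //.
  rewrite (_ : ga%:~R / jc ga de t * (qf a b c x y / 2) = ga%:~R / jc ga de t * (a%:R * x ^+ 2 / 2)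
      + ga%:~R / jc ga de t * (b%:R * (x + y) ^+ 2 / 2) + ga%:~R / jc ga de t *
      (c%:R * y ^+ 2 / 2)); last by rewrite /qf; ring.
  by rewrite !e2piD; ring.
have m1 : (-1 : C) != 0 by rewrite oppr_eq0 oner_eq0.
have sg (n : nat) (u : int) : (-1) ^ (n%:Z * u ^+ 2) = (-1) ^ (n%:Z * u) :> C.
  have [x [->|->]] := par2 u.
    by rewrite (@signz_even R _ (n%:Z * (2 * x ^+ 2))) ?(@signz_even R _ (n%:Z * x)) //; ring.
  have -> : n%:Z * (2 * x + 1) ^+ 2 = n%:Z * (2 * x + 1) + 2 * (n%:Z * (2 * x ^+ 2 + x)) by ring.
  by apply: (@sgn_eq _ _ (n%:Z * (2 * x ^+ 2 + x))).
have sq u v : (-1) ^ (qz a b c u v) = (-1) ^ (a%:Z * u) * (-1) ^ (b%:Z * (u + v)) * (-1) ^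
    (c%:Z * v) :> C.
  by rewrite /qz !expfzDr // !sg.
have sd (x y z : int) : (-1) ^ (x * (y + z)) = (-1) ^ (x * y) * (-1) ^ (x * z) :> C by rewrite
    mulrDr expfzDr.
have sqq u v m n : (-1) ^ (qz a b c u v + qz a b c m n) = (-1) ^ (a%:Z * (u + m)) * (-1) ^
    (b%:Z * ((u + v) + (m + n))) * (-1) ^ (c%:Z * (v + n)) :> C.
  by rewrite expfzDr // !sq !sd; ring.
have k3 (p r : bool) u v m n (t x y : C) : p || r -> 0 < complex.Im t ->
  W p r (t, x + u%:~R * t + m%:~R, y + v%:~R * t + n%:~R) =
  (-1) ^ (qz a b c u v + qz a b c m n) * e2pi (- (t * (qf a b c u%:~R v%:~R / 2)) - bq a b c u%:~R
      v%:~R x y) * W p r (t, x, y).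
  move=> o ht; rewrite /W /=.
  have -> : x + u%:~R * t + m%:~R + (y + v%:~R * t + n%:~R) = (x + y) + (u + v)%:~R * t +
      (m + n)%:~R by rewrite !intrD; ring.
  rewrite h3 // i3 // j3 // sqq.
  (* The character is additive, and the lattice vector acting on x + y is the sum of those acting on
     x and on y, so the product of the three characters is trivial. *)
  have cc : (-1) ^ (chi%:Z * (p%:Z * m + r%:Z * u)) * (-1) ^
      (chi%:Z * (p%:Z * (m + n) + r%:Z * (u + v))) * (-1) ^ (chi%:Z * (p%:Z * n + r%:Z * v)) =
      1 :> C.
    rewrite -!expfzDr // (@signz_even R _ (chi%:Z * (p%:Z * (m + n) + r%:Z * (u + v)))) //; ring.
  have -> : e2pi (- (t * (qf a b c u%:~R v%:~R / 2)) - bq a b c u%:~R v%:~R x y) =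
    e2pi (- (a%:R * u%:~R ^+ 2 * t / 2) - a%:R * u%:~R * x) *
        e2pi (- (b%:R * (u + v)%:~R ^+ 2 * t / 2) - b%:R * (u + v)%:~R * (x + y)) *
        e2pi (- (c%:R * v%:~R ^+ 2 * t / 2) - c%:R * v%:~R * y).
    by rewrite -!e2piD; congr e2pi; rewrite /qf /bq intrD; ring.
  move: cc; set c1 := (-1) ^ (chi%:Z * (p%:Z * m + r%:Z * u)); set c2 := (-1) ^ (chi%:Z * _);
      set c3 := (-1) ^ (chi%:Z * _) => cc.
  set u0 := RHS; transitivity (u0 * (c1 * c2 * c3)); last by rewrite cc mulr1.
  by rewrite /u0; ring.
exists (fun q => 3^-1 * sum_half (fun p r => W p r q)); last first.
  by move=> t ht; rewrite /sum_half /W /= addr0 !h5 // !i5 // !j5 //; field.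
split.
- by move=> q hq; apply: hol3M; [exact: hol3_const|apply: hol3D; [apply: hol3D|]; exact: k1].
- move=> al be ga de t x y det ht; rewrite expr0z mul1r /sum_half !k2 // -!mulrDr mulrCA;
      congr (_ * (_ * _)) => /=.
  have := oddz_det det; case: (oddz al); case: (oddz be); case: (oddz ga); case: (oddz de) => //= _;
      ring.
- move=> u v m n t x y ht; rewrite /sum_half !k3 //; ring.
have cW p r : p || r -> Jcusp (W p r).
  move=> o K; have [M1 [Y1 b1]] := h4 p r K o; have [M2 [Y2 b2]] := i4 p r (K + K) o;
      have [M3 [Y3 b3]] := j4 p r K o.
  exists (M1 * M2 * M3), (Num.max (Num.max Y1 Y2) Y3) => t x y; rewrite !gt_max =>
      /andP[/andP[t1 t2] t3] hx hy.
  rewrite /W /= !cabsM; apply: ler_pM; rewrite ?mulr_ge0 ?cabs_ge0 ?b3 //; apply: ler_pM;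
      rewrite ?cabs_ge0 ?b1 //.
  by apply: b2 => //; apply: le_trans (cabsD _ _) _; apply: lerD.
apply: JcuspM; first by move=> K; exists (cabs 3^-1), 0.
by apply: Jcusp_D; [apply: Jcusp_D|]; exact: cW.
Qed.

End Units.

(** * The form of index (1,1,1) and weight -2 *)

Section ZElt.
Variable R : realType.
Notation C := (CC R).
Notation tpi := (tpi R).
Notation C3 := (C3 R).
Opaque theta.

Lemma cdiff_e2pi (x : C) : cdiff (@e2pi R) x (tpi * e2pi x).
Proof.
have h := cdiff_comp (cdiff_cexp (tpi * x)) (cdiffM (cdiff_const tpi x) (cdiff_id x)).
by move: h; rewrite mulr1 mul0r addr0 mulrC; apply: cdiff_ext; exists 1.
Qed.

(** The derivative is the value at x = 0 of (theta(x + z) - theta(z)) / x, which [hol3_div_x] makes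
    holomorphic in t and z jointly. *)
Lemma dtheta_ex : exists dth : C -> C -> C,
  (forall (g : C3 -> C) q, inH q -> hol3 g q -> hol3 (fun q => dth q.1.1 (g q)) q) /\
  forall t z : C, 0 < complex.Im t -> cdiff (theta t) z (dth t z).
Proof.
pose f (p : C3) : C := theta p.1.1 (p.1.2 + p.2) - theta p.1.1 p.2.
have hf p : inH p -> hol3 f p.
  by move=> hp; apply: hol3D; [|apply: hol3N]; apply: hol3_theta => //; try exact: hol3_0;
      [apply: hol3D; [exact: hol3_1|exact: hol3_2]|exact: hol3_2].
have [t y _|F hF eF] := hol3_div_x hf; first by rewrite /f /= add0r subrr.
exists (fun t z => F (t, 0, z)); split.
  move=> g q hq hg; apply: (@hol3_comp3 R F (fun q => q.1.1) (fun=> 0) g) => //;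
      [exact: hF|exact: hol3_0|exact: hol3_const].
move=> t z ht; exists (fun w => F (t, w - z, z)); split.
- apply: cder_cont; apply: (@cder_comp R (fun x => F (t, x, z)) (fun w => w - z));
      last by apply: cderD; [exact: cder_id|exact: cder_const].
  by rewrite subrr; exact: (slice1 (hF (t, 0, z) ht)).
- by rewrite subrr.
- by exists 1 => // w _; have := eF t (w - z) z ht; rewrite /f /= subrK => ->; rewrite mulrC.
Qed.

(** [quad_bound] at distance 1/4 from [p] gives 4 (2 M + M / 2) = 10 M. *)
Lemma cdiff_bd (f : C -> C) (p l : C) (M : R) : (forall z, cder f z) ->
    (forall z, cabs (z - p) < 1 -> cabs (f z) <= M) -> cdiff f p l ->
  cabs l <= 10 * M.
Proof.
move=> df bf dl; pose z : C := p + 4^-1.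
have c4 : cabs (4^-1 : C) = 4^-1 by rewrite cabsV cabs_nat.
have zp : z - p = 4^-1 by rewrite /z addrAC subrr add0r.
have := @quad_bound R f p l 1 M ltr01 (fun z _ => df z) bf dl z ltac:(by rewrite zp c4; lra).
rewrite zp c4 expr1n divr1 => h.
have b1 := bf z ltac:(by rewrite zp c4; lra); have b2 := bf p ltac:(by rewrite subrr cabs0; lra).
have -> : l = 4 * (f z - f p - (f z - f p - l * 4^-1)) by field.
have := cabsB (f z - f p) (f z - f p - l * 4^-1); have := cabsB (f z) (f p); rewrite cabsM cabs_nat;
    lra.
Qed.

(* The form theta'(x) theta(x+y) theta(y) - theta(x) theta'(x+y) theta(y) + theta(x) theta(x+y)
   theta'(y), divided by 2 pi i. *)
Lemma thetasq_lift : exists2 u, J 1 1 1 (-2%:Z) u & forall t y : C, 0 < complex.Im t ->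
    u (t, 0, y) = theta t y ^+ 2.
Proof.
have [dth [hol dd]] := dtheta_ex; have P0 := tpi_ne0 R.
(* Differentiating the laws of theta produces an extra multiple of z theta under SL2(Z), and of u
   theta under translation by u t. In the alternating sum these extras combine to x - (x + y) + y =
   0 and u - (u + v) + v = 0. *)
have dmod (al be ga de : int) (t z : C) : al * de - be * ga = 1 -> 0 < complex.Im t ->
  dth (mob al be ga de t) (z / jc ga de t) = e2pi (ga%:~R / jc ga de t * (z ^+ 2 / 2)) *
      (dth t z + tpi * (ga%:~R / jc ga de t) * z * theta t z).
  move=> det ht; have j0 := jc_ne0 ht det; have hm := mob_im ht det; set j := jc ga de t in j0 *.
  have lin : cdiff (fun w => w / j) z j^-1.
    by have := cdiffM (cdiff_id z) (cdiff_const j^-1 z); rewrite mulr0 add0r mul1r.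
  have d1 := @cdiff_comp R (theta (mob al be ga de t)) (fun w => w / j) z _ _ (dd _ (z / j) hm) lin.
  have sq : cdiff (fun w => ga%:~R / j * (w ^+ 2 / 2)) z (ga%:~R / j * z).
    have := cdiffM (cdiff_const (ga%:~R / j / 2) z) (cdiffM (cdiff_id z) (cdiff_id z)).
    rewrite mul0r addr0 mulr1 mul1r (_ : ga%:~R / j / 2 * (z + z) = ga%:~R / j * z); last by field.
    by apply: cdiff_ext; exists 1 => // w _; field.
  have d2 := cdiffM (cdiffM (cdiff_const j^-1 z) (@cdiff_comp R (@e2pi R) _ z _ _ (cdiff_e2pi _)
      sq)) (dd t z ht).
  have d3 : cdiff (fun w => theta (mob al be ga de t) (w / j)) z
      (j^-1 * e2pi (ga%:~R / j * (z ^+ 2 / 2)) * dth t z +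
      (j^-1 * (tpi * e2pi (ga%:~R / j * (z ^+ 2 / 2)) * (ga%:~R / j * z)) + 0 *
      e2pi (ga%:~R / j * (z ^+ 2 / 2))) * theta t z).
    by apply: cdiff_ext d2; exists 1 => // w _; rewrite /mob /j /jc theta_mod.
  have e := cdiff_unique d1 d3; apply: (@mulIf _ j^-1); first by rewrite invr_eq0.
  by rewrite e; ring.
have dell (u m : int) (t z : C) : 0 < complex.Im t ->
  dth t (z + u%:~R * t + m%:~R) = (-1) ^ (u + m) * e2pi (- (u%:~R ^+ 2 * t / 2) - u%:~R * z) *
      (dth t z - tpi * u%:~R * theta t z).
  move=> ht; have lin : cdiff (fun w => w + u%:~R * t + m%:~R) z 1.
    by have := cdiffD (cdiffD (cdiff_id z) (cdiff_const (u%:~R * t) z)) (cdiff_const (m%:~R) z);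
        rewrite !addr0.
  have d1 := @cdiff_comp R (theta t) (fun w => w + u%:~R * t + m%:~R) z _ _
      (dd t (z + u%:~R * t + m%:~R) ht) lin.
  have sq : cdiff (fun w => - (u%:~R ^+ 2 * t / 2) - u%:~R * w) z (- u%:~R).
    have := cdiffD (cdiff_const (- (u%:~R ^+ 2 * t / 2)) z) (cdiffM (cdiff_const (- u%:~R) z)
        (cdiff_id z)).
    by rewrite mul0r addr0 mulr1 add0r; apply: cdiff_ext; exists 1 => // w _; rewrite mulNr.
  have d2 := cdiffM (cdiffM (cdiff_const ((-1) ^ (u + m)) z) (@cdiff_comp R (@e2pi R) _ z _ _
      (cdiff_e2pi _) sq)) (dd t z ht).
  have d3 : cdiff (fun w => theta t (w + u%:~R * t + m%:~R)) z
      ((-1) ^ (u + m) * e2pi (- (u%:~R ^+ 2 * t / 2) - u%:~R * z) * dth t z +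
      ((-1) ^ (u + m) * (tpi * e2pi (- (u%:~R ^+ 2 * t / 2) - u%:~R * z) * - u%:~R) + 0 *
      e2pi (- (u%:~R ^+ 2 * t / 2) - u%:~R * z)) * theta t z).
    by apply: cdiff_ext d2; exists 1 => // w _; rewrite theta_law.
  by have := cdiff_unique d1 d3; rewrite mulr1 => ->; ring.
have dcusp (K : R) : exists M Y : R, forall t z : C, Y < complex.Im t -> cabs z <= K ->
    cabs (dth t z) <= M.
  have [M [Y h]] := theta_cusp (K + 1); exists (10 * M), (Num.max Y 0) => t z; rewrite gt_max =>
      /andP[tY t0] hz.
  apply: (@cdiff_bd (theta t) z _ M) (dd t z t0); first by move=> w; exact: cder_theta.
  by move=> w wz; apply: h => //; have := cabsD (w - z) z; rewrite subrK; lra.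
pose w (p : C3) : C := dth p.1.1 p.1.2 * theta p.1.1 (p.1.2 + p.2) * theta p.1.1 p.2 - theta p.1.1
    p.1.2 * dth p.1.1 (p.1.2 + p.2) * theta p.1.1 p.2
   + theta p.1.1 p.1.2 * theta p.1.1 (p.1.2 + p.2) * dth p.1.1 p.2.
exists (fun p => tpi^-1 * w p); last first.
  move=> t y ht; have dP : dth t 0 = tpi by apply: cdiff_unique (dd t 0 ht) _; exact: cdiff_theta0.
  by rewrite /w /= add0r theta0 dP; field.
have cx : Jcusp (fun p : C3 => theta p.1.1 p.1.2) by move=> K; have [M [Y h]] := theta_cusp K;
    exists M, Y => t x y tY hx hy; exact: h.
have cy : Jcusp (fun p : C3 => theta p.1.1 p.2) by move=> K; have [M [Y h]] := theta_cusp K;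
    exists M, Y => t x y tY hx hy; exact: h.
have cxy : Jcusp (fun p : C3 => theta p.1.1 (p.1.2 + p.2)).
  by move=> K; have [M [Y h]] := theta_cusp (K + K); exists M, Y => t x y tY hx hy; apply: h => //;
      apply: le_trans (cabsD _ _) _; apply: lerD.
have ex : Jcusp (fun p : C3 => dth p.1.1 p.1.2) by move=> K; have [M [Y h]] := dcusp K;
    exists M, Y => t x y tY hx hy; exact: h.
have ey : Jcusp (fun p : C3 => dth p.1.1 p.2) by move=> K; have [M [Y h]] := dcusp K; exists M, Y =>
    t x y tY hx hy; exact: h.
have exy : Jcusp (fun p : C3 => dth p.1.1 (p.1.2 + p.2)).
  by move=> K; have [M [Y h]] := dcusp (K + K); exists M, Y => t x y tY hx hy; apply: h => //;
      apply: le_trans (cabsD _ _) _; apply: lerD.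
have cc (k : C) : Jcusp (fun=> k) by move=> K; exists (cabs k), 0.
split.
- move=> p hp; apply: hol3M; first exact: hol3_const.
  have hxy := hol3D (hol3_1 p) (hol3_2 p).
  apply: hol3D; [apply: hol3D; [|apply: hol3N]|]; (apply: hol3M; [apply: hol3M|]);
      (apply: hol || (apply: hol3_theta; [by []|exact: hol3_0|])) => //; try exact: hol3_1;
      try exact: hol3_2.
- move=> al be ga de t x y det ht; have j0 := jc_ne0 ht det; have hm := mob_im ht det.
  rewrite /w /= -mulrDl !dmod // /mob /jc !theta_mod // -/(jc ga de t).
  have -> : e2pi (ga%:~R / jc ga de t * (qf 1 1 1 x y / 2)) = e2pi (ga%:~R / jc ga de t *
      (x ^+ 2 / 2)) * e2pi (ga%:~R / jc ga de t * ((x + y) ^+ 2 / 2)) * e2pi (ga%:~R / jc ga de t *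
      (y ^+ 2 / 2)).
    by rewrite -!e2piD; congr e2pi; rewrite /qf; ring.
  have -> : jc ga de t ^ (- 2%:Z) = (jc ga de t)^-1 * (jc ga de t)^-1 by rewrite -exprnN expr2
      invfM.
  by ring.
- move=> u v m n t x y ht; rewrite /w /=.
  have -> : x + u%:~R * t + m%:~R + (y + v%:~R * t + n%:~R) = (x + y) + (u + v)%:~R * t +
      (m + n)%:~R by rewrite !intrD; ring.
  rewrite !dell // !theta_law //.
  have -> : (-1) ^ (qz 1 1 1 u v + qz 1 1 1 m n) = 1 :> C.
    by apply: (@signz_even R _ (u ^+ 2 + u * v + v ^+ 2 + m ^+ 2 + m * n + n ^+ 2)); rewrite /qz;
        ring.
  have s1 : (-1) ^ (u + m) * (-1) ^ (u + v + (m + n)) * (-1) ^ (v + n) = 1 :> C.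
    by rewrite -!expfzDr ?oppr_eq0 ?oner_eq0 //; apply: (@signz_even R _ (u + v + m + n)); ring.
  have -> : e2pi (- (t * (qf 1 1 1 u%:~R v%:~R / 2)) - bq 1 1 1 u%:~R v%:~R x y) =
    e2pi (- (u%:~R ^+ 2 * t / 2) - u%:~R * x) * e2pi (- ((u + v)%:~R ^+ 2 * t / 2) - (u + v)%:~R *
        (x + y)) * e2pi (- (v%:~R ^+ 2 * t / 2) - v%:~R * y).
    by rewrite -!e2piD; congr e2pi; rewrite /qf /bq intrD; ring.
  rewrite [in tpi * (u + v)%:~R]intrD.
  set u0 := RHS; transitivity (u0 * ((-1) ^ (u + m) * (-1) ^ (u + v + (m + n)) * (-1) ^ (v + n)));
      last by rewrite s1 mulr1.
  rewrite /u0; move: ((-1) ^ (u + m)) ((-1) ^ (u + v + (m + n))) ((-1) ^ (v + n)) (e2pi _) (e2pi _)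
      (e2pi _) => ? ? ? ? ? ?; ring.
- apply: JcuspM; first exact: cc.
  apply: Jcusp_D; [apply: Jcusp_D|]; first by do 2!apply: JcuspM => //.
    have := JcuspM (cc (-1)) (JcuspM (JcuspM cx exy) cy) => h K; have [M [Y hM]] := h K;
        exists M, Y => t x y tY hx hy.
    by have := hM t x y tY hx hy; rewrite mulN1r.
  by do 2!apply: JcuspM => //.
Qed.

End ZElt.

(** * Bases *)

Section Freeness.
Variable R : realType.
Notation C := (CC R).
Notation C3 := (C3 R).
Opaque theta.

Definition elt := (int * (C3 -> C))%type.
Definition elt0 : elt := (0, fun=> 0).
Notation wt B i := (nth elt0 B i).1.
Notation el B i := (nth elt0 B i).2.
Definition lincomb (B : seq elt) (c : nat -> C) (p : C3) : C := \sum_(i < size B) c i * el B i p.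

Lemma lincomb_nil c p : lincomb [::] c p = 0.
Proof. by rewrite /lincomb big_ord0. Qed.
Lemma lincomb_cons b B c p : lincomb (b :: B) c p = c 0%N * b.2 p + lincomb B (fun i => c i.+1) p.
Proof. by rewrite /lincomb big_ord_recl. Qed.
Lemma lincomb_cat B B' c p : lincomb (B ++ B') c p = lincomb B c p + lincomb B'
    (fun i => c (size B + i)%N) p.
Proof.
elim: B c => [|b B IH] c; first by rewrite lincomb_nil add0r.
by rewrite cat_cons !lincomb_cons IH addrA.
Qed.

Lemma lincomb_eqc B c c' p : (forall i, (i < size B)%N -> c i = c' i) -> lincomb B c p =
    lincomb B c' p.
Proof. by move=> h; apply: eq_bigr => i _; rewrite h. Qed.

Definition allJ a b c (B : seq elt) := forall i, (i < size B)%N -> J a b c (wt B i) (el B i).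
Definition MFs (k : int) (B : seq elt) (g : nat -> C -> C) := forall i, (i < size B)%N ->
    MF (k - wt B i) (g i).
(* Independence is required at each fixed t, which is stronger than over functions of t and is what
   the induction preserves. *)
Definition Free a b c (B : seq elt) := [/\ allJ a b c B,
  forall k f, J a b c k f -> exists2 g, MFs k B g & forall p, inH p -> f p = lincomb B
      (fun i => g i p.1.1) p &
  forall (t : C) (cs : nat -> C), 0 < complex.Im t -> (forall x y : C, lincomb B cs (t, x, y) = 0)
      -> forall i, (i < size B)%N -> cs i = 0].

Lemma J_sub a b c k f B g : J a b c k f -> allJ a b c B -> MFs k B g ->
    J a b c k (fun p => f p - lincomb B (fun i => g i p.1.1) p).
Proof.
elim: B f g => [|b0 B IH] f g hf hB hg; first by apply: J_ext hf => p _; rewrite lincomb_nil subr0.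
have h0 := hB 0%N isT; have g0 := hg 0%N isT; rewrite /= in h0 g0.
have hf' : J a b c k (fun p => f p + -1 * (g 0%N p.1.1 * b0.2 p)).
  by apply: J_D => //; apply: J_Z; have := J_MF g0 h0; rewrite subrK.
have := IH _ (fun i => g i.+1) hf' (fun i => hB i.+1) (fun i => hg i.+1).
by apply: J_ext => p _; rewrite lincomb_cons; ring.
Qed.

Lemma lincomb_cder a b c B cs (t x y : C) : allJ a b c B -> 0 < complex.Im t ->
    cder (fun x => lincomb B cs (t, x, y)) x.
Proof.
move=> jB ht; elim: B cs jB => [|b0 B IH] cs jB.
  by apply: cder_ext (cder_const 0 x); exists 1 => // w _; rewrite lincomb_nil.
have [h1 _ _ _] := jB 0%N isT; have h2 := slice1 (h1 (t, x, y) ht).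
apply: cder_ext (cderD (cderM (cder_const (cs 0%N) x) h2)
    (IH (fun i => cs i.+1) (fun i => jB i.+1))); exists 1 => // w _.
by rewrite lincomb_cons.
Qed.

Lemma J00_x c k f : J 0 0 c k f -> forall t x y : C, 0 < complex.Im t -> f (t, x, y) = f (t, 0, y).
Proof.
move=> [h1 _ h3 _] t x y ht; have per u m (z : C) : f (t, z + u%:~R * t + m%:~R, y) = f (t, z, y).
  have := h3 u 0 m 0 t z y ht; rewrite mulr0z mul0r !addr0 => ->.
  rewrite (_ : qz 0 0 c _ _ + _ = 0); last by rewrite /qz; ring.
  rewrite (_ : qf 0 0 c _ _ = 0); last by rewrite /qf; ring.
  rewrite (_ : bq 0 0 c _ _ z y = 0); last by rewrite /bq; ring.
  by rewrite mul0r mulr0 subr0 oppr0 e2pi0 expr0z !mul1r.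
apply: (@ell_liouville R t (fun x => f (t, x, y))) => // z; first exact: (slice1 (h1 (t, z, y) ht)).
- by have := per 0 1 z; rewrite mulr0z mul0r addr0 mulr1z => ->.
- by have := per 1 0 z; rewrite mulr0z addr0 mulr1z mul1r => ->.
Qed.

Definition eqB (B B' : seq elt) := size B = size B' /\ forall i, (i < size B)%N -> wt B i =
    wt B' i /\ forall p, inH p -> el B i p = el B' i p.
Lemma Free_eq a b c B B' : eqB B B' -> Free a b c B -> Free a b c B'.
Proof.
move=> [es eB] [h1 h2 h3]; have eS cs p : inH p -> lincomb B cs p = lincomb B' cs p.
  by move=> hp; rewrite /lincomb -es; apply: eq_bigr => i _; have [_ ->] := eB i (ltn_ord i).
split.
- by move=> i; rewrite -es => ib; have [<- e] := eB i ib; apply: J_ext (h1 i ib).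
- move=> k f /h2[g hg e]; exists g; last by move=> p hp; rewrite e // eS.
  by move=> i; rewrite -es => ib; have [<- _] := eB i ib; exact: hg.
- by move=> t cs ht z i; rewrite -es => ib; apply: (h3 t) => // x y; rewrite eS.
Qed.

Definition fmap (F : (C3 -> C) -> C3 -> C) (k : int) (B : seq elt) : seq elt :=
    [seq (b.1 + k, F b.2) | b <- B].
Lemma fmap_nth F k B i : (i < size B)%N -> nth elt0 (fmap F k B) i = (wt B i + k, F (el B i)).
Proof. by move=> h; rewrite (nth_map elt0). Qed.
Lemma fmap_cat F k B B' : fmap F k (B ++ B') = fmap F k B ++ fmap F k B'.
Proof. exact: map_cat. Qed.
Lemma lincomb_fmap F k (m : C3 -> C) (s : C3 -> C3) B c p : (forall f, F f p = m p * f (s p)) ->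
    lincomb (fmap F k B) c p = m p * lincomb B c (s p).
Proof.
move=> hF; elim: B c => [|b B IH] c; first by rewrite !lincomb_nil mulr0.
by rewrite /fmap /= -/(fmap F k B) !lincomb_cons IH /= hF; ring.
Qed.

Definition mul_theta_x (f : C3 -> C) (p : C3) : C := theta p.1.1 p.1.2 * f p.
Definition res_x0 (f : C3 -> C) (p : C3) : C := f (p.1.1, 0, p.2).

(** A combination of [Lf] makes the form vanish at x = 0, and the quotient by theta is expanded in
    [B]. In a relation at fixed t, setting x = 0 kills the coefficients of [Lf]; what is left is
    divided by theta. *)
Lemma Free_ext0 a b c B Lf : Free a b c B -> allJ a.+1 b c Lf ->
  (forall k f, J a.+1 b c k f -> exists2 g, MFs k Lf g & forall t y : C, 0 < complex.Im t ->
      f (t, 0, y) = lincomb Lf (fun i => g i t) (t, 0, y)) ->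
  (forall (t : C) cs, 0 < complex.Im t -> (forall y : C, lincomb Lf cs (t, 0, y) = 0) -> forall i,
      (i < size Lf)%N -> cs i = 0) ->
  Free a.+1 b c (fmap mul_theta_x (-1) B ++ Lf).
Proof.
move=> [h1 h2 h3] jL sL iL; have sz : size (fmap mul_theta_x (-1) B) = size B by rewrite size_map.
have Sth cs p : lincomb (fmap mul_theta_x (-1) B) cs p = theta p.1.1 p.1.2 * lincomb B cs p by
    apply: (@lincomb_fmap _ _ (fun p => theta p.1.1 p.1.2) id).
split.
- move=> i; rewrite size_cat sz nth_cat sz => ib; case: ltnP => h.
    rewrite fmap_nth //=; have := J_M (J_theta R) (h1 i h); rewrite addrC add1n !add0n; exact: id.
  by apply: jL; rewrite ltn_subLR.
- move=> k f jf; have [g hg eg] := sL k f jf; have jr := J_sub jf jL hg.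
  have [|q jq eq] := J_div jr; first by move=> t y ht /=; rewrite eg // subrr.
  have [g' hg' eg'] := h2 _ _ jq.
  exists (fun i => if (i < size B)%N then g' i else g (i - size B)%N).
    move=> i; rewrite size_cat sz nth_cat sz => ib; case: ltnP => h.
      by rewrite fmap_nth //= (_ : k - (_ + -1) = k + 1 - wt B i); [exact: hg'|ring].
    by apply: hg; rewrite ltn_subLR.
  move=> p hp; rewrite lincomb_cat Sth sz.
  rewrite (lincomb_eqc (c' := fun i => g' i p.1.1)); last by move=> i ->.
  rewrite -(eg' p hp) -(eq p hp) [X in _ + X](lincomb_eqc (c' := fun i => g i p.1.1)) ?subrK //.
  by move=> i _; rewrite ltnNge leq_addr /= addKn.
- move=> t cs ht z.
  have cL i : (i < size Lf)%N -> cs (size B + i)%N = 0.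
    apply: (iL t (fun i => cs (size B + i)%N) ht) => y.
    by have := z 0 y; rewrite lincomb_cat Sth sz /= theta0 mul0r add0r.
  have cB i : (i < size B)%N -> cs i = 0.
    apply: (h3 t cs ht) => x y.
    have hS x' : lincomb Lf (fun i => cs (size B + i)%N) (t, x', y) = 0 by rewrite /lincomb big1 //
        => j _; rewrite cL ?mul0r.
    apply: (@cont_eq_dense R t (fun x => lincomb B cs (t, x, y)) (fun=> 0) x ht); last first.
      move=> w tw; have := z w y; rewrite lincomb_cat Sth sz hS addr0 /= => /eqP.
      by rewrite mulf_eq0 (negPf tw) => /eqP.
    + exact: cont_const.
    by apply: cder_cont; exact: lincomb_cder h1 ht.
  move=> i; rewrite size_cat sz => ib; case: (ltnP i (size B)) => h; first exact: cB.
  by rewrite -(subnKC h); apply: cL; rewrite ltn_subLR.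
Qed.

Lemma Free_ext a b c B Lf : Free a b c B -> allJ a.+1 b c Lf -> Free 0 0 (b + c) (fmap res_x0 0 Lf)
    -> Free a.+1 b c (fmap mul_theta_x (-1) B ++ Lf).
Proof.
move=> fB jL [r1 r2 r3]; have sz : size (fmap res_x0 0 Lf) = size Lf by rewrite size_map.
have SR cs (t x y : C) : lincomb (fmap res_x0 0 Lf) cs (t, x, y) = lincomb Lf cs (t, 0, y).
  by rewrite (@lincomb_fmap _ _ (fun=> 1) (fun p => (p.1.1, 0, p.2))) ?mul1r // => f; rewrite mul1r.
apply: Free_ext0 => //.
- move=> k f /J_res/r2[g hg eg]; exists g => [i iL|t y ht].
    by have := hg i; rewrite sz => /(_ iL); rewrite fmap_nth //= addr0.
  by have := eg (t, 0, y) ht; rewrite /= SR.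
- move=> t cs ht z i iL; apply: (r3 t cs ht); last by rewrite sz.
  by move=> x y; rewrite SR.
Qed.

Lemma Free_swap a b c a' b' c' B (s : C3 -> C3) (F := fun (f : C3 -> C) p => f (s p)) :
  (forall k f, J a b c k f -> J a' b' c' k (F f)) -> (forall k f, J a' b' c' k f -> J a b c k (F f))
      ->
  (forall p, s (s p) = p) -> (forall p, (s p).1.1 = p.1.1) -> Free a b c B ->
      Free a' b' c' (fmap F 0 B).
Proof.
move=> f1 f2 ss st [h1 h2 h3]; have sz : size (fmap F 0 B) = size B by rewrite size_map.
have SF cs p : lincomb (fmap F 0 B) cs p = lincomb B cs (s p) by rewrite
    (@lincomb_fmap _ _ (fun=> 1) s) ?mul1r // => f; rewrite mul1r.
split.
- by move=> i; rewrite sz => ib; rewrite fmap_nth //= addr0; apply/f1/h1.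
- move=> k f /f2/h2[g hg eg]; exists g => [i|p hp].
    by rewrite sz => ib; rewrite fmap_nth //= addr0; exact: hg.
  rewrite SF; have hs : inH (s p) by rewrite /inH st.
  by have := eg _ hs; rewrite /F ss st.
- move=> t cs ht z i; rewrite sz => ib; apply: (h3 t cs ht) => // x y.
  have := z (s (t, x, y)).1.2 (s (t, x, y)).2; rewrite SF.
  have e : (t, (s (t, x, y)).1.2, (s (t, x, y)).2) = s (t, x, y) by move: (st (t, x, y));
      case: (s (t, x, y)) => [[? ?] ?] /= ->.
  by rewrite e ss.
Qed.

Lemma Free_swap_xy a b c B : Free a b c B -> Free c b a (fmap (@swap_xy R) 0 B).
Proof.
apply: (@Free_swap a b c c b a B (fun p => (p.1.1, p.2, p.1.2)));
    [exact: J_swap_xy|exact: J_swap_xy|by move=> [[]]|by []].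
Qed.

Lemma Free_flip_x a b c B : Free a b c B -> Free b a c (fmap (@flip_x R) 0 B).
Proof.
apply: (@Free_swap a b c b a c B (fun p => (p.1.1, - p.1.2 - p.2, p.2)));
    [exact: J_flip_x|exact: J_flip_x| |by []].
by move=> [[t x] y] /=; congr (_, _, _); ring.
Qed.

Lemma Free_000 u : J 0 0 0 0 u -> (forall t : C, 0 < complex.Im t -> u (t, 0, 0) = 1) ->
    Free 0 0 0 [:: (0, u)].
Proof.
move=> ju u1; have [_ uc] := J000 ju; have u1' t x y : 0 < complex.Im t -> u (t, x, y) = 1 by move=>
    ht; rewrite uc // u1.
split.
- by case.
- move=> k f jf; have [mf fc] := J000 jf; exists (fun _ t => f (t, 0, 0)).
    by case=> //= _; rewrite subr0.
  by move=> [[t x] y] hp; rewrite lincomb_cons lincomb_nil /= addr0 u1' // mulr1 fc.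
- by move=> t cs ht z [] //= _; have := z 0 0; rewrite lincomb_cons lincomb_nil /= u1 // mulr1
      addr0.
Qed.

Lemma Free_x m B u : Free m 0 0 B -> J m.+1 0 0 0 u -> (forall t : C, 0 < complex.Im t ->
    u (t, 0, 0) = 1) ->
  Free m.+1 0 0 (fmap mul_theta_x (-1) B ++ [:: (0, u)]).
Proof.
move=> fB ju u1; apply: Free_ext => //; first by case.
by apply: Free_000; [exact: (J_res ju)|].
Qed.

Definition mul_theta_y (f : C3 -> C) (p : C3) : C := theta p.1.1 p.2 * f p.
Definition mul_theta_xy (f : C3 -> C) (p : C3) : C := theta p.1.1 (p.1.2 + p.2) * f p.

Lemma Free_y m B u : Free 0 0 m B -> J 0 0 m.+1 0 u -> (forall t : C, 0 < complex.Im t ->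
    u (t, 0, 0) = 1) ->
  Free 0 0 m.+1 (fmap mul_theta_y (-1) B ++ [:: (0, u)]).
Proof.
move=> /Free_swap_xy fB /J_swap_xy ju u1; have := Free_swap_xy (Free_x fB ju u1);
    rewrite /fmap map_cat -!map_comp.
rewrite (_ : map _ [:: (0, swap_xy u)] = [:: (0, u)]); last by rewrite /= addr0; congr [:: (_, _)];
    apply/funext => -[[]].
rewrite (_ : map _ B = [seq (b.1 + -1, mul_theta_y b.2) | b <- B]) //; apply: eq_map => -[k f] /=.
by rewrite !addr0; congr (_, _); apply/funext => -[[]].
Qed.

Lemma unit_abc a b c : exists2 u, J a.+1 b.+1 c.+1 0 u & forall t : C, 0 < complex.Im t ->
    u (t, 0, 0) = 1.
Proof.
have [F hF] := slot_true R a; have [G hG] := slot_true R b; have [H hH] := slot_true R c;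
    exact: unit_ex hF hG hH.
Qed.

(** The slots of index 0 carry no character, so the slot in x must be of that kind too, which asks
    for index at least 2. On x = 0 the form has index 0, so the value 1 spreads from the origin to
    all y. *)
Lemma unit_x a : exists2 u, J a.+2 0 0 0 u & forall t x y : C, 0 < complex.Im t -> x = 0 ->
    u (t, x, y) = 1.
Proof.
have [F hF] := @slot_false R a.+2 ltac:(by []); have [u ju u1] := unit_ex hF (slot_1 R) (slot_1 R).
exists u => // t x y ht ->; have [_ uc] := J000 (J_res ju); have := uc t 0 y ht; by rewrite /= u1.
Qed.

Lemma unit_y m : exists2 u, J 0 0 m.+2 0 u & forall t : C, 0 < complex.Im t -> u (t, 0, 0) = 1.
Proof. by have [u ju u1] := unit_x m; exists (swap_xy u); [exact: J_swap_xy|move=> t ht;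
    rewrite /swap_xy /= u1]. Qed.

(** Forms of index (1, 0, c) all vanish at x = 0, so division by theta is a bijection onto index (0,
    0, c) and no lifts are to be added. *)
Lemma Free_1 c B : Free 0 0 c B -> Free 1 0 c (fmap mul_theta_x (-1) B).
Proof.
move=> fB; rewrite -[fmap _ _ _]cats0; apply: Free_ext0 => //.
by move=> k f jf; exists (fun _ _ => 0) => // t y ht; rewrite lincomb_nil (J_vanish jf).
Qed.

Lemma Free_001 : Free 0 0 1 [:: (-1, fun p : C3 => theta p.1.1 p.2)].
Proof.
have j1 : J 0 0 0 0 (fun=> 1 : C) by exact: (J_of_MF (MF_c 1)).
have := Free_swap_xy (Free_1 (Free_000 j1 (fun _ _ => erefl))).
rewrite /fmap /= add0r addr0 (_ : swap_xy _ = fun p : C3 => theta p.1.1 p.2) //; apply/funext =>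
    -[[t x] y].
by rewrite /swap_xy /mul_theta_x mulr1.
Qed.

(** * Bases in all indices, with the generating functions of their weights *)

Section Gen.
Variables (K : fieldType) (tt : K).
Definition gen (B : seq elt) : K := \sum_(b <- B) tt ^ b.1.
Hypothesis t0 : tt != 0.
Lemma gen_cat B B' : gen (B ++ B') = gen B + gen B'.
Proof. by rewrite /gen big_cat. Qed.
Lemma gen_fmap F k B : gen (fmap F k B) = tt ^ k * gen B.
Proof.
rewrite /gen big_map mulr_sumr; apply: eq_bigr => b _ /=; by rewrite expfzDr // mulrC.
Qed.

Lemma gen_fmap0 F B : gen (fmap F 0 B) = gen B.
Proof. by rewrite gen_fmap expr0z mul1r. Qed.

(* The weight generating function in rank one; it equals [Ppol], see [Ppol_gen1]. *)
Fixpoint gen1 (m : nat) : K := match m with 0 => 1 | S m' => tt ^ (-1) * gen1 m' +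
    (if m' is 0 then 0 else 1) end.
Lemma gen1SS m : gen1 m.+2 = tt ^ (-1) * gen1 m.+1 + 1.
Proof. by []. Qed.

Lemma rank1_basis m : exists2 B, Free 0 0 m B & gen B = gen1 m.
Proof.
elim: m => [|[|m] [B fB gB]].
- exists [:: (0, fun=> 1)]; last by rewrite /gen big_seq1 expr0z.
  by apply: Free_000 => //; exact: (J_of_MF (MF_c 1)).
- exists (fmap (@swap_xy R) 0 (fmap mul_theta_x (-1) B)); last by rewrite gen_fmap0 gen_fmap gB /=
      addr0.
  exact/Free_swap_xy/Free_1.
- have [u ju u1] := unit_y m; exists (fmap mul_theta_y (-1) B ++ [:: (0, u)]); first exact: Free_y.
  by rewrite gen_cat gen_fmap gB gen1SS /gen big_seq1 expr0z.
Qed.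

(** For b = 0 the quadratic form separates x and y, so a form of weight 0 that equals 1 on x = 0
    lifts every form in y. The generating functions of the weights therefore multiply. *)
Lemma ac_basis a c : exists2 B, Free a 0 c B & gen B = gen1 a * gen1 c.
Proof.
have [Bc fc gc] := rank1_basis c.
elim: a => [|[|a] [B fB gB]].
- by exists Bc => //; rewrite mul1r.
- by exists (fmap mul_theta_x (-1) B); [exact: Free_1|rewrite gen_fmap gB /= addr0 mulrA].
have [u ju u1] := unit_x a; pose Lu (f : C3 -> C) p := u p * f p.
exists (fmap mul_theta_x (-1) B ++ fmap Lu 0 Bc); last by rewrite gen_cat gen_fmap gen_fmap0 gB gc
    gen1SS; ring.
apply: Free_ext => //.
  move=> i; rewrite size_map => ib; rewrite fmap_nth //=; have [jc _ _] := fc.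
  by have := J_M ju (jc i ib); rewrite addn0 !add0n addrC.
rewrite add0n; have [jc _ _] := fc; apply: Free_eq fc; split; first by rewrite !size_map.
move=> i ib; rewrite fmap_nth ?size_map // fmap_nth //= !addr0; split => // -[[t x] y] hp.
by rewrite /res_x0 /Lu /= u1 // mul1r (J00_x (jc i ib)).
Qed.

Lemma bc_basis b c : exists2 B, Free 0 b c B & gen B = gen1 b * gen1 c.
Proof. by have [B fB gB] := ac_basis b c; exists (fmap (@flip_x R) 0 B);
    [exact: Free_flip_x|rewrite gen_fmap0]. Qed.
Lemma ab_basis a b : exists2 B, Free a b 0 B & gen B = gen1 a * gen1 b.
Proof. by have [B fB gB] := bc_basis b a; exists (fmap (@swap_xy R) 0 B);
    [exact: Free_swap_xy|rewrite gen_fmap0 mulrC]. Qed.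

(* Generators of the restriction lift to products of theta factors with lifts of lower index, plus
   one unit. *)
Lemma lifts_step a b c b' c' L Lf : (forall k f, J a b c k f -> J a b' c' (k - 1) (L f)) ->
  (b' + c' = (b + c).+1)%N -> (forall f (p : C3), inH p -> res_x0 (L f) p = mul_theta_y (res_x0 f)
      p) ->
  (exists2 u, J a b' c' 0 u & forall t : C, 0 < complex.Im t -> u (t, 0, 0) = 1) ->
  allJ a b c Lf -> Free 0 0 (b + c) (fmap res_x0 0 Lf) -> gen Lf = gen1 (b + c) ->
      (1 < b' + c')%N ->
  exists Lf', [/\ allJ a b' c' Lf', Free 0 0 (b' + c') (fmap res_x0 0 Lf') & gen Lf' =
      gen1 (b' + c')].
Proof.
move=> hL bc hR [u ju u1] jL fL gL bc1; exists (fmap L (-1) Lf ++ [:: (0, u)]); split.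
- move=> i; rewrite size_cat size_map nth_cat size_map addn1 ltnS => ib; case: ltnP => h.
    by rewrite fmap_nth //=; apply/hL/jL.
  by rewrite (_ : i = size Lf) ?subnn //; apply/eqP; rewrite eqn_leq ib h.
- have jr : J 0 0 (b + c).+1 0 (res_x0 u) by rewrite -bc; exact: (J_res ju).
  have := Free_y fL jr u1; rewrite bc; apply: Free_eq; split;
      first by rewrite !(size_cat, size_map).
  move=> i; rewrite size_cat !size_map addn1 ltnS => ib; rewrite fmap_cat !nth_cat !size_map.
  case: ltnP => h; last by rewrite (_ : i = size Lf) ?subnn /= ?addr0 //; apply/eqP;
      rewrite eqn_leq ib h.
  rewrite !fmap_nth ?size_map //= !addr0; split => // p hp; by rewrite hR.
- by rewrite gen_cat gen_fmap gL bc /gen big_seq1 expr0z; move: bc1; rewrite bc; case: (b + c)%N.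
Qed.

(** Starting from index (a + 1, 1, 1), multiplication by theta(x + y) raises b and multiplication by
    theta(y) raises c; both restrict to theta(y) on x = 0, and each step adds one form of weight
    0. *)
Lemma lifts a b c : exists Lf, [/\ allJ a.+1 b.+1 c.+1 Lf, Free 0 0 (b.+1 + c.+1) (fmap res_x0 0 Lf)
    & gen Lf = gen1 (b.+1 + c.+1)].
Proof.
have Jxy b' c' k f : J a.+1 b' c' k f -> J a.+1 b'.+1 c' (k - 1) (mul_theta_xy f).
  by move=> jf; have := J_M (J_theta_xy R) jf; rewrite !add0n add1n addrC.
have Jy b' c' k f : J a.+1 b' c' k f -> J a.+1 b' c'.+1 (k - 1) (mul_theta_y f).
  by move=> jf; have := J_M (J_theta_y R) jf; rewrite !add0n add1n addrC.
elim: b => [|b [Lf [jL fL gL]]]; last first.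
  apply: (@lifts_step a.+1 b.+1 c.+1 b.+2 c.+1 mul_theta_xy Lf) => //;
      [exact: Jxy| |exact: unit_abc].
  by move=> f p hp; rewrite /res_x0 /mul_theta_xy /mul_theta_y /= add0r.
elim: c => [|c [Lf [jL fL gL]]]; last first.
  by apply: (@lifts_step a.+1 1 c.+1 1 c.+2 mul_theta_y Lf) => //; [exact: Jy|exact: unit_abc].
(* In index (1, 1, 1) there is no weight 0 factor in x to complete theta(x + y) theta(y), and
   [thetasq_lift] takes over; for a larger first entry [unit_x] supplies the factor. *)
have [s js es] : exists2 s, J a.+1 1 1 (- 2%:Z) s & forall t y : C, 0 < complex.Im t ->
    s (t, 0, y) = theta t y ^+ 2.
  case: a {Jxy Jy} => [|a]; first exact: thetasq_lift.
  have [u ju u1] := unit_x a; exists (fun p => u p * (theta p.1.1 (p.1.2 + p.2) * theta p.1.1 p.2)).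
    by have := J_M ju (J_M (J_theta_xy R) (J_theta_y R)); rewrite add0n addn0.
  by move=> t y ht /=; rewrite u1 // mul1r add0r expr2.
have [u ju u1] := unit_abc a 0 0.
exists [:: (- 2%:Z, s); (0, u)]; split.
- by case=> [|[|i]].
- apply: Free_eq (Free_y Free_001 (J_res ju) u1); split => //; case=> [|[|i]] //= _; rewrite ?addr0;
      split => // -[[t x] y] hp.
  by rewrite /res_x0 /mul_theta_y /= es // expr2.
- by rewrite /gen big_cons big_seq1 /= addr0 mulr1 expr0z; congr (_ + 1); rewrite -expfzDr.
Qed.

Fixpoint gen3 (a b c : nat) : K := match a with 0 => gen1 b * gen1 c | S a' => tt ^ (-1) *
    gen3 a' b c + gen1 (b + c) end.

(** If b or c is 0, the two remaining entries belong to independent coordinates. Otherwise the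
    induction on a starts at index (0, b, c), where the same holds. *)
Theorem J_basis a b c : exists2 B, Free a b c B & gen B = if (b == 0)%N then gen1 a * gen1 c else if
    (c == 0)%N then gen1 a * gen1 b else gen3 a b c.
Proof.
case: b => [|b] /=; first exact: ac_basis.
case: c => [|c] /=; first exact: ab_basis.
elim: a => [|a [B fB gB]]; first exact: bc_basis.
have [Lf [jL fL gL]] := lifts a b c; exists (fmap mul_theta_x (-1) B ++ Lf); first exact: Free_ext.
by rewrite gen_cat gen_fmap gB gL.
Qed.

End Gen.
End Freeness.

(** * The generating function of the weights *)

Section GenFun.
Variables (K : fieldType) (tt : K).
Hypothesis t0 : tt != 0.
Hypothesis t1 : 1 - tt ^ (-1) != 0.
Notation gen1 := (@gen1 K tt).

Lemma tX (n : nat) : tt ^ (- n%:Z) = (tt ^ (-1)) ^+ n.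
Proof. by rewrite -exprnN exprN1 exprVn. Qed.
Lemma tX1 (n : nat) : tt ^ (1 - n.+1%:Z) = (tt ^ (-1)) ^+ n.
Proof. by rewrite -tX; congr (_ ^ _); lia. Qed.
Lemma Qpol_nat (n : nat) : Qpol tt n%:Z = (1 - (tt ^ (-1)) ^+ n) / (1 - tt ^ (-1)).
Proof.
rewrite /Qpol; case: n => [|n] /=; first by rewrite expr0 subrr mul0r.
by rewrite tX.
Qed.

Lemma Qpol_pred (n : nat) : Qpol tt (n.+1%:Z - 1) = (1 - (tt ^ (-1)) ^+ n) / (1 - tt ^ (-1)).
Proof. by rewrite -Qpol_nat; congr Qpol; lia. Qed.
Lemma gen1_closed m : gen1 m.+1 = (tt ^ (-1)) ^+ m.+1 + (1 - (tt ^ (-1)) ^+ m) / (1 - tt ^ (-1)).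
Proof.
elim: m => [|m IH]; first by rewrite /= expr0 subrr mul0r mulr1.
by rewrite gen1SS IH !exprS; move: t1; move: (tt ^ (-1)) => s s1; field.
Qed.

Lemma Ppol_gen1 m : Ppol tt m = gen1 m.
Proof.
case: m => [|[|m]] //; first by rewrite /= mulr1 addr0.
by rewrite gen1_closed /Ppol tX tX1.
Qed.

Lemma gen3_closed a b c : gen3 tt a b c = (tt ^ (-1)) ^+ a * (gen1 b * gen1 c) + gen1 (b + c) *
    ((1 - (tt ^ (-1)) ^+ a) / (1 - tt ^ (-1))).
Proof.
elim: a => [|a IH] /=; first by rewrite expr0 subrr mul0r mulr0 addr0 mul1r.
by rewrite IH exprS; move: t1; move: (tt ^ (-1)) => s s1; field.
Qed.

(** With s = t^-1 both sides are rational functions of s and of powers of s, and for positive a, b,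
    c the identity holds with the powers replaced by independent variables. Zero entries are split
    off because [Ppol], [Qpol] and the last term change shape there. *)
Lemma gen_formula a b c :
  (if (b == 0)%N then gen1 a * gen1 c else if (c == 0)%N then gen1 a * gen1 b else gen3 tt a b c) =
          Ppol tt a * Ppol tt b * Ppol tt c
          + Qpol tt a%:Z * Qpol tt b%:Z * Qpol tt c%:Z
          + (2 * tt ^ (-1) - 1) * Qpol tt (a%:Z - 1) * Qpol tt (b%:Z - 1) * Qpol tt (c%:Z - 1)
          - tt ^ (-1) * (Qpol tt a%:Z * Qpol tt (b%:Z - 1) * Qpol tt (c%:Z - 1)
                        + Qpol tt (a%:Z - 1) * Qpol tt b%:Z * Qpol tt (c%:Z - 1)
                        + Qpol tt (a%:Z - 1) * Qpol tt (b%:Z - 1) * Qpol tt c%:Z)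
          + (if (a * b * c)%N == 0%N then 0 else tt ^ (1 - a%:Z - b%:Z - c%:Z)).
Proof.
have q0 : Qpol tt 0%N%:Z = 0 by rewrite /Qpol lexx.
have q1 : Qpol tt (0%N%:Z - 1) = 0 by rewrite /Qpol.
rewrite !Ppol_gen1; case: b => [|b]; first by rewrite muln0 mul0n /= q0 q1 !(mulr0, mul0r, addr0,
    subr0) mulr1.
case: c => [|c]; first by rewrite muln0 /= q0 q1 !(mulr0, mul0r, addr0, subr0) mulr1.
case: a => [|a]; first by rewrite !mul0n /= q0 q1 !(mulr0, mul0r, addr0, subr0) mul1r.
have -> : ((a.+1 * b.+1 * c.+1)%N == 0%N) = false by [].
have -> : (b.+1 == 0)%N = false by [].
have -> : (c.+1 == 0)%N = false by [].
rewrite gen3_closed addSn !gen1_closed !Qpol_pred !Qpol_nat.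
have -> : tt ^ (1 - a.+1%:Z - b.+1%:Z - c.+1%:Z) = (tt ^ (-1)) ^+ (a + b + c).+2.
  by rewrite -tX; congr (_ ^ _); lia.
rewrite addnS !exprS !exprD; move: t1; move: (tt ^ (-1)) => s s1.
by move: (s ^+ a) (s ^+ b) (s ^+ c) => x y z; field.
Qed.

End GenFun.

(** * Frechet differentiability *)

Section Bridge.
Variable R : realType.
Notation C := (CC R).
Notation C3 := (C3 R).

Lemma nnegC (x : C) : 0 <= x -> x = (complex.Re x)%:C%C /\ 0 <= complex.Re x.
Proof. by case: x => a b; rewrite lecE /= => /andP[/eqP -> h]. Qed.
Lemma posC (x : C) : 0 < x -> x = (complex.Re x)%:C%C /\ 0 < complex.Re x.
Proof. by case: x => a b; rewrite ltcE /= => /andP[/eqP -> h]. Qed.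

Lemma ccvgP (u : nat -> C) (l : C) : (u @ \oo --> l)%classic <-> ccvg u l.
Proof.
split=> [/cvgrPdist_lt h e e0|h].
  have [|N _ hN] := h e%:C%C; first by rewrite ltcR.
  by exists N => n nN; have := hN n nN; rewrite /= cabs_norm ltcR cabsC.
apply/cvgrPdist_lt => eps /posC[-> e0]; have [N hN] := h _ e0.
by exists N => // n nN; rewrite /= cabs_norm ltcR cabsC hN.
Qed.

Definition rv (x y : C) : 'rV[C]_2 := \row_j (if j == 0 then x else y).
Lemma rv0 x y : rv x y 0 0 = x. Proof. by rewrite mxE. Qed.
Lemma rv1 x y : rv x y 0 1 = y. Proof. by rewrite mxE. Qed.
Lemma ord2E (i : 'I_2) : i = 0 \/ i = 1.
Proof. by case: i => [[|[|//]] h]; [left|right]; apply: val_inj. Qed.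
Lemma rvE (z : 'rV[C]_2) : z = rv (z 0 0) (z 0 1).
Proof. by apply/rowP => i; rewrite mxE; have [->|->] := ord2E i. Qed.

Notation V := (C * 'rV[C]_2)%type.

Lemma entry_le (x : 'rV[C]_2) i : `|x 0 i| <= `|x|.
Proof.
rewrite -[`|x|]/(mx_norm x) mx_normE.
have h := le_bigmax (0%:nng : {nonneg C}) (fun ij : 'I_1 * 'I_2 => `|x ij.1 ij.2|%:nng) (0, i).
exact: h.
Qed.

Lemma fst_le (h : V) : `|h.1| <= `|h|.
Proof. by rewrite [leRHS]/Num.norm /= num_le_max lexx. Qed.
Lemma snd_le (h : V) : `|h.2| <= `|h|.
Proof. by rewrite [leRHS]/Num.norm /= num_le_max lexx orbT. Qed.

(** Frechet differentiability with named partial derivatives and real tolerances, the common form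
    through which [differentiable] and [hol3] are translated into each other. *)
Definition eps_diff (F : V -> C) (v : V) (A B D : C) := forall e : R, 0 < e -> exists2 r : R,
    0 < r &
  forall h : V, cabs h.1 < r -> cabs (h.2 0 0) < r -> cabs (h.2 0 1) < r ->
  cabs (F (h + v) - F v - (A * h.1 + B * h.2 0 0 + D * h.2 0 1)) <= e * (cabs h.1 + cabs (h.2 0 0) +
      cabs (h.2 0 1)).

Lemma diff_to_eps (F : V -> C) (v : V) : differentiable F v -> exists A B D, eps_diff F v A B D.
Proof.
move=> /diff_locallyP[_ /eqaddoP h].
pose e1 : V := (1, 0); pose e2 : V := (0, rv 1 0); pose e3 : V := (0, rv 0 1).
have dec (k : V) : k = k.1 *: e1 + k.2 0 0 *: e2 + k.2 0 1 *: e3.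
  case: k => x z; rewrite /e1 /e2 /e3 /=; congr (_, _) => /=.
    by rewrite !scaler0 !addr0 /GRing.scale /= mulr1.
  rewrite scaler0 add0r; apply/rowP => i; rewrite !mxE; have [->|->] := ord2E i => /=.
    by rewrite mulr1 mulr0 addr0.
  by rewrite mulr1 mulr0 add0r.
exists ('d F v e1), ('d F v e2), ('d F v e3) => e e0.
pose n (k : V) : R := complex.Re `|k|.
have nE k : `|k| = (n k)%:C%C /\ 0 <= n k by apply: nnegC.
pose N := n e1 + n e2 + n e3; have [[E1 n1] [E2 n2] [E3 n3]] := And3 (nE e1) (nE e2) (nE e3).
have N0 : 0 <= N by rewrite /N; lra.
have nb (k : V) : n k <= N * (cabs k.1 + cabs (k.2 0 0) + cabs (k.2 0 1)).
  rewrite -lecR -(nE k).1 {1}(dec k); apply: le_trans (ler_normD _ _) _;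
      apply: le_trans (lerD (ler_normD _ _) (lexx _)) _.
  rewrite !normrZ E1 E2 E3 !cabs_norm -!rmorphM -!rmorphD lecR.
  have := cabs_ge0 k.1; have := cabs_ge0 (k.2 0 0); have := cabs_ge0 (k.2 0 1); rewrite /N; nra.
have N1 : 0 < N + 1 by lra.
have ep : 0 < (e / (N + 1))%:C%C :> C by rewrite ltcR divr_gt0.
have /nbhs_norm0P[r /posC[-> r0] hr] := h _ ep.
exists (complex.Re r / (3 * (N + 1))); first by rewrite divr_gt0 // mulr_gt0.
move=> k; rewrite !ltr_pdivlMr ?mulr_gt0 // => k1 k2 k3.
have kr : `|k| < (complex.Re r)%:C%C.
  rewrite (nE k).1 ltcR; apply: le_lt_trans (nb k) _.
  have := cabs_ge0 k.1; have := cabs_ge0 (k.2 0 0); have := cabs_ge0 (k.2 0 1); nra.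
have := hr k kr; rewrite /= -[X in `|X| <= _ -> _]/(F (k + v) - (F v + 'd F v k)) (nE k).1 cabs_norm
    -rmorphM lecR.
have dk : 'd F v k = 'd F v e1 * k.1 + 'd F v e2 * k.2 0 0 + 'd F v e3 * k.2 0 1.
  by rewrite {1}(dec k) !linearD !linearZ; congr (_ + _ + _); exact: mulrC.
rewrite -dk -[F (k + v) - F v - _]addrA -opprD => hb; apply: le_trans hb _.
apply: le_trans (ler_wpM2l _ (nb k)) _; first by rewrite divr_ge0 ?ltW.
rewrite mulrA ler_wpM2r ?addr_ge0 ?cabs_ge0 // mulrAC ler_pdivrMr // ler_wpM2l ?(ltW e0) //; lra.
Qed.

Lemma diff_of_eps (F : V -> C) (v : V) A B D : eps_diff F v A B D -> differentiable F v.
Proof.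
move=> h; pose df (k : V) : C := A * k.1 + B * k.2 0 0 + D * k.2 0 1.
have lin : linear df by move=> a x y; rewrite /df /= !mxE -[a *: x.1]/(a * x.1) -[a *: (_ : C)]/(a *
    _); ring.
pose L : {linear V -> C} := HB.pack df (GRing.isLinear.Build _ _ _ _ df lin).
pose n (k : V) : R := complex.Re `|k|.
have nE k : `|k| = (n k)%:C%C /\ 0 <= n k by apply: nnegC.
have c1 (k : V) : cabs k.1 <= n k by rewrite -lecR -cabs_norm -(nE k).1; exact: fst_le.
have c2 (k : V) i : cabs (k.2 0 i) <= n k.
  by rewrite -lecR -cabs_norm -(nE k).1; apply: le_trans (entry_le _ _) (snd_le _).
pose M := cabs A + cabs B + cabs D; have M0 : 0 <= M by rewrite !addr_ge0 ?cabs_ge0.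
have bL (k : V) : cabs (df k) <= M * n k.
  rewrite /df; have := cabsD (A * k.1 + B * k.2 0 0) (D * k.2 0 1);
      have := cabsD (A * k.1) (B * k.2 0 0).
  rewrite !cabsM; have := c1 k; have := c2 k 0; have := c2 k 1; have := cabs_ge0 A;
      have := cabs_ge0 B; have := cabs_ge0 D; rewrite /M; nra.
have cL : continuous L.
  apply: continuousfor0_continuous; apply/cvgrPdist_lt => eps /posC[-> e0];
      apply/(@nbhs_norm0P _ V); have M1 : 0 < M + 1 by lra.
  exists (complex.Re eps / (M + 1))%:C%C; first by rewrite /= ltcR divr_gt0.
  move=> w /=; rewrite (nE w).1 ltcR ltr_pdivlMr // => kw.
  rewrite -[X in `|X - _|]/(df 0) -[X in `|_ - X|]/(df w) (_ : df 0 - df w = - df w);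
      last by rewrite /df /= !mxE; ring.
  rewrite normrN cabs_norm ltcR; apply: le_lt_trans (bL _) _; have := (nE w).2; nra.
have oL : F \o shift v = cst (F v) + L +o_ (0 : V) id.
  apply/eqaddoP => eps /posC[-> e0]; have [r r0 hr] := h (complex.Re eps / 3)
      ltac:(by rewrite divr_gt0).
  apply/(@nbhs_norm0P _ V); exists r%:C%C; first by rewrite /= ltcR.
  move=> k /=; rewrite (nE k).1 ltcR => kr.
  rewrite -[X in `|X| <= _]/(F (k + v) - (F v + df k)) cabs_norm -rmorphM lecR opprD addrA.
  have b1 := c1 k; have b2 := c2 k 0; have b3 := c2 k 1.
  apply: le_trans (hr k _ _ _) _; try exact: le_lt_trans kr.
  have : cabs k.1 + cabs (k.2 0 0) + cabs (k.2 0 1) <= 3 * n k by lra.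
  move=> b; have := ler_wpM2l (ltW e0) b; lra.
have dL := diff_unique cL oL.
by apply/diff_locallyP; rewrite dL.
Qed.

Lemma eps_hol3 (F : V -> C) (p : C3) A B D : eps_diff F (p.1.1, rv p.1.2 p.2) A B D ->
    hol3 (fun q => F (q.1.1, rv q.1.2 q.2)) p.
Proof.
move=> h; exists A, B, D; apply: hol3P => e e0; have [r r0 hr] := h e e0; exists r => // q qr.
pose k : V := (q.1.1 - p.1.1, rv (q.1.2 - p.1.2) (q.2 - p.2)).
have e2 : k + (p.1.1, rv p.1.2 p.2) = (q.1.1, rv q.1.2 q.2).
  by rewrite /k; congr (_, _) => /=; [rewrite subrK|apply/rowP => i; rewrite !mxE; case: ifP;
      rewrite subrK].
have := hr k; rewrite e2 /k /= rv0 rv1; apply; apply: le_lt_trans qr;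
    [exact: d3_0|exact: d3_1|exact: d3_2].
Qed.

Lemma hol3_eps (f : C3 -> C) p A B D : hol3d f p A B D -> forall e : R, 0 < e -> exists2 r : R,
    0 < r & forall q : C3, d3 p q < r ->
  cabs (f q - f p - (A * (q.1.1 - p.1.1) + B * (q.1.2 - p.1.2) + D * (q.2 - p.2))) <= e * d3 p q.
Proof.
move=> [a [b [c [[ca aA] [cb bB] [cc cD] [r0 r00 hr0]]]]] e e0.
have [r1 r10 h1] := ca e e0; have [r2 r20 h2] := cb e e0; have [r3 r30 h3] := cc e e0.
exists (Num.min (Num.min r0 r1) (Num.min r2 r3)); first by rewrite !lt_min r00 r10 r20.
move=> q; rewrite !lt_min => /andP[/andP[q0 q1] /andP[q2 q3]].
rewrite hr0 // -aA -bB -cD (_ : _ - _ = (a q - a p) * (q.1.1 - p.1.1) + (b q - b p) *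
    (q.1.2 - p.1.2) + (c q - c p) * (q.2 - p.2)); last by ring.
have b1 := ltW (h1 q q1); have b2 := ltW (h2 q q2); have b3 := ltW (h3 q q3).
apply: le_trans (cabsD _ _) _; apply: le_trans (lerD (cabsD _ _) (lexx _)) _;
    rewrite (cabsM (a q - _)) (cabsM (b q - _)) (cabsM (c q - _)) /d3 !mulrDr.
by apply: lerD; [apply: lerD|]; apply: ler_wpM2r; rewrite ?cabs_ge0.
Qed.

Lemma hol3_diff (F : V -> C) (v : V) : hol3 (fun q => F (q.1.1, rv q.1.2 q.2)) (v.1, v.2 0 0,
    v.2 0 1) -> differentiable F v.
Proof.
move=> [A [B [D h]]]; apply: (@diff_of_eps F v A B D) => e e0; have [r r0 hr] := hol3_eps h e0.
exists (r / 3); first by rewrite divr_gt0.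
move=> k k1 k2 k3; pose q : C3 := (k.1 + v.1, k.2 0 0 + v.2 0 0, k.2 0 1 + v.2 0 1).
have dq : d3 (v.1, v.2 0 0, v.2 0 1) q = cabs k.1 + cabs (k.2 0 0) + cabs (k.2 0 1) by rewrite /d3
    /q /= !addrK.
have := hr q; rewrite dq => /(_ ltac:(lra)); rewrite /q /= !addrK -rvE -surjective_pairing.
rewrite (_ : (k.1 + v.1, rv (k.2 0 0 + v.2 0 0) (k.2 0 1 + v.2 0 1)) = k + v) //.
by congr (_, _) => /=; rewrite [RHS]rvE !mxE.
Qed.

End Bridge.

(** * Fourier expansions and boundedness at the cusp *)

Section Fourier.
Variable R : realType.
Notation C := (CC R).
Notation C3 := (C3 R).

(** Compactness one variable at a time: x by [tube], then y, then t along a horizontal segment,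
    keeping a margin for the variables still to be treated. *)
Lemma box_bd (f : C3 -> C) (K Y : R) : (forall p, inH p -> cont3 f p) -> 0 <= K -> 0 < Y ->
  exists M, forall t x y : C, complex.Im t = Y -> 0 <= complex.Re t <= 1 -> cabs x <= K -> cabs y <=
      K -> cabs (f (t, x, y)) <= M.
Proof.
move=> cf K0 Y0.
have st1 (t0 : C) : 0 < complex.Im t0 -> exists2 d : R, 0 < d & exists M, forall t x y,
    cabs (t - t0) < d -> cabs x <= K -> cabs y <= K -> cabs (f (t, x, y)) <= M.
  move=> ht; pose Bd (y : C) (d M : R) := forall t x, cabs (t - t0) < d -> cabs x <= K ->
      cabs (f (t, x, y)) <= M.
  have [||z d M d' M' dd MM hB t x td xK|y _|d d0 [M hM]] := @rect_bd R Bd ((- K) +i* (- K))%C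
      (2 * K) (2 * K).
  - by rewrite mulr_ge0.
  - by rewrite mulr_ge0.
  - by apply: le_trans (hB t x _ xK) MM; exact: lt_le_trans dd.
  - have [|d d0 [M hM]] := @tube R f t0 y K K0; first by move=> x; exact: cf.
    by exists d => //; exists M => y' yy t x td xK; exact: hM.
  - exists d => //; exists M => t x y td xK yK; exact: (hM y (inrect_ball yK)).
pose Bd (t : C) (d M : R) := forall x y, cabs x <= K -> cabs y <= K -> cabs (f (t, x, y)) <= M.
have [||z d M d' M' dd MM hB x y xK yK|t|d d0 [M hM]] := @rect_bd R Bd (0 +i* Y)%C 1 0 => //.
- exact: le_trans (hB x y xK yK) MM.
- rewrite /inrect /= addr0 -eq_le => /andP[_ /eqP tY]; have [|d d0 [M hM]] := st1 t;
      first by rewrite -tY.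
  by exists d => //; exists M => t' td x y xK yK; exact: hM.
by exists M => t x y tY t01 xK yK; apply: hM => //; rewrite /inrect /= add0r t01 tY addr0 lexx.
Qed.

Lemma terms_bd (u : nat -> C) l : ccvg (fun N => \sum_(j < N) u j) l -> exists2 K : R, 0 <= K &
    forall n, cabs (u n) <= K.
Proof.
move=> cu; have [N _ hN] := ccvg_bounded cu.
exists (2 * (cabs l + 1) + \sum_(j < N) cabs (u j)).
  by apply: addr_ge0; [rewrite mulr_ge0 // addr_ge0 ?cabs_ge0|apply: sumr_ge0 => i _;
      exact: cabs_ge0].
move=> n; case: (ltnP n N) => h.
  rewrite (bigD1 (Ordinal h)) //= addrCA lerDl addr_ge0 ?mulr_ge0 ?addr_ge0 ?cabs_ge0 //.
  by apply: sumr_ge0 => i _; exact: cabs_ge0.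
have -> : u n = \sum_(j < n.+1) u j - \sum_(j < n) u j by rewrite big_ord_recr /= addrAC subrr
    add0r.
have h1 := hN n h; have h2 := hN n.+1 (leqW h); have := cabsB (\sum_(j < n.+1) u j)
    (\sum_(j < n) u j).
have : 0 <= \sum_(j < N) cabs (u j) by apply: sumr_ge0 => i _; exact: cabs_ge0.
lra.
Qed.

(** The expansion converges pointwise in x and y, so uniformity is taken from compactness: [F] is
    bounded at height 1 by continuity, and for fixed x and y it is a power series in q, so
    [weak_max] carries the bound to greater heights. Period 1 in t comes with the expansion. *)
Lemma fourier_cusp (F : C3 -> C) (c : nat -> C -> C -> C) : (forall p, inH p -> cont3 F p) ->
  (forall t x y : C, 0 < complex.Im t -> ccvg (fun N => \sum_(j < N) c j x y * e2pi t ^+ j)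
      (F (t, x, y))) -> Jcusp F.
Proof.
move=> cF hc K; have p2 := pi_ge2 R; have p0 := pi_gt0 R.
have [M hM] := @box_bd F `|K| 1 cF (normr_ge0 K) ltr01; exists (`|M| * 2), 2 => t x y t2 hx hy.
have hK := ler_norm K; have it : 0 < complex.Im t by lra.
pose c' j := c j x y.
have cb (r : R) : 0 <= r < 1 -> exists2 B : R, 0 <= B & forall n, cabs (c' n) * r ^+ n <= B.
  move=> r01; pose s := (1 + r) / 2; have cs : cabs (s%:C%C : C) = s by rewrite cabs_real ger0_norm
      // /s; lra.
  have [|u uq hu] := @circle_e2pi R (s%:C%C); first by rewrite cs /s; lra.
  have [B B0 hB] := @terms_bd (fun j => c j x y * e2pi u ^+ j) _ (hc u x y hu); exists B => // n;
      apply: le_trans (hB n); rewrite cabsM cabsX uq cs.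
  by rewrite ler_wpM2l ?cabs_ge0 // lerXn2r ?nnegrE // /s; lra.
have GE (u : C) : 0 < complex.Im u -> psum c' (e2pi u) = F (u, x, y).
  by move=> hu; apply: ccvg_unique (hc u x y hu); apply: psum_cvg => //; rewrite e2pi_lt1.
pose r := expR (- (2 * pi)) : R; have r0 : 0 < r by exact: expR_gt0.
have r2 : r <= 2^-1.
  by rewrite /r expRN lef_pV2 ?posrE ?expR_gt0 //; apply: le_trans (expR_ge1Dx _); lra.
have bd q : cabs q = r -> cabs (psum c' q) <= `|M|.
  move=> qr; have [|u uq hu] := @circle_e2pi R q; first by rewrite qr; lra.
  have iu : complex.Im u = 1.
    have : expR (- (2 * pi * complex.Im u)) = r by rewrite -cabs_e2pi uq.
    move=> /expR_inj/oppr_inj e; apply: (@mulfI _ (2 * pi)); first by rewrite gt_eqF // mulr_gt0.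
    by rewrite e mulr1.
  pose m := Num.floor (complex.Re u); pose v := u - m%:~R.
  have ev : e2pi v = q by rewrite /v e2piD -mulrNz e2pi_int mulr1.
  have iv : complex.Im v = 1 by rewrite /v ImD ImN Im_int subr0.
  rewrite -ev GE; last by rewrite iv.
  apply: le_trans (hM v x y iv _ _ _) (ler_norm _); [|lra|lra].
  have f1 : m%:~R <= complex.Re u by exact: floor_le.
  have f2 : complex.Re u < m%:~R + 1 by rewrite -(intrD _ m 1); exact: floorD1_gt.
  rewrite /v ReD ReN Re_int; lra.
have qr : cabs (e2pi t) <= r / 2.
  have : cabs (e2pi t) <= r * r by rewrite /r -expRD cabs_e2pi ler_expR; nra.
  move=> h; apply: le_trans h _; nra.
rewrite -GE //; apply: le_trans (@weak_max R (psum c') r `|M| (e2pi t) _ _ bd _) _;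
    [lra|exact: psum_cder|lra|].
rewrite ler_wpM2l // ler_pdivrMr; lra.
Qed.

(** For each fixed x and y the expansion is the Taylor series of the function on the disc given by
    [qdisc]. *)
Lemma cusp_fourier (F : C3 -> C) : (forall p, inH p -> hol3 F p) ->
    (forall t x y : C, 0 < complex.Im t -> F (t + 1, x, y) = F (t, x, y)) -> Jcusp F ->
  exists c : nat -> C -> C -> C, forall t x y : C, 0 < complex.Im t ->
      ccvg (fun N => \sum_(j < N) c j x y * e2pi t ^+ j) (F (t, x, y)).
Proof.
move=> hF F1 cF.
have ex (w : C * C) : exists a : nat -> C, forall t : C, 0 < complex.Im t ->
    ccvg (fun N => \sum_(j < N) a j * e2pi t ^+ j) (F (t, w.1, w.2)).
  case: w => x y /=; have [M [Y hM]] := cF (Num.max (cabs x) (cabs y)).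
  have [t ht|t ht|t tY|G dG FG] := @qdisc R (fun t => F (t, x, y)) M Y.
  - exact: (slice0 (hF (t, x, y) ht)).
  - exact: F1.
  - by apply: hM => //; rewrite le_max lexx ?orbT.
  have [a ha] := taylor ltr01 dG; exists a => t ht; rewrite FG //; set q := e2pi t.
  have q1 : cabs q < 1 by rewrite e2pi_lt1.
  pose r := (1 + cabs q) / 2; have q0 := cabs_ge0 q; have r01 : 0 < r < 1 by rewrite /r; lra.
  have [|B B0 hB] := @circle_bd R G r ltac:(lra); first by move=> z zr; apply/cder_cont/dG;
      rewrite zr; lra.
  have [_ hw] := ha r r01 B hB; have qr : cabs q < r by rewrite /r; lra.
  have x01 : 0 <= cabs q / r < 1 by rewrite divr_ge0 ?ltr_pdivrMr ?mul1r //; lra.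
  move=> e e0; pose E := B * (r / (r - cabs q)) + 1.
  have E0 : 0 < E by rewrite /E ltr_wpDl // mulr_ge0 // divr_ge0 //; lra.
  have [N hN] := exprn_small x01 (divr_gt0 e0 E0); exists N => n nN; rewrite cabsC.
  apply: le_lt_trans (hw q qr n) _; have := hN n nN; rewrite ltr_pdivlMr // => h;
      apply: le_lt_trans h.
  have : 0 <= (cabs q / r) ^+ n by rewrite exprn_ge0 //; have /andP[] := x01.
  by rewrite /E; move: (_ ^+ n) (r / _) => u v u0; nra.
have [f hf] := choice ex; exists (fun j x y => f (x, y) j) => t x y ht; exact: (hf (x, y)).
Qed.

End Fourier.

(** * Change of lattice basis *)

Section Interface.
Variable R : realType.
Notation C := (CC R).
Notation C3 := (C3 R).
Variables (L : lattice 2) (a b c : nat) (U : 'M[int]_2).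
Hypothesis Uu : U \in unitmx.
Hypothesis GE : gram3 a b c = \matrix_(i, j) bil L (row i U) (row j U).

(** The analogue of [rv] over any ring, so that lattice vectors and complex points share one
    computation of the bilinear form. *)
Definition rva (A : nzRingType) (x y : A) : 'rV[A]_2 := \row_j (if j == 0 then x else y).

Lemma gramU : U *m gram L *m U^T = gram3 a b c.
Proof.
have iz (m n : nat) (M : 'M[int]_(m, n)) : map_mx intr M = M by apply/matrixP => i j;
    rewrite mxE intz.
rewrite GE; apply/matrixP => i j; rewrite [RHS]mxE /bil iz [LHS]mxE [RHS]mxE; apply: eq_bigr => k _.
by rewrite !mxE; congr (_ * _); apply: eq_bigr => l _; rewrite mxE.
Qed.

Lemma mulmx2 (A : nzRingType) m n (M : 'M[A]_(m, 2)) (N : 'M[A]_(2, n)) i j : (M *m N) i j = M i 0 *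
    N 0 j + M i 1 * N 1 j.
Proof.
rewrite mxE !big_ord_recl big_ord0 addr0; congr (M _ _ * N _ _ + M _ _ * N _ _); exact: val_inj.
Qed.

Lemma bilU (A : comNzRingType) (u v x y : A) :
  bil L (rva u v *m map_mx intr U) (rva x y *m map_mx intr U) = a%:R * u * x + b%:R * (u + v) *
      (x + y) + c%:R * v * y.
Proof.
have -> : bil L (rva u v *m map_mx intr U) (rva x y *m map_mx intr U) =
    (rva u v *m map_mx intr (gram3 a b c) *m (rva x y)^T) 0 0.
  by rewrite /bil -gramU trmx_mul !map_mxM map_trmx !mulmxA.
have g00 : gram3 a b c 0 0 = (a + b)%N by rewrite mxE.
have g01 : gram3 a b c 0 1 = b by rewrite mxE.
have g10 : gram3 a b c 1 0 = b by rewrite mxE.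
have g11 : gram3 a b c 1 1 = (c + b)%N by rewrite mxE.
have gE i j : map_mx intr (gram3 a b c) i j = (gram3 a b c i j)%:~R :> A by rewrite mxE.
rewrite mulmx2 !mulmx2 !gE g00 g01 g10 g11 !mxE /= -!pmulrn !natrD.
ring.
Qed.

Definition UC : 'M[C]_2 := map_mx intr U.
Definition VC : 'M[C]_2 := map_mx intr (invmx U).
Lemma UVC : UC *m VC = 1%:M.
Proof. by rewrite /UC /VC -map_mxM mulmxV // map_mx1. Qed.
Lemma VUC : VC *m UC = 1%:M.
Proof. by rewrite /UC /VC -map_mxM mulVmx // map_mx1. Qed.

Lemma bilC (u v x y : C) : bil L (rv u v *m UC) (rv x y *m UC) = bq a b c u v x y.
Proof. exact: bilU. Qed.
Lemma qformC (x y : C) : qform L (rv x y *m UC) = qf a b c x y / 2.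
Proof. by rewrite /qform bilC /bq /qf; congr (_ / _); ring. Qed.
Lemma bilZ (u v : int) : bil L (rva u v *m U) (rva u v *m U) = qz a b c u v.
Proof.
have := bilU u v u v; rewrite (_ : map_mx intr U = U); last by apply/matrixP => i j;
    rewrite mxE intz.
by move=> ->; rewrite /qz !natz; ring.
Qed.

Lemma inclU (u v : int) : lat_incl R (rva u v *m U) = rv u%:~R v%:~R *m UC.
Proof.
rewrite /lat_incl map_mxM; congr (_ *m _); apply/rowP => i; rewrite !mxE; by case: ifP.
Qed.

Lemma rvD (x y x' y' : C) : rv x y + rv x' y' = rv (x + x') (y + y').
Proof. by apply/rowP => i; rewrite !mxE; case: ifP. Qed.
Lemma rvZ (k x y : C) : k *: rv x y = rv (k * x) (k * y).
Proof. by apply/rowP => i; rewrite !mxE; case: ifP. Qed.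

Definition mkH (t : C) (ht : 0 < complex.Im t) : uhp R :=
    exist (fun w : C => is_true (0 < complex.Im w)) t ht.
Lemma jextE (f : jfun R 2) (tau : uhp R) z : jext f (val tau, z) = f tau z.
Proof. by rewrite /jext /= valK. Qed.
Lemma jextE' (f : jfun R 2) (t : C) z (ht : 0 < complex.Im t) : jext f (t, z) = f (mkH ht) z.
Proof. exact: (jextE f (mkH ht)). Qed.

(** x and y are coordinates with respect to the chosen lattice basis, the rows of [U]: the point is
    the row (x, y) times [UC]. *)
Definition to_coord (f : jfun R 2) (p : C3) : C := jext f (p.1.1, rv p.1.2 p.2 *m UC).
Definition of_coord (g : C3 -> C) : jfun R 2 := fun tau z => g (val tau, (z *m VC) 0 0,
    (z *m VC) 0 1).

Lemma det2 (g : 'M[int]_2) : \det g = g 0 0 * g 1 1 - g 0 1 * g 1 0.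
Proof.
rewrite (expand_det_row _ 0) !big_ord_recl big_ord0 /cofactor !det_mx11 !mxE addr0 expr0 mul1r expr1
    mulN1r mulrN.
by congr (_ * _ - _ * _); congr (g _ _); apply: val_inj.
Qed.

Definition mkm (al be ga de : int) : 'M[int]_2 := \matrix_(i, j)
    (if i == 0 then (if j == 0 then al else be) else (if j == 0 then ga else de)).
Lemma mkm_det al be ga de : al * de - be * ga = 1 -> \det (mkm al be ga de) == 1.
Proof. by move=> h; rewrite det2 !mxE /= h. Qed.

Lemma weak_J k f : weak_jacobi L k f -> J a b c k (to_coord f).
Proof.
move=> [hh hm he [cf hf]].
have h1 p : inH p -> hol3 (to_coord f) p.
  move=> hp; pose X (q : C3) : C := UC 0 0 * q.1.2 + UC 1 0 * q.2; pose Y (q : C3) : C := UC 0 1 *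
      q.1.2 + UC 1 1 * q.2.
  have XY (q : C3) : rv q.1.2 q.2 *m UC = rv (X q) (Y q).
    apply/rowP => i; rewrite mulmx2 rv0 rv1 /X /Y.
    by have [->|->] := ord2E i; rewrite ?rv0 ?rv1; congr (_ + _); exact: mulrC.
  have hX : hol3 X p by apply: hol3D; (apply: hol3M; first exact: hol3_const);
      [exact: hol3_1|exact: hol3_2].
  have hY : hol3 Y p by apply: hol3D; (apply: hol3M; first exact: hol3_const);
      [exact: hol3_1|exact: hol3_2].
  have [A [B [D e]]] := diff_to_eps (hh (mkH hp) (rv (X p) (Y p))).
  have hF := @eps_hol3 R (jext f) (p.1.1, X p, Y p) A B D e.
  apply: hol3_eq (@hol3_comp3 R _ (fun q => q.1.1) X Y p hF (hol3_0 p) hX hY) => q /=.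
  by rewrite /to_coord XY.
split => //.
- move=> al be ga de t x y det ht; pose g : SL2Z := exist (fun h : 'M[int]_2 =>
      is_true (\det h == 1)) _ (mkm_det det).
  have ga0 : autj g (mkH ht) = jc ga de t by rewrite /autj /= !mxE.
  have mg : val (mobius g (mkH ht)) = mob al be ga de t by rewrite /= ga0 !mxE.
  rewrite /to_coord /= -mg jextE (jextE' _ _ ht).
  have := hm g (mkH ht) (rv x y *m UC); rewrite ga0 qformC /= !mxE /= => <-.
  by rewrite scalemxAl rvZ; congr (f _ (rv _ _ *m _)); rewrite mulrC.
- move=> u v m n t x y ht; rewrite /to_coord /= !(jextE' _ _ ht).
  have := he (rva u v *m U) (rva m n *m U) (mkH ht) (rv x y *m UC);
      rewrite !inclU !bilZ qformC bilC /= => <-.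
  by rewrite scalemxAl rvZ -!mulmxDl !rvD; congr (f _ (rv _ _ *m _)); rewrite [t * _]mulrC.
- apply: (@fourier_cusp R _ (fun j x y => cf j (rv x y *m UC))); first by move=> p hp;
      exact: hol3_cont (h1 p hp).
  move=> t x y ht; have /ccvgP := hf (mkH ht) (rv x y *m UC); rewrite /to_coord /= (jextE' _ _ ht);
      apply: ccvg_ext => N.
  by rewrite /series /= big_mkord.
Qed.

Lemma J_weak k g : J a b c k g -> weak_jacobi L k (of_coord g).
Proof.
move=> [h1 h2 h3 h4].
have zU (z : 'rV[C]_2) : rv ((z *m VC) 0 0) ((z *m VC) 0 1) *m UC = z by rewrite -rvE -mulmxA VUC
    mulmx1.
split.
- move=> tau z; apply: hol3_diff => /=.
  pose X (q : C3) : C := (rv q.1.2 q.2 *m VC) 0 0; pose Y (q : C3) : C := (rv q.1.2 q.2 *m VC) 0 1.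
  pose p : C3 := (val tau, z 0 0, z 0 1); have hp : inH p := valP tau.
  have hX : hol3 X p.
    apply: (@hol3_eq R (fun q => q.1.2 * VC 0 0 + q.2 * VC 1 0)).
      by move=> q; rewrite /X mulmx2 rv0 rv1.
    by apply: hol3D; apply: hol3M; try exact: hol3_const; [exact: hol3_1|exact: hol3_2].
  have hY : hol3 Y p.
    apply: (@hol3_eq R (fun q => q.1.2 * VC 0 1 + q.2 * VC 1 1)).
      by move=> q; rewrite /Y mulmx2 rv0 rv1.
    by apply: hol3D; apply: hol3M; try exact: hol3_const; [exact: hol3_1|exact: hol3_2].
  have hg := @hol3_comp3 R g (fun q => q.1.1) X Y p (h1 (p.1.1, X p, Y p) hp) (hol3_0 p) hX hY.
  apply: hol3_ext hg; exists (complex.Im p.1.1); first exact: hp.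
  by move=> q /inH_near hq; rewrite (jextE' _ _ hq).
- move=> g0 tau z; have ht := valP tau; have det := valP g0; rewrite /= det2 in det;
      move/eqP: det => det.
  have := h2 _ _ _ _ (val tau) ((z *m VC) 0 0) ((z *m VC) 0 1) det ht.
  rewrite -qformC zU /of_coord => <-; congr (g (_, _, _)); by rewrite -scalemxAl mxE mulrC.
- move=> l m tau z; have ht := valP tau.
  have lE (w : 'rV[int]_2) : w = rva ((w *m invmx U) 0 0) ((w *m invmx U) 0 1) *m U.
    rewrite (_ : rva _ _ = w *m invmx U); first by rewrite -mulmxA mulVmx // mulmx1.
    by apply/rowP => i; rewrite mxE; have [->|->] := ord2E i.
  move: (lE l) (lE m); set u := (l *m _) 0 0; set v := (l *m _) 0 1; set m1 := (m *m _) 0 0;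
      set n1 := (m *m _) 0 1 => -> ->.
  have := h3 u v m1 n1 (val tau) ((z *m VC) 0 0) ((z *m VC) 0 1) ht.
  have bE := bilC u%:~R v%:~R ((z *m VC) 0 0) ((z *m VC) 0 1); rewrite zU in bE.
  rewrite !inclU !bilZ qformC bE /of_coord => <-.
  rewrite scalemxAl rvZ -addrA -mulmxDl rvD mulmxDl -mulmxA UVC mulmx1.
  by congr (g (_, _, _)); rewrite mxE ?rv0 ?rv1 addrA [val tau * _]mulrC.
- have F1 (t x y : C) : 0 < complex.Im t -> g (t + 1, x, y) = g (t, x, y).
    move=> ht; have := h2 1 1 0 1 t x y erefl ht.
    by rewrite /mob /jc mulr1z mulr0z !mul0r add0r !divr1 mul1r exp1rz e2pi0 !mul1r.
  have [cc hcc] := cusp_fourier h1 F1 h4; exists (fun j z => cc j ((z *m VC) 0 0) ((z *m VC) 0 1))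
      => tau z.
  apply/ccvgP; apply: ccvg_ext (hcc (val tau) _ _ (valP tau)) => N; by rewrite /series /= big_mkord.
Qed.

Lemma to_coord_at (f : jfun R 2) (tau : uhp R) z : f tau z = to_coord f (val tau, (z *m VC) 0 0,
    (z *m VC) 0 1).
Proof. by rewrite /to_coord /= -rvE -mulmxA VUC mulmx1 jextE. Qed.
Lemma of_coord_at g (tau : uhp R) x y : of_coord g tau (rv x y *m UC) = g (val tau, x, y).
Proof. by rewrite /of_coord -mulmxA UVC mulmx1 rv0 rv1. Qed.
End Interface.

(** * The ring generated by E4 and E6 *)

Section Main.
Variable R : realType.
Notation C := (CC R).

Lemma eisE k (tau : uhp R) : eis_series k tau = ES k (e2pi (val tau)).
Proof.
apply: cvg_lim; first exact: norm_hausdorff.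
apply/ccvgP; apply: ccvg_ext (ES_cvg k _) => [N|]; last by rewrite e2pi_lt1; exact: (valP tau).
by rewrite /series /= big_mkord.
Qed.

Lemma E4E (tau : uhp R) : E4 tau = e4 (val tau).
Proof. by rewrite /E4 eisE. Qed.
Lemma E6E (tau : uhp R) : E6 tau = e6 (val tau).
Proof. by rewrite /E6 eisE. Qed.

(** An element of the direct sum has components of several weights, so each of its coefficients is a
    sum of modular forms of several weights. *)
Lemma modular_ring_sum (s : seq int) (wt : int -> int) (h : int -> C -> C) : (forall k, k \in s ->
    MF (wt k) (h k)) ->
  @modular_ring R (fun tau => \sum_(k <- s) h k (val tau)).
Proof.
move=> hs; have [p hp] : exists p : {poly {poly C}}, forall t : C, 0 < complex.Im t ->
    \sum_(k <- s) h k t = p.[e4 t, e6 t].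
  elim: s hs => [|k s IH] hs; first by exists 0 => t _; rewrite big_nil !horner0.
  have [p hp] := IH (fun j js => hs j (mem_behead (s := k :: s) js)).
  have [q hq] := MF_gen (hs k (mem_head k s)).
  by exists (q + p) => t ht; rewrite big_cons hp // hq // !hornerE.
by exists p; apply/funext => tau; rewrite hp ?E4E ?E6E //; exact: (valP tau).
Qed.

Lemma tvar_ne0 : tvar != 0.
Proof. by rewrite /tvar tofrac_eq0 polyX_eq0. Qed.
Lemma tvar_ne1 : 1 - tvar ^ (-1) != 0.
Proof.
rewrite subr_eq0 exprN1 eq_sym -(inj_eq invr_inj) invrK invr1 /tvar -tofrac1 tofrac_eq.
by apply/eqP => /(congr1 (fun p : {poly int} => p`_1)); rewrite coefX coef1.
Qed.

End Main.

Theorem theorem1p3 (R : realType) (L : lattice 2) (a b c : nat) :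
  is_gram_matrix L (gram3 a b c) ->
  exists (n : nat) (k : 'I_n -> int) (phi : 'I_n -> jfun R 2),
    [/\ forall i, weak_jacobi L (k i) (phi i),
        free_on (@modular_ring R) (weak_jacobi_all L) phi
      & let t := tvar in
        let P x := Ppol t x in
        let Q x := Qpol t x in
        \sum_(i < n) t ^ (k i) =
          P a * P b * P c
          + Q a%:Z * Q b%:Z * Q c%:Z
          + (2 * t ^ (-1) - 1) * Q (a%:Z - 1) * Q (b%:Z - 1) * Q (c%:Z - 1)
          - t ^ (-1) * (Q a%:Z * Q (b%:Z - 1) * Q (c%:Z - 1)
                        + Q (a%:Z - 1) * Q b%:Z * Q (c%:Z - 1)
                        + Q (a%:Z - 1) * Q (b%:Z - 1) * Q c%:Z)
          + (if (a * b * c)%N == 0%N then 0 else t ^ (1 - a%:Z - b%:Z - c%:Z))].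

Proof.
case=> U Uu GE.
have [B [JBB sp ind] gB] := @J_basis R {fraction {poly int}} tvar tvar_ne0 a b c.
pose wt i := (nth (elt0 R) B i).1; pose el i := (nth (elt0 R) B i).2.
have W i : (i < size B)%N -> weak_jacobi L (wt i) (of_coord U (el i)).
  by move=> iB; apply: (J_weak Uu GE); exact: JBB.
exists (size B), (fun i => wt i), (fun i => of_coord U (el i)); split; first by move=> i; exact: W.
- split=> [i|f [s [F [us hF ->]]]].
    exists [:: wt i], (fun=> of_coord U (el i)); split=> // [k|]; last by apply/funext => tau;
        apply/funext => z; rewrite big_seq1.
    by rewrite inE => /eqP ->; exact: W.
  (* Each homogeneous component is expanded on its own; for k outside [s] a dummy value allows one
     choice function on all integers. *)
  have ex k : exists G : nat -> CC R -> CC R, k \in s ->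
      MFs k B G /\ forall p, inH p -> to_coord U (F k) p = lincomb B (fun i => G i p.1.1) p.
    case ks: (k \in s); last by exists (fun _ _ => 0).
    by have [G h1 h2] := sp k _ (weak_J GE (hF k ks)); exists G.
  have [G hG] := choice ex.
  exists (fun (i : 'I_(size B)) (tau : uhp R) => \sum_(k <- s) G k i (val tau)); split.
    split=> [i|].
      apply: (@modular_ring_sum R s (fun k => k - wt i) (fun k => G k i)) => k ks.
      by have [h _] := hG k ks; exact: h.
    apply/funext => tau; apply/funext => z; under [RHS]eq_bigr => i _ do rewrite mulr_suml.
    rewrite exchange_big /=; apply: eq_big_seq => k ks; have [_ h] := hG k ks.
    by rewrite (to_coord_at Uu) h //; exact: (valP tau).
  (* Uniqueness is checked at each [tau]: the difference of two families of coefficients is a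
     relation at that fixed point. No modularity of [g] enters, thanks to the pointwise form of
     independence. *)
  move=> g [_ eg]; apply/funext => i; apply/funext => tau.
  pose ext (h : 'I_(size B) -> uhp R -> CC R) j := if insub j is Some i then h i tau else 0.
  pose g0 (i : 'I_(size B)) (tau : uhp R) := \sum_(k <- s) G k i (val tau).
  have extE h (j : 'I_(size B)) : ext h j = h j tau by rewrite /ext valK.
  have := ind (val tau) (fun j => ext g0 j - ext g j) (valP tau) _ i (ltn_ord i).
  rewrite !extE => H; apply/eqP; rewrite -subr_eq0; apply/eqP; apply: H => x y.
  pose z := rv x y *m UC R U.
  have zE j : of_coord U (el j) tau z = el j (val tau, x, y) by rewrite (of_coord_at Uu).
  have e1 : \sum_(k <- s) F k tau z = \sum_(j < size B) g0 j tau * el j (val tau, x, y).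
    under [RHS]eq_bigr => j _ do rewrite mulr_suml.
    rewrite exchange_big /=; apply: eq_big_seq => k ks; have [_ h] := hG k ks.
    rewrite (to_coord_at Uu) h; last exact: (valP tau).
    by rewrite /z -mulmxA (UVC R Uu) mulmx1 rv0 rv1.
  have := congr1 (fun f => f tau z) eg; rewrite /= e1 => e2.
  rewrite /lincomb; under eq_bigr => j _ do rewrite mulrBl !extE.
  by rewrite sumrB e2; apply/eqP; rewrite subr_eq0; apply/eqP; apply: eq_bigr => j _; rewrite zE.
- rewrite /= -(gen_formula tvar_ne0 tvar_ne1) -gB /gen (big_nth (elt0 R)) big_mkord.
  by [].
Qed.
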